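(* Let $(M,\Omega)$ be a closed symplectic manifold, let $\pi:T^*M\to M$ be the canonical projection, let $\omega_0$ be the canonical symplectic form on $T^*M$, and let $H:T^*M\to\mathbb{R}$ be the standard kinetic energy Hamiltonian of a Riemannian metric on $M$. Then there exists $e_0>0$ such that for almost all $e\in(0,e_0)$ (with respect to Lebesgue measure) the Hamiltonian flow of $H$ with respect to the twisted symplectic form $\omega_0+\pi^*\Omega$ has a periodic orbit on the energy level $H^{-1}(e)$ whose projection to $M$ is contractible.
   Context: The standard kinetic energy Hamiltonian of a Riemannian metric $g$ is $H(q,p)=\tfrac12\|p\|^2$, where $\|\cdot\|$ is the dual norm on $T_q^*M$ induced by $g$. *)

(* Defs.v *)
From HB Require Import structures.
From mathcomp Require Import all_boot all_order all_algebra.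
From mathcomp Require Import all_classical all_reals all_analysis.

Set Implicit Arguments.
Unset Strict Implicit.
Unset Printing Implicit Defensive.

Import Order.TTheory GRing.Theory Num.Theory.
Import numFieldNormedType.Exports.

Local Open Scope classical_set_scope.
Local Open Scope ring_scope.

(* Vectors are rows, a linear map is a matrix acting on the right
   (v |-> v *m L, as for the library's Jacobian 'J), the covector with row p
   pairs with v as p *m v^T, and the bilinear form with matrix B is
   (u, v) |-> u *m B *m v^T. *)

Fixpoint Ck_on (R : realType) (n : nat) (W : normedModType R) (k : nat)
    (U : set 'rV[R]_n) (f : 'rV[R]_n -> W) : Prop :=
  (forall y, U y -> {for y, continuous f}) /\
  if k is k'.+1 then
    forall v : 'rV[R]_n,
      (forall y, U y -> derivable f y v) /\ Ck_on k' U (fun y => 'D_v f y)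
  else True.

Definition smooth_on (R : realType) (n : nat) (W : normedModType R)
    (U : set 'rV[R]_n) (f : 'rV[R]_n -> W) : Prop :=
  forall k, Ck_on k U f.

Definition partial (R : realType) (n : nat) (W : normedModType R)
    (i : 'I_n) (f : 'rV[R]_n -> W) (y : 'rV[R]_n) : W :=
  'D_(delta_mx 0 i) f y.

(* [coord c] is meaningful on [dom c] only, and [param c] is its inverse there.
   [chart_at x] is a preferred chart around x. It fixes the model 'rV[R]_n of
   the tangent space at x and of its dual: every (co)vector or tensor at x is
   represented by its components in [chart_at x], and [chart_change] computes
   the components in the other charts.  *)
Record atlas (R : realType) (T : Type) (n : nat) := Atlas {
  chart : Type;
  dom : chart -> set T;
  coord : chart -> T -> 'rV[R]_n;
  param : chart -> 'rV[R]_n -> T;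
  chart_at : T -> chart }.

Arguments chart {R T n} _.
Arguments dom {R T n} _ _.
Arguments coord {R T n} _ _.
Arguments param {R T n} _ _.
Arguments chart_at {R T n} _ _.

Record smooth_manifold (R : realType) (M : topologicalType) (n : nat)
    (A : atlas R M n) : Prop := SmoothManifold {
  manifold_hausdorff : hausdorff_space M;
  manifold_second_countable : @second_countable M;
  dom_open : forall c, open (dom A c);
  dom_chart_at : forall x, dom A (chart_at A x) x;
  coord_open : forall c, open (coord A c @` dom A c);
  coordK : forall c x, dom A c x -> param A c (coord A c x) = x;
  coord_continuous : forall c x, dom A c x -> {for x, continuous (coord A c)};
  param_continuous : forall c y, (coord A c @` dom A c) y ->
    {for y, continuous (param A c)};
  transition_smooth : forall c d,
    smooth_on (coord A c @` (dom A c `&` dom A d)) (coord A d \o param A c) }.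

Definition closed_manifold (R : realType) (M : topologicalType) (n : nat)
    (A : atlas R M n) : Prop :=
  smooth_manifold A /\ compact [set: M].

(* v *m chart_change A c d x has in d the components which v has in c. *)
Definition chart_change (R : realType) (T : Type) (n : nat) (A : atlas R T n)
    (c d : chart A) (x : T) : 'M[R]_n :=
  'J (coord A d \o param A c) (coord A c x).

Definition tangent_map (R : realType) (T T' : Type) (n n' : nat)
    (A : atlas R T n) (A' : atlas R T' n') (f : T -> T') (x : T)
    : 'M[R]_(n, n') :=
  'J (coord A' (chart_at A' (f x)) \o f \o param A (chart_at A x))
     (coord A (chart_at A x) x).

Definition differential (R : realType) (T : Type) (n : nat) (A : atlas R T n)
    (f : T -> R) (x : T) : 'rV[R]_n :=
  \row_i partial i (f \o param A (chart_at A x)) (coord A (chart_at A x) x).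

Definition has_velocity (R : realType) (T : Type) (n : nat) (A : atlas R T n)
    (gamma : R -> T) (t : R) (v : 'rV[R]_n) : Prop :=
  (\forall s \near t, dom A (chart_at A (gamma t)) (gamma s)) /\
  is_derive t 1 (fun s => coord A (chart_at A (gamma t)) (gamma s)) v.

Definition components1 (R : realType) (T : Type) (n : nat) (A : atlas R T n)
    (alpha : T -> 'rV[R]_n) (c : chart A) (y : 'rV[R]_n) : 'rV[R]_n :=
  let x := param A c y in
  alpha x *m (chart_change c (chart_at A x) x)^T.

Definition components2 (R : realType) (T : Type) (n : nat) (A : atlas R T n)
    (B : T -> 'M[R]_n) (c : chart A) (y : 'rV[R]_n) : 'M[R]_n :=
  let x := param A c y in
  let J := chart_change c (chart_at A x) x in
  J *m B x *m J^T.

Definition smooth_tensor2 (R : realType) (T : Type) (n : nat) (A : atlas R T n)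
    (B : T -> 'M[R]_n) : Prop :=
  forall c : chart A, smooth_on (coord A c @` dom A c) (components2 B c).

(* (d alpha)_ij = D_i alpha_j - D_j alpha_i *)
Definition d1 (R : realType) (T : Type) (n : nat) (A : atlas R T n)
    (alpha : T -> 'rV[R]_n) (x : T) : 'M[R]_n :=
  let c := chart_at A x in
  let a j y := components1 alpha c y 0 j in
  \matrix_(i, j) (partial i (a j) (coord A c x) - partial j (a i) (coord A c x)).

(* (dB)_ijk in the chart c, for an antisymmetric B *)
Definition d2 (R : realType) (T : Type) (n : nat) (A : atlas R T n)
    (B : T -> 'M[R]_n) (c : chart A) (i j k : 'I_n) (y : 'rV[R]_n) : R :=
  let b i j y := components2 B c y i j in
  partial i (b j k) y + partial j (b k i) y + partial k (b i j) y.

Definition pullback2 (R : realType) (T T' : Type) (n n' : nat)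
    (A : atlas R T n) (A' : atlas R T' n') (f : T -> T')
    (B : T' -> 'M[R]_n') (x : T) : 'M[R]_n :=
  tangent_map A A' f x *m B (f x) *m (tangent_map A A' f x)^T.

Record symplectic_form (R : realType) (T : Type) (n : nat) (A : atlas R T n)
    (Omega : T -> 'M[R]_n) : Prop := SymplecticForm {
  symplectic_smooth : smooth_tensor2 A Omega;
  symplectic_antisym : forall x, (Omega x)^T = - Omega x;
  symplectic_nondegenerate :
    forall x (v : 'rV[R]_n), v *m Omega x = 0 -> v = 0;
  symplectic_closed : forall c y, (coord A c @` dom A c) y ->
    forall i j k, d2 (A := A) Omega c i j k y = 0 }.

Record riemannian_metric (R : realType) (T : Type) (n : nat) (A : atlas R T n)
    (g : T -> 'M[R]_n) : Prop := RiemannianMetric {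
  metric_smooth : smooth_tensor2 A g;
  metric_sym : forall x, (g x)^T = g x;
  metric_pos : forall x (v : 'rV[R]_n),
    v != 0 -> 0 < (v *m g x *m v^T) 0 0 }.

(* [fiber] is the row of components of the covector in the preferred chart at
   [base]. A record rather than a product, whose product topology would be the
   wrong one: [chart_at] need not be locally constant. *)
Record cotangent (R : realType) (T : Type) (n : nat) :=
  Covector { base : T; fiber : 'rV[R]_n }.

Definition cotangent_atlas (R : realType) (T : Type) (n : nat)
    (A : atlas R T n) : atlas R (cotangent R T n) (n + n) :=
  {| chart := chart A;
     dom := fun c => [set x | dom A c (base x)];
     coord := fun c x =>
       let q := base x in
       row_mx (coord A c q) (fiber x *m (chart_change c (chart_at A q) q)^T);
     param := fun c y =>
       let q := param A c (lsubmx y) in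
       Covector q (rsubmx y *m (chart_change (chart_at A q) c q)^T);
     chart_at := fun x => chart_at A (base x) |}.

(* lambda_(q, p) (xi) = p (d pi xi) *)
Definition liouville_form (R : realType) (T : Type) (n : nat)
    (A : atlas R T n) (x : cotangent R T n) : 'rV[R]_(n + n) :=
  fiber x *m (tangent_map (cotangent_atlas A) A (@base R T n) x)^T.

(* omega_0 = - d lambda = dq /\ dp *)
Definition canonical_form (R : realType) (T : Type) (n : nat)
    (A : atlas R T n) (x : cotangent R T n) : 'M[R]_(n + n) :=
  - d1 (cotangent_atlas A) (liouville_form A) x.

Definition twisted_form (R : realType) (T : Type) (n : nat)
    (A : atlas R T n) (Omega : T -> 'M[R]_n) (x : cotangent R T n)
    : 'M[R]_(n + n) :=
  canonical_form A x
  + pullback2 (cotangent_atlas A) A (@base R T n) Omega x.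

Definition dual_norm (R : realType) (T : Type) (n : nat) (g : T -> 'M[R]_n)
    (x : cotangent R T n) : R :=
  sup [set `|(fiber x *m v^T) 0 0|
      | v in [set v : 'rV[R]_n | (v *m g (base x) *m v^T) 0 0 <= 1]].

Definition kinetic_energy (R : realType) (T : Type) (n : nat)
    (g : T -> 'M[R]_n) (x : cotangent R T n) : R :=
  2^-1 * dual_norm g x ^+ 2.

(* Sign convention for the Hamiltonian vector field X: omega (X, -) = dH. With
   omega_0 = dq /\ dp this gives q' = dH/dp, p' = - dH/dq. *)
Definition hamiltonian_orbit (R : realType) (T : Type) (n : nat)
    (A : atlas R T n) (omega : T -> 'M[R]_n) (H : T -> R) (gamma : R -> T)
    : Prop :=
  forall t, exists2 v : 'rV[R]_n, has_velocity A gamma t v &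
    v *m omega (gamma t) = differential A H (gamma t).

(* The loop sigma : R / T Z -> M is freely homotopic to a constant loop. *)
Definition contractible_loop (R : realType) (M : topologicalType) (T : R)
    (sigma : R -> M) : Prop :=
  exists (x0 : M) (F : R * R -> M),
    [/\ {within `[0, 1] `*` `[0, T], continuous F},
        forall t, t \in `[0, T] -> F (0, t) = sigma t,
        forall t, t \in `[0, T] -> F (1, t) = x0
      & forall s, s \in `[0, 1] -> F (s, 0) = F (s, T)].

Definition contractible_periodic_orbit_on_level (R : realType)
    (M : topologicalType) (n : nat) (A : atlas R M n)
    (omega : cotangent R M n -> 'M[R]_(n + n)) (H : cotangent R M n -> R)
    (e : R) : Prop :=
  exists (gamma : R -> cotangent R M n) (T : R),
    [/\ 0 < T,
        hamiltonian_orbit (cotangent_atlas A) omega H gamma,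
        forall t, gamma (t + T) = gamma t,
        forall t, H (gamma t) = e
      & contractible_loop T (fun t => base (gamma t))].

(* Main.v *)
(* A variational argument reaches every small energy e. On loops x of free
   period T in a chart where Omega = dL, the critical points of the action
   S(x, T) = 1/(2T) int g(x', x') + e T - int L(x') are the closed magnetic
   geodesics of energy e. Along the ray s |-> (x(0) + s (x - x(0)), s T) the
   action of a short loop has a single critical point, a maximum, so S is
   minimised on the Nehari set where the radial derivative vanishes, and minima
   there are genuine critical points. A small parallelogram spanned by u and w
   with Omega(u, w) > 0 shows that the minimum is O(e); this bounds the period,
   and the length tends to 0 with e, so that a minimiser stays inside one chart.
   Compactness is made finite dimensional: loops are replaced by closed
   N-gons in finitely many charts, and the rescaled minimal polygons converge
   along an ultrafilter on N to a closed solution of the Euler-Lagrange equation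
   in one chart ball, which makes it contractible. A minimal polygon could have
   its base point on the boundary of the chart ball; this is excluded by
   comparing the actions in two charts up to O(1/N) and penalising the distance
   of the base point to a limit base point. The Euler-Lagrange equation is
   invariant under chart changes, hence its solution lifts to an orbit in the
   cotangent bundle. *)

From HB Require Import structures.
From mathcomp Require Import all_boot all_order all_algebra.
From mathcomp Require Import all_classical all_reals all_analysis.
From mathcomp Require Import ring lra.
Require Import Defs.

Set Implicit Arguments.
Unset Strict Implicit.
Unset Printing Implicit Defensive.

Import Order.TTheory GRing.Theory Num.Theory.
Import numFieldNormedType.Exports.

Local Open Scope classical_set_scope.
Local Open Scope ring_scope.

(** * Differential calculus on row vectors *)

(** Every error is measured against the kinetic term [kin]. Closedness of a polygon kills the
    constant part of L, so act = kin - flux and neh = kin - 2 flux up to a small multiple of [kin],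
    with [flux] quadratic; on the Nehari set act, flux and kin/2 agree within a few percent. Hence T
    >= 1/(5 C^2), kin <= act / 0.46 and e T <= kin, and the bounds T1 <= T <= T2, kin <= M imposed
    for compactness are inactive near the minimum. Only the base vertex can meet its constraint, and
    no argument inside one chart excludes it: L is chosen chart by chart, so the action of a polygon
    has no intrinsic meaning. The comparison of two charts rests on the exterior derivative of L,
    through a discrete Stokes formula, and on an a priori speed bound, which comes from the
    equations at the vertices other than the base. The penalty then survives only in the equation at
    the base vertex, with a size tending to 0. Criticality under the Nehari constraint is drawn from
    the intermediate value theorem, as the constraint function is handled as a merely continuous
    one. *)

Lemma cvg_sumr (R : numFieldType) (W : normedModType R) (T I : Type)
    (F : set_system T) (r : seq I) (f : I -> T -> W) (a : I -> W) :
  Filter F -> (forall i, f i x @[x --> F] --> a i) ->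
  \sum_(i <- r) f i x @[x --> F] --> \sum_(i <- r) a i.
Proof.
by move=> FF fa; apply: cvg_big => [|i _]; [exact: add_continuous | exact: fa].
Qed.

Lemma entry_continuous (K : numFieldType) p q (i : 'I_p) (j : 'I_q) :
  continuous (fun M : 'M[K]_(p, q) => M i j).
Proof. exact: matrix_normedtype.coord_continuous. Qed.

Section DirectionalDerivatives.
Variables (R : realType) (n : nat).
Local Notation V := 'rV[R]_n.

Lemma is_derive_line (W : normedModType R) (f : V -> W) (y v : V) (t : R) :
  derivable f (y + t *: v) v ->
  is_derive t 1 (fun s : R => f (y + s *: v)) ('D_v f (y + t *: v)).
Proof.
have E : (fun h : R => h^-1 *: (((fun s : R => f (y + s *: v)) \o shift t) (h *: 1)
           - f (y + t *: v)))
  = (fun h : R => h^-1 *: ((f \o shift (y + t *: v)) (h *: v) - f (y + t *: v))).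
  apply/funext => h /=; congr (_ *: (f _ - _)).
  by rewrite [_%:A]mulr1 scalerDl addrCA.
move=> df; apply: DeriveDef; first by rewrite /derivable E.
by rewrite /derive E.
Qed.

Lemma derivableZdir (W : normedModType R) (f : V -> W) (y v : V) (a : R) :
  derivable f y v -> derivable f y (a *: v) /\ 'D_(a *: v) f y = a *: 'D_v f y.
Proof.
move=> df.
have [->|a0] := eqVneq a 0.
  by rewrite !scale0r derive0; split=> //; exact: derivable0.
have dF : is_derive (0 : R) 1 (fun s : R => f (y + s *: v)) ('D_v f y).
  by have := @is_derive_line W f y v 0; rewrite scale0r addr0; apply.
have dF' : differentiable (fun s : R => f (y + s *: v)) (a * 0).
  by rewrite mulr0; apply/derivable1_diffP.
have E : (fun h : R => h^-1 *: ((f \o shift y) (h *: (a *: v)) - f y))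
   = (fun h : R => h^-1 *: ((((fun s : R => f (y + s *: v)) \o ( *%R a)) \o shift 0) (h *: 1)
       - ((fun s : R => f (y + s *: v)) \o ( *%R a)) 0)).
  apply/funext => h /=; rewrite addr0 [_%:A]mulr1 mulr0 scale0r addr0 scalerA.
  by rewrite [a * h]mulrC [y + _]addrC.
have dl : is_diff (0 : R) ( *%R a) ( *%R a) by exact: is_diff_scaler.
have dcomp : differentiable ((fun s : R => f (y + s *: v)) \o ( *%R a)) (0 : R).
  exact: differentiable_comp.
split; first by rewrite /derivable E; exact/derivable1_diffP.
have -> : 'D_(a *: v) f y = 'D_1 ((fun s : R => f (y + s *: v)) \o ( *%R a)) 0.
  by rewrite /derive E.
rewrite deriveE // diff_comp // diff_val /= mulr1 mulr0.
rewrite -[X in 'd _ _ X = _]mulr1 -[(a * 1)%R]/(a *: (1:R)) linearZ /=.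
congr (_ *: _).
by rewrite -deriveE ?derive_val //; apply/derivable1_diffP.
Qed.

Lemma mvt_line (f : V -> R) (y v : V) :
  (forall t, t \in `[0, 1] -> derivable f (y + t *: v) v) ->
  exists2 t, t \in `[(0 : R), 1] & f (y + v) - f y = 'D_v f (y + t *: v).
Proof.
move=> df.
have [||t t01 E] := @MVT_segment R (fun s => f (y + s *: v))
  (fun t => 'D_v f (y + t *: v)) 0 1 ler01.
- by move=> t /subset_itv_oo_cc t01; apply: is_derive_line; apply: df.
- apply: derivable_within_continuous => t t01.
  by have [] := is_derive_line (df t t01).
by exists t => //; move: E; rewrite scale1r scale0r addr0 subr0 mulr1.
Qed.

Section C1.
Variables (U : set V) (f : V -> R).
Hypothesis oU : open U.
Hypothesis df : forall v y : V, U y -> derivable f y v.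
Hypothesis cf : forall v y : V, U y -> {for y, continuous ('D_v f)}.

(** The increment along [h *: (v + w)] is split at [y + h *: v]. The leg along [v] is a difference
    quotient; the mean value theorem turns the other into a derivative along [w] at a nearby point,
    which continuity moves to [y]. *)
Lemma deriveDdir (y v w : V) : U y -> 'D_(v + w) f y = 'D_v f y + 'D_w f y.
Proof.
move=> Uy; apply: cvg_lim => //; apply/cvgrPdist_le => e e0.
have e20 : 0 < e / 2 by rewrite divr_gt0.
have /cvgrPdist_le/(_ _ e20) := @cf w _ Uy.
move=> /(filterI (oU Uy)) /nbhs_ballP[r /= r0 rcf].
have /cvgrPdist_le/(_ _ e20) H := @df v _ Uy.
near=> h.
have h0 : h != 0 by near: h; exact: nbhs_dnbhs_neq.
have hr : `|h| * (`|v| + `|w| + 1) < r.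
  rewrite -ltr_pdivlMr; last by rewrite ltr_wpDl // addr_ge0.
  by near: h; apply: dnbhs0_lt; rewrite divr_gt0 // ltr_wpDl // addr_ge0.
have close t : t \in `[(0 : R), 1] -> ball y r (y + h *: v + t *: (h *: w)).
  rewrite in_itv /= => /andP[t0 t1]; rewrite -ball_normE /=.
  rewrite -addrA opprD addrA subrr sub0r normrN (le_lt_trans _ hr) //.
  rewrite (le_trans (ler_normD _ _)) // !normrZ (ger0_norm t0).
  rewrite -addrA mulrDr lerD2l mulrDr mulr1 mulrCA.
  by rewrite ler_wpDr // ler_wpM2l // ler_piMl.
have [t t01 E] : exists2 t, t \in `[(0 : R), 1] &
    f (y + h *: v + h *: w) - f (y + h *: v)
    = 'D_(h *: w) f (y + h *: v + t *: (h *: w)).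
  by apply: mvt_line => t /close /rcf[Ut _]; exact: df.
have [Ut Ht] := rcf _ (close _ t01).
have := (derivableZdir h (@df w _ Ut)).2 => Dh; rewrite {}Dh in E.
have -> : (f \o shift y) (h *: (v + w)) - f y
    = (f (y + h *: v + h *: w) - f (y + h *: v)) + ((f \o shift y) (h *: v) - f y).
  rewrite /= [h *: v + y]addrC addrA subrK scalerDr; congr (f _ - _).
  by rewrite addrC addrA.
rewrite scalerDr E scalerA mulVf // scale1r opprD addrACA addrC.
rewrite [X in `|X|](_ : _ = ('D_w f y - 'D_w f (y + h *: v + t *: (h *: w))) +
   ('D_v f y - h^-1 *: ((f \o shift y) (h *: v) - f y))); last by ring.
rewrite (le_trans (ler_normD _ _)) // [leRHS](splitr e) lerD //.
by near: h; exact: H.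
Unshelve. all: by end_near. Qed.

Lemma derive_coord_sum (y v : V) : U y ->
  'D_v f y = \sum_i v 0 i * 'D_(delta_mx 0 i) f y.
Proof.
move=> Uy; rewrite {1}(row_sum_delta v).
have D0 : 'D_0 f y = 0 by rewrite derive0.
have := @big_morph _ _ (fun v => 'D_v f y) 0 +%R 0 +%R
  (fun a b => deriveDdir a b Uy) D0.
move=> ->; apply: eq_bigr => i _.
by rewrite (derivableZdir _ (@df _ _ Uy)).2.
Qed.

(** [Ck_on] speaks of directional derivatives only; the total derivative, which the chain rule and
    Jacobians use, is recovered from them. The candidate [v |-> 'D_v f y] is linear, and the mean
    value theorem on a segment reduces the remainder to the oscillation of the [n] partial
    derivatives. *)
Lemma C1_differentiable (y : V) : U y -> differentiable f y.
Proof.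
move=> Uy.
pose d (v : V) : R := 'D_v f y.
have lin_d : linear d.
  move=> a v w; rewrite /d deriveDdir // (derivableZdir _ (@df _ _ Uy)).2 //.
pose dM := GRing.isLinear.Build _ _ _ _ _ lin_d.
pose dL : {linear V -> R} := HB.pack d dM.
have dLc : continuous (dL : V -> R).
  have -> : (dL : V -> R) = (fun v => \sum_i v 0 i * 'D_(delta_mx 0 i) f y).
    by apply/funext => v; exact: derive_coord_sum.
  move=> v; apply: (cvg_sumr (F := nbhs v)) => i; apply: cvgMr_tmp.
  exact: entry_continuous.
have E : f \o shift y = cst (f y) + (dL : V -> R) +o_ (0 : V) id.
  apply/eqaddoP => _/posnumP[e].
  (* Each of the [n] partial derivatives contributes one such error; adding 1 keeps the divisor
     positive when [n = 0]. *)
  have cD i : \forall z \near y, `|'D_(delta_mx 0 i) f y - 'D_(delta_mx 0 i) f z|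
       <= e%:num / (n%:R + 1).
    have /cvgrPdist_le := @cf (delta_mx 0 i) y Uy.
    by apply; rewrite divr_gt0 // ltr_wpDl.
  have : \forall z \near y, U z /\ forall i, `|'D_(delta_mx 0 i) f y - 'D_(delta_mx 0 i) f z|
       <= e%:num / (n%:R + 1).
    have nU : nbhs y U by apply: open_nbhs_nbhs.
    by near=> z; split; [near: z; exact: nU | near: z; exact: filter_forall cD].
  move=> /nbhs_ballP[r /= r0 rP].
  have near_r : \forall h \near (0 : V), `|h| < r by exact: nbhs0_lt.
  near=> h.
  have hr : `|h| < r by near: h; exact: near_r.
  have close t : t \in `[(0 : R), 1] -> ball y r (y + t *: h).
    rewrite in_itv /= => /andP[t0 t1]; rewrite -ball_normE /=.
    rewrite opprD addrA subrr sub0r normrN normrZ (ger0_norm t0).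
    by rewrite (le_lt_trans _ hr) // ler_piMl.
  have [t t01 Et] := @mvt_line f y h (fun t t01 => @df _ _ (rP _ (close t t01)).1).
  rewrite -[X in X <= _]/(`|f (h + y) - (f y + d h)|).
  have [Ut Ht] := rP _ (close _ t01).
  rewrite opprD addrA [h + y]addrC Et /d !derive_coord_sum // -sumrB.
  rewrite (le_trans (ler_norm_sum _ _ _)) //.
  have hc i : `|h 0 i| <= `|h|.
    by rewrite [leRHS]/Num.Def.normr /= mx_normrE; exact: (le_bigmax _ _ (ord0, i)).
  rewrite (@le_trans _ _ (\sum_(i < n) `|h| * (e%:num / (n%:R + 1)))) //.
    apply: ler_sum => i _; rewrite -mulrBr normrM ler_pM //.
    by rewrite distrC.
  rewrite sumr_const card_ord -mulrnAr [leRHS]mulrC ler_wpM2l //.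
  by rewrite -[_ *+ n]mulr_natl mulrA ler_pdivrMr ?ltr_wpDl // mulrC ler_wpM2l // lerDl.
have := @diff_unique R V R f dL y dLc E => dfE.
apply/diff_locallyP; split; first by rewrite dfE.
by rewrite dfE.
Unshelve. all: by end_near. Qed.

End C1.
End DirectionalDerivatives.

(** * Functions of class Ck and derivatives along curves *)

Section CkBasics.
Variables (R : realType) (n : nat).
Local Notation V := 'rV[R]_n.

Lemma Ck_on_ext (W : normedModType R) k (U : set V) (f g : V -> W) :
  open U -> {in U, f =1 g} -> Ck_on k U f -> Ck_on k U g.
Proof.
move=> oU; elim: k f g => [|k IH] f g fg [cf df].
  split=> // y Uy; have Hn : \forall z \near y, f z = g z.
    by apply: filterS (open_nbhs_nbhs (conj oU Uy)) => z Uz; apply: fg; rewrite inE.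
  rewrite /prop_for /continuous_at -fg ?inE //.
  exact: cvg_trans (near_eq_cvg Hn) (cf y Uy).
have Hn y (Uy : U y) : \forall z \near y, f z = g z.
  by apply: filterS (open_nbhs_nbhs (conj oU Uy)) => z Uz; apply: fg; rewrite inE.
split.
  move=> y Uy; rewrite /prop_for /continuous_at -fg ?inE //.
  exact: cvg_trans (near_eq_cvg (Hn y Uy)) (cf y Uy).
move=> v; have [dv cv] := df v; split.
  by move=> y Uy; apply: near_eq_derivable (dv y Uy); exact: Hn.
apply: IH cv => y; rewrite inE => Uy.
by apply: near_eq_derive; exact: Hn.
Qed.

Lemma Ck_onW (W : normedModType R) k (U : set V) (f : V -> W) :
  Ck_on k.+1 U f -> Ck_on k U f.
Proof.
elim: k f => [|k IH] f [cf df]; first by split.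
by split=> // v; have [dv cv] := df v; split=> //; exact: IH.
Qed.

Lemma Ck_on_entry p q k (U : set V) (f : V -> 'M[R]_(p, q)) i j :
  open U -> Ck_on k U f -> Ck_on k U (fun y => f y i j : R).
Proof.
move=> oU; elim: k f => [|k IH] f [cf df].
  split=> // y Uy; apply: (@continuous_comp _ _ _ f (fun A : 'M[R]_(p, q) => A i j) y (cf y Uy)).
  exact: entry_continuous.
split.
  move=> y Uy; apply: (@continuous_comp _ _ _ f (fun A : 'M[R]_(p, q) => A i j) y (cf y Uy)).
  exact: entry_continuous.
move=> v; have [dv cv] := df v; split.
  by move=> y Uy; have /derivable_mxP := dv y Uy; apply.
apply: Ck_on_ext (IH _ cv) => // y; rewrite inE => Uy.
by rewrite derive_mx ?mxE //; exact: dv.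
Qed.

Lemma Ck_on_open_subset (W : normedModType R) k (U U' : set V) (f : V -> W) :
  U' `<=` U -> Ck_on k U f -> Ck_on k U' f.
Proof.
move=> sub; elim: k f => [|k IH] f [cf df]; first by split=> // y /sub; exact: cf.
split=> [y /sub|v]; first exact: cf.
by have [dv cv] := df v; split=> [y /sub|]; [exact: dv | exact: IH].
Qed.

Lemma entry_norm p q (A : 'M[R]_(p, q)) i j : `|A i j| <= `|A|.
Proof.
by rewrite [leRHS]/Num.Def.normr /= mx_normrE; exact: (le_bigmax _ _ (i, j)).
Qed.

Lemma mx_norm_le p q (A : 'M[R]_(p, q)) (c : R) :
  0 <= c -> (forall i j, `|A i j| <= c) -> `|A| <= c.
Proof.
move=> c0 Ac; rewrite [leLHS]/Num.Def.normr /= mx_normrE.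
by apply: bigmax_le => // -[i j] _; exact: Ac.
Qed.

Lemma differentiable_mx p q (f : V -> 'M[R]_(p, q)) y :
  (forall i j, differentiable (fun z => f z i j : R) y) -> differentiable f y.
Proof.
move=> df.
have -> : f = \sum_(i < p) (\sum_(j < q) (fun z => (f z i j : R) *: (delta_mx i j : 'M[R]_(p, q)))).
  apply/funext => z; rewrite {1}(matrix_sum_delta (f z)).
  rewrite fct_sumE; apply: eq_bigr => i _; rewrite fct_sumE.
  by apply: eq_bigr.
apply: differentiable_sum => i; apply: differentiable_sum => j.
by apply: differentiableZl; exact: df.
Qed.

Lemma C1_differentiable_mx p q (U : set V) (f : V -> 'M[R]_(p, q)) y :
  open U -> Ck_on 1 U f -> U y -> differentiable f y.
Proof.
move=> oU cf Uy; apply: differentiable_mx => i j.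
have [_ df] := Ck_on_entry i j oU cf.
apply: (@C1_differentiable R n U) => // [v z Uz|v z Uz].
  by have [+ _] := df v; exact.
by have [_ [+ _]] := df v; exact.
Qed.

Lemma is_derive_curve (W : normedModType R) (f : V -> W) (X : R -> V) (t : R) (X' : V) :
  differentiable f (X t) -> is_derive t 1 X X' ->
  is_derive t 1 (fun s => f (X s)) ('D_X' f (X t)).
Proof.
move=> df dX.
have dX' : differentiable X t by apply/derivable1_diffP; case: dX.
have dc : differentiable (f \o X) t by exact: differentiable_comp.
apply: DeriveDef; first by apply/derivable1_diffP.
rewrite -[LHS]/('D_1 (f \o X) t) deriveE // diff_comp //= -deriveE //.
by rewrite -(deriveE _ dX') derive_val.
Qed.

Lemma is_derive_mx (p q : nat) (f : R -> 'M[R]_(p, q)) (t : R) (f' : 'M[R]_(p, q)) :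
  (forall i j, is_derive t 1 (fun s => f s i j : R) (f' i j)) -> is_derive t 1 f f'.
Proof.
move=> df.
have d : derivable f t 1 by apply/derivable_mxP => i j; case: (df i j).
apply: DeriveDef => //; rewrite derive_mx //; apply/matrixP => i j; rewrite mxE.
by have [_ ->] := df i j.
Qed.

Lemma is_derive_entry (p q : nat) (f : R -> 'M[R]_(p, q)) (t : R) (f' : 'M[R]_(p, q)) i j :
  is_derive t 1 f f' -> is_derive t 1 (fun s => f s i j : R) (f' i j).
Proof.
move=> [d <-]; have /derivable_mxP/(_ i j) dij := d.
by apply: DeriveDef => //; rewrite derive_mx // mxE.
Qed.

End CkBasics.

(** * Symmetry of second derivatives *)

Section Schwarz.
Variables (R : realType) (n : nat).
Local Notation V := 'rV[R]_n.

Lemma derivable_shift (f : V -> R) (a y v : V) :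
  derivable f (y + a) v ->
  derivable (fun z => f (z + a)) y v /\ 'D_v (fun z => f (z + a)) y = 'D_v f (y + a).
Proof.
have E : (fun h : R => h^-1 *: (((fun z => f (z + a)) \o shift y) (h *: v) - f (y + a)))
 = (fun h : R => h^-1 *: ((f \o shift (y + a)) (h *: v) - f (y + a))).
  by apply/funext => h /=; rewrite addrA.
by rewrite /derivable /derive E.
Qed.

(** The second difference of [f] over the parallelogram spanned by [s *: u] and [s *: v], divided by
    the square of [s], is symmetric in [u] and [v]; two applications of the mean value theorem show
    that it tends to each of the mixed derivatives. *)
Lemma schwarz (U : set V) (f : V -> R) (u v y : V) :
  open U -> Ck_on 2 U f -> U y ->
  'D_u (fun z => 'D_v f z) y = 'D_v (fun z => 'D_u f z) y.
Proof.
move=> oU cf Uy.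
have second (a b : V) (e : R) : 0 < e -> \forall s \near (0 : R)^'+,
    `|s^-1 ^+ 2 * (f (y + s *: a + s *: b) - f (y + s *: a) - f (y + s *: b) + f y)
      - 'D_b (fun z => 'D_a f z) y| <= e.
  move=> e0.
  have [_ /(_ a)[da [_ /(_ b)[dba [+ _]]]]] := cf.
  move=> /(_ _ Uy)/cvgrPdist_le/(_ _ e0) H.
  have nU : nbhs y U by apply: open_nbhs_nbhs.
  have : \forall z \near y, U z /\ `|'D_b (fun z => 'D_a f z) y - 'D_b (fun z => 'D_a f z) z| <= e.
    by near=> z; split; [near: z; exact: nU | near: z; exact: H].
  move=> /nbhs_ballP[r /= r0 rP].
  near=> s.
  have s0 : 0 < s by near: s; exact: nbhs_right_gt.
  have hr : s * (`|a| + `|b| + 1) < r.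
    rewrite -ltr_pdivlMr; last by rewrite ltr_wpDl // addr_ge0.
    by near: s; apply: nbhs_right_lt; rewrite divr_gt0 // ltr_wpDl // addr_ge0.
  have close p q : p \in `[(0 : R), 1] -> q \in `[(0 : R), 1] ->
      ball y r (y + p *: (s *: a) + q *: (s *: b)).
    rewrite !in_itv /= => /andP[p0 p1] /andP[q0 q1]; rewrite -ball_normE /=.
    rewrite -addrA opprD addrA subrr sub0r normrN (le_lt_trans _ hr) //.
    rewrite (le_trans (ler_normD _ _)) // !normrZ (ger0_norm p0) (ger0_norm q0).
    rewrite (gtr0_norm s0) -addrA mulrDr lerD //.
      by rewrite ler_piMl // mulr_ge0 // ltW.
    rewrite mulrDr ler_wpDr ?ler_piMl ?mulr_ge0 //; exact: ltW.
  pose g z := f (z + s *: b) - f z.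
  have I1 : (1 : R) \in `[(0 : R), 1] by rewrite in_itv /= ler01 lexx.
  have I0 : (0 : R) \in `[(0 : R), 1] by rewrite in_itv /= ler01 lexx.
  have dg p : p \in `[(0 : R), 1] -> derivable g (y + p *: (s *: a)) (s *: a) /\
     'D_(s *: a) g (y + p *: (s *: a)) = s * ('D_a f (y + p *: (s *: a) + s *: b) - 'D_a f (y + p *: (s *: a))).
    move=> p01.
    have [U1 _] := rP _ (close p 1 p01 I1); rewrite scale1r in U1.
    have [U0 _] := rP _ (close p 0 p01 I0); rewrite scale0r addr0 in U0.
    have [d1 e1] := derivableZdir s (da _ U1).
    have [d0 e00] := derivableZdir s (da _ U0).
    have [d1' e1'] := derivable_shift d1.
    split; first exact: derivableB.
    by rewrite deriveB // e1' e1 e00 -scalerBr.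
  have [p p01 Ep] := @mvt_line R n g y (s *: a) (fun p p01 => (dg p p01).1).
  rewrite (dg p p01).2 in Ep.
  have dDa q : q \in `[(0 : R), 1] -> derivable (fun z => 'D_a f z) (y + p *: (s *: a) + q *: (s *: b)) (s *: b)
     /\ 'D_(s *: b) (fun z => 'D_a f z) (y + p *: (s *: a) + q *: (s *: b))
        = s * 'D_b (fun z => 'D_a f z) (y + p *: (s *: a) + q *: (s *: b)).
    move=> q01; have [Uq _] := rP _ (close p q p01 q01).
    by have [] := derivableZdir s (dba _ Uq).
  have [q q01 Eq] := @mvt_line R n (fun z => 'D_a f z) (y + p *: (s *: a)) (s *: b) (fun q q01 => (dDa q q01).1).
  rewrite (dDa q q01).2 in Eq; rewrite Eq in Ep.
  have -> : f (y + s *: a + s *: b) - f (y + s *: a) - f (y + s *: b) + f y = g (y + s *: a) - g y.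
    by rewrite /g; ring.
  rewrite Ep mulrA -expr2 mulrA -exprMn mulVf ?gt_eqF // expr1n mul1r distrC.
  by have [_ ] := rP _ (close p q p01 q01).
have := second v u; have := second u v.
set A := 'D_u _ _; set B := 'D_v _ _; move: A B => A B HB HA.
apply/eqP; rewrite -subr_eq0 -normr_le0; apply/ler_addgt0Pr => e e0.
have e20 : 0 < e / 2 by rewrite divr_gt0.
rewrite add0r.
pose q s := s^-1 ^+ 2 * (f (y + s *: u + s *: v) - f (y + s *: u) - f (y + s *: v) + f y).
have qE s : q s = s^-1 ^+ 2 * (f (y + s *: v + s *: u) - f (y + s *: v) - f (y + s *: u) + f y).
  by rewrite /q [y + s *: v + s *: u]addrAC; ring.
have H : \forall s \near (0 : R)^'+, `|A - B| <= e.
  near=> s.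
  have HB1 : `|q s - B| <= e / 2 by near: s; exact: HB.
  have HA1 : `|q s - A| <= e / 2 by rewrite qE; near: s; exact: HA.
  have -> : A - B = (q s - B) - (q s - A) by ring.
  by rewrite (le_trans (ler_normB _ _)) // [leRHS]splitr lerD.
by have [s] := filter_ex H.
Unshelve. all: by end_near. Qed.

End Schwarz.

(** * Uniform estimates on closed balls *)

Section Bounds.
Variables (R : realType) (n : nat).
Local Notation V := 'rV[R]_n.
Variables (y0 : V) (r : R).
Hypothesis r0 : 0 <= r.

Definition cball : set V := [set y | `|y - y0| <= r].

Lemma cball_center : cball y0.
Proof. by rewrite /cball /= subrr normr0. Qed.

Lemma cball_compact : compact cball.
Proof.
have -> : cball = [set v : V | forall i, `[y0 ord0 i - r, y0 ord0 i + r]%classic (v ord0 i)].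
  apply/seteqP; split => v /=.
    move=> vr i; rewrite in_itv /=; have := entry_norm (v - y0) ord0 i.
    move=> /le_trans/(_ vr); rewrite !mxE ler_norml => /andP[]; lra.
  move=> vr; apply: mx_norm_le => // i j; rewrite (ord1 i).
  move: (vr j); rewrite in_itv /= !mxE ler_norml => /andP[]; lra.
apply: (@rV_compact R n (fun i => `[y0 ord0 i - r, y0 ord0 i + r]%classic)) => i.
exact: segment_compact.
Qed.

Lemma cball_convex y y' t : cball y -> cball y' -> t \in `[(0 : R), 1] ->
  cball (y + t *: (y' - y)).
Proof.
rewrite /cball /= in_itv /= => By By' /andP[t0 t1].
have -> : y + t *: (y' - y) - y0 = (1 - t) *: (y - y0) + t *: (y' - y0).
  by apply/rowP => i; rewrite !mxE; ring.
rewrite (le_trans (ler_normD _ _)) // !normrZ (ger0_norm t0) ger0_norm ?subr_ge0 //.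
by rewrite (@le_trans _ _ ((1 - t) * r + t * r)) ?lerD ?ler_wpM2l ?subr_ge0 // -mulrDl subrK mul1r.
Qed.

Lemma cball_bounded (f : V -> R) : (forall y, cball y -> {for y, continuous f}) ->
  exists2 C, 0 <= C & forall y, cball y -> `|f y| <= C.
Proof.
move=> cf.
have [|||y By Hy] := @compact_EVT_max V R (fun y => `|f y|) cball.
- by exists y0; exact: cball_center.
- exact: cball_compact.
- apply/continuous_in_subspaceT => y; rewrite inE => By.
  by apply: continuous_comp (cf y By) _; exact: norm_continuous.
by exists `|f y| => // z Bz; apply: Hy; rewrite inE.
Qed.

Variable U : set V.
Hypothesis oU : open U.
Hypothesis sU : cball `<=` U.

Lemma C1_bound (f : V -> R) : Ck_on 1 U f ->
  exists2 C, 0 <= C & [/\ forall y, cball y -> `|f y| <= C,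
    forall y w, cball y -> `|'D_w f y| <= C * `|w| &
    forall y y', cball y -> cball y' -> `|f y' - f y| <= C * `|y' - y|].
Proof.
move=> [cf df].
have [C0 C00 H0] := @cball_bounded f (fun y By => cf y (sU By)).
have dd v y (Uy : U y) : derivable f y v by have [+ _] := df v; exact.
have cd v y (Uy : U y) : {for y, continuous ('D_v f)} by have [_ [+ _]] := df v; exact.
have /choice[C1 H1] : forall i : 'I_n, exists C, 0 <= C /\ forall y, cball y -> `|'D_(delta_mx 0 i) f y| <= C.
  move=> i; have [|C Cp H] := @cball_bounded (fun y => 'D_(delta_mx 0 i) f y).
    by move=> y By; exact/cd/sU.
  by exists C.
pose C := C0 + \sum_i C1 i.
have C10 : 0 <= \sum_i C1 i by apply: sumr_ge0 => i _; exact: (H1 i).1.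
have D1 y w : cball y -> `|'D_w f y| <= C * `|w|.
  move=> By; rewrite (derive_coord_sum oU dd cd) ?(le_trans (ler_norm_sum _ _ _)) //; last exact: sU.
  rewrite mulrDl ler_wpDl ?mulr_ge0 // mulr_suml ler_sum // => i _.
  by rewrite normrM mulrC ler_pM //; [exact: (H1 i).2 | exact: entry_norm].
exists C; first exact: addr_ge0.
split=> // [y By|y y' By By']; first by rewrite ler_wpDr // H0.
have [|t t01 E] := @mvt_line R n f y (y' - y).
  by move=> t t01; apply/dd/sU; exact: cball_convex.
by rewrite [y + (y' - y)]addrC subrK in E; rewrite E; apply: D1; exact: cball_convex.
Qed.

(** The last two clauses, a Lipschitz derivative and a quadratic Taylor remainder, are all that the
    variational argument draws from second derivatives. *)
Definition C2_bounds p q (f : V -> 'M[R]_(p, q)) (C : R) : Prop :=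
  [/\ forall y, cball y -> `|f y| <= C,
    forall y w, cball y -> `|'D_w f y| <= C * `|w|,
    forall y y', cball y -> cball y' -> `|f y' - f y| <= C * `|y' - y|,
    forall y y' w, cball y -> cball y' -> `|'D_w f y' - 'D_w f y| <= C * `|y' - y| * `|w| &
    forall y y', cball y -> cball y' -> `|f y' - f y - 'D_(y' - y) f y| <= C * `|y' - y| ^+ 2].

Lemma C2_bound_real (f : V -> R) : Ck_on 2 U f ->
  exists2 C, 0 <= C & [/\ forall y, cball y -> `|f y| <= C,
    forall y w, cball y -> `|'D_w f y| <= C * `|w|,
    forall y y', cball y -> cball y' -> `|f y' - f y| <= C * `|y' - y|,
    forall y y' w, cball y -> cball y' -> `|'D_w f y' - 'D_w f y| <= C * `|y' - y| * `|w| &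
    forall y y', cball y -> cball y' -> `|f y' - f y - 'D_(y' - y) f y| <= C * `|y' - y| ^+ 2].
Proof.
move=> cf.
have [C C0 [H1 H2 H3]] := C1_bound (Ck_onW cf).
have [cf0 df] := cf.
have dd v y (Uy : U y) : derivable f y v by have [+ _] := df v; exact.
have cd v y (Uy : U y) : {for y, continuous ('D_v f)} by have [_ [+ _]] := df v; exact.
have /choice[C1 Hi] : forall i : 'I_n, exists C, 0 <= C /\ forall y y', cball y -> cball y' ->
    `|'D_(delta_mx 0 i) f y' - 'D_(delta_mx 0 i) f y| <= C * `|y' - y|.
  move=> i; have [_ cd1] := df (delta_mx 0 i); have [D D0 [_ _ HD]] := C1_bound cd1.
  by exists D.
have C10 : 0 <= \sum_i C1 i by apply: sumr_ge0 => i _; exact: (Hi i).1.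
pose D := C + \sum_i C1 i.
have CD : C <= D by rewrite lerDl.
have L1 y y' w : cball y -> cball y' -> `|'D_w f y' - 'D_w f y| <= D * `|y' - y| * `|w|.
  move=> By By'; rewrite !(derive_coord_sum oU dd cd) -?sumrB; try exact: sU.
  rewrite (le_trans (ler_norm_sum _ _ _)) //.
  rewrite mulrDl mulrDl ler_wpDl ?mulr_ge0 // !mulr_suml ler_sum // => i _.
  by rewrite -mulrBr normrM mulrC ler_pM //; [exact: (Hi i).2 | exact: entry_norm].
exists D; first exact: addr_ge0.
split=> // [y By|y w By|y y' By By'|y y' By By'].
- exact: le_trans (H1 _ By) CD.
- by apply: le_trans (H2 _ _ By) _; rewrite ler_wpM2r.
- by apply: le_trans (H3 _ _ By By') _; rewrite ler_wpM2r.
- have [|t t01 E] := @mvt_line R n f y (y' - y).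
    by move=> t t01; apply/dd/sU; exact: cball_convex.
  rewrite [y + _]addrC subrK in E; rewrite E.
  apply: (le_trans (L1 _ _ _ By (cball_convex By By' t01))).
  rewrite [y + _]addrC addrK expr2 mulrA ler_wpM2r // ler_wpM2l ?addr_ge0 //.
  move: t01; rewrite in_itv /= => /andP[t0 t1].
  by rewrite normrZ (ger0_norm t0) ler_piMl.
Qed.

Lemma C2_bound p q (f : V -> 'M[R]_(p, q)) : Ck_on 2 U f ->
  exists2 C, 0 <= C & C2_bounds f C.
Proof.
move=> cf.
have dd v y (By : cball y) : derivable f y v by have [_ /(_ v)[+ _]] := cf; apply; exact: sU.
pose good i j C := 0 <= C /\ [/\ forall y, cball y -> `|f y i j| <= C,
    forall y w, cball y -> `|'D_w (fun z => f z i j : R) y| <= C * `|w|,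
    forall y y', cball y -> cball y' -> `|f y' i j - f y i j| <= C * `|y' - y|,
    forall y y' w, cball y -> cball y' -> `|'D_w (fun z => f z i j : R) y' - 'D_w (fun z => f z i j : R) y| <= C * `|y' - y| * `|w| &
    forall y y', cball y -> cball y' -> `|f y' i j - f y i j - 'D_(y' - y) (fun z => f z i j : R) y| <= C * `|y' - y| ^+ 2].
have /choice[D H] : forall i : 'I_p, exists D : 'I_q -> R, forall j, good i j (D j).
  move=> i; have /choice[D HD] : forall j, exists C, good i j C; last by exists D.
  by move=> j; have [C C0 HC] := C2_bound_real (Ck_on_entry i j oU cf); exists C.
pose C := \sum_i \sum_j D i j.
have D0 i j : 0 <= D i j by exact: (H i j).1.
have DC i j : D i j <= C.
  rewrite /C (bigD1 i) //= (bigD1 j) //= -addrA lerDl addr_ge0 //; first by rewrite sumr_ge0.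
  by rewrite sumr_ge0 // => k _; rewrite sumr_ge0.
have C0 : 0 <= C by rewrite sumr_ge0 // => i _; rewrite sumr_ge0.
have dE v y i j : cball y -> ('D_v f y) i j = 'D_v (fun z => f z i j : R) y.
  by move=> By; rewrite (derive_mx (dd v y By)) mxE.
exists C => //.
split=> [y By|y w By|y y' By By'|y y' w By By'|y y' By By'];
  (apply: mx_norm_le => [|i j]; first by rewrite ?mulr_ge0 ?exprn_ge0);
  rewrite ?mxE ?dE //; have [_ [h1 h2 h3 h4 h5]] := H i j.
- exact: le_trans (h1 _ By) (DC i j).
- by apply: le_trans (h2 _ _ By) _; rewrite ler_wpM2r.
- by apply: le_trans (h3 _ _ By By') _; rewrite ler_wpM2r.
- by apply: le_trans (h4 _ _ _ By By') _; rewrite !ler_wpM2r.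
- by apply: le_trans (h5 _ _ By By') _; rewrite ler_wpM2r ?exprn_ge0.
Qed.

End Bounds.

(** * Discrete action of polygonal loops *)

Section SumLemmas.
Variable R : realType.

Lemma sum_sqr_le (a : nat -> R) (N : nat) :
  (\sum_(k < N) a k) ^+ 2 <= N%:R * \sum_(k < N) a k ^+ 2.
Proof.
case: N => [|N]; first by rewrite !big_ord0 mulr0 expr0n.
elim: N => [|N IH]; first by rewrite !big_ord_recr !big_ord0 /= !add0r mul1r.
rewrite big_ord_recr [in leRHS]big_ord_recr /=.
set S := \sum_(k < _) a k in IH *; set Q := \sum_(k < _) _ in IH *; set b := a _.
rewrite -natr1; set m : R := N.+1%:R in IH *.
have m0 : 0 < m by rewrite /m ltr0n.
have : 2 * S * b <= Q + m * b ^+ 2.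
  rewrite -(ler_pM2l m0); have := sqr_ge0 (S - m * b); nra.
nra.
Qed.

Lemma norm_sum_le (N : nat) (f g : nat -> R) :
  (forall k, (k < N)%N -> `|f k| <= g k) -> `|\sum_(k < N) f k| <= \sum_(k < N) g k.
Proof.
by move=> fg; rewrite (le_trans (ler_norm_sum _ _ _)) // ler_sum // => k _; exact: fg.
Qed.

Lemma unimodal_max (psi h : R -> R) (s : R) :
  (forall t : R, t \in `[0, 2] -> is_derive t 1 psi (h t)) ->
  (forall t : R, 0 < t -> t < 1 -> 0 <= h t) -> (forall t : R, 1 < t -> t <= 2 -> h t <= 0) ->
  0 < s -> s <= 2 -> psi s <= psi 1.
Proof.
move=> dpsi hp hn s0 s2.
have sI t : 0 < t -> t <= 2 -> t \in `[(0 : R), 2].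
  by move=> t0 t2; rewrite in_itv /= t2 ltW.
have mvt a b : 0 < a -> b <= 2 -> a < b ->
    exists2 c, c \in `]a, b[ & psi b - psi a = h c * (b - a).
  move=> a0 b2 ab.
  have I t : t \in `[a, b] -> t \in `[(0 : R), 2].
    rewrite in_itv /= => /andP[at_ tb].
    by apply: sI; [exact: lt_le_trans at_ | exact: le_trans tb b2].
  have D (t : R) : t \in `]a, b[ -> is_derive t 1 psi (h t).
    by move=> /subset_itv_oo_cc /I; exact: dpsi.
  have cpsi : {within `[a, b], continuous psi}.
    by apply: derivable_within_continuous => t /I /dpsi[].
  exact: (MVT ab D cpsi).
case: (ltgtP s 1) => [s1|s1|->] //.
  have [|c] := mvt s 1 s0 _ s1; first by rewrite ler1n.
  rewrite in_itv /= => /andP[c0 c1] E.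
  by rewrite -subr_ge0 E mulr_ge0 ?subr_ge0 ?(ltW s1) // hp // (lt_trans s0).
have [c] := mvt 1 s ltr01 s2 s1.
rewrite in_itv /= => /andP[c0 c1] E.
by rewrite -subr_le0 E mulr_le0_ge0 ?subr_ge0 ?(ltW s1) // hn // (le_trans (ltW c1)).
Qed.

End SumLemmas.

(** * Abstract Lagrangians and their action on polygons *)

Section Lagrangian.
Variables (R : realType) (n : nat).
Local Notation V := 'rV[R]_n.

(* [lB y u v] is a metric, [lL y v] a one-form, [lB1 y w u v] and [lL1 y w v]
   are their derivatives at [y] in the direction [w]. *)
Record lag := Lag {
  lB : V -> V -> V -> R;
  lB1 : V -> V -> V -> V -> R;
  lL : V -> V -> R;
  lL1 : V -> V -> V -> R }.

(** The variational part sees a chart only through this interface. [U] is the open domain where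
    derivatives exist and are continuous, [K] the set where the bounds hold with one constant.
    Continuity is stated along arbitrary filters because it serves at points, within intervals and
    along an ultrafilter. *)
Record lag_ok (U K : set V) (C : R) (l : lag) : Prop := LagOk {
  lag_sub : K `<=` U;
  lag_open : open U;
  lag_C1 : 1 <= C;
  lB_lin : forall y a u u' v, lB l y (a *: u + u') v = a * lB l y u v + lB l y u' v;
  lB_sym : forall y u v, lB l y u v = lB l y v u;
  lB1_lin : forall y w a u u' v, lB1 l y w (a *: u + u') v = a * lB1 l y w u v + lB1 l y w u' v;
  lB1_sym : forall y w u v, lB1 l y w u v = lB1 l y w v u;
  lB1_linw : forall y a w w' u v, U y ->
    lB1 l y (a *: w + w') u v = a * lB1 l y w u v + lB1 l y w' u v;
  lL_lin : forall y a u u', lL l y (a *: u + u') = a * lL l y u + lL l y u';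
  lL1_lin : forall y w a u u', lL1 l y w (a *: u + u') = a * lL1 l y w u + lL1 l y w u';
  lL1_linw : forall y a w w' u, U y ->
    lL1 l y (a *: w + w') u = a * lL1 l y w u + lL1 l y w' u;
  lB_ell : forall y v, K y -> `|v| ^+ 2 <= C * lB l y v v;
  lB_bd : forall y u v, K y -> `|lB l y u v| <= C * `|u| * `|v|;
  lB_lip : forall y y' u v, K y -> K y' ->
    `|lB l y' u v - lB l y u v| <= C * `|y' - y| * `|u| * `|v|;
  lB_tay : forall y y' u v, K y -> K y' ->
    `|lB l y' u v - lB l y u v - lB1 l y (y' - y) u v| <= C * `|y' - y| ^+ 2 * `|u| * `|v|;
  lB1_bd : forall y w u v, K y -> `|lB1 l y w u v| <= C * `|w| * `|u| * `|v|;
  lB1_lip : forall y y' w u v, K y -> K y' ->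
    `|lB1 l y' w u v - lB1 l y w u v| <= C * `|y' - y| * `|w| * `|u| * `|v|;
  lL_bd : forall y v, K y -> `|lL l y v| <= C * `|v|;
  lL_lip : forall y y' v, K y -> K y' -> `|lL l y' v - lL l y v| <= C * `|y' - y| * `|v|;
  lL_tay : forall y y' v, K y -> K y' ->
    `|lL l y' v - lL l y v - lL1 l y (y' - y) v| <= C * `|y' - y| ^+ 2 * `|v|;
  lL1_bd : forall y w v, K y -> `|lL1 l y w v| <= C * `|w| * `|v|;
  lL1_lip : forall y y' w v, K y -> K y' ->
    `|lL1 l y' w v - lL1 l y w v| <= C * `|y' - y| * `|w| * `|v|;
  lB_der : forall y w u v t, U (y + t *: w) ->
    is_derive t 1 (fun s => lB l (y + s *: w) u v) (lB1 l (y + t *: w) w u v);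
  lL_der : forall y w v t, U (y + t *: w) ->
    is_derive t 1 (fun s => lL l (y + s *: w) v) (lL1 l (y + t *: w) w v);
  lB_cvg : forall (T : Type) (F : set_system T) (FF : Filter F) (y u v : T -> V) y0 u0 v0,
    U y0 -> y @ F --> y0 -> u @ F --> u0 -> v @ F --> v0 ->
    lB l (y t) (u t) (v t) @[t --> F] --> lB l y0 u0 v0;
  lB1_cvg : forall (T : Type) (F : set_system T) (FF : Filter F) (y w u v : T -> V) y0 w0 u0 v0,
    U y0 -> y @ F --> y0 -> w @ F --> w0 -> u @ F --> u0 -> v @ F --> v0 ->
    lB1 l (y t) (w t) (u t) (v t) @[t --> F] --> lB1 l y0 w0 u0 v0;
  lL_cvg : forall (T : Type) (F : set_system T) (FF : Filter F) (y v : T -> V) y0 v0,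
    U y0 -> y @ F --> y0 -> v @ F --> v0 -> lL l (y t) (v t) @[t --> F] --> lL l y0 v0;
  lL1_cvg : forall (T : Type) (F : set_system T) (FF : Filter F) (y w v : T -> V) y0 w0 v0,
    U y0 -> y @ F --> y0 -> w @ F --> w0 -> v @ F --> v0 ->
    lL1 l (y t) (w t) (v t) @[t --> F] --> lL1 l y0 w0 v0 }.

End Lagrangian.

Section Discrete.
Variables (R : realType) (n : nat).
Local Notation V := 'rV[R]_n.

(** A polygon with [N] edges is a sequence whose entries 0 to [N] matter; closedness [x N = x 0] is
    a separate condition. The parameter interval has length 1, so [dl x k] stands for [x' / N] and
    [sqn] for the integral of [|x'|^2]. The dilation [scal] fixes the base vertex. *)
Definition dl (x : nat -> V) k : V := x k.+1 - x k.
Definition vv (x : nat -> V) k : V := x k - x 0%N.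
Definition scal (s : R) (x : nat -> V) k : V := x 0%N + s *: vv x k.
Definition per (N : nat) (x : nat -> V) : R := \sum_(k < N) `|dl x k|.
Definition sqn (N : nat) (x : nat -> V) : R := N%:R * \sum_(k < N) `|dl x k| ^+ 2.

Lemma scal0 s x : scal s x 0 = x 0%N.
Proof. by rewrite /scal /vv subrr scaler0 addr0. Qed.

Lemma dl_scal s x k : dl (scal s x) k = s *: dl x k.
Proof. by rewrite /dl /scal opprD addrACA subrr add0r -scalerBr /vv opprB addrA subrK. Qed.

Lemma vv_scal s x k : vv (scal s x) k = s *: vv x k.
Proof. by rewrite {1}/vv scal0 /scal addrC addKr. Qed.

Lemma scal1 x : scal 1 x = x.
Proof. by apply/funext => k; rewrite /scal /vv scale1r addrC subrK. Qed.

Lemma per_ge0 N x : 0 <= per N x.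
Proof. exact: sumr_ge0. Qed.

Lemma sqn_ge0 N x : 0 <= sqn N x.
Proof. by rewrite mulr_ge0 // sumr_ge0 // => k _; exact: sqr_ge0. Qed.

Lemma per_sqr N x : per N x ^+ 2 <= sqn N x.
Proof. exact: (sum_sqr_le (fun k => `|dl x k|)). Qed.

Lemma vv_per N x k : (k <= N)%N -> `|vv x k| <= per N x.
Proof.
move=> kN; have -> : vv x k = \sum_(j < k) dl x j.
  elim: k {kN} => [|k IH]; first by rewrite big_ord0 /vv subrr.
  by rewrite big_ord_recr /= -IH /vv /dl addrC addrA subrK.
rewrite (le_trans (ler_norm_sum _ _ _)) // /per.
rewrite -!(big_mkord xpredT (fun k => `|dl x k|)).
by rewrite (big_cat_nat _ kN) //= lerDl sumr_ge0.
Qed.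

Lemma per_scal N s x : 0 <= s -> per N (scal s x) = s * per N x.
Proof.
move=> s0; rewrite /per mulr_sumr; apply: eq_bigr => k _.
by rewrite dl_scal normrZ ger0_norm.
Qed.

Lemma sum_dl N x : x N = x 0%N -> \sum_(k < N) dl x k = 0.
Proof.
move=> xN; have -> : \sum_(k < N) dl x k = x N - x 0%N; last by rewrite xN subrr.
elim: N {xN} => [|N IH]; first by rewrite big_ord0 subrr.
by rewrite big_ord_recr /= IH /dl addrC addrA subrK.
Qed.

Variables (U K : set V) (C : R) (l : lag R n).
Hypothesis ok : lag_ok U K C l.
Variables (N : nat) (e : R).

(** [En / (2 T) + e T - Fl] is the action of the loop run in time [T]. [En1] and [Fl1] differentiate
    the coefficients when each vertex moves along [vv], so that [neh] is the derivative of
    [act (scal s x) (s T)] in [s] at 1. [flux] is the second order part of [Fl] at the base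
    vertex. *)
Definition En (x : nat -> V) : R := N%:R * \sum_(k < N) lB l (x k) (dl x k) (dl x k).
Definition Fl (x : nat -> V) : R := \sum_(k < N) lL l (x k) (dl x k).
Definition En1 (x : nat -> V) : R := N%:R * \sum_(k < N) lB1 l (x k) (vv x k) (dl x k) (dl x k).
Definition Fl1 (x : nat -> V) : R := \sum_(k < N) lL1 l (x k) (vv x k) (dl x k).
Definition flux (x : nat -> V) : R := \sum_(k < N) lL1 l (x 0%N) (vv x k) (dl x k).
Definition kin (x : nat -> V) (T : R) : R := En x / (2 * T) + e * T.
Definition act (x : nat -> V) (T : R) : R := kin x T - Fl x.
Definition neh (x : nat -> V) (T : R) : R := kin x T - Fl x + En1 x / (2 * T) - Fl1 x.

Let C0 : 0 <= C.
Proof. exact: le_trans ler01 (lag_C1 ok). Qed.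

Lemma lL0 y : lL l y 0 = 0.
Proof. by have := lL_lin ok y (-1) 0 0; rewrite scaler0 addr0; lra. Qed.

Lemma lL_sum y (u : nat -> V) m : lL l y (\sum_(k < m) u k) = \sum_(k < m) lL l y (u k).
Proof.
elim: m => [|m IH]; first by rewrite !big_ord0 lL0.
rewrite !big_ord_recr /= -IH addrC -[u m]scale1r (lL_lin ok) mul1r addrC.
by rewrite scale1r.
Qed.

Lemma lBZ y a b u v : lB l y (a *: u) (b *: v) = a * b * lB l y u v.
Proof.
have Z c p q : lB l y (c *: p) q = c * lB l y p q.
  have := lB_lin ok y c p 0 q; have := lB_lin ok y (-1) 0 0 q.
  rewrite !scaler0 !addr0; lra.
by rewrite Z (lB_sym ok) Z (lB_sym ok) mulrA.
Qed.

Lemma lB1Z y w a b u v : lB1 l y w (a *: u) (b *: v) = a * b * lB1 l y w u v.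
Proof.
have Z c p q : lB1 l y w (c *: p) q = c * lB1 l y w p q.
  have := lB1_lin ok y w c p 0 q; have := lB1_lin ok y w (-1) 0 0 q.
  rewrite !scaler0 !addr0; lra.
by rewrite Z (lB1_sym ok) Z (lB1_sym ok) mulrA.
Qed.

Lemma lB1Zw y a w u v : U y -> lB1 l y (a *: w) u v = a * lB1 l y w u v.
Proof.
move=> Uy; have := lB1_linw ok a w 0 u v Uy; have := lB1_linw ok (-1) 0 0 u v Uy.
rewrite !scaler0 !addr0; lra.
Qed.

Lemma lLZ y a v : lL l y (a *: v) = a * lL l y v.
Proof. by have := lL_lin ok y a v 0; rewrite addr0 lL0 addr0. Qed.

Lemma lL1Z y w a v : lL1 l y w (a *: v) = a * lL1 l y w v.
Proof.
have := lL1_lin ok y w a v 0; have := lL1_lin ok y w (-1) 0 0.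
rewrite !scaler0 !addr0; lra.
Qed.

Lemma lL1Zw y a w v : U y -> lL1 l y (a *: w) v = a * lL1 l y w v.
Proof.
move=> Uy; have := lL1_linw ok a w 0 v Uy; have := lL1_linw ok (-1) 0 0 v Uy.
rewrite !scaler0 !addr0; lra.
Qed.

Section Estimates.
Variables (x : nat -> V) (T : R).
Hypothesis xK1 : forall k, (k < N)%N -> K (x k).
Hypothesis xN : x N = x 0%N.
Hypothesis T0 : 0 < T.
Hypothesis e0 : 0 < e.

Let xK0 k : (k < N)%N -> K (x 0%N).
Proof. by move=> kN; apply: xK1; exact: leq_ltn_trans kN. Qed.

Lemma sqn_En : sqn N x <= C * En x.
Proof.
rewrite /sqn /En mulrCA ler_wpM2l // mulr_sumr ler_sum // => k _.
exact: (lB_ell ok) (xK1 (ltn_ord k)).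
Qed.

Lemma En_ge0 : 0 <= En x.
Proof.
have := le_trans (sqn_ge0 N x) sqn_En; rewrite pmulr_rge0 //.
exact: lt_le_trans ltr01 (lag_C1 ok).
Qed.

Lemma kin_gt0 : 0 < kin x T.
Proof. by rewrite ltr_wpDl ?mulr_gt0 // divr_ge0 ?En_ge0 // mulr_ge0 // ltW. Qed.

Lemma sqn_kin : sqn N x <= 2 * C * T * kin x T.
Proof.
have h : En x <= 2 * T * kin x T.
  rewrite /kin mulrDr mulrCA divff ?mulr1 ?gt_eqF ?mulr_gt0 //.
  by rewrite lerDl ltW // !mulr_gt0.
have := sqn_En; have := ler_wpM2l C0 h; lra.
Qed.

Lemma sum_vdl3 : \sum_(k < N) C * `|vv x k| ^+ 2 * `|dl x k| <= C * per N x * sqn N x.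
Proof.
rewrite (@le_trans _ _ (C * per N x ^+ 2 * per N x)) //.
  rewrite {2}/per mulr_sumr ler_sum // => k _.
  rewrite ler_wpM2r // ler_wpM2l // ler_sqr ?nnegrE ?per_ge0 //.
  exact: (vv_per _ (ltnW (ltn_ord k))).
have := ler_wpM2l (mulr_ge0 C0 (per_ge0 N x)) (per_sqr N x); lra.
Qed.

Lemma sum_vdl2 : N%:R * (\sum_(k < N) C * `|vv x k| * `|dl x k| * `|dl x k|)
   <= C * per N x * sqn N x.
Proof.
rewrite /sqn [leRHS]mulrCA ler_wpM2l // mulr_sumr ler_sum // => k _.
rewrite -mulrA -expr2 ler_wpM2r ?sqr_ge0 // ler_wpM2l //.
exact: (vv_per _ (ltnW (ltn_ord k))).
Qed.

Lemma En1_le : `|En1 x| <= C * per N x * sqn N x.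
Proof.
apply: le_trans sum_vdl2; rewrite /En1 normrM ger0_norm // ler_wpM2l //.
apply: (norm_sum_le (f := fun k => lB1 l (x k) (vv x k) (dl x k) (dl x k))
  (g := fun k => C * `|vv x k| * `|dl x k| * `|dl x k|)) => k kN.
exact: (lB1_bd ok) (xK1 kN).
Qed.

Lemma Fl1_le : `|Fl1 x - flux x| <= C * per N x * sqn N x.
Proof.
apply: le_trans sum_vdl3; rewrite /Fl1 /flux -sumrB.
apply: (norm_sum_le (f := fun k => lL1 l (x k) (vv x k) (dl x k) - lL1 l (x 0%N) (vv x k) (dl x k))
  (g := fun k => C * `|vv x k| ^+ 2 * `|dl x k|)) => k kN.
by have := lL1_lip ok (vv x k) (dl x k) (xK0 kN) (xK1 kN); rewrite expr2 mulrA.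
Qed.

(** Closedness removes the first order term, which is [L] at the base vertex applied to the sum of
    the edges. After subtraction of the second order term, the Taylor remainder is of third order in
    the size of the loop. *)
Lemma Fl_le : `|Fl x - flux x| <= C * per N x * sqn N x.
Proof.
apply: le_trans sum_vdl3; rewrite /Fl /flux -sumrB.
have -> : \sum_(k < N) (lL l (x k) (dl x k) - lL1 l (x 0%N) (vv x k) (dl x k)) =
   \sum_(k < N) (lL l (x k) (dl x k) - lL l (x 0%N) (dl x k) - lL1 l (x 0%N) (vv x k) (dl x k)).
  apply/eqP; rewrite -subr_eq0 -sumrB.
  rewrite (eq_bigr (fun k : 'I_N => lL l (x 0%N) (dl x k))) => [|k _]; last by ring.
  by rewrite -(lL_sum _ (dl x)) sum_dl // lL0.
apply: (norm_sum_le (f := fun k => lL l (x k) (dl x k) - lL l (x 0%N) (dl x k) - lL1 l (x 0%N) (vv x k) (dl x k))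
  (g := fun k => C * `|vv x k| ^+ 2 * `|dl x k|)) => k kN.
exact: (lL_tay ok) (xK0 kN) (xK1 kN).
Qed.

Lemma flux_le : `|flux x| <= C * sqn N x.
Proof.
rewrite (@le_trans _ _ (C * per N x * per N x)) //; last first.
  by rewrite -mulrA -expr2 ler_wpM2l // per_sqr.
rewrite {2}/per mulr_sumr /flux.
apply: (norm_sum_le (f := fun k => lL1 l (x 0%N) (vv x k) (dl x k))
  (g := fun k => C * per N x * `|dl x k|)) => k kN.
apply: le_trans (lL1_bd ok _ _ (xK0 kN)) _.
by rewrite ler_wpM2r // ler_wpM2l // (vv_per _ (ltnW kN)).
Qed.

(** Relative size of the third order errors: they are bounded by [C per sqn (1 + 1/T)], and
    [sqn <= 2 C T kin] turns this into [2 small kin]. *)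
Definition small : R := C ^+ 2 * per N x * (1 + T).

Lemma err_le : C * per N x * sqn N x * (1 + T^-1) <= 2 * small * kin x T.
Proof.
have h := ler_wpM2l (mulr_ge0 C0 (per_ge0 N x)) sqn_kin.
have T1 : 0 <= 1 + T^-1 by rewrite addr_ge0 // invr_ge0 ltW.
apply: le_trans (ler_wpM2r T1 h) _.
rewrite le_eqVlt; apply/orP; left; apply/eqP; rewrite /small.
by field; rewrite gt_eqF.
Qed.

Lemma err_le1 : C * per N x * sqn N x <= 2 * small * kin x T.
Proof.
apply: le_trans err_le; rewrite ler_peMr ?lerDl ?invr_ge0 ?(ltW T0) //.
exact: mulr_ge0 (mulr_ge0 C0 (per_ge0 N x)) (sqn_ge0 N x).
Qed.

Lemma act_kin : `|act x T - (kin x T - flux x)| <= 2 * small * kin x T.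
Proof.
apply: le_trans err_le1; have -> : act x T - (kin x T - flux x) = - (Fl x - flux x).
  by rewrite /act; ring.
by rewrite normrN Fl_le.
Qed.

(** [Fl] and [Fl1] contribute one [flux] each, whence the factor 2, while [En1] is entirely of third
    order. *)
Lemma neh_kin : `|neh x T - (kin x T - 2 * flux x)| <= 4 * small * kin x T.
Proof.
have h1 := En1_le; have h2 := Fl1_le; have h3 := Fl_le; have h4 := err_le.
have -> : neh x T - (kin x T - 2 * flux x) =
   En1 x / (2 * T) - (Fl x - flux x) - (Fl1 x - flux x) by rewrite /neh; ring.
have h5 : `|En1 x / (2 * T)| <= C * per N x * sqn N x * T^-1.
  rewrite normrM (ger0_norm (x := (2 * T)^-1)) ?invr_ge0 ?mulr_ge0 ?(ltW T0) //.
  rewrite ler_pM // ?invr_ge0 ?mulr_ge0 ?(ltW T0) //.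
  by rewrite lef_pV2 ?posrE ?mulr_gt0 // ler_peMl ?(ltW T0) // ler1n.
move: h2 h3 h5; rewrite !ler_norml => /andP[? ?] /andP[? ?] /andP[? ?].
have h6 := err_le1; apply/andP; split; lra.
Qed.

End Estimates.

(** * The action along a ray *)

Section Ray.
Variables (x : nat -> V) (T : R).
Hypothesis xK : forall s k, s \in `[(0 : R), 2] -> (k < N)%N -> K (scal s x k).
Hypothesis xN : x N = x 0%N.
Hypothesis T0 : 0 < T.
Hypothesis e0 : 0 < e.

Let I1 : (1 : R) \in `[(0 : R), 2].
Proof. by rewrite in_itv /= ler01 ler1n. Qed.

Let xK1 k : (k < N)%N -> K (x k).
Proof. by move=> kN; rewrite -(scal1 x); exact: xK. Qed.

Let xK0 k : (k < N)%N -> K (x 0%N).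
Proof. by move=> kN; apply: xK1; exact: leq_ltn_trans kN. Qed.

Hypothesis sm : small x T <= 1 / 100.
Hypothesis per1 : per N x <= 1.

(** Edges scale exactly along the ray, so the action is [s] times an expression in which only the
    points of evaluation depend on [s]; [h] is the derivative of this product. *)
Let q s : R := N%:R * \sum_(k < N) lB l (scal s x k) (dl x k) (dl x k).
Let f s : R := \sum_(k < N) lL l (scal s x k) (dl x k).
Let q' s : R := N%:R * \sum_(k < N) lB1 l (scal s x k) (vv x k) (dl x k) (dl x k).
Let f' s : R := \sum_(k < N) lL1 l (scal s x k) (vv x k) (dl x k).
Let h s : R := q s / (2 * T) + e * T - f s + s * (q' s / (2 * T) - f' s).

Lemma act_scal s : 0 < s -> act (scal s x) (s * T) = s * (q s / (2 * T) + e * T - f s).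
Proof.
move=> s0; rewrite /act /kin /En /Fl.
under eq_bigr => k _ do rewrite dl_scal lBZ.
under [X in _ - X]eq_bigr => k _ do rewrite dl_scal lLZ.
rewrite -!mulr_sumr /q /f; field.
by rewrite !gt_eqF.
Qed.

Lemma neh_scal s : s \in `[(0 : R), 2] -> 0 < s -> neh (scal s x) (s * T) = s * h s.
Proof.
move=> s2 s0; rewrite /neh -/(act _ _) act_scal // /En1 /Fl1.
have E1 : \sum_(k < N) lB1 l (scal s x k) (vv (scal s x) k) (dl (scal s x) k) (dl (scal s x) k)
  = \sum_(k < N) s ^+ 3 * lB1 l (scal s x k) (vv x k) (dl x k) (dl x k).
  apply: eq_bigr => k _; rewrite dl_scal vv_scal lB1Z lB1Zw; first by ring.
  exact: (lag_sub ok) (xK s2 (ltn_ord k)).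
have E2 : \sum_(k < N) lL1 l (scal s x k) (vv (scal s x) k) (dl (scal s x) k)
  = \sum_(k < N) s ^+ 2 * lL1 l (scal s x k) (vv x k) (dl x k).
  apply: eq_bigr => k _; rewrite dl_scal vv_scal lL1Z lL1Zw; first by ring.
  exact: (lag_sub ok) (xK s2 (ltn_ord k)).
rewrite E1 E2 -!mulr_sumr /h /q' /f'; field.
by rewrite !gt_eqF.
Qed.

Lemma ray_der s : s \in `[(0 : R), 2] ->
  is_derive s 1 (fun s => s * (q s / (2 * T) + e * T - f s)) (h s).
Proof.
move=> s2.
have dq : is_derive s 1 q (q' s).
  rewrite /q /q'; apply: is_derive_eq.
    apply: is_deriveZ.
    have -> : (fun s => \sum_(k < N) lB l (scal s x k) (dl x k) (dl x k))
        = \sum_(k < N) (fun s => lB l (scal s x k) (dl x k) (dl x k)).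
      by apply/funext => t; rewrite fct_sumE.
    apply: is_derive_sum => k; apply: (lB_der ok).
    exact: (lag_sub ok) (xK s2 (ltn_ord k)).
  by [].
have df : is_derive s 1 f (f' s).
  rewrite /f /f'.
  have -> : (fun s => \sum_(k < N) lL l (scal s x k) (dl x k))
        = \sum_(k < N) (fun s => lL l (scal s x k) (dl x k)).
    by apply/funext => t; rewrite fct_sumE.
  apply: is_derive_sum => k; apply: (lL_der ok).
  exact: (lag_sub ok) (xK s2 (ltn_ord k)).
apply: is_derive_eq.
rewrite /h /= !scaler0 !add0r !addr0 /GRing.scale /=; ring.
Qed.

Lemma scal_sub s s' k : scal s x k - scal s' x k = (s - s') *: vv x k.
Proof. by rewrite /scal opprD addrACA subrr add0r scalerBl. Qed.

Hypothesis neh0 : neh x T = 0.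

(** To leading order [h s] is [kin - 2 s flux], and [neh x T = 0] forces [2 flux] to be about [kin].
    The slope is therefore about [- kin]; the errors allowed by [small <= 1/100] leave at least half
    of it. Increments are estimated because [lag_ok] gives Lipschitz bounds for [lB1] and [lL1] but
    no derivatives. *)
Lemma ray_decr s s' : s' \in `[(0 : R), 2] -> s \in `[(0 : R), 2] -> s' < s ->
  h s - h s' <= (s - s') * (- (kin x T / 2)).
Proof.
move=> s'2 s2 ss.
have d0 : 0 < s - s' by rewrite subr_gt0.
move: (s2) (s'2); rewrite !in_itv /= => /andP[s0 sle2] /andP[s'0 s'le2].
have P0 := per_ge0 N x.
set E := C * per N x * sqn N x.
have E0 : 0 <= E := mulr_ge0 (mulr_ge0 C0 P0) (sqn_ge0 N x).
have qd : `|q s - q s'| <= (s - s') * E.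
  rewrite /q -mulrBr -sumrB normrM (ger0_norm (x := N%:R)) //.
  apply: le_trans (ler_wpM2l (ltW d0) (sum_vdl2 x)); rewrite mulrCA ler_wpM2l // mulr_sumr.
  apply: (norm_sum_le (f := fun k => lB l (scal s x k) (dl x k) (dl x k) - lB l (scal s' x k) (dl x k) (dl x k))
   (g := fun k => (s - s') * (C * `|vv x k| * `|dl x k| * `|dl x k|))) => k kN.
  apply: le_trans (lB_lip ok _ _ (xK s'2 kN) (xK s2 kN)) _.
  by rewrite scal_sub normrZ gtr0_norm // le_eqVlt; apply/orP; left; apply/eqP; ring.
have q1 : `|q' s| <= E.
  rewrite /q' normrM (ger0_norm (x := N%:R)) //.
  apply: le_trans (sum_vdl2 x); rewrite ler_wpM2l //.
  apply: (norm_sum_le (f := fun k => lB1 l (scal s x k) (vv x k) (dl x k) (dl x k))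
   (g := fun k => C * `|vv x k| * `|dl x k| * `|dl x k|)) => k kN.
  exact: (lB1_bd ok) (xK s2 kN).
have q1d : `|q' s - q' s'| <= (s - s') * E.
  rewrite /q' -mulrBr -sumrB normrM (ger0_norm (x := N%:R)) //.
  apply: le_trans (ler_wpM2l (ltW d0) (sum_vdl2 x)); rewrite mulrCA ler_wpM2l // mulr_sumr.
  apply: (norm_sum_le (f := fun k => lB1 l (scal s x k) (vv x k) (dl x k) (dl x k) - lB1 l (scal s' x k) (vv x k) (dl x k) (dl x k))
   (g := fun k => (s - s') * (C * `|vv x k| * `|dl x k| * `|dl x k|))) => k kN.
  apply: le_trans (lB1_lip ok _ _ _ (xK s'2 kN) (xK s2 kN)) _.
  rewrite scal_sub normrZ gtr0_norm //.
  have v1 : `|vv x k| <= 1 by apply: le_trans per1; exact: (vv_per _ (ltnW kN)).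
  rewrite (_ : C * _ * _ * _ * _ = (s - s') * (C * `|vv x k| * `|dl x k| * `|dl x k|) * `|vv x k|); last by ring.
  by rewrite ler_piMr // !mulr_ge0 // ltW.
have fd : `|f s - f s' - (s - s') * flux x| <= (s - s') * (2 * E).
  rewrite /f /flux mulr_sumr -!sumrB.
  apply: (@le_trans _ _ (\sum_(k < N) (s - s') * (2 * (C * `|vv x k| ^+ 2 * `|dl x k|)))); last first.
    by rewrite -!mulr_sumr ler_wpM2l ?(ltW d0) // ler_wpM2l // (sum_vdl3 x).
  apply: (norm_sum_le (f := fun k => lL l (scal s x k) (dl x k) - lL l (scal s' x k) (dl x k) - (s - s') * lL1 l (x 0%N) (vv x k) (dl x k))
   (g := fun k => (s - s') * (2 * (C * `|vv x k| ^+ 2 * `|dl x k|)))) => k kN.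
  have Us' : U (scal s' x k) := lag_sub ok (xK s'2 kN).
  have := lL_tay ok (dl x k) (xK s'2 kN) (xK s2 kN).
  rewrite scal_sub lL1Zw // normrZ gtr0_norm // => A.
  have B' : `|lL1 l (scal s' x k) (vv x k) (dl x k) - lL1 l (x 0%N) (vv x k) (dl x k)| <= C * s' * `|vv x k| ^+ 2 * `|dl x k|.
    apply: le_trans (lL1_lip ok _ _ (xK0 kN) (xK s'2 kN)) _.
    rewrite {1}/scal addrAC subrr add0r normrZ (ger0_norm s'0).
    by rewrite le_eqVlt; apply/orP; left; apply/eqP; ring.
  rewrite (_ : _ - _ = (lL l (scal s x k) (dl x k) - lL l (scal s' x k) (dl x k) - (s - s') * lL1 l (scal s' x k) (vv x k) (dl x k))
    + (s - s') * (lL1 l (scal s' x k) (vv x k) (dl x k) - lL1 l (x 0%N) (vv x k) (dl x k))); last by ring.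
  apply: le_trans (ler_normD _ _) _; rewrite [X in _ + X]normrM gtr0_norm //.
  have B'' := ler_wpM2l (ltW d0) B'.
  have Y0 : 0 <= C * `|vv x k| ^+ 2 * `|dl x k| by rewrite !mulr_ge0 ?sqr_ge0.
  have Z0 : 0 <= (s - s') * (C * `|vv x k| ^+ 2 * `|dl x k|) by rewrite mulr_ge0 // ltW.
  move: A B'' Y0 Z0; set Y := `|vv x k| ^+ 2 * `|dl x k|; nra.
have f1 : `|f' s - flux x| <= 2 * E.
  rewrite /f' /flux -sumrB.
  apply: (@le_trans _ _ (\sum_(k < N) (2 * (C * `|vv x k| ^+ 2 * `|dl x k|)))); last first.
    by rewrite -!mulr_sumr ler_wpM2l // (sum_vdl3 x).
  apply: (norm_sum_le (f := fun k => lL1 l (scal s x k) (vv x k) (dl x k) - lL1 l (x 0%N) (vv x k) (dl x k))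
   (g := fun k => (2 * (C * `|vv x k| ^+ 2 * `|dl x k|)))) => k kN.
  apply: le_trans (lL1_lip ok _ _ (xK0 kN) (xK s2 kN)) _.
  rewrite {1}/scal addrAC subrr add0r normrZ (ger0_norm s0).
  rewrite (_ : C * _ * _ * _ = s * (C * `|vv x k| ^+ 2 * `|dl x k|)); last by ring.
  by rewrite ler_wpM2r // !mulr_ge0 ?sqr_ge0.
have f1d : `|f' s - f' s'| <= (s - s') * E.
  rewrite /f' -sumrB.
  apply: (@le_trans _ _ (\sum_(k < N) (s - s') * (C * `|vv x k| ^+ 2 * `|dl x k|))); last first.
    by rewrite -mulr_sumr ler_wpM2l ?(ltW d0) // (sum_vdl3 x).
  apply: (norm_sum_le (f := fun k => lL1 l (scal s x k) (vv x k) (dl x k) - lL1 l (scal s' x k) (vv x k) (dl x k))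
   (g := fun k => (s - s') * (C * `|vv x k| ^+ 2 * `|dl x k|))) => k kN.
  apply: le_trans (lL1_lip ok _ _ (xK s'2 kN) (xK s2 kN)) _.
  rewrite scal_sub normrZ gtr0_norm //.
  by rewrite le_eqVlt; apply/orP; left; apply/eqP; ring.
have nk := neh_kin xK1 xN T0 e0; rewrite neh0 in nk.
have er : E * (1 + T^-1) <= 2 * small x T * kin x T := err_le xK1 T0 e0.
have k0 := kin_gt0 xK1 T0 e0.
have smk : small x T * kin x T <= 1 / 100 * kin x T by rewrite ler_wpM2r // ltW.
set iT := T^-1 in er; have iT0 : 0 < iT by rewrite invr_gt0.
have -> : h s - h s' = (q s - q s') * iT / 2 - (f s - f s')
   + ((s - s') * q' s + s' * (q' s - q' s')) * iT / 2
   - ((s - s') * f' s + s' * (f' s - f' s')).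
  by rewrite /h /iT; field; rewrite gt_eqF.
move: qd q1 q1d fd f1 f1d nk; rewrite !ler_norml.
set d := s - s' in d0 *.
move=> /andP[_ a1] /andP[_ a2] /andP[_ a3] /andP[b1 _] /andP[b2 _] /andP[b3 _] /andP[c1 c2].
have A1 : (q s - q s') * iT <= d * E * iT by rewrite ler_wpM2r // ltW.
have A2 : d * q' s * iT <= d * E * iT by rewrite ler_wpM2r ?(ltW iT0) // ler_wpM2l // ltW.
have A3 : s' * (q' s - q' s') * iT <= 2 * (d * E) * iT.
  rewrite ler_wpM2r // ?(ltW iT0) //.
  apply: le_trans (ler_wpM2l s'0 a3) _; by rewrite ler_wpM2r // mulr_ge0 // ltW.
have B2 : d * (flux x - 2 * E) <= d * f' s by rewrite ler_wpM2l ?(ltW d0) //; lra.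
have B3 : - (2 * (d * E)) <= s' * (f' s - f' s').
  by apply: le_trans (ler_wpM2l s'0 b3); rewrite mulrN lerN2 ler_wpM2r // mulr_ge0 // ltW.
have er' := ler_wpM2l (ltW d0) er.
have smk' := ler_wpM2l (ltW d0) smk.
have c' : d * (2 * flux x) >= d * (96 / 100 * kin x T) by rewrite ler_wpM2l ?(ltW d0) //; lra.
have D0 : 0 <= d * E by rewrite mulr_ge0 // ltW.
have D1 : 0 <= d * E * iT by rewrite mulr_ge0 // ltW.
lra.
Qed.

Lemma ray_h1 : h 1 = 0.
Proof. by have := neh_scal I1 ltr01; rewrite scal1 mul1r neh0 mul1r => <-. Qed.

Lemma ray_pos s : 0 < s -> s < 1 -> 0 < neh (scal s x) (s * T).
Proof.
move=> s0 s1; have s2 : s \in `[(0 : R), 2] by rewrite in_itv /= ltW //=; lra.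
rewrite neh_scal // pmulr_rgt0 //.
have := ray_decr s2 I1 s1; rewrite ray_h1; have k0 := kin_gt0 xK1 T0 e0.
have : 0 < (1 - s) * kin x T by rewrite mulr_gt0 // subr_gt0.
nra.
Qed.

Lemma ray_neg s : 1 < s -> s <= 2 -> neh (scal s x) (s * T) < 0.
Proof.
move=> s1 s2'; have s2 : s \in `[(0 : R), 2] by rewrite in_itv /=; lra.
have s0 : 0 < s by lra.
rewrite neh_scal // pmulr_rlt0 //.
have := ray_decr I1 s2 s1; rewrite ray_h1; have k0 := kin_gt0 xK1 T0 e0.
have : 0 < (s - 1) * kin x T by rewrite mulr_gt0 // subr_gt0.
nra.
Qed.

Lemma ray_max s : 0 < s -> s <= 2 -> act (scal s x) (s * T) <= act x T.
Proof.
move=> s0 s2; pose psi s := s * (q s / (2 * T) + e * T - f s).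
have sI t : 0 < t -> t <= 2 -> t \in `[(0 : R), 2].
  by move=> t0 t2; rewrite in_itv /= t2 ltW.
have -> : act x T = psi 1 by rewrite -[in LHS](scal1 x) -[T in LHS]mul1r act_scal.
rewrite act_scal // -/(psi s).
apply: (@unimodal_max _ psi h) => // [t t2|t t0 t1|t t1 t2]; first exact: ray_der.
  have t2 : t <= 2 by rewrite (le_trans (ltW t1)) // ler1n.
  by have := ray_pos t0 t1; rewrite neh_scal ?sI // pmulr_rgt0 // => /ltW.
have t0 : 0 < t by rewrite (lt_trans ltr01).
by have := ray_neg t1 t2; rewrite neh_scal ?sI // pmulr_rlt0 // => /ltW.
Qed.

End Ray.
End Discrete.

(** * Minimisers on the Nehari set *)

Section NehariAbstract.
Variable R : realType.

Lemma dist1_lt (a d s : R) : a < d -> 1 - a <= s -> s <= 1 + a -> `|s - 1| < d.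
Proof. by move=> ad s1 s2; rewrite ltr_norml; apply/andP; split; lra. Qed.

Lemma norm_itv_lt (d p q z : R) : `|p| < d -> `|q| < d -> p <= z -> z <= q -> `|z| < d.
Proof.
by rewrite !ltr_norml => /andP[? ?] /andP[? ?] pz zq; apply/andP; split; lra.
Qed.

Lemma mul_gt0_close (c y : R) : c != 0 -> `|y - c| < `|c| / 2 -> 0 < c * y.
Proof.
move=> c0; have [cp|cp] := ltrP 0 c.
  by rewrite (gtr0_norm cp) ltr_norml => /andP[? ?]; rewrite pmulr_rgt0 //; lra.
have cn : c < 0 by rewrite lt_neqAle c0.
by rewrite (ltr0_norm cn) ltr_norml => /andP[? ?]; rewrite nmulr_rgt0 //; lra.
Qed.

(** If [c = dZ 1 0] were not 0, take a small [t] of sign opposite to [c]. The signs of [G] at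
    [1 - a] and [1 + a] persist when 0 is replaced by [t], so the intermediate value theorem yields
    [s] with [G s t = 0]. Going from 0 to [t] lowers [Z s], hence [Z s t < Z s 0 <= Z 1 0], against
    minimality. *)
Lemma nehari_critical (Z dZ G : R -> R -> R) (d : R) :
  0 < d ->
  (forall s t, `|s - 1| < d -> `|t| < d -> derivable (Z s) t 1 /\ 'D_1 (Z s) t = dZ s t) ->
  (forall ep, 0 < ep -> exists2 d', 0 < d' & forall s t, `|s - 1| < d' -> `|t| < d' ->
     `|dZ s t - dZ 1 0| < ep) ->
  (forall s, `|s - 1| < d -> {for 0, continuous (G s)}) ->
  (forall s t, `|s - 1| < d -> `|t| < d -> {for s, continuous (G ^~ t)}) ->
  (forall s, 1 - d < s -> s < 1 -> 0 < G s 0) ->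
  (forall s, 1 < s -> s < 1 + d -> G s 0 < 0) ->
  (forall s, `|s - 1| < d -> Z s 0 <= Z 1 0) ->
  (forall s t, `|s - 1| < d -> `|t| < d -> G s t = 0 -> Z 1 0 <= Z s t) ->
  dZ 1 0 = 0.
Proof.
move=> d0 H1 H2 H3 H4 Hp Hn H6 H7; apply/eqP; apply/negP => /negP c0.
set c := dZ 1 0 in c0 H2 *; clearbody c.
have c20 : 0 < `|c| / 2 by rewrite divr_gt0 // normr_gt0.
have [d' d'0 Hd'] := H2 _ c20.
have [a [a0 ad ad']] : exists a, [/\ 0 < a, a < d & a < d'].
  have m0 : 0 < Num.min d d' by rewrite lt_min d0.
  have am : Num.min d d' / 2 < Num.min d d' by rewrite ltr_pdivrMr // ltr_pMr // ltr1n.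
  exists (Num.min d d' / 2); rewrite divr_gt0 //; split=> //.
    by apply: lt_le_trans am _; rewrite ge_min lexx.
  by apply: lt_le_trans am _; rewrite ge_min lexx orbT.
have near_a s : 1 - a <= s -> s <= 1 + a -> `|s - 1| < d /\ `|s - 1| < d'.
  by move=> ? ?; split; exact: (@dist1_lt a).
have [nm1 nm2] : `|1 - a - 1| < d /\ `|1 - a - 1| < d' by apply: near_a; rewrite // lerD2l ge0_cp // ltW.
have [np1 np2] : `|1 + a - 1| < d /\ `|1 + a - 1| < d' by apply: near_a; rewrite // lerD2l ge0_cp // ltW.
have Gm : 0 < G (1 - a) 0 by apply: Hp; rewrite ?ltrD2l ?ltrN2 // gtrBl.
have Gp : G (1 + a) 0 < 0 by apply: Hn; rewrite ?ltrD2l // ltrDl.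
have Hnear : \forall t \near (0 : R), [/\ `|t| < a, 0 < G (1 - a) t & G (1 + a) t < 0].
  have K1 : \forall t \near (0 : R), `|t| < a by exact: nbhs0_lt.
  have K2 : \forall t \near (0 : R), 0 < G (1 - a) t by exact: (cvgr_gt _ (H3 _ nm1)).
  have K3 : \forall t \near (0 : R), G (1 + a) t < 0 by exact: (cvgr_lt _ (H3 _ np1)).
  by near=> t; split; near: t.
have /nbhs_ballP[r /= r0 Hr] := Hnear.
have [t [t0 ct ta Gmt Gpt]] : exists t, [/\ t != 0, c * t < 0, `|t| < a, 0 < G (1 - a) t & G (1 + a) t < 0].
  have r20 : 0 < r / 2 by rewrite divr_gt0.
  exists (- Num.sg c * (r / 2)).
  have [ta Gmt Gpt] : [/\ `|- Num.sg c * (r / 2)| < a, 0 < G (1 - a) (- Num.sg c * (r / 2)) & G (1 + a) (- Num.sg c * (r / 2)) < 0].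
    apply: Hr; rewrite -ball_normE /= sub0r normrN normrM normrN normr_sg c0 mul1r.
    by rewrite gtr0_norm // ltr_pdivrMr // ltr_pMr // ltr1n.
  split=> //; first by rewrite mulf_neq0 ?oppr_eq0 ?sgr_eq0 // gt_eqF.
  by rewrite mulrA mulrN [c * _]mulrC -normrEsg nmulr_rlt0 // oppr_lt0 normr_gt0.
clear Hnear Hr r r0 H3 Gm Gp.
have [s sI Gs] : exists2 s, s \in `[1 - a, 1 + a] & G s t = 0.
  have := @IVT R (G ^~ t) (1 - a) (1 + a) 0 _ _ _; apply.
  - by rewrite lerD2l ge0_cp // ltW.
  - apply/continuous_in_subspaceT => s; rewrite inE /= in_itv /= => /andP[s1 s2].
    by have [sd _] := near_a s s1 s2; apply: H4 => //; exact: lt_trans ad.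
  - rewrite ge_min le_max; apply/andP; split; apply/orP; [right|left]; exact: ltW.
move: sI; rewrite in_itv /= => /andP[s1 s2].
have [sd sd'] := near_a s s1 s2.
have := H7 s t sd (lt_trans ta ad) Gs; apply/negP; rewrite -ltNge.
apply: lt_le_trans (H6 s sd).
have mvt (p q : R) : p < q -> `|p| < d -> `|q| < d ->
    exists2 z, p < z < q & Z s q - Z s p = dZ s z * (q - p).
  move=> pq pd qd.
  have I z : z \in `[p, q] -> `|z| < d.
    by rewrite in_itv /= => /andP[? ?]; exact: (norm_itv_lt pd qd).
  have D (z : R) : z \in `]p, q[ -> is_derive z 1 (Z s) (dZ s z).
    by move=> /subset_itv_oo_cc /I zd; have [? ?] := H1 s z sd zd; exact: DeriveDef.
  have cZ : {within `[p, q], continuous (Z s)}.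
    by apply: derivable_within_continuous => z /I zd; have [] := H1 s z sd zd.
  by have [z zI E] := MVT pq D cZ; exists z => //; move: zI; rewrite in_itv.
have td : `|t| < d := lt_trans ta ad.
have td' : `|t| < d' := lt_trans ta ad'.
have n0 : `|0 : R| < d by rewrite normr0.
have sgz z : `|z| <= `|t| -> 0 < c * dZ s z.
  by move=> zt; apply: mul_gt0_close => //; exact: Hd' sd' (le_lt_trans zt td').
have [tp|tn|te] := ltrgt0P t.
- have [z /andP[z1 z2] E] := mvt 0 t tp n0 td.
  rewrite -subr_lt0 E subr0.
  have cz : 0 < c * dZ s z by apply: sgz; rewrite (gtr0_norm z1) (gtr0_norm tp) ltW.
  have cn : c < 0 by rewrite -(pmulr_llt0 _ tp).
  by rewrite pmulr_llt0 // -(nmulr_rgt0 _ cn).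
- have [z /andP[z1 z2] E] := mvt t 0 tn td n0.
  rewrite -subr_gt0 E sub0r.
  have cz : 0 < c * dZ s z by apply: sgz; rewrite (ltr0_norm z2) (ltr0_norm tn) lerN2 ltW.
  have cp : 0 < c by rewrite -(nmulr_llt0 _ tn).
  by rewrite pmulr_lgt0 ?oppr_gt0 // -(pmulr_rgt0 _ cp).
- by rewrite te eqxx in t0.
Unshelve. all: by end_near. Qed.

End NehariAbstract.

Section Compactness.

(** In the application the functionals are continuous only at points of [A], where the period is not
    0 and the vertices lie in [U]; closedness of [Q] is therefore formulated relatively to [A]. *)
Lemma compact_min_closed (R : realType) (X : topologicalType) (A Q : set X) (f : X -> R) :
  compact A -> (A `&` Q) !=set0 -> (forall z, A z -> {for z, continuous f}) ->
  (forall z, A z -> closure (A `&` Q) z -> Q z) ->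
  exists2 z, (A `&` Q) z & forall z', (A `&` Q) z' -> f z <= f z'.
Proof.
move=> cA nAQ cf clQ.
have E : A `&` Q = A `&` closure (A `&` Q).
  apply/seteqP; split=> z [Az]; last by move=> /clQ Qz; split=> //; exact: Qz.
  by move=> Qz; split=> //; exact: subset_closure.
have cAQ : compact (A `&` Q).
  by rewrite E; apply: compact_closedI => //; exact: closed_closure.
have [|z] := compact_EVT_min nAQ cAQ (f := f).
  by apply/continuous_in_subspaceT => z; rewrite inE => -[Az _]; exact: cf.
by rewrite inE => AQz Hz; exists z => // z' AQz'; apply: Hz; rewrite inE.
Qed.

Lemma closure_preimage (X Y : topologicalType) (S : set X) (D : set Y) (phi : X -> Y) z :
  {for z, continuous phi} -> closed D -> (forall w, S w -> D (phi w)) ->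
  closure S z -> D (phi z).
Proof.
move=> cphi cD SD clS; apply: cD => B nB.
by have [w [Sw Bw]] := clS _ (cphi _ nB); exists (phi w); split=> //; exact: SD.
Qed.

End Compactness.

(** * Continuity and first variation of the discrete action *)

Section Variation.
Variables (R : realType) (n : nat).
Local Notation V := 'rV[R]_n.
Variables (U K : set V) (C : R) (l : lag R n).
Hypothesis ok : lag_ok U K C l.
Variables (N : nat) (e : R).

Lemma En_ext x x' : (forall k, (k <= N)%N -> x k = x' k) -> En l N x = En l N x'.
Proof.
move=> E; congr (_ * _); apply: eq_bigr => k _; rewrite /dl.
by rewrite !E // ltnW.
Qed.

Lemma Fl_ext x x' : (forall k, (k <= N)%N -> x k = x' k) -> Fl l N x = Fl l N x'.
Proof. by move=> E; apply: eq_bigr => k _; rewrite /dl !E // ltnW. Qed.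

Lemma act_ext x x' T : (forall k, (k <= N)%N -> x k = x' k) -> act l N e x T = act l N e x' T.
Proof. by move=> E; rewrite /act /kin (En_ext E) (Fl_ext E). Qed.

Lemma kin_ext x x' T : (forall k, (k <= N)%N -> x k = x' k) -> kin l N e x T = kin l N e x' T.
Proof. by move=> E; rewrite /kin (En_ext E). Qed.

Lemma neh_ext x x' T : (forall k, (k <= N)%N -> x k = x' k) -> neh l N e x T = neh l N e x' T.
Proof.
move=> E; rewrite /neh (kin_ext _ E) (Fl_ext E); congr (_ + _ / _ - _).
  congr (_ * _); apply: eq_bigr => k _; rewrite /dl /vv.
  by rewrite !E // ltnW.
by apply: eq_bigr => k _; rewrite /dl /vv !E // ltnW.
Qed.

(** First variations when the polygon moves in the direction [z] and, for [dact], the period in the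
    direction [th]. The symmetry of [lB] merges two terms into the one with factor 2. *)
Definition dEn (y z : nat -> V) : R := N%:R * \sum_(k < N)
  (lB1 l (y k) (z k) (dl y k) (dl y k) + 2 * lB l (y k) (dl y k) (dl z k)).
Definition dFl (y z : nat -> V) : R := \sum_(k < N)
  (lL1 l (y k) (z k) (dl y k) + lL l (y k) (dl z k)).
Definition dact (y : nat -> V) (T : R) (z : nat -> V) (th : R) : R :=
  dEn y z / (2 * T) - En l N y * th / (2 * T ^+ 2) + e * th - dFl y z.

Section Cvg.
Variables (I : Type) (F : set_system I).
Hypothesis FF : Filter F.
Variables (y z : I -> nat -> V) (y0 z0 : nat -> V) (T th : I -> R) (T0 th0 : R).
Hypothesis cy : forall k, (k <= N)%N -> y t k @[t --> F] --> y0 k.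
Hypothesis cz : forall k, (k <= N)%N -> z t k @[t --> F] --> z0 k.
Hypothesis cT : T @ F --> T0.
Hypothesis cth : th @ F --> th0.
Hypothesis Uy : forall k, (k < N)%N -> U (y0 k).
Hypothesis T00 : T0 != 0.

Let cdl (u : I -> nat -> V) (u0 : nat -> V) :
  (forall k, (k <= N)%N -> u t k @[t --> F] --> u0 k) ->
  forall k : 'I_N, dl (u t) k @[t --> F] --> dl u0 k.
Proof. by move=> cu k; apply: cvgB; apply: cu => //; exact: ltnW. Qed.

Let cvv k : (k <= N)%N -> vv (y t) k @[t --> F] --> vv y0 k.
Proof. by move=> kN; apply: cvgB; apply: cy. Qed.

Lemma En_cvg : En l N (y t) @[t --> F] --> En l N y0.
Proof.
apply: cvgMl_tmp; apply: cvg_sumr => k.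
by apply: (lB_cvg ok) => //; [exact: Uy|apply: cy; exact: ltnW|exact: cdl|exact: cdl].
Qed.

Lemma En1_cvg : En1 l N (y t) @[t --> F] --> En1 l N y0.
Proof.
apply: cvgMl_tmp; apply: cvg_sumr => k.
by apply: (lB1_cvg ok) => //; [exact: Uy|apply: cy; exact: ltnW|apply: cvv; exact: ltnW|exact: cdl|exact: cdl].
Qed.

Lemma Fl_cvg : Fl l N (y t) @[t --> F] --> Fl l N y0.
Proof.
apply: cvg_sumr => k.
by apply: (lL_cvg ok) => //; [exact: Uy|apply: cy; exact: ltnW|exact: cdl].
Qed.

Lemma Fl1_cvg : Fl1 l N (y t) @[t --> F] --> Fl1 l N y0.
Proof.
apply: cvg_sumr => k.
by apply: (lL1_cvg ok) => //; [exact: Uy|apply: cy; exact: ltnW|apply: cvv; exact: ltnW|exact: cdl].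
Qed.

Let c2T : (2 * T t)^-1 @[t --> F] --> (2 * T0)^-1.
Proof. by apply: cvgV; [rewrite mulf_neq0 | apply: cvgMl_tmp]. Qed.

Lemma kin_cvg : kin l N e (y t) (T t) @[t --> F] --> kin l N e y0 T0.
Proof.
by apply: cvgD; [apply: cvgM; [exact: En_cvg | exact: c2T] | apply: cvgMl_tmp].
Qed.

Lemma act_cvg : act l N e (y t) (T t) @[t --> F] --> act l N e y0 T0.
Proof. by apply: cvgB; [exact: kin_cvg | exact: Fl_cvg]. Qed.

Lemma neh_cvg : neh l N e (y t) (T t) @[t --> F] --> neh l N e y0 T0.
Proof.
apply: cvgB; last exact: Fl1_cvg.
by apply: cvgD; [exact: act_cvg | apply: cvgM; [exact: En1_cvg | exact: c2T]].
Qed.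

Lemma dact_cvg : dact (y t) (T t) (z t) (th t) @[t --> F] --> dact y0 T0 z0 th0.
Proof.
apply: cvgB; last first.
  apply: cvg_sumr => k; apply: cvgD.
    by apply: (lL1_cvg ok) => //; [exact: Uy|apply: cy; exact: ltnW|apply: cz; exact: ltnW|exact: cdl].
  by apply: (lL_cvg ok) => //; [exact: Uy|apply: cy; exact: ltnW|exact: cdl].
apply: cvgD; last exact: cvgMl_tmp.
apply: cvgB.
  apply: cvgM; last exact: c2T.
  apply: cvgMl_tmp; apply: cvg_sumr => k; apply: cvgD.
    by apply: (lB1_cvg ok) => //; [exact: Uy|apply: cy; exact: ltnW|apply: cz; exact: ltnW|exact: cdl|exact: cdl].
  by apply: cvgMl_tmp; apply: (lB_cvg ok) => //; [exact: Uy|apply: cy; exact: ltnW|exact: cdl|exact: cdl].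
apply: cvgM; first by apply: cvgM => //; exact: En_cvg.
apply: cvgV; first by rewrite mulf_neq0 // expf_neq0.
by apply: cvgMl_tmp; apply: cvgM.
Qed.

End Cvg.

Section Der.
Variables (y z : nat -> V) (T th : R).

Definition mv (t : R) k : V := y k + t *: z k.

Lemma dl_mv t k : dl (mv t) k = dl y k + t *: dl z k.
Proof. by rewrite /dl /mv scalerBr opprD addrACA. Qed.

Lemma En_der t : (forall k, (k < N)%N -> U (mv t k)) ->
  is_derive t 1 (fun t => En l N (mv t)) (dEn (mv t) z).
Proof.
move=> Ut.
pose g (k : 'I_N) (s : R) := lB l (mv s k) (dl y k) (dl y k)
  + s * (2 * lB l (mv s k) (dl y k) (dl z k)) + s ^+ 2 * lB l (mv s k) (dl z k) (dl z k).
have lin k a u v w : lB l k (u + a *: v) w = lB l k u w + a * lB l k v w.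
  by rewrite addrC (lB_lin ok) addrC.
have gE k s : g k s = lB l (mv s k) (dl (mv s) k) (dl (mv s) k).
  rewrite dl_mv lin [lB l _ (dl y k) (_ + _)](lB_sym ok) [lB l _ (dl z k) (_ + _)](lB_sym ok) !lin [lB l _ (dl z k) (dl y k)](lB_sym ok) /g.
  by ring.
have -> : (fun t => En l N (mv t)) = N%:R \*: (\sum_(k < N) g k).
  apply/funext => s; rewrite /En /GRing.scale /= fct_sumE; congr (_ * _).
  by apply: eq_bigr => k _; rewrite gE.
have dg (k : 'I_N) : is_derive t 1 (g k) (lB1 l (mv t k) (z k) (dl (mv t) k) (dl (mv t) k)
    + 2 * lB l (mv t k) (dl (mv t) k) (dl z k)).
  have D u v : is_derive t 1 (fun s => lB l (mv s k) u v) (lB1 l (mv t k) (z k) u v).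
    by apply: (lB_der ok); exact: Ut.
  have D1 := D (dl y k) (dl y k); have D2 := D (dl y k) (dl z k); have D3 := D (dl z k) (dl z k).
  have lin1 p a u v w : lB1 l (mv t k) p (u + a *: v) w = lB1 l (mv t k) p u w + a * lB1 l (mv t k) p v w.
    by rewrite addrC (lB1_lin ok) addrC.
  rewrite /g; apply: is_derive_eq.
  rewrite dl_mv lin1 [lB1 l _ _ (dl y k) (_ + _)](lB1_sym ok) [lB1 l _ _ (dl z k) (_ + _)](lB1_sym ok) !lin1.
  rewrite [lB1 l _ _ (dl z k) (dl y k)](lB1_sym ok) lin /GRing.scale /=.
  by rewrite !mulr1 ?expr1; ring.
exact: is_deriveZ.
Qed.

Lemma Fl_der t : (forall k, (k < N)%N -> U (mv t k)) ->
  is_derive t 1 (fun t => Fl l N (mv t)) (dFl (mv t) z).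
Proof.
move=> Ut.
pose g (k : 'I_N) (s : R) := lL l (mv s k) (dl y k) + s * lL l (mv s k) (dl z k).
have lin k a u v : lL l k (u + a *: v) = lL l k u + a * lL l k v.
  by rewrite addrC (lL_lin ok) addrC.
have -> : (fun t => Fl l N (mv t)) = \sum_(k < N) g k.
  apply/funext => s; rewrite /Fl fct_sumE.
  by apply: eq_bigr => k _; rewrite dl_mv lin.
apply: is_derive_sum => k.
have D u : is_derive t 1 (fun s => lL l (mv s k) u) (lL1 l (mv t k) (z k) u).
  by apply: (lL_der ok); exact: Ut.
have D1 := D (dl y k); have D2 := D (dl z k).
have lin1 p a u v : lL1 l (mv t k) p (u + a *: v) = lL1 l (mv t k) p u + a * lL1 l (mv t k) p v.
  by rewrite addrC (lL1_lin ok) addrC.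
rewrite /g; apply: is_derive_eq.
by rewrite dl_mv lin1 /GRing.scale /= !mulr1; ring.
Qed.

Lemma act_der t : (forall k, (k < N)%N -> U (mv t k)) -> T + t * th != 0 ->
  is_derive t 1 (fun t => act l N e (mv t) (T + t * th)) (dact (mv t) (T + t * th) z th).
Proof.
move=> Ut T0; have D1 := En_der Ut; have D2 := Fl_der Ut.
have T2 : 2 * (T + t * th) != 0 by rewrite mulf_neq0.
have D3 : is_derive t 1 (fun t : R => 2 * (T + t * th)) (2 * th).
  by apply: is_derive_eq; rewrite /GRing.scale /= !(mulr0, mulr1, add0r, addr0); ring.
have D4 : is_derive t 1 (fun t : R => (2 * (T + t * th))^-1) (- (2 * th) / (2 * (T + t * th)) ^+ 2).
  have [dd ee] := D3; apply: DeriveDef; first exact: derivableV.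
  by rewrite deriveV // ee /GRing.scale /= mulrC mulrN mulNr.
have D5 : is_derive t 1 (fun t : R => e * (T + t * th)) (e * th).
  by apply: is_derive_eq; rewrite /GRing.scale /= !(mulr0, mulr1, add0r, addr0); ring.
rewrite /act /kin; apply: is_derive_eq.
by rewrite /dact /GRing.scale /=; field.
Qed.

End Der.
End Variation.

Lemma exists_pos_le (R : realType) (a b : R) : 0 < a -> 0 < b ->
  exists d, [/\ 0 < d, d <= a & d <= b].
Proof.
move=> a0 b0; exists (Num.min a b); split; first by rewrite lt_min a0.
  by rewrite ge_min lexx.
by rewrite ge_min lexx orbT.
Qed.

Lemma near1_itv (R : realType) (s d : R) : d <= 1 -> `|s - 1| < d ->
  s \in `[(0 : R), 2] /\ 0 < s /\ s <= 2.
Proof.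
move=> d1; rewrite ltr_norml in_itv /= => /andP[sa sb].
by split; [apply/andP; split|split]; lra.
Qed.

(** * Minimal polygons and their criticality *)

Section Minimizer.
Variables (R : realType) (n : nat).
Local Notation V := 'rV[R]_n.
Variables (U K : set V) (C : R) (l : lag R n).
Hypothesis ok : lag_ok U K C l.
Variables (N : nat) (e : R).
Variables (T1 T2 M : R).
Hypothesis T10 : 0 < T1.

(** The Nehari set with base vertex confined to [O]. The bounds on period and [kin] provide
    compactness and turn out to be strict at the polygons that matter; the condition on the base
    vertex is the one that needs a separate argument. *)
Record adm (O : set V) (x : nat -> V) (T : R) : Prop := Adm {
  adm_loop : x N = x 0%N;
  adm_K : forall k, (k < N)%N -> K (x k);
  adm_O : O (x 0%N);
  adm_T1 : T1 <= T;
  adm_T2 : T <= T2;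
  adm_kin : kin l N e x T <= M;
  adm_neh : neh l N e x T = 0 }.

Variable O : set V.
Variable pen : V -> R.

Lemma adm_min : (0 < N)%N -> compact K -> closed O -> continuous pen ->
  (exists x T, adm O x T) ->
  exists x T, adm O x T /\ forall x' T', adm O x' T' ->
    act l N e x T + pen (x 0%N) <= act l N e x' T' + pen (x' 0%N).
Proof.
move=> N0 cK cO cpen [x1 [t1 a1]].
pose X := prod_topology (fun _ : nat => V).
pose A : set (X * R) := [set f : X | forall k, K (f k)] `*` `[T1, T2].
pose Q : set (X * R) := [set p | [/\ p.1 N = p.1 0%N, O (p.1 0%N),
   kin l N e p.1 p.2 <= M & neh l N e p.1 p.2 = 0]].
pose f (p : X * R) := act l N e p.1 p.2 + pen (p.1 0%N).
have cA : compact A.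
  apply: compact_setX; last exact: segment_compact.
  exact: (@tychonoff nat (fun=> V) (fun=> K)).
(* The entries beyond the last edge do not influence the functionals but must lie in [K] for
   Tychonoff's theorem; they are replaced by the base vertex. *)
pose tr (x : nat -> V) k := if (k < N)%N then x k else x 0%N.
have trE x : x N = x 0%N -> forall k, (k <= N)%N -> tr x k = x k.
  by move=> xN k; rewrite leq_eqVlt /tr => /predU1P[->|->] //; rewrite ltnn.
have trA x T : adm O x T -> (A `&` Q) (tr x : X, T).
  move=> a; have E := trE _ (adm_loop a); split.
    split; last by rewrite /= in_itv /= (adm_T1 a) (adm_T2 a).
    move=> k; rewrite /= /tr; case: ifP => kN; first exact: (adm_K a).
    exact: (adm_K a).
  split=> /=.
  - by rewrite !E // (adm_loop a).
  - by rewrite E //; exact: adm_O a.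
  - by rewrite (kin_ext _ _ _ E); exact: adm_kin a.
  - by rewrite (neh_ext _ _ _ E); exact: adm_neh a.
have Aadm p : (A `&` Q) p -> adm O p.1 p.2.
  move=> [[pK]]; rewrite /= in_itv /= => /andP[? ?] [? ? ? ?].
  by split=> // k _; exact: pK.
have cp (p : X * R) k : w.1 k @[w --> p] --> p.1 k.
  apply: (@continuous_comp _ _ _ (fun w : X * R => w.1) (fun g : X => g k)).
    exact: cvg_fst.
  exact: (@proj_continuous nat (fun=> V) k).
have c2 (p : X * R) : w.2 @[w --> p] --> p.2 by exact: cvg_snd.
have Ap (p : X * R) : A p -> [/\ forall k, (k < N)%N -> U (p.1 k) & p.2 != 0].
  move=> [pK]; rewrite /= in_itv /= => /andP[p1 p2]; split=> [k _|].
    by apply: (lag_sub ok); exact: pK.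
  by rewrite gt_eqF // (lt_le_trans T10).
have c3 p : A p -> [/\ act l N e w.1 w.2 @[w --> p] --> act l N e p.1 p.2,
    kin l N e w.1 w.2 @[w --> p] --> kin l N e p.1 p.2 &
    neh l N e w.1 w.2 @[w --> p] --> neh l N e p.1 p.2].
  move=> /Ap[pU p20].
  have cp' k : (k <= N)%N -> w.1 k @[w --> nbhs p] --> p.1 k by move=> _; exact: cp.
  split.
  - exact: (act_cvg ok (nbhs_filter p) cp' (c2 p) pU p20).
  - exact: (kin_cvg ok (nbhs_filter p) cp' (c2 p) pU p20).
  - exact: (neh_cvg ok (nbhs_filter p) cp' (c2 p) pU p20).
have [|||p AQp Hp] := @compact_min_closed R _ A Q f cA.
- by exists (tr x1 : X, t1); exact: trA.
- move=> p /c3[ca _ _]; apply: cvgD; first exact: ca.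
  exact: (cvg_comp (fun w : X * R => w.1 0%N) pen (cp p 0%N) (cpen _)).
- move=> p /c3[_ ck cn] clp; split.
  + have : `|p.1 N - p.1 0%N| <= 0.
      apply: (closure_preimage (phi := fun w : X * R => `|w.1 N - w.1 0%N|) (D := [set t : R | t <= 0]) _ _ _ clp).
      * by apply: cvg_norm; apply: cvgB; apply: cp.
      * exact: closed_le.
      * by move=> w [_ [-> _ _ _]] /=; rewrite subrr normr0.
    by rewrite normr_le0 subr_eq0 => /eqP.
  + apply: (closure_preimage (phi := fun w : X * R => w.1 0%N) (D := O) _ cO _ clp); first exact: cp.
    by move=> w [_ []].
  + apply: (closure_preimage (phi := fun w : X * R => kin l N e w.1 w.2) (D := [set t : R | t <= M]) _ _ _ clp).
    * exact: ck.
    * exact: closed_le.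
    * by move=> w [_ []].
  + apply: (closure_preimage (phi := fun w : X * R => neh l N e w.1 w.2) (D := [set t : R | t = 0]) _ _ _ clp).
    * exact: cn.
    * exact: closed_eq.
    * by move=> w [_ []].
exists p.1, p.2; split; first exact: Aadm.
move=> x' T' a'; have := Hp _ (trA _ _ a'); rewrite /f /=.
by have E := trE _ (adm_loop a'); rewrite (act_ext _ _ _ E) E.
Qed.

Record rayhyp (x : nat -> V) (T : R) : Prop := RayHyp {
  ray_loop : x N = x 0%N;
  ray_K : forall s k, s \in `[(0 : R), 2] -> (k < N)%N -> K (scal s x k);
  ray_T : 0 < T;
  ray_small : small C N x T <= 1 / 100;
  ray_per : per N x <= 1;
  ray_neh : neh l N e x T = 0 }.

Variable dpen : V -> V -> R.
Hypothesis pen_der : forall (o w : V) (t : R), is_derive t 1 (fun s : R => pen (o + s *: w)) (dpen (o + t *: w) w).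
Hypothesis dpen_cvg : forall (I : Type) (F : set_system I) (FF : Filter F) (o : I -> V) (o0 w : V),
  o @ F --> o0 -> dpen (o t) w @[t --> F] --> dpen o0 w.

(** Instance of [nehari_critical]: [s] runs along the ray and [t] along the variation. A nearby
    polygon with [neh = 0] is admissible since the strict inequalities at [x] persist and the base
    vertex stays in [O] by assumption on [eta 0]. *)
Lemma crit x T (eta : nat -> V) th : 0 < e ->
  rayhyp x T -> (forall k, (k < N)%N -> nbhs (x k) K) -> T1 < T -> T < T2 ->
  kin l N e x T < M -> eta N = eta 0%N -> (\forall t \near (0 : R), O (x 0%N + t *: eta 0%N)) ->
  (forall x' T', adm O x' T' -> act l N e x T + pen (x 0%N) <= act l N e x' T' + pen (x' 0%N)) ->
  dact l N e x T eta th + dpen (x 0%N) (eta 0%N) = 0.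
Proof.
move=> e0 rx xi TT1 TT2 kM etaN nO Hmin.
have T0 := ray_T rx.
(* [W s t] is the dilation by [s] of [x + t eta], and [TT s t] is [s (T + t th)]. Dilations fix the
   base vertex, so the penalty is constant along rays and the penalised action keeps its maximum at
   [s = 1]. *)
pose W s t : nat -> V := mv (scal s x) (scal s eta) t.
pose TT s t : R := s * T + t * (s * th).
pose pn t := pen (x 0%N + t *: eta 0%N).
pose Z s t := act l N e (W s t) (TT s t) + pn t.
pose dZ s t := dact l N e (W s t) (TT s t) (scal s eta) (s * th) + dpen (x 0%N + t *: eta 0%N) (eta 0%N).
pose G s t := neh l N e (W s t) (TT s t).
have W0 s t : W s t 0%N = x 0%N + t *: eta 0%N by rewrite /W /mv !scal0.
have WN s t : W s t N = W s t 0%N by rewrite /W /mv /scal /vv (ray_loop rx) etaN.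
have Ws0 s : W s 0 = scal s x by apply/funext => k; rewrite /W /mv scale0r addr0.
have TTs0 s : TT s 0 = s * T by rewrite /TT mul0r addr0.
have scal_cvg (I : Type) (F : set_system I) (FF : Filter F) (u : nat -> V) (s : I -> R) s0 k :
    s @ F --> s0 -> scal (s i) u k @[i --> F] --> scal s0 u k.
  by move=> cs; apply: cvgD; [exact: cvg_cst | apply: cvgZr_tmp].
have W_cvg (I : Type) (F : set_system I) (FF : Filter F) (s t : I -> R) s0 t0 k :
    s @ F --> s0 -> t @ F --> t0 -> W (s i) (t i) k @[i --> F] --> W s0 t0 k.
  move=> cs ct; apply: cvgD; first exact: scal_cvg.
  by apply: cvgZ => //; exact: scal_cvg.
have TT_cvg (I : Type) (F : set_system I) (FF : Filter F) (s t : I -> R) s0 t0 :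
    s @ F --> s0 -> t @ F --> t0 -> TT (s i) (t i) @[i --> F] --> TT s0 t0.
  move=> cs ct; apply: cvgD; first by apply: cvgMr_tmp.
  by apply: cvgM => //; apply: cvgMr_tmp.
have c1 : fst @ nbhs ((1, 0) : R * R) --> (1 : R) by exact: cvg_fst.
have c2 : snd @ nbhs ((1, 0) : R * R) --> (0 : R) by exact: cvg_snd.
have W10 : W 1 0 = x by rewrite Ws0 scal1.
have TT10 : TT 1 0 = T by rewrite TTs0 mul1r.
have xU k : (k < N)%N -> U (x k) by move=> kN; apply: (lag_sub ok); apply: nbhs_singleton; exact: xi.
have near1 : \forall p \near ((1, 0) : R * R), [/\ forall k : 'I_N, K (W p.1 p.2 k),
   T1 < TT p.1 p.2 < T2, kin l N e (W p.1 p.2) (TT p.1 p.2) < M & O (x 0%N + p.2 *: eta 0%N)].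
  have K1' (k : 'I_N) : \forall p \near ((1, 0) : R * R), K (W p.1 p.2 k).
    by apply: (W_cvg _ _ _ _ _ _ _ k c1 c2); rewrite W10; exact: xi.
  have K1 : \forall p \near ((1, 0) : R * R), forall k : 'I_N, K (W p.1 p.2 k).
    exact: (filter_forall _ K1').
  have cTT : TT p.1 p.2 @[p --> ((1, 0) : R * R)] --> T by rewrite -TT10; exact: TT_cvg.
  have K2 : \forall p \near ((1, 0) : R * R), T1 < TT p.1 p.2 by exact: (cvgr_gt _ cTT).
  have K2' : \forall p \near ((1, 0) : R * R), TT p.1 p.2 < T2 by exact: (cvgr_lt _ cTT).
  have K3 : \forall p \near ((1, 0) : R * R), kin l N e (W p.1 p.2) (TT p.1 p.2) < M.
    have cW k : (k <= N)%N -> W p.1 p.2 k @[p --> nbhs ((1, 0) : R * R)] --> x k.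
      by move=> _; rewrite -W10; exact: W_cvg.
    have Tn0 : T != 0 by rewrite gt_eqF.
    exact: (cvgr_lt _ (kin_cvg ok (nbhs_filter _) cW cTT xU Tn0)).
  have K4 : \forall p \near ((1, 0) : R * R), O (x 0%N + p.2 *: eta 0%N).
    exact: (c2 _ nO).
  near=> p; split; first by near: p.
  - by apply/andP; split; near: p.
  - by near: p.
  - by near: p.
have [d1 d10 Hd1] : exists2 d, 0 < d & forall s t, `|s - 1| < d -> `|t| < d ->
   [/\ forall k, (k < N)%N -> K (W s t k), T1 < TT s t < T2, kin l N e (W s t) (TT s t) < M & O (x 0%N + t *: eta 0%N)].
  have /nbhs_ballP[d /= d0 Hd] := near1; exists d => // s t sd td.
  have [] := Hd (s, t); first by split => /=; rewrite -ball_normE /= ?sub0r ?normrN // distrC.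
  by move=> A B D E; split=> // k kN; exact: (A (Ordinal kN)).
have [d [d0 dd1 dle1]] := exists_pos_le d10 (ltr01 : 0 < (1 : R)).
have Hd s t : `|s - 1| < d -> `|t| < d ->
   [/\ forall k, (k < N)%N -> K (W s t k), T1 < TT s t < T2, kin l N e (W s t) (TT s t) < M & O (x 0%N + t *: eta 0%N)].
  by move=> sd td; apply: Hd1; [exact: lt_le_trans sd dd1 | exact: lt_le_trans td dd1].
have sI s : `|s - 1| < d -> s \in `[(0 : R), 2] /\ 0 < s /\ s <= 2 by exact: near1_itv.
clear near1 Hd1 d1 d10 dd1.
have UW s t : `|s - 1| < d -> `|t| < d -> forall k, (k < N)%N -> U (W s t k).
  by move=> sd td k kN; apply: (lag_sub ok); have [+ _ _ _] := Hd s t sd td; exact.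
have TT0 s t : `|s - 1| < d -> `|t| < d -> TT s t != 0.
  by move=> sd td; have [_ /andP[+ _] _ _] := Hd s t sd td; move=> /(lt_trans T10)/gt_eqF->.
have n0 : `|0 : R| < d by rewrite normr0.
have n1 : `|1 - 1 : R| < d by rewrite subrr normr0.
have <- : dZ 1 0 = dact l N e x T eta th + dpen (x 0%N) (eta 0%N).
  by rewrite /dZ W10 TT10 scal1 mul1r scale0r addr0.
apply: (@nehari_critical R Z dZ G d) => //.
- move=> s t sd td.
  have D1 : is_derive t 1 (fun t => act l N e (W s t) (TT s t)) (dact l N e (W s t) (TT s t) (scal s eta) (s * th)).
    by apply: (act_der ok); [exact: UW | exact: TT0].
  have D2 := pen_der (x 0%N) (eta 0%N) t.
  have [dd ee] : is_derive t 1 (Z s) (dZ s t) by exact: is_deriveD.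
  by split.
- move=> ep ep0.
  have co : x 0%N + p.2 *: eta 0%N @[p --> nbhs ((1, 0) : R * R)] --> x 0%N + (0 : R) *: eta 0%N.
    by apply: cvgD; [exact: cvg_cst | apply: cvgZr_tmp].
  have cd : dpen (x 0%N + p.2 *: eta 0%N) (eta 0%N) @[p --> nbhs ((1, 0) : R * R)]
      --> dpen (x 0%N + (0 : R) *: eta 0%N) (eta 0%N).
    exact: dpen_cvg co.
  have cdZ : dZ p.1 p.2 @[p --> ((1, 0) : R * R)] --> dZ 1 0.
    apply: cvgD; last exact: cd.
      apply: (dact_cvg ok (nbhs_filter _)).
      + by move=> k _; exact: W_cvg.
      + by move=> k _; exact: scal_cvg.
      + exact: TT_cvg.
      + exact: cvgMr_tmp.
      + by move=> k kN; rewrite W10; exact: xU.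
      + by rewrite TT10 gt_eqF.
  move/cvgrPdist_lt/(_ _ ep0)/nbhs_ballP: cdZ => [d' /= d'0 Hd'].
  exists d' => // s t sd td; rewrite distrC; apply: (Hd' (s, t)).
  by split => /=; rewrite -ball_normE /= ?sub0r ?normrN // distrC.
- move=> s sd; apply: (neh_cvg ok (nbhs_filter _)).
  + by move=> k _; apply: W_cvg; [exact: cvg_cst | exact: cvg_id].
  + by apply: TT_cvg; [exact: cvg_cst | exact: cvg_id].
  + exact: UW.
  + exact: TT0.
- move=> s t sd td; apply: (neh_cvg ok (nbhs_filter _)).
  + by move=> k _; apply: W_cvg; [exact: cvg_id | exact: cvg_cst].
  + by apply: TT_cvg; [exact: cvg_id | exact: cvg_cst].
  + exact: UW.
  + exact: TT0.
- move=> s s1 s2; rewrite /G Ws0 TTs0.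
  have sd : `|s - 1| < d by rewrite ltr_norml; apply/andP; split; lra.
  have [_ [s0 _]] := sI s sd.
  exact: (ray_pos ok (ray_K rx) (ray_loop rx) (ray_T rx) e0 (ray_small rx) (ray_per rx) (ray_neh rx)).
- move=> s s1 s2; rewrite /G Ws0 TTs0.
  have sd : `|s - 1| < d by rewrite ltr_norml; apply/andP; split; lra.
  have [_ [_ s2']] := sI s sd.
  exact: (ray_neg ok (ray_K rx) (ray_loop rx) (ray_T rx) e0 (ray_small rx) (ray_per rx) (ray_neh rx)).
- move=> s sd; rewrite /Z W10 TT10 Ws0 TTs0 lerD2r.
  have [_ [s0 s2']] := sI s sd.
  exact: (ray_max ok (ray_K rx) (ray_loop rx) (ray_T rx) e0 (ray_small rx) (ray_per rx) (ray_neh rx)).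
- move=> s t sd td Gst; rewrite /Z W10 TT10 /pn scale0r addr0 -(W0 s t).
  apply: Hmin; have [h1 /andP[h2 h3] h4 h5] := Hd s t sd td.
  by split=> //; [rewrite W0 | exact: ltW | exact: ltW | exact: ltW].
Unshelve. all: by end_near. Qed.

End Minimizer.

Section Chain.
Variable R : realType.

(** No step from [N - 1] back to 0 is assumed: two indices below [N] are joined inside the interval,
    without crossing the base vertex. *)
Lemma chain_bound (f c : nat -> R) (N : nat) :
  (forall k, (0 < k < N)%N -> `|f k - f k.-1| <= c k) -> (forall k, 0 <= c k) ->
  forall j k, (j < N)%N -> (k < N)%N -> `|f k - f j| <= \sum_(m < N) c m.
Proof.
move=> fc c0.
have up j d : (j + d < N)%N -> `|f (j + d)%N - f j| <= \sum_(j.+1 <= m < (j + d).+1) c m.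
  elim: d => [|d IH] jd; first by rewrite addn0 subrr normr0 sumr_ge0.
  rewrite addnS in jd *; rewrite big_nat_recr /= ?ltnS ?leq_addr //.
  have -> : f (j + d).+1 - f j = (f (j + d)%N - f j) + (f (j + d).+1 - f (j + d)%N) by ring.
  rewrite (le_trans (ler_normD _ _)) // lerD // ?IH //; first exact: ltnW.
  by apply: (fc (j + d).+1); rewrite /= jd.
have sub a b : (b <= N)%N -> \sum_(a <= m < b) c m <= \sum_(m < N) c m.
  move=> bN; rewrite -(big_mkord xpredT c).
  have [ab|ba] := leqP a b; last first.
    by rewrite [leLHS]big_geq ?(ltnW ba) //; apply: sumr_ge0 => m _; exact: c0.
  have -> : \sum_(0 <= i < N) c i = \sum_(0 <= i < a) c i + (\sum_(a <= i < b) c i + \sum_(b <= i < N) c i).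
    by rewrite -!big_cat_nat // (leq_trans ab).
  by rewrite addrCA lerDl addr_ge0 ?sumr_ge0.
move=> j k jN kN; wlog jk : j k jN kN / (j <= k)%N.
  by move=> H; case/orP: (leq_total j k) => ?; [exact: H | rewrite distrC; exact: H].
rewrite -(subnKC jk) in kN *; apply: le_trans (up _ _ kN) _.
exact: sub.
Qed.

End Chain.

(** * A priori bounds and discrete Euler-Lagrange equations *)

Section Consequences.
Variables (R : realType) (n : nat).
Local Notation V := 'rV[R]_n.
Variables (U K : set V) (C : R) (l : lag R n).
Hypothesis ok : lag_ok U K C l.
Variables (N : nat) (e : R).
Hypothesis e0 : 0 < e.

Let C0 : 0 <= C.
Proof. exact: le_trans ler01 (lag_C1 ok). Qed.

Let Cp : 0 < C.
Proof. exact: lt_le_trans ltr01 (lag_C1 ok). Qed.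

Section Ray.
Variables (x : nat -> V) (T : R).
Hypothesis rx : rayhyp K C l N e x T.

Lemma ray_K1 k : (k < N)%N -> K (x k).
Proof.
by move=> kN; rewrite -(scal1 x); apply: (ray_K rx) => //; rewrite in_itv /= ler01 ler1n.
Qed.

Let k0 : 0 < kin l N e x T := kin_gt0 ok ray_K1 (ray_T rx) e0.

Let smk : small C N x T * kin l N e x T <= 1 / 100 * kin l N e x T.
Proof. by rewrite ler_wpM2r ?(ltW k0) // (ray_small rx). Qed.

Lemma ray_flux : 96 / 100 * kin l N e x T <= 2 * flux l N x <= 104 / 100 * kin l N e x T.
Proof.
have := neh_kin ok ray_K1 (ray_loop rx) (ray_T rx) e0.
rewrite (ray_neh rx) ler_norml => /andP[? ?]; have := smk.
by move=> ?; apply/andP; split; lra.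
Qed.

Lemma ray_act : 46 / 100 * kin l N e x T <= act l N e x T.
Proof.
have := act_kin ok ray_K1 (ray_loop rx) (ray_T rx) e0.
rewrite ler_norml => /andP[? ?]; have := smk; have /andP[? ?] := ray_flux.
by move=> ?; lra.
Qed.

(** About half of [kin] is carried by the flux, which is at most [C sqn <= 2 C^2 T kin]. Cancelling
    [kin] bounds the period below independently of the energy. *)
Lemma ray_T1 : 1 / (5 * C ^+ 2) <= T.
Proof.
have fl := flux_le ok ray_K1.
have sq := sqn_kin ok ray_K1 (ray_T rx) e0.
have /andP[f1 _] := ray_flux.
have h : 48 / 100 * kin l N e x T <= 2 * C ^+ 2 * T * kin l N e x T.
  apply: (@le_trans _ _ (C * sqn N x)).
    by apply: le_trans fl; rewrite (le_trans _ (ler_norm _)) //; lra.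
  by apply: le_trans (ler_wpM2l C0 sq) _; rewrite expr2; lra.
rewrite ler_pM2r // in h.
have c2 : 0 < C ^+ 2 by rewrite exprn_gt0.
rewrite ler_pdivrMr ?mulr_gt0 //; lra.
Qed.

Lemma ray_eT : e * T <= kin l N e x T.
Proof.
rewrite lerDr; apply: divr_ge0; first exact: (En_ge0 ok ray_K1).
by rewrite mulr_ge0 // ltW // (ray_T rx).
Qed.

End Ray.

Variables (y0 : V) (r rho T1 T2 M : R).
Hypothesis KE : K = cball y0 (3 * r).
Hypothesis rho0 : 0 < rho.
Hypothesis rho_r : 2 * rho <= r.
Hypothesis rho1 : rho <= 1.
Hypothesis rhoC : C ^+ 2 * rho * (1 + T2) <= 1 / 100.
Hypothesis rhoM : 2 * C * T2 * M <= rho ^+ 2.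
Hypothesis T10 : 0 < T1.
Variable O : set V.
Hypothesis OK : O `<=` cball y0 (2 * r).
Hypothesis N0 : (0 < N)%N.

Lemma K_per x T : (forall k, (k < N)%N -> K (x k)) -> 0 < T -> T <= T2 ->
  kin l N e x T <= M -> 0 <= M -> sqn N x <= rho ^+ 2 /\ per N x <= rho.
Proof.
move=> xK T0 TT2 kM M0.
have s1 : sqn N x <= rho ^+ 2.
  apply: le_trans rhoM; apply: le_trans (sqn_kin ok xK T0 e0) _.
  have T20 := lt_le_trans T0 TT2.
  apply: (@le_trans _ _ (2 * C * T * M)); first by rewrite ler_wpM2l // !mulr_ge0 // ltW.
  by rewrite ler_wpM2r // ler_wpM2l // mulr_ge0.
split=> //; rewrite -(ler_sqr (x := per N x)) ?nnegrE ?per_ge0 ?(ltW rho0) //.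
exact: le_trans (per_sqr N x) s1.
Qed.

(** The base vertex lies in the ball of radius [2 r], and a dilation by at most 2 of a loop of
    perimeter [rho] adds at most [2 rho <= r]; this is why [K] has radius [3 r]. *)
Lemma scal_K x s k : O (x 0%N) -> per N x <= rho -> s \in `[(0 : R), 2] -> (k <= N)%N ->
  K (scal s x k).
Proof.
move=> Ox Px; rewrite in_itv /= => /andP[s0 s2] kN; rewrite KE /cball /=.
have -> : scal s x k - y0 = (x 0%N - y0) + s *: vv x k.
  by rewrite /scal addrAC.
apply: le_trans (ler_normD _ _) _; rewrite normrZ ger0_norm //.
have h1 := OK Ox; rewrite /cball /= in h1.
have h2 : s * `|vv x k| <= 2 * rho.
  by rewrite ler_pM // (le_trans (vv_per _ kN)).
have -> : 3 * r = 2 * r + r by ring.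
by apply: lerD => //; exact: le_trans h2 rho_r.
Qed.

Lemma adm_per x T : adm K l N e T1 T2 M O x T -> sqn N x <= rho ^+ 2 /\ per N x <= rho.
Proof.
move=> a; have T0 := lt_le_trans T10 (adm_T1 a).
apply: (K_per (adm_K a) T0 (adm_T2 a) (adm_kin a)).
exact: le_trans (ltW (kin_gt0 ok (fun k => adm_K a (k := k)) T0 e0)) (adm_kin a).
Qed.

Lemma adm_ray x T : adm K l N e T1 T2 M O x T -> rayhyp K C l N e x T.
Proof.
move=> a; have [sq pe] := adm_per a; have T0 := lt_le_trans T10 (adm_T1 a).
split=> //.
- exact: adm_loop a.
- by move=> s k s2 kN; apply: scal_K (ltnW kN) => //; exact: adm_O a.
- apply: le_trans rhoC; rewrite /small; apply: ler_pM.
  + by rewrite mulr_ge0 ?exprn_ge0 ?per_ge0.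
  + by rewrite addr_ge0 // ltW.
  + by rewrite ler_wpM2l // exprn_ge0.
  + by rewrite lerD2l (adm_T2 a).
- exact: le_trans rho1.
- exact: adm_neh a.
Qed.

Lemma adm_interior x T k : adm K l N e T1 T2 M O x T -> (k < N)%N -> nbhs (x k) K.
Proof.
move=> a kN; have [_ pe] := adm_per a.
have r0 : 0 < r by apply: lt_le_trans rho_r; rewrite mulr_gt0.
apply/nbhs_ballP; exists (r / 2); first by rewrite /= divr_gt0.
move=> z; rewrite -ball_normE /= => zx; rewrite KE /cball /=.
have h1 := OK (adm_O a); rewrite /cball /= in h1.
have h2 := le_trans (vv_per x (ltnW kN)) pe.
have -> : z - y0 = (x 0%N - y0) + vv x k - (x k - z).
  by rewrite /vv; apply/rowP => i; rewrite !mxE; ring.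
apply: le_trans (ler_normB _ _) _.
have rr : rho <= r / 2 by rewrite ler_pdivlMr // mulrC.
have -> : 3 * r = (2 * r + r / 2) + r / 2 by field.
exact: lerD (le_trans (ler_normD _ _) (lerD h1 (le_trans h2 rr))) (ltW zx).
Qed.

(** [mom] is the momentum on edge [j], and [bas k w] moves the vertex [k] alone. Indices are read
    modulo [N], so that [bas 0 w] moves the vertices 0 and [N] together and [prv 0] is [N - 1]. *)
Definition mom (x : nat -> V) (T : R) (j : nat) (w : V) : R := N%:R * lB l (x j) (dl x j) w / T.
Definition bas (k : nat) (w : V) (j : nat) : V := if (j %% N == k)%N then w else 0.
Definition prv (k : nat) : nat := ((k + N.-1) %% N)%N.
(** The difference of [L] at consecutive vertices is, to first order, its derivative along the edge;
    with the [lL1] term it makes up the exterior derivative of [L], so the choice of the primitive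
    disappears in the limit. *)
Definition force (x : nat -> V) (T : R) (k : nat) (w : V) : R :=
  N%:R * lB1 l (x k) w (dl x k) (dl x k) / (2 * T) - lL1 l (x k) w (dl x k)
  + (lL l (x k) w - lL l (x (prv k)) w).

Lemma dact_basis x T k w : T != 0 -> (forall k, (k < N)%N -> U (x k)) -> (k < N)%N ->
  dact l N e x T (bas k w) 0 = force x T k w - (mom x T k w - mom x T (prv k) w).
Proof.
move=> T0 xU kN.
have kpN : (prv k < N)%N by rewrite ltn_mod.
have b1 (j : 'I_N) : bas k w j = if j == Ordinal kN then w else 0.
  by rewrite /bas modn_small //.
have b2 (j : 'I_N) : bas k w j.+1 = if j == Ordinal kpN then w else 0.
  rewrite /bas; congr (if _ then _ else _).
  apply/eqP/eqP => [E|/(congr1 val) /= E].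
    apply: val_inj; rewrite /= /prv -E modnDml addSnnS prednK // modnDr modn_small //.
  rewrite E /prv -addn1 modnDml -addnA addn1 prednK // modnDr modn_small //.
have lB0 y u : lB l y u 0 = 0 by have := lBZ ok y 1 0 u 0; rewrite scaler0 scale1r mulr0 mul0r.
have lBB y u v1 v2 : lB l y u (v1 - v2) = lB l y u v1 - lB l y u v2.
  rewrite (lB_sym ok) addrC -scaleN1r (lB_lin ok) mulN1r addrC.
  by rewrite (lB_sym ok) [lB l y v2 u](lB_sym ok).
have lLB y v1 v2 : lL l y (v1 - v2) = lL l y v1 - lL l y v2.
  by rewrite addrC -scaleN1r (lL_lin ok) mulN1r addrC.
have E1 : \sum_(j < N) (lB1 l (x j) (bas k w j) (dl x j) (dl x j) + 2 * lB l (x j) (dl x j) (dl (bas k w) j))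
  = lB1 l (x k) w (dl x k) (dl x k) + 2 * lB l (x (prv k)) (dl x (prv k)) w - 2 * lB l (x k) (dl x k) w.
  rewrite (eq_bigr (fun j : 'I_N => (if j == Ordinal kN then lB1 l (x j) w (dl x j) (dl x j) else 0)
    + (if j == Ordinal kpN then 2 * lB l (x j) (dl x j) w else 0)
    - (if j == Ordinal kN then 2 * lB l (x j) (dl x j) w else 0))); last first.
    move=> j _; rewrite [dl (bas k w) j]/dl b1 b2 lBB.
    have z1 : lB1 l (x j) 0 (dl x j) (dl x j) = 0.
      by have := lB1Zw ok 0 0 (dl x j) (dl x j) (xU j (ltn_ord j)); rewrite scale0r mul0r.
    by case: ifP => _; case: ifP => _; rewrite ?lB0 ?z1; ring.
  by rewrite sumrB big_split /= -!big_mkcond /= !big_pred1_eq.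
have E2 : dFl l N x (bas k w) = lL1 l (x k) w (dl x k) + lL l (x (prv k)) w - lL l (x k) w.
  rewrite /dFl (eq_bigr (fun j : 'I_N => (if j == Ordinal kN then lL1 l (x j) w (dl x j) else 0)
    + (if j == Ordinal kpN then lL l (x j) w else 0)
    - (if j == Ordinal kN then lL l (x j) w else 0))); last first.
    move=> j _; rewrite [dl (bas k w) j]/dl b1 b2 lLB.
    have z1 : lL1 l (x j) 0 (dl x j) = 0.
      by have := lL1Zw ok 0 0 (dl x j) (xU j (ltn_ord j)); rewrite scale0r mul0r.
    by case: ifP => _; case: ifP => _; rewrite ?(lL0 ok) ?z1; ring.
  by rewrite sumrB big_split /= -!big_mkcond /= !big_pred1_eq.
rewrite /dact /dEn E1 E2 /force /mom.
by field.
Qed.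

(** Varying the period alone fixes the energy: at a critical point the right-hand side vanishes,
    that is [En = 2 e T^2]. *)
Lemma dact_time x T : T != 0 -> (forall k, (k < N)%N -> U (x k)) ->
  dact l N e x T (fun=> 0) 1 = e - En l N x / (2 * T ^+ 2).
Proof.
move=> T0 xU.
have d0 j : dl (fun _ : nat => 0 : V) j = 0 by rewrite /dl subrr.
have lB0 y u : lB l y u 0 = 0 by have := lBZ ok y 1 0 u 0; rewrite scaler0 scale1r mulr0 mul0r.
have E1 : dEn l N x (fun=> 0) = 0.
  rewrite /dEn big1 ?mulr0 // => j _; rewrite d0 lB0 mulr0 addr0.
  by have := lB1Zw ok 0 0 (dl x j) (dl x j) (xU j (ltn_ord j)); rewrite scale0r mul0r.
have E2 : dFl l N x (fun=> 0) = 0.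
  rewrite /dFl big1 // => j _; rewrite d0 (lL0 ok) addr0.
  by have := lL1Zw ok 0 0 (dl x j) (xU j (ltn_ord j)); rewrite scale0r mul0r.
by rewrite /dact E1 E2 mul0r add0r subr0 !mulr1 addrC.
Qed.

Lemma prv_pos k : (0 < k < N)%N -> prv k = k.-1.
Proof.
case: k => // k /= kN; rewrite /prv addSnnS prednK // modnDr modn_small //.
exact: ltnW.
Qed.

(** [2 C / T1 + 3 C] is the bound on momenta obtained in [velocity_bound]; ellipticity converts it
    into a speed at the cost of the factor [C T2]. *)
Definition velB : R := C * T2 * (2 * C / T1 + 3 * C).

(** The total of the forces is controlled by [sqn] and [per], independently of [N]. As [sqn <= 1],
    some edge has [N |dl| <= 1], and the momentum bound spreads from it to all edges. The equation
    is assumed at positive indices only, because at the vertex 0 it may fail when the base vertex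
    lies on the boundary. *)
Lemma velocity_bound x T : (forall k, (k < N)%N -> K (x k)) -> T1 <= T -> T <= T2 ->
  sqn N x <= 1 -> per N x <= 1 ->
  (forall k w, (0 < k < N)%N -> mom x T k w - mom x T (prv k) w = force x T k w) ->
  forall k, (k < N)%N -> N%:R * `|dl x k| <= velB.
Proof.
move=> xK TT1 TT2 sq pe EL.
have T0 : 0 < T := lt_le_trans T10 TT1.
have NR : 0 < N%:R :> R by rewrite ltr0n.
pose c k := C * (N%:R * `|dl x k| ^+ 2) / (2 * T) + C * `|dl x k| + C * `|dl x k.-1|.
have c0 k : 0 <= c k.
  rewrite /c !addr_ge0 ?mulr_ge0 ?invr_ge0 ?exprn_ge0 ?(ltW NR) //.
  by rewrite mulr_ge0 ?(ltW T0).
have step k w : (0 < k < N)%N -> `|mom x T k w - mom x T k.-1 w| <= c k * `|w|.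
  move=> kN; have /andP[kp kN'] := kN.
  have k1N : (k.-1 < N)%N by rewrite (leq_ltn_trans (leq_pred k)).
  have <- : mom x T (prv k) w = mom x T k.-1 w by rewrite prv_pos.
  rewrite EL // /force (prv_pos kN).
  rewrite /c [leRHS]mulrDl [X in _ <= X + _]mulrDl.
  apply: le_trans (ler_normD _ _) _; apply: lerD; last first.
    apply: le_trans (lL_lip ok _ (xK _ k1N) (xK _ kN')) _.
    by rewrite /dl prednK.
  apply: le_trans (ler_normB _ _) _; apply: lerD.
    rewrite normrM (ger0_norm (x := (2 * T)^-1)) ?invr_ge0 ?mulr_ge0 ?(ltW T0) //.
    rewrite [leRHS]mulrAC ler_wpM2r ?invr_ge0 ?mulr_ge0 ?(ltW T0) //.
    rewrite normrM (ger0_norm (x := N%:R)) // -!mulrA [leRHS]mulrCA ler_wpM2l //.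
    apply: le_trans (lB1_bd ok _ _ _ (xK _ kN')) _.
    by rewrite le_eqVlt; apply/orP; left; apply/eqP; ring.
  apply: le_trans (lL1_bd ok _ _ (xK _ kN')) _.
  by rewrite le_eqVlt; apply/orP; left; apply/eqP; ring.
have csum : \sum_(k < N) c k <= C / T1 + 3 * C.
  rewrite /c !big_split /= -!mulr_sumr -mulr_suml -mulr_sumr -mulr_sumr.
  (* [k.-1] is 0 for [k = 0], so the first edge is counted twice, whence the factor 2. *)
  have p1 : \sum_(k < N) `|dl x k.-1| <= 2 * per N x.
    rewrite /per; case: N N0 => // N' _.
    rewrite big_ord_recl /= [in leRHS]mulr_natl mulr2n lerD //.
      by rewrite big_ord_recl /= lerDl sumr_ge0.
    by rewrite [leRHS]big_ord_recr /= lerDl.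
  have -> : C * (N%:R * \sum_(k < N) `|dl x k| ^+ 2) / (2 * T) = C * sqn N x / (2 * T) by [].
  have q1 : C * sqn N x / (2 * T) <= C / T1.
    apply: ler_pM.
    - exact: mulr_ge0 C0 (sqn_ge0 N x).
    - by rewrite invr_ge0 mulr_ge0 // ltW.
    - by rewrite ler_piMr.
    - rewrite lef_pV2 ?posrE ?mulr_gt0 //.
      by apply: le_trans TT1 _; rewrite ler_peMl ?(ltW T0) // ler1n.
  have := ler_wpM2l C0 p1; have := ler_wpM2l C0 pe; rewrite /per in pe *; lra.
have [k1 k1N k1s] : exists2 k1, (k1 < N)%N & N%:R * `|dl x k1| <= 1.
  apply: contrapT => H.
  have H' k : (k < N)%N -> 1 < N%:R * `|dl x k|.
    by move=> kN; rewrite ltNge; apply/negP => h; apply: H; exists k.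
  have pos k : (k < N)%N -> 0 < N%:R ^+ 2 * `|dl x k| ^+ 2 - 1.
    by move=> kN; rewrite subr_gt0 -exprMn exprn_egt1 // H'.
  have : 0 < \sum_(k < N) (N%:R ^+ 2 * `|dl x k| ^+ 2 - 1).
    rewrite (bigD1 (Ordinal N0)) //= ltr_pwDl ?pos // sumr_ge0 // => k _.
    exact/ltW/pos.
  have -> : \sum_(k < N) (N%:R ^+ 2 * `|dl x k| ^+ 2 - 1) = N%:R * (sqn N x - 1).
    by rewrite sumrB -mulr_sumr sumr_const card_ord /sqn; ring.
  by rewrite pmulr_rgt0 // subr_gt0 ltNge sq.
have momb k w : (k < N)%N -> `|mom x T k w| <= (2 * C / T1 + 3 * C) * `|w|.
  move=> kN.
  have h1 := chain_bound (f := fun k => mom x T k w) (c := fun k => c k * `|w|) (fun k => step k w)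
     (fun k => mulr_ge0 (c0 k) (normr_ge0 w)) k1N kN.
  rewrite -mulr_suml in h1.
  have h2 := le_trans h1 (ler_wpM2r (normr_ge0 w) csum).
  have h3 : `|mom x T k1 w| <= C / T1 * `|w|.
    rewrite /mom normrM (ger0_norm (x := T^-1)) ?invr_ge0 ?(ltW T0) // normrM (ger0_norm (x := N%:R)) //.
    rewrite [leRHS]mulrAC; apply: ler_pM => //; rewrite ?mulr_ge0 ?invr_ge0 ?(ltW T0) //.
      apply: le_trans (ler_wpM2l (ltW NR) (lB_bd ok _ _ (xK _ k1N))) _.
      rewrite mulrA ler_wpM2r // mulrCA -[leRHS]mulr1 ler_wpM2l //.
    by rewrite lef_pV2 ?posrE.
  have -> : mom x T k w = (mom x T k w - mom x T k1 w) + mom x T k1 w by rewrite subrK.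
  apply: le_trans (ler_normD _ _) _; lra.
move=> k kN.
have [->|d0] := eqVneq (dl x k) 0.
  rewrite normr0 mulr0 /velB !mulr_ge0 ?addr_ge0 ?mulr_ge0 ?invr_ge0 ?(ltW T10) //.
  exact: le_trans (ltW T0) TT2.
have dp : 0 < `|dl x k| by rewrite normr_gt0.
rewrite -(ler_pM2r dp) -mulrA -expr2.
apply: le_trans (ler_wpM2l (ltW NR) (lB_ell ok _ (xK _ kN))) _.
have -> : N%:R * (C * lB l (x k) (dl x k) (dl x k)) = C * (T * mom x T k (dl x k)).
  by rewrite /mom; field; rewrite gt_eqF.
rewrite /velB -!mulrA ler_wpM2l //; apply: ler_pM => //; first exact: ltW.
  rewrite -(pmulr_rge0 _ T0).
  have -> : T * mom x T k (dl x k) = N%:R * lB l (x k) (dl x k) (dl x k).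
    by rewrite /mom; field; rewrite gt_eqF.
  rewrite mulr_ge0 // -(pmulr_rge0 _ Cp).
  exact: le_trans (sqr_ge0 _) (lB_ell ok _ (xK _ kN)).
by rewrite [2 * (C / T1)]mulrA; apply: le_trans (ler_norm _) (momb _ _ kN).
Qed.

End Consequences.

(** * Chart changes of polygonal loops *)

Section Growth.
Variable R : realType.

(** Cutting [[0, s]] into [m] pieces divides the total of the terms in [b] by [m], so [b] drops out
    however large it is. The lemma is applied with [a] of order [1/N] and [b] of order [N]. *)
Lemma quadratic_increments (D : R -> R) (a b : R) (s : R) : 0 <= a -> 0 <= b ->
  0 <= s -> s <= 2 ->
  (forall t h, 0 <= t -> 0 <= h -> t + h <= 2 -> `|D (t + h) - D t| <= a * h + b * h ^+ 2) ->
  `|D s - D 0| <= a * s.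
Proof.
move=> a0 b0 s0 s2 H.
have step m : (0 < m)%N -> `|D s - D 0| <= a * s + b * s ^+ 2 / m%:R.
  move=> m0; have mR : 0 < m%:R :> R by rewrite ltr0n.
  pose h := s / m%:R.
  have h0 : 0 <= h by rewrite divr_ge0 // ltW.
  have mh : m%:R * h = s by rewrite /h mulrC divfK // gt_eqF.
  have ind k : (k <= m)%N -> `|D (k%:R * h) - D 0| <= k%:R * (a * h + b * h ^+ 2).
    elim: k => [|k IH] km; first by rewrite !mul0r subrr normr0.
    have -> : D (k.+1%:R * h) - D 0 = (D (k%:R * h + h) - D (k%:R * h)) + (D (k%:R * h) - D 0).
      by rewrite -natr1 mulrDl mul1r; ring.
    apply: le_trans (ler_normD _ _) _; rewrite -natr1 mulrDl mul1r addrC.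
    apply: lerD; first exact: IH (ltnW km).
    apply: H => //; first by rewrite mulr_ge0.
    have -> : k%:R * h + h = k.+1%:R * h by rewrite -natr1 mulrDl mul1r.
    by apply: le_trans s2; rewrite -mh ler_wpM2r // ler_nat.
  have := ind m (leqnn m); rewrite mh => /le_trans; apply.
  rewrite le_eqVlt; apply/orP; left; apply/eqP; rewrite /h; field.
  by rewrite gt_eqF.
apply/ler_addgt0Pr => ep ep0.
have [m Hm] : exists m : nat, b * s ^+ 2 / ep < m%:R.
  exists (Num.bound (b * s ^+ 2 / ep)); apply: archi_boundP.
  by rewrite divr_ge0 ?mulr_ge0 ?exprn_ge0 // ltW.
have mR : 0 < m%:R :> R.
  by apply: le_lt_trans Hm; rewrite divr_ge0 ?mulr_ge0 ?exprn_ge0 // ltW.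
have m0 : (0 < m)%N by rewrite -(ltr0n R).
apply: le_trans (step m m0) _; rewrite lerD2l.
by move: Hm; rewrite ltr_pdivrMr // => /ltW Hm; rewrite ler_pdivrMr // [leRHS]mulrC.
Qed.

Lemma sum_const_le (N : nat) (f : nat -> R) (c : R) :
  (forall k, (k < N)%N -> `|f k| <= c) -> `|\sum_(k < N) f k| <= N%:R * c.
Proof.
move=> H; apply: le_trans (norm_sum_le (g := fun=> c) H) _.
by rewrite sumr_const card_ord mulr_natl.
Qed.

End Growth.

Section Stokes.
Variables (R : realType) (n : nat).
Local Notation V := 'rV[R]_n.
Variables (U K : set V) (C : R) (l : lag R n).
Hypothesis ok : lag_ok U K C l.
Variable N : nat.

(** The exterior derivative of the one-form [lL l]. In a chart of the manifold it represents the
    symplectic form and is thus compatible with chart changes, unlike [L]. *)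
Definition om (l : lag R n) (y u v : V) : R := lL1 l y u v - lL1 l y v u.

Definition inc (y y' : nat -> V) k : V := y' k - y k.

(* The boundary term [sum L(y_k, zeta_{k+1} - zeta_k)] is summed by parts, so
   that only the antisymmetric part of the derivative of [L] survives. *)
Lemma discrete_stokes (y y' : nat -> V) :
  (forall k, (k <= N)%N -> K (y k)) -> (forall k, (k <= N)%N -> K (y' k)) ->
  y N = y 0%N -> y' N = y' 0%N ->
  `|Fl l N y' - Fl l N y - \sum_(k < N) om l (y k) (inc y y' k) (dl y k)| <=
  \sum_(k < N) C * (`|inc y y' k| ^+ 2 * `|dl y k| + `|inc y y' k| * `|dl (inc y y') k|
     + `|dl y k| ^+ 2 * `|inc y y' k.+1| + `|dl y k| * `|dl (inc y y') k|).
Proof.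
move=> yK y'K yN y'N; set z := inc y y'.
have lLB p u v : lL l p (u - v) = lL l p u - lL l p v.
  by rewrite addrC -scaleN1r (lL_lin ok) mulN1r addrC.
have lLD p u v : lL l p (u + v) = lL l p u + lL l p v.
  by rewrite -[u]scale1r (lL_lin ok) mul1r scale1r.
have lL1D p w u v : lL1 l p w (u + v) = lL1 l p w u + lL1 l p w v.
  by rewrite -[u]scale1r (lL1_lin ok) mul1r scale1r.
have shift : \sum_(k < N) lL l (y k) (z k) = \sum_(k < N) lL l (y k.+1) (z k.+1).
  apply/eqP; rewrite -subr_eq0 -sumrB.
  have -> : \sum_(k < N) (lL l (y k) (z k) - lL l (y k.+1) (z k.+1)) =
      lL l (y 0%N) (z 0%N) - lL l (y N) (z N).
    elim: (N) => [|m IH]; first by rewrite big_ord0 subrr.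
    by rewrite big_ord_recr /= IH; ring.
  by rewrite /z /inc yN y'N subrr.
have -> : Fl l N y' - Fl l N y - \sum_(k < N) om l (y k) (z k) (dl y k) =
  \sum_(k < N) ((lL l (y' k) (dl y k) - lL l (y k) (dl y k) - lL1 l (y k) (z k) (dl y k))
    + (lL l (y' k) (dl z k) - lL l (y k) (dl z k))
    - (lL l (y k.+1) (z k.+1) - lL l (y k) (z k.+1) - lL1 l (y k) (dl y k) (z k.+1))
    - lL1 l (y k) (dl y k) (dl z k)).
  apply/eqP; rewrite -subr_eq0 /Fl -!sumrB.
  rewrite (eq_bigr (fun k : 'I_N => lL l (y k.+1) (z k.+1) - lL l (y k) (z k))).
    by rewrite sumrB shift subrr.
  move=> k _; have -> : dl y' k = dl y k + dl z k.
    by rewrite /dl /z /inc; apply/rowP => i; rewrite !mxE; ring.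
  have -> : z k.+1 = z k + dl z k by rewrite /dl addrC subrK.
  rewrite /om; move: (dl y k) (dl z k) (z k) => a b c.
  by rewrite !lLD !lL1D; ring.
apply: (norm_sum_le (f := fun k => (lL l (y' k) (dl y k) - lL l (y k) (dl y k) - lL1 l (y k) (z k) (dl y k))
    + (lL l (y' k) (dl z k) - lL l (y k) (dl z k))
    - (lL l (y k.+1) (z k.+1) - lL l (y k) (z k.+1) - lL1 l (y k) (dl y k) (z k.+1))
    - lL1 l (y k) (dl y k) (dl z k))
  (g := fun k => C * (`|z k| ^+ 2 * `|dl y k| + `|z k| * `|dl z k|
     + `|dl y k| ^+ 2 * `|z k.+1| + `|dl y k| * `|dl z k|))) => k kN.
have Ky := yK k (ltnW kN); have Ky' := y'K k (ltnW kN); have KyS := yK k.+1 kN.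
have h1 := lL_tay ok (dl y k) Ky Ky'.
have h2 := lL_lip ok (dl z k) Ky Ky'.
have h3 := lL_tay ok (z k.+1) Ky KyS.
have h4 := lL1_bd ok (dl y k) (dl z k) Ky.
rewrite -/(z k) in h1 h2; rewrite -/(dl y k) in h3.
rewrite expr2 !mulrA in h1; rewrite expr2 !mulrA in h3.
rewrite !mulrDr !mulrA.
apply: le_trans (ler_normB _ _) _; apply: lerD => //.
apply: le_trans (ler_normB _ _) _; apply: lerD => //.
by apply: le_trans (ler_normD _ _) _; apply: lerD.
Qed.

End Stokes.

(** * Energy and flux under a chart change, up to O(1/N) *)

Section Transition.
Variables (R : realType) (n : nat).
Local Notation V := 'rV[R]_n.

(** A chart change [phi] with derivative [dphi] respects the metric and the exterior derivative of
    the one-form. Nothing relates the primitives themselves, which are chosen independently in each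
    chart. *)
Record transition (W K2 : set V) (A : R) (l1 l2 : lag R n) (phi : V -> V) (dphi : V -> V -> V)
    : Prop := Transition {
  tr_A1 : 1 <= A;
  tr_K : forall y, W y -> K2 (phi y);
  tr_lin : forall y a u v, W y -> dphi y (a *: u + v) = a *: dphi y u + dphi y v;
  tr_bd : forall y v, W y -> `|dphi y v| <= A * `|v|;
  tr_lip : forall y y', W y -> W y' -> `|phi y' - phi y| <= A * `|y' - y|;
  tr_dlip : forall y y' v, W y -> W y' -> `|dphi y' v - dphi y v| <= A * `|y' - y| * `|v|;
  tr_tay : forall y y', W y -> W y' -> `|phi y' - phi y - dphi y (y' - y)| <= A * `|y' - y| ^+ 2;
  tr_B : forall y u v, W y -> lB l2 (phi y) (dphi y u) (dphi y v) = lB l1 y u v;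
  tr_om : forall y u v, W y -> om l2 (phi y) (dphi y u) (dphi y v) = om l1 y u v }.

Variables (U1 U2 K1 K2 W : set V) (C A : R) (l1 l2 : lag R n) (phi : V -> V) (dphi : V -> V -> V).
Hypothesis ok1 : lag_ok U1 K1 C l1.
Hypothesis ok2 : lag_ok U2 K2 C l2.
Hypothesis tr : transition W K2 A l1 l2 phi dphi.
Hypothesis CA : C <= A.
Hypothesis WK1 : W `<=` K1.
Variables (N : nat) (x : nat -> V).
Hypothesis N0 : (0 < N)%N.
Hypothesis xN : x N = x 0%N.
Hypothesis xW : forall s k, s \in `[(0 : R), 2] -> (k <= N)%N -> W (scal s x k).
Hypothesis xv : forall k, (k < N)%N -> N%:R * `|dl x k| <= A.
Hypothesis per1 : per N x <= 1.

Let NR : 0 < N%:R :> R.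
Proof. by rewrite ltr0n. Qed.
Let A0 : 0 <= A.
Proof. exact: le_trans ler01 (tr_A1 tr). Qed.

Let d : R := A / N%:R.
Let d0 : 0 <= d.
Proof. by rewrite divr_ge0 // ltW. Qed.

Let dx k : (k < N)%N -> `|dl x k| <= d.
Proof. by move=> kN; rewrite ler_pdivlMr // mulrC xv. Qed.

Let vx k : (k <= N)%N -> `|vv x k| <= 1.
Proof. by move=> kN; apply: le_trans per1; exact: vv_per. Qed.

(** [phi] does not commute with dilations, so [trl s] is in general no dilation of [trl 1]; the
    family is the image of the ray of the first chart. *)
Definition trl (s : R) (k : nat) : V := phi (scal s x k).

Lemma trl_loop s : trl s N = trl s 0%N.
Proof. by rewrite /trl /scal /vv xN subrr. Qed.

Let dscal s k : scal s x k.+1 - scal s x k = s *: dl x k.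
Proof. by rewrite -/(dl (scal s x) k) dl_scal. Qed.

Section FixS.
Variable s : R.
Hypothesis s02 : s \in `[(0 : R), 2].

Let s0 : 0 <= s.
Proof. by move: s02; rewrite in_itv /= => /andP[]. Qed.
Let s2 : s <= 2.
Proof. by move: s02; rewrite in_itv /= => /andP[]. Qed.

Let sdx k : (k < N)%N -> `|s *: dl x k| <= 2 * d.
Proof. by move=> kN; rewrite normrZ ger0_norm // ler_pM // dx. Qed.

Lemma dl_trl_bd k : (k < N)%N -> `|dl (trl s) k| <= 2 * A * d.
Proof.
move=> kN; apply: le_trans (tr_lip tr (xW s02 (ltnW kN)) (xW s02 kN)) _.
by rewrite dscal mulrAC mulrC ler_wpM2r // sdx.
Qed.

Lemma dl_trl_tay k : (k < N)%N -> `|dl (trl s) k - dphi (scal s x k) (s *: dl x k)| <= 4 * A * d ^+ 2.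
Proof.
move=> kN; have := tr_tay tr (xW s02 (ltnW kN)) (xW s02 kN); rewrite dscal.
move=> /le_trans; apply; have := sdx kN => h.
have h2 : `|s *: dl x k| ^+ 2 <= (2 * d) ^+ 2 by rewrite ler_sqr ?nnegrE // mulr_ge0.
by apply: le_trans (ler_wpM2l A0 h2) _; rewrite le_eqVlt; apply/orP; left; apply/eqP; ring.
Qed.

Lemma dphi_bd k : (k < N)%N -> `|dphi (scal s x k) (s *: dl x k)| <= 2 * A * d.
Proof.
move=> kN; apply: le_trans (tr_bd tr _ (xW s02 (ltnW kN))) _.
by rewrite mulrAC mulrC ler_wpM2r // sdx.
Qed.

(** By the speed bound an edge is no longer than [A / N], and its image agrees with its image under
    [dphi] up to the square of this length. Each of the [N] terms is off by [O(1/N^3)], and [En]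
    carries a factor [N]. *)
Lemma En_trl : `|En l2 N (trl s) - En l1 N (scal s x)| <= 16 * A ^+ 6 / N%:R.
Proof.
rewrite /En -mulrBr -sumrB normrM ger0_norm //.
have -> : 16 * A ^+ 6 / N%:R = N%:R * (N%:R * (16 * A ^+ 3 * d ^+ 3)).
  by rewrite /d; field; rewrite gt_eqF.
rewrite ler_wpM2l //.
apply: (sum_const_le (f := fun k => lB l2 (trl s k) (dl (trl s) k) (dl (trl s) k) - lB l1 (scal s x k) (dl (scal s x) k) (dl (scal s x) k))) => k kN.
rewrite dl_scal -(tr_B tr _ _ (xW s02 (ltnW kN))) -/(trl s k).
set a := dphi _ _; set b := dl (trl s) k.
have lBD p u v w : lB l2 p (u + v) w = lB l2 p u w + lB l2 p v w.
  by rewrite -[u]scale1r (lB_lin ok2) mul1r scale1r.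
have -> : lB l2 (trl s k) b b - lB l2 (trl s k) a a = lB l2 (trl s k) (b - a) b + lB l2 (trl s k) (b - a) a.
  have -> : lB l2 (trl s k) (b - a) b = lB l2 (trl s k) b b - lB l2 (trl s k) a b.
    by apply/eqP; rewrite -subr_eq opprK -lBD subrK.
  have -> : lB l2 (trl s k) (b - a) a = lB l2 (trl s k) b a - lB l2 (trl s k) a a.
    by apply/eqP; rewrite -subr_eq opprK -lBD subrK.
  by rewrite (lB_sym ok2 _ b a); ring.
have Kk : K2 (trl s k) := tr_K tr (xW s02 (ltnW kN)).
have h1 := dl_trl_tay kN; have h2 := dl_trl_bd kN; have h3 := dphi_bd kN.
rewrite -/a -/b in h1 h2 h3.
have bound p : `|p| <= 2 * A * d -> `|lB l2 (trl s k) (b - a) p| <= 8 * A ^+ 3 * d ^+ 3.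
  move=> hp; apply: le_trans (lB_bd ok2 _ _ Kk) _.
  have -> : 8 * A ^+ 3 * d ^+ 3 = A * (4 * A * d ^+ 2) * (2 * A * d) by ring.
  have C0 : 0 <= C := le_trans ler01 (lag_C1 ok1).
  by apply: ler_pM => //; [exact: mulr_ge0 | exact: ler_pM].
apply: le_trans (ler_normD _ _) _; have := bound b h2; have := bound a h3; lra.
Qed.

End FixS.

Lemma om_bd p u v : K2 p -> `|om l2 p u v| <= 2 * A * `|u| * `|v|.
Proof.
move=> Kp; apply: le_trans (ler_normB _ _) _.
have h1 := lL1_bd ok2 u v Kp; have h2 := lL1_bd ok2 v u Kp.
have h3 : C * `|u| * `|v| <= A * `|u| * `|v| by rewrite !ler_wpM2r.
rewrite mulrAC in h2; lra.
Qed.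

(** By the discrete Stokes formula in both charts, the changes of [Fl] between [s] and [s + h] are
    sums of exterior derivatives over corresponding small quadrilaterals, which [phi] matches. The
    errors linear in [h] are of order [1/N]; those quadratic in [h] grow with [N] and are removed by
    [quadratic_increments]. *)
Lemma Fl_trl_step s h : 0 <= s -> 0 <= h -> s + h <= 2 ->
  `|(Fl l2 N (trl (s + h)) - Fl l1 N (scal (s + h) x)) - (Fl l2 N (trl s) - Fl l1 N (scal s x))|
  <= 24 * A ^+ 6 / N%:R * h + N%:R * (100 * A ^+ 4 * (1 + d)) * h ^+ 2.
Proof.
move=> s0 h0 sh2.
have A1 := tr_A1 tr.
have s02 : s \in `[(0 : R), 2] by rewrite in_itv /= s0 (le_trans _ sh2) // lerDl.
have sh02 : s + h \in `[(0 : R), 2] by rewrite in_itv /= addr_ge0.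
have h2 : h <= 2 by apply: le_trans sh2; rewrite lerDr.
have C0 : 0 <= C := le_trans ler01 (lag_C1 ok1).
pose z1 := inc (scal s x) (scal (s + h) x).
pose z2 := inc (trl s) (trl (s + h)).
have z1E k : z1 k = h *: vv x k by rewrite /z1 /inc scal_sub addrAC subrr add0r.
have dsE k : scal (s + h) x k - scal s x k = h *: vv x k by exact: z1E.
have dz1E k : dl z1 k = h *: dl x k.
  by rewrite /dl !z1E -scalerBr /vv opprB addrA subrK.
have S1 := discrete_stokes ok1 (y := scal s x) (y' := scal (s + h) x)
  (fun k kN => WK1 (xW s02 kN)) (fun k kN => WK1 (xW sh02 kN)).
have S2 := discrete_stokes ok2 (y := trl s) (y' := trl (s + h))
  (fun k kN => tr_K tr (xW s02 kN)) (fun k kN => tr_K tr (xW sh02 kN)) (trl_loop s) (trl_loop (s + h)).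
rewrite -/z2 in S2; rewrite -/z1 in S1.
have e1 : scal s x N = scal s x 0%N by rewrite /scal /vv xN.
have e2 : scal (s + h) x N = scal (s + h) x 0%N by rewrite /scal /vv xN.
move: (S1 e1 e2) => {}S1.
have z2b k : (k <= N)%N -> `|z2 k| <= A * h.
  move=> kN; apply: le_trans (tr_lip tr (xW s02 kN) (xW sh02 kN)) _.
  by rewrite dsE normrZ ger0_norm // ler_wpM2l // ler_piMr // vx.
have z2t k : (k <= N)%N -> `|z2 k - h *: dphi (scal s x k) (vv x k)| <= A * h ^+ 2.
  move=> kN; have := tr_tay tr (xW s02 kN) (xW sh02 kN); rewrite dsE.
  have lin0 : dphi (scal s x k) (h *: vv x k) = h *: dphi (scal s x k) (vv x k).
    have := tr_lin tr h (vv x k) 0 (xW s02 kN); have := tr_lin tr (-1) 0 0 (xW s02 kN).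
    by rewrite !scaler0 !addr0 scaleN1r addNr => -> ->; rewrite addr0.
  rewrite lin0 => /le_trans; apply; rewrite normrZ ger0_norm // exprMn.
  by rewrite ler_wpM2l // ler_piMr ?exprn_ge0 // exprn_ile1 ?vx.
have dz2 k : (k < N)%N -> `|dl z2 k| <= 3 * A * d * h + 2 * A * h ^+ 2.
  move=> kN; have kN' := ltnW kN.
  have -> : dl z2 k = (z2 k.+1 - h *: dphi (scal s x k.+1) (vv x k.+1))
     - (z2 k - h *: dphi (scal s x k) (vv x k))
     + h *: ((dphi (scal s x k.+1) (vv x k.+1) - dphi (scal s x k.+1) (vv x k))
     + (dphi (scal s x k.+1) (vv x k) - dphi (scal s x k) (vv x k))).
    by rewrite /dl; apply/rowP => i; rewrite !mxE; ring.
  have t1 := z2t _ kN; have t2 := z2t _ kN'.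
  have t3 : `|dphi (scal s x k.+1) (vv x k.+1) - dphi (scal s x k.+1) (vv x k)| <= A * d.
    have -> : dphi (scal s x k.+1) (vv x k.+1) = dphi (scal s x k.+1) (dl x k) + dphi (scal s x k.+1) (vv x k).
      have := tr_lin tr 1 (dl x k) (vv x k) (xW s02 kN); rewrite !scale1r => <-.
      by rewrite /vv /dl addrA subrK.
    rewrite addrK; apply: le_trans (tr_bd tr _ (xW s02 kN)) _.
    by rewrite ler_wpM2l // dx.
  have t4 : `|dphi (scal s x k.+1) (vv x k) - dphi (scal s x k) (vv x k)| <= 2 * A * d.
    apply: le_trans (tr_dlip tr _ (xW s02 kN') (xW s02 kN)) _; rewrite dscal.
    have s2 : s <= 2 by move: s02; rewrite in_itv /= => /andP[].
    have q1 : `|s *: dl x k| <= 2 * d by rewrite normrZ ger0_norm // ler_pM // dx.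
    have -> : 2 * A * d = A * (2 * d) * 1 by ring.
    by rewrite ler_pM ?mulr_ge0 // ?vx // ler_wpM2l.
  apply: le_trans (ler_normD _ _) _; rewrite normrZ ger0_norm //.
  have t5 : h * `|dphi (scal s x k.+1) (vv x k.+1) - dphi (scal s x k.+1) (vv x k)
     + (dphi (scal s x k.+1) (vv x k) - dphi (scal s x k) (vv x k))| <= h * (3 * A * d).
    by rewrite ler_wpM2l // (le_trans (ler_normD _ _)) //; lra.
  apply: le_trans (lerD (le_trans (ler_normB _ _) (lerD t1 t2)) t5) _.
  by rewrite le_eqVlt; apply/orP; left; apply/eqP; ring.
pose ker k := om l2 (trl s k) (z2 k) (dl (trl s) k) - om l1 (scal s x k) (z1 k) (dl (scal s x) k).
have kerb k : (k < N)%N -> `|ker k| <= 4 * A ^+ 3 * d * h ^+ 2 + 8 * A ^+ 3 * d ^+ 2 * h.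
  move=> kN; have kN' := ltnW kN; rewrite /ker z1E dl_scal.
  have Wk := xW s02 kN'; have Kk : K2 (trl s k) := tr_K tr Wk.
  have -> : om l1 (scal s x k) (h *: vv x k) (s *: dl x k)
      = om l2 (trl s k) (h *: dphi (scal s x k) (vv x k)) (dphi (scal s x k) (s *: dl x k)).
    rewrite -(tr_om tr _ _ Wk) -/(trl s k); congr (om _ _ _ _).
    have := tr_lin tr h (vv x k) 0 Wk; have := tr_lin tr (-1) 0 0 Wk.
    by rewrite !scaler0 !addr0 scaleN1r addNr => -> ->; rewrite addr0.
  set a := h *: _; set b := dphi _ (s *: _).
  have Uk : U2 (trl s k) := lag_sub ok2 Kk.
  have omE : om l2 (trl s k) (z2 k) (dl (trl s) k) - om l2 (trl s k) a b
     = om l2 (trl s k) (z2 k - a) (dl (trl s) k) + om l2 (trl s k) a (dl (trl s) k - b).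
    have Dl u u' v : lL1 l2 (trl s k) (u - u') v = lL1 l2 (trl s k) u v - lL1 l2 (trl s k) u' v.
      by rewrite addrC -scaleN1r (lL1_linw ok2) // mulN1r addrC.
    have Dr u v v' : lL1 l2 (trl s k) u (v - v') = lL1 l2 (trl s k) u v - lL1 l2 (trl s k) u v'.
      by rewrite addrC -scaleN1r (lL1_lin ok2) mulN1r addrC.
    by rewrite /om !Dl !Dr; ring.
  rewrite omE; apply: le_trans (ler_normD _ _) _; apply: lerD.
    apply: le_trans (om_bd _ _ Kk) _.
    have -> : 4 * A ^+ 3 * d * h ^+ 2 = 2 * A * (A * h ^+ 2) * (2 * A * d) by ring.
    by rewrite ler_pM ?mulr_ge0 // ?(dl_trl_bd s02) // ler_wpM2l ?mulr_ge0 // z2t.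
  apply: le_trans (om_bd _ _ Kk) _.
  have -> : 8 * A ^+ 3 * d ^+ 2 * h = 2 * A * (h * A) * (4 * A * d ^+ 2) by ring.
  rewrite ler_pM ?mulr_ge0 // ?(dl_trl_tay s02) // ler_wpM2l ?mulr_ge0 //.
  rewrite /a normrZ ger0_norm // ler_wpM2l //.
  by apply: le_trans (tr_bd tr _ Wk) _; rewrite ler_piMr // vx.
have S1b : `|Fl l1 N (scal (s + h) x) - Fl l1 N (scal s x) -
   \sum_(k < N) om l1 (scal s x k) (z1 k) (dl (scal s x) k)| <= N%:R * (A * (3 * d * h ^+ 2 + 6 * d ^+ 2 * h)).
  apply: le_trans S1 _; rewrite -[leRHS]ger0_norm; last first.
    by rewrite !(mulr_ge0, addr_ge0) // ?exprn_ge0.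
  rewrite -[leLHS]ger0_norm; last first.
    by apply: sumr_ge0 => k _; rewrite !(mulr_ge0, addr_ge0) // ?exprn_ge0.
  rewrite [leRHS]ger0_norm; last by rewrite !(mulr_ge0, addr_ge0) // ?exprn_ge0.
  apply: (sum_const_le (f := fun k => C * (`|z1 k| ^+ 2 * `|dl (scal s x) k| + `|z1 k| * `|dl z1 k|
     + `|dl (scal s x) k| ^+ 2 * `|z1 k.+1| + `|dl (scal s x) k| * `|dl z1 k|))) => k kN.
  rewrite ger0_norm; last by rewrite !(mulr_ge0, addr_ge0) // ?exprn_ge0.
  have s2 : s <= 2 by move: s02; rewrite in_itv /= => /andP[].
  have v1 := vx (ltnW kN); have v2 := vx kN; have dk := dx kN.
  have a1 : `|z1 k| <= h by rewrite z1E normrZ ger0_norm // ler_piMr.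
  have a2 : `|z1 k.+1| <= h by rewrite z1E normrZ ger0_norm // ler_piMr.
  have a3 : `|dl z1 k| <= h * d by rewrite dz1E normrZ ger0_norm // ler_wpM2l.
  have a4 : `|dl (scal s x) k| <= 2 * d by rewrite dl_scal normrZ ger0_norm // ler_pM.
  apply: ler_pM; [exact: C0|by rewrite !addr_ge0 ?mulr_ge0 ?exprn_ge0|exact: CA|].
  have -> : 3 * d * h ^+ 2 + 6 * d ^+ 2 * h = h ^+ 2 * (2 * d) + h * (h * d) + (2 * d) ^+ 2 * h + (2 * d) * (h * d) by ring.
  by rewrite !lerD // ler_pM ?exprn_ge0 // ler_sqr ?nnegrE // mulr_ge0.
have S2b : `|Fl l2 N (trl (s + h)) - Fl l2 N (trl s) -
   \sum_(k < N) om l2 (trl s k) (z2 k) (dl (trl s) k)| <=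
   N%:R * (A * ((A * h) ^+ 2 * (2 * A * d) + A * h * (3 * A * d * h + 2 * A * h ^+ 2)
     + (2 * A * d) ^+ 2 * (A * h) + (2 * A * d) * (3 * A * d * h + 2 * A * h ^+ 2))).
  apply: le_trans S2 _; rewrite -[leLHS]ger0_norm; last first.
    by apply: sumr_ge0 => k _; rewrite !(mulr_ge0, addr_ge0) // ?exprn_ge0.
  apply: (sum_const_le (f := fun k => C * (`|z2 k| ^+ 2 * `|dl (trl s) k| + `|z2 k| * `|dl z2 k|
     + `|dl (trl s) k| ^+ 2 * `|z2 k.+1| + `|dl (trl s) k| * `|dl z2 k|))) => k kN.
  rewrite ger0_norm; last by rewrite !(mulr_ge0, addr_ge0) // ?exprn_ge0.
  have a1 := z2b _ (ltnW kN); have a2 := z2b _ kN; have a3 := dz2 _ kN; have a4 := dl_trl_bd s02 kN.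
  apply: ler_pM; [exact: C0|by rewrite !addr_ge0 ?mulr_ge0 ?exprn_ge0|exact: CA|].
  by rewrite !lerD // ler_pM ?exprn_ge0 // ler_sqr ?nnegrE // !mulr_ge0.
have S3b : `|\sum_(k < N) ker k| <= N%:R * (4 * A ^+ 3 * d * h ^+ 2 + 8 * A ^+ 3 * d ^+ 2 * h).
  exact: sum_const_le.
have -> : Fl l2 N (trl (s + h)) - Fl l1 N (scal (s + h) x) - (Fl l2 N (trl s) - Fl l1 N (scal s x))
  = (Fl l2 N (trl (s + h)) - Fl l2 N (trl s) - \sum_(k < N) om l2 (trl s k) (z2 k) (dl (trl s) k))
  - (Fl l1 N (scal (s + h) x) - Fl l1 N (scal s x) - \sum_(k < N) om l1 (scal s x k) (z1 k) (dl (scal s x) k))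
  + \sum_(k < N) ker k.
  have -> : \sum_(k < N) ker k = \sum_(k < N) om l2 (trl s k) (z2 k) (dl (trl s) k) - \sum_(k < N) om l1 (scal s x k) (z1 k) (dl (scal s x) k).
    by rewrite -sumrB.
  by set S1' := \sum_(k < N) _; set S2' := \sum_(k < N) _; ring.
apply: le_trans (ler_normD _ _) _.
apply: le_trans (lerD (le_trans (ler_normB _ _) (lerD S2b S1b)) S3b) _.
have -> : 24 * A ^+ 6 / N%:R * h = N%:R * (24 * A ^+ 4 * d ^+ 2 * h).
  by rewrite /d; field; rewrite gt_eqF.
have -> : N%:R * (100 * A ^+ 4 * (1 + d)) * h ^+ 2 = N%:R * (100 * A ^+ 4 * (1 + d) * h ^+ 2) by ring.
rewrite -!mulrDr ler_wpM2l //.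
have hh : h ^+ 3 <= 2 * h ^+ 2 by rewrite exprS ler_wpM2r ?exprn_ge0.
have A2 : A <= A ^+ 4 by rewrite -[leLHS]expr1; apply: ler_weXn2l.
have A3 : A ^+ 3 <= A ^+ 4 by apply: ler_weXn2l.
have q1 : 0 <= d * h ^+ 2 by rewrite mulr_ge0 // exprn_ge0.
have q2 : 0 <= d ^+ 2 * h by rewrite mulr_ge0 // exprn_ge0.
have q3 : 0 <= h ^+ 2 by rewrite exprn_ge0.
have w1 := ler_wpM2r q1 A2; have w2 := ler_wpM2r q2 A2; have w3 := ler_wpM2r q1 A3; have w4 := ler_wpM2r q2 A3.
have w5 : A ^+ 3 * h ^+ 3 <= A ^+ 4 * (2 * h ^+ 2) by rewrite ler_pM // ?exprn_ge0.
have w6 : 0 <= A ^+ 4 * (d * h ^+ 2) by rewrite mulr_ge0 // exprn_ge0.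
have w7 : 0 <= A ^+ 4 * h ^+ 2 by rewrite mulr_ge0 // exprn_ge0.
have w8 : 0 <= A ^+ 4 * (d ^+ 2 * h) by rewrite mulr_ge0 // exprn_ge0.
lra.
Qed.

(** At [s = 0] both polygons are constant and both sides vanish, so the increments from 0 determine
    the difference without a constant of integration. *)
Lemma Fl_trl s : s \in `[(0 : R), 2] ->
  `|Fl l2 N (trl s) - Fl l1 N (scal s x)| <= 48 * A ^+ 6 / N%:R.
Proof.
rewrite in_itv /= => /andP[s0 s2].
pose D s := Fl l2 N (trl s) - Fl l1 N (scal s x).
have D0 : D 0 = 0.
  have z1 k : dl (scal 0 x) k = 0 by rewrite dl_scal scale0r.
  have z2 k : dl (trl 0) k = 0 by rewrite /dl /trl /scal !scale0r subrr.
  by rewrite /D /Fl !big1 ?subrr // => k _; rewrite ?z1 ?z2 ?(lL0 ok1) ?(lL0 ok2).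
have a0 : 0 <= 24 * A ^+ 6 / N%:R by rewrite divr_ge0 ?mulr_ge0 ?exprn_ge0.
have b0 : 0 <= N%:R * (100 * A ^+ 4 * (1 + d)) by rewrite !mulr_ge0 ?exprn_ge0 // addr_ge0.
have := quadratic_increments a0 b0 s0 s2 (D := D) (fun t h t0 h0 th => Fl_trl_step t0 h0 th).
rewrite D0 subr0 => /le_trans; apply.
apply: le_trans (ler_wpM2l a0 s2) _.
by rewrite le_eqVlt; apply/orP; left; apply/eqP; field; rewrite gt_eqF.
Qed.

End Transition.

(** * Transfer of Nehari polygons to another chart *)

Section Compare.
Variables (R : realType) (n : nat).
Local Notation V := 'rV[R]_n.
Variables (U1 U2 K1 K2 W : set V) (C A : R) (l1 l2 : lag R n) (phi : V -> V) (dphi : V -> V -> V).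
Hypothesis ok1 : lag_ok U1 K1 C l1.
Hypothesis ok2 : lag_ok U2 K2 C l2.
Hypothesis tr : transition W K2 A l1 l2 phi dphi.
Hypothesis CA : C <= A.
Hypothesis WK1 : W `<=` K1.
Variables (N : nat) (x : nat -> V) (e T : R).
Hypothesis N0 : (0 < N)%N.
Hypothesis e0 : 0 < e.
Hypothesis rx : rayhyp K1 C l1 N e x T.
Hypothesis xW : forall s k, s \in `[(0 : R), 2] -> (k <= N)%N -> W (scal s x k).
Hypothesis xv : forall k, (k < N)%N -> N%:R * `|dl x k| <= A.
Variables (rho T1 T2 M : R) (O2 : set V).
Hypothesis rho0 : 0 < rho.
Hypothesis rhoC : C ^+ 2 * rho * (1 + T2) <= 1 / 100.
Hypothesis rhoM : 2 * C * T2 * M <= rho ^+ 2.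
Hypothesis T1C : T1 <= 1 / (20 * C ^+ 2).
Hypothesis TT2 : T <= T2 / 2.
Hypothesis kM : kin l1 N e x T <= M / 2.
Hypothesis phiO : O2 (phi (x 0%N)).
Hypothesis NE : 160 * A ^+ 8 / N%:R <= e / (500 * C ^+ 2).

Let ka := kin l1 N e x T.
Let E := 160 * A ^+ 8 / N%:R.
Let T0 : 0 < T := ray_T rx.
Let NR : 0 < N%:R :> R. Proof. by rewrite ltr0n. Qed.
Let C0 : 0 < C. Proof. exact: lt_le_trans ltr01 (lag_C1 ok1). Qed.
Let A0 : 0 < A. Proof. exact: lt_le_trans ltr01 (tr_A1 tr). Qed.
Let k0 : 0 < ka. Proof. exact: (kin_gt0 ok1 (ray_K1 rx) T0 e0). Qed.

Let E0 : 0 <= E.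
Proof. by rewrite divr_ge0 ?mulr_ge0 ?exprn_ge0 ?(ltW A0). Qed.

(** Since [T >= 1 / (5 C^2)], [kin] is at least [e T >= e / (5 C^2)]; the hypothesis [NE] asks for
    one hundredth of this. *)
Let Ek : E <= ka / 100.
Proof.
apply: le_trans NE _; rewrite ler_pdivlMr ?ltr0n //.
apply: le_trans (ray_eT ok1 rx).
apply: le_trans (ler_wpM2l (ltW e0) (ray_T1 ok1 e0 rx)).
by rewrite le_eqVlt; apply/orP; left; apply/eqP; field; rewrite gt_eqF.
Qed.

Let sI (s : R) : 1 / 4 <= s -> s <= 3 / 2 -> s \in `[(0 : R), 2].
Proof. by move=> ? ?; rewrite in_itv /=; apply/andP; split; lra. Qed.

Let err : R := C * per N x * sqn N x.

Let err0 : 0 <= err.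
Proof. exact: mulr_ge0 (mulr_ge0 (ltW C0) (per_ge0 N x)) (sqn_ge0 N x). Qed.

Let errk : err * (1 + T^-1) <= 2 / 100 * ka.
Proof.
apply: le_trans (err_le ok1 (ray_K1 rx) T0 e0) _.
rewrite ler_wpM2r ?(ltW k0) //; have := ray_small rx; lra.
Qed.

Lemma kin_scal_le s : 1 / 4 <= s -> s <= 3 / 2 ->
  `|kin l1 N e (scal s x) (s * T) - s * ka| <= s * ka / 100.
Proof.
move=> s14 s32; have s0 : 0 < s by lra.
have s02 := sI s14 s32.
pose D := En l1 N (scal s x) - s ^+ 2 * En l1 N x.
have Db : `|D| <= s ^+ 2 * err.
  rewrite /D /En mulrCA -mulrBr mulr_sumr -sumrB normrM (ger0_norm (x := N%:R)) //.
  rewrite /err /sqn.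
  have -> : s ^+ 2 * (C * per N x * (N%:R * (\sum_(k < N) `|dl x k| ^+ 2)))
    = N%:R * (\sum_(k < N) (s ^+ 2 * C * per N x) * `|dl x k| ^+ 2) by rewrite -mulr_sumr; ring.
  rewrite ler_wpM2l //.
  apply: (norm_sum_le (f := fun k => lB l1 (scal s x k) (dl (scal s x) k) (dl (scal s x) k) - s ^+ 2 * lB l1 (x k) (dl x k) (dl x k))
   (g := fun k => (s ^+ 2 * C * per N x) * `|dl x k| ^+ 2)) => k kN.
  rewrite dl_scal (lBZ ok1) -expr2 -mulrBr normrM (ger0_norm (x := s ^+ 2)) ?exprn_ge0 ?(ltW s0) //.
  rewrite -[leRHS]mulrA -[leRHS]mulrA ler_wpM2l ?exprn_ge0 ?(ltW s0) //.
  apply: le_trans (lB_lip ok1 _ _ (ray_K1 rx kN) (ray_K rx s02 kN)) _.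
  rewrite -!mulrA ler_wpM2l ?(ltW C0) // -expr2 ler_wpM2r ?exprn_ge0 //.
  have -> : scal s x k - x k = (s - 1) *: vv x k by rewrite -[in x k](scal1 x) scal_sub.
  rewrite normrZ (le_trans _ (vv_per _ (ltnW kN))) // ler_piMl // ler_norml.
  by apply/andP; split; lra.
have -> : kin l1 N e (scal s x) (s * T) - s * ka = D / (2 * (s * T)).
  by rewrite /kin /D /ka /kin; field; rewrite !gt_eqF.
have sT0 : 0 < 2 * (s * T) by rewrite !mulr_gt0.
rewrite normrM (ger0_norm (x := (2 * (s * T))^-1)) ?invr_ge0 ?(ltW sT0) //.
rewrite ler_pdivrMr //; apply: le_trans Db _.
have h : err * T^-1 <= 2 / 100 * ka.
  by apply: le_trans errk; apply: (ler_wpM2l err0); rewrite lerDr.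
have -> : s ^+ 2 * err = s ^+ 2 * T * (err * T^-1) by field; rewrite gt_eqF.
have -> : s * ka / 100 * (2 * (s * T)) = s ^+ 2 * T * (2 / 100 * ka) by field.
by rewrite ler_wpM2l // mulr_ge0 ?exprn_ge0 ?(ltW s0) ?(ltW T0).
Qed.

Lemma Fl_scal_le s : 1 / 4 <= s -> s <= 3 / 2 ->
  `|Fl l1 N (scal s x) - s ^+ 2 * flux l1 N x| <= s ^+ 3 * (2 / 100 * ka).
Proof.
move=> s14 s32; have s0 : 0 < s by lra.
have s02 := sI s14 s32.
have F1 : scal s x N = scal s x 0%N by rewrite /scal /vv (ray_loop rx).
have F2 : flux l1 N (scal s x) = s ^+ 2 * flux l1 N x.
  rewrite /flux mulr_sumr; apply: eq_bigr => k _.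
  rewrite scal0 dl_scal vv_scal (lL1Z ok1) (lL1Zw ok1); first by ring.
  exact: (lag_sub ok1) (ray_K1 rx N0).
rewrite -F2; apply: le_trans (Fl_le ok1 (fun k => ray_K rx s02 (k := k)) F1) _.
have -> : sqn N (scal s x) = s ^+ 2 * sqn N x.
  rewrite /sqn mulrCA; congr (_ * _); rewrite mulr_sumr; apply: eq_bigr => k _.
  by rewrite dl_scal normrZ exprMn gtr0_norm.
rewrite per_scal ?(ltW s0) //.
have -> : C * (s * per N x) * (s ^+ 2 * sqn N x) = s ^+ 3 * err by rewrite /err; ring.
rewrite ler_wpM2l ?exprn_ge0 ?(ltW s0) //; apply: le_trans errk.
by rewrite -[leLHS]mulr1; apply: (ler_wpM2l err0); rewrite lerDl invr_ge0 ltW.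
Qed.

(** The error [16 A^6 / N] of [En_trl] is divided by [2 s T >= 1 / (10 C^2)], and [C <= A]: hence
    the constant 160 and the exponent 8 in [E]. *)
Lemma kin_trl_le s : 1 / 4 <= s -> s <= 3 / 2 ->
  `|kin l2 N e (trl phi x s) (s * T) - kin l1 N e (scal s x) (s * T)| <= E.
Proof.
move=> s14 s32; have s0 : 0 < s by lra.
have s02 := sI s14 s32.
have h := En_trl ok1 ok2 tr CA N0 xW xv s02.
have sT0 : 0 < 2 * (s * T) by rewrite !mulr_gt0.
rewrite /kin opprD addrACA subrr addr0 -mulrBl normrM (ger0_norm (x := (2 * (s * T))^-1)) ?invr_ge0 ?(ltW sT0) //.
rewrite ler_pdivrMr //; apply: le_trans h _.
have TC := ray_T1 ok1 e0 rx.
have h1 : 1 / (10 * C ^+ 2) <= 2 * (s * T).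
  have -> : 1 / (10 * C ^+ 2) = 2 * (1 / 4 * (1 / (5 * C ^+ 2))) by field; rewrite gt_eqF.
  by rewrite ler_wpM2l // ler_pM // divr_ge0 // mulr_ge0 // exprn_ge0 // ltW.
apply: le_trans (ler_wpM2l E0 h1).
have h2 : 1 / (10 * A ^+ 2) <= 1 / (10 * C ^+ 2).
  rewrite ler_pM2l // lef_pV2 ?posrE ?mulr_gt0 ?exprn_gt0 //.
  by rewrite ler_wpM2l // ler_sqr ?nnegrE ?(ltW A0) ?(ltW C0).
apply: le_trans (ler_wpM2l E0 h2).
by rewrite /E le_eqVlt; apply/orP; left; apply/eqP; field; rewrite !gt_eqF.
Qed.

Lemma Fl_trl_le s : 1 / 4 <= s -> s <= 3 / 2 ->
  `|Fl l2 N (trl phi x s) - Fl l1 N (scal s x)| <= E.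
Proof.
move=> s14 s32.
apply: le_trans (Fl_trl ok1 ok2 tr CA WK1 N0 (ray_loop rx) xW xv (ray_per rx) (sI s14 s32)) _.
rewrite ler_wpM2r ?invr_ge0 // ler_pM ?exprn_ge0 ?ler_nat ?(ltW A0) //.
by apply: ler_weXn2l => //; exact: tr_A1 tr.
Qed.

Let M0 : 0 <= M.
Proof. by have := ltW (lt_le_trans k0 kM); rewrite pmulr_lge0. Qed.

Lemma kin_trl_M s : 1 / 4 <= s -> s <= 3 / 2 -> kin l2 N e (trl phi x s) (s * T) <= M.
Proof.
move=> s14 s32; have := kin_trl_le s14 s32; have := kin_scal_le s14 s32.
rewrite !ler_norml => /andP[_ h1] /andP[_ h2].
have h3 : s * ka <= 3 / 2 * ka by rewrite ler_wpM2r // ltW.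
have := Ek; have := k0; have : ka <= M / 2 by []; lra.
Qed.

Let yK s (s02 : s \in `[(0 : R), 2]) k : (k < N)%N -> K2 (trl phi x s k).
Proof. by move=> kN; apply: (tr_K tr); apply: xW => //; exact: ltnW. Qed.

Let sTT2 s : s <= 3 / 2 -> s * T <= T2.
Proof.
move=> s32; have := ler_wpM2r (ltW T0) s32; have := T0; have := TT2; lra.
Qed.

(** The Nehari function is expressed through [Fl] rather than [flux], because [Fl] is the quantity
    compared between the charts. *)
Lemma neh_trl_le s : 1 / 4 <= s -> s <= 3 / 2 ->
  `|neh l2 N e (trl phi x s) (s * T) -
    (kin l2 N e (trl phi x s) (s * T) - 2 * Fl l2 N (trl phi x s))|
  <= 8 / 100 * kin l2 N e (trl phi x s) (s * T).
Proof.
move=> s14 s32; have s0 : 0 < s by lra.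
have s02 := sI s14 s32; have sT0 : 0 < s * T by rewrite mulr_gt0.
have yN := trl_loop phi (ray_loop rx) s.
have [_ pe] := K_per ok2 e0 rho0 rhoM (yK s02) sT0 (sTT2 s32) (kin_trl_M s14 s32) M0.
have sm : small C N (trl phi x s) (s * T) <= 1 / 100.
  apply: le_trans rhoC; apply: ler_pM.
  - by rewrite mulr_ge0 ?exprn_ge0 ?per_ge0 ?(ltW C0).
  - by rewrite addr_ge0 // ltW.
  - by rewrite ler_wpM2l // exprn_ge0 ?(ltW C0).
  - by rewrite lerD2l sTT2.
have h1 := neh_kin ok2 (yK s02) yN sT0 e0.
have h2 := Fl_le ok2 (yK s02) yN.
have h3 := err_le1 ok2 (yK s02) sT0 e0.
have kp := kin_gt0 ok2 (yK s02) sT0 e0.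
have sk := ler_wpM2r (ltW kp) sm.
move: h1 h2; rewrite !ler_norml => /andP[? ?] /andP[? ?]; apply/andP; split; lra.
Qed.

Lemma neh_trl_continuous : {within `[1 / 4, 3 / 2], continuous (fun s : R => neh l2 N e (trl phi x s) (s * T))}.
Proof.
apply/subspace_continuousP => s /=; rewrite in_itv /= => /andP[s14 s32].
have s0 : 0 < s by lra.
apply: (neh_cvg ok2 (F := within `[1 / 4, 3 / 2]%classic (nbhs s)) _ (y := fun s => trl phi x s) (T := fun s => s * T)).
- move=> k kN; apply/cvgrPdist_le => ep ep0.
  have [d d0 dP] : exists2 d : R, 0 < d & A * d <= ep.
    exists (ep / A); first by rewrite divr_gt0.
    by rewrite mulrCA divff ?mulr1 // gt_eqF.
  near=> t.
  have [t14 t32] : 1 / 4 <= t /\ t <= 3 / 2.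
    have : t \in `[(1 / 4 : R), 3 / 2] by near: t; exact: withinT.
    by rewrite in_itv /= => /andP[].
  apply: le_trans (tr_lip tr (xW (sI t14 t32) kN) (xW (sI s14 s32) kN)) _.
  apply: le_trans dP; rewrite ler_pM2l // scal_sub normrZ.
  have h : `|s - t| <= d.
    near: t; apply: (@cvg_within _ (nbhs s)); apply/nbhs_ballP; exists d => //= t.
    by rewrite -ball_normE /= => /ltW.
  rewrite -[leRHS]mulr1; apply: ler_pM => //.
  exact: le_trans (vv_per _ kN) (ray_per rx).
- apply: cvgM; last exact: cvg_cst.
  exact: (@cvg_within _ (nbhs s)).
- move=> k kN; apply: (lag_sub ok2); exact: yK (sI s14 s32) _ kN.
- by rewrite gt_eqF // mulr_gt0.
Unshelve. all: by end_near.
Qed.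

(** The image of a Nehari polygon is only nearly on the Nehari set of the other chart, but its
    Nehari function changes sign along [trl s]. At a zero the action differs by at most [2 E] from
    that of [scal s x], which is at most that of [x] by maximality on the ray. The slack in
    [T <= T2 / 2] and [kin <= M / 2] absorbs the factor [s]. *)
Lemma compare : exists s : R, adm K2 l2 N e T1 T2 M O2 (trl phi x s) (s * T) /\
  act l2 N e (trl phi x s) (s * T) <= act l1 N e x T + 320 * A ^+ 8 / N%:R.
Proof.
pose G (s : R) := neh l2 N e (trl phi x s) (s * T).
have I1 : 1 / 4 <= (1 / 4 : R) /\ (1 / 4 : R) <= 3 / 2 by split; lra.
have I2 : 1 / 4 <= (3 / 2 : R) /\ (3 / 2 : R) <= 3 / 2 by split; lra.
have /andP[f1 f2] := ray_flux ok1 e0 rx.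
(* At [s = 1/4] the kinetic term is about [ka / 4] and twice the flux about [ka / 16]. *)
have G1 : 0 <= G (1 / 4).
  have := neh_trl_le I1.1 I1.2; have := kin_trl_le I1.1 I1.2; have := Fl_trl_le I1.1 I1.2.
  have := kin_scal_le I1.1 I1.2; have := Fl_scal_le I1.1 I1.2; rewrite -/(G _).
  have -> : (1 / 4 : R) ^+ 3 = 1 / 64 by field.
  have -> : (1 / 4 : R) ^+ 2 = 1 / 16 by field.
  move: f1 f2 (Ek) (k0); rewrite -/ka !ler_norml.
  move: ka E (G _) (kin l2 _ _ _ _) (kin l1 _ _ _ _) (Fl l2 _ _) (Fl l1 _ _) (flux _ _ _).
  move=> a b c d f g h i f1 f2 Ek' k0' /andP[? ?] /andP[? ?] /andP[? ?] /andP[? ?] /andP[? ?].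
  lra.
(* At [s = 3/2] the kinetic term is about [3/2 ka] and twice the flux about [9/4 ka]. *)
have G2 : G (3 / 2) <= 0.
  have := neh_trl_le I2.1 I2.2; have := kin_trl_le I2.1 I2.2; have := Fl_trl_le I2.1 I2.2.
  have := kin_scal_le I2.1 I2.2; have := Fl_scal_le I2.1 I2.2; rewrite -/(G _).
  have -> : (3 / 2 : R) ^+ 3 = 27 / 8 by field.
  have -> : (3 / 2 : R) ^+ 2 = 9 / 4 by field.
  move: f1 f2 (Ek) (k0); rewrite -/ka !ler_norml.
  move: ka E (G _) (kin l2 _ _ _ _) (kin l1 _ _ _ _) (Fl l2 _ _) (Fl l1 _ _) (flux _ _ _).
  move=> a b c d f g h i f1 f2 Ek' k0' /andP[? ?] /andP[? ?] /andP[? ?] /andP[? ?] /andP[? ?].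
  lra.
have [|s] := IVT I1.2 neh_trl_continuous (v := 0).
  by apply/andP; split; rewrite ?ge_min ?le_max; apply/orP; [right|left].
rewrite in_itv /= => /andP[s14 s32] Gs; have s0 : 0 < s by lra.
exists s; split.
  split.
  - exact: (trl_loop phi (ray_loop rx) s).
  - exact: (yK (sI s14 s32)).
  - by rewrite /trl scal0.
  - apply: le_trans T1C _.
    have -> : 1 / (20 * C ^+ 2) = 1 / 4 * (1 / (5 * C ^+ 2)) by field; rewrite gt_eqF.
    apply: ler_pM => //; last exact: (ray_T1 ok1 e0 rx).
    by rewrite divr_ge0 // mulr_ge0 // exprn_ge0 // ltW.
  - exact: sTT2.
  - exact: kin_trl_M.
  - exact: Gs.
have s2 : s <= 2 by lra.
have := ray_max ok1 (ray_K rx) (ray_loop rx) T0 e0 (ray_small rx) (ray_per rx) (ray_neh rx) s0 s2.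
have := kin_trl_le s14 s32; have := Fl_trl_le s14 s32; rewrite !ler_norml => /andP[? ?] /andP[? ?].
have -> : 320 * A ^+ 8 / N%:R = 2 * E by rewrite /E; ring.
rewrite /act; lra.
Qed.

End Compare.

(** * The continuum limit *)

Section DiscreteSolution.
Variables (R : realType) (n : nat).
Local Notation V := 'rV[R]_n.
Variables (U K : set V) (C : R) (l : lag R n).
Hypothesis ok : lag_ok U K C l.
Variable A : R.
Hypothesis CA : C <= A.

Definition vel (N : nat) (x : nat -> V) (T : R) (k : nat) : V := (N%:R / T) *: dl x k.

(** The discrete equations hold exactly except at the vertex 0, where the penalty leaves a defect of
    size [ep]. All bounds are independent of [N], as the limit requires. *)
Record dsol (e : R) (N : nat) (x : nat -> V) (T ep : R) : Prop := DSol {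
  ds_N : (0 < N)%N;
  ds_loop : x N = x 0%N;
  ds_K : forall k, (k < N)%N -> K (x k);
  ds_T0 : 0 < T;
  ds_TA : T <= A;
  ds_vel : forall k, (k < N)%N -> `|vel N x T k| <= A;
  ds_EL : forall k w, (0 < k < N)%N -> mom l N x T k w - mom l N x T (prv N k) w = force l N x T k w;
  ds_ep : 0 <= ep;
  ds_EL0 : forall w, `|mom l N x T 0 w - mom l N x T (prv N 0) w - force l N x T 0 w| <= ep * `|w|;
  ds_en : En l N x = 2 * e * T ^+ 2 }.

(* The right-hand side of the Euler-Lagrange equation. *)
Definition elf (y v w : V) : R := lB1 l y w v v / 2 + om l y v w.

Let C1 : 1 <= C := lag_C1 ok.
Let C0 : 0 <= C. Proof. exact: le_trans ler01 C1. Qed.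
Let A1 : 1 <= A. Proof. exact: le_trans C1 CA. Qed.
Let A0 : 0 <= A. Proof. exact: le_trans ler01 A1. Qed.

Lemma lB1_diff y y' w u v D : K y -> K y' -> `|u| <= A -> `|v| <= A ->
  `|y' - y| <= D -> `|u - v| <= D ->
  `|lB1 l y' w u u - lB1 l y w v v| <= 3 * A ^+ 3 * D * `|w|.
Proof.
move=> Ky Ky' uA vA yD uD; have D0 : 0 <= D := le_trans (normr_ge0 _) yD.
have E : lB1 l y w u u - lB1 l y w v v = lB1 l y w (u - v) u + lB1 l y w (u - v) v.
  have Dl p q z : lB1 l y w (p - q) z = lB1 l y w p z - lB1 l y w q z.
    by rewrite addrC -scaleN1r (lB1_lin ok) mulN1r addrC.
  by rewrite !Dl (lB1_sym ok _ _ u v); ring.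
have -> : lB1 l y' w u u - lB1 l y w v v = (lB1 l y' w u u - lB1 l y w u u) + (lB1 l y w (u - v) u + lB1 l y w (u - v) v).
  by rewrite -E; ring.
apply: le_trans (ler_normD _ _) _.
have h1 : `|lB1 l y' w u u - lB1 l y w u u| <= A ^+ 3 * D * `|w|.
  apply: le_trans (lB1_lip ok _ _ _ Ky Ky') _.
  have -> : A ^+ 3 * D * `|w| = A * D * `|w| * A * A by ring.
  by rewrite !ler_pM ?mulr_ge0.
have h2 z : `|z| <= A -> `|lB1 l y w (u - v) z| <= A ^+ 3 * D * `|w|.
  move=> zA; apply: le_trans (lB1_bd ok _ _ _ Ky) _.
  have -> : A ^+ 3 * D * `|w| = A * (A * `|w|) * D * A by ring.
  by rewrite !ler_pM ?mulr_ge0 // ler_peMl.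
apply: le_trans (lerD h1 (le_trans (ler_normD _ _) (lerD (h2 _ uA) (h2 _ vA)))) _.
by rewrite le_eqVlt; apply/orP; left; apply/eqP; ring.
Qed.

Section One.
Variables (e : R) (N : nat) (x : nat -> V) (T ep : R).
Hypothesis ds : dsol e N x T ep.

Let N0 : (0 < N)%N := ds_N ds.
Let NR : 0 < N%:R :> R. Proof. by rewrite ltr0n. Qed.
Let T0 : 0 < T := ds_T0 ds.

(** Integer indices unroll the polygon periodically, so that a window of consecutive vertices may
    run across the vertex 0. *)
Definition ix (k : int) : nat := `|(k %% N)%Z|%N.

Let Nz : (N : int) != 0. Proof. by rewrite -lt0n. Qed.

Lemma ix_lt k : (ix k < N)%N.
Proof.
rewrite -ltz_nat /ix gez0_abs ?modz_ge0 //.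
by rewrite ltz_pmod // ltz_nat.
Qed.

Lemma ixE k : (ix k)%:Z = (k %% N)%Z.
Proof. by rewrite /ix gez0_abs ?modz_ge0. Qed.

Lemma ixS k : ix (k + 1) = (if (ix k).+1 == N then 0 else (ix k).+1)%N /\
  (((k + 1) %/ N)%Z - (k %/ N)%Z = ((ix k).+1 == N)%:Z).
Proof.
have E : k = (k %/ N)%Z * N + (ix k)%:Z by rewrite ixE -divz_eq.
have lt := ix_lt k.
set q := (k %/ N)%Z in E *; set a := ix k in E lt *.
have E1 : k + 1 = q * N + a.+1%:Z by rewrite E -addrA -addn1 PoszD.
split.
  apply/eqP; rewrite -eqz_nat ixE E1 modzMDl modz_nat; apply/eqP; congr Posz.
  case: eqP => [->|/eqP ne]; first by rewrite modnn.
  by rewrite modn_small // ltn_neqAle ne.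
rewrite E1 divzMDl // divz_nat addrAC subrr add0r; congr Posz.
case: eqP => [->|/eqP ne]; first by rewrite divnn N0.
by rewrite divn_small // ltn_neqAle ne.
Qed.

Lemma prv_ixS k : prv N (ix (k + 1)) = ix k.
Proof.
have [-> _] := ixS k; have lt := ix_lt k; rewrite /prv.
case: eqP => [E|_].
  by rewrite add0n modn_small ?prednK // -E.
by rewrite addSnnS prednK // modnDr modn_small.
Qed.

Let X k := x (ix k).
Let W k := vel N x T (ix k).

Let XK k : K (X k). Proof. exact: (ds_K ds (ix_lt k)). Qed.
Let WA k : `|W k| <= A. Proof. exact: (ds_vel ds (ix_lt k)). Qed.

Lemma dX k : X (k + 1) - X k = (T / N%:R) *: W k.
Proof.
have -> : (T / N%:R) *: W k = dl x (ix k).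
  rewrite /W /vel scalerA; have -> : T / N%:R * (N%:R / T) = 1; last by rewrite scale1r.
  by field; rewrite !gt_eqF.
rewrite /X /dl; have [-> _] := ixS k.
by case: eqP => // ->; rewrite (ds_loop ds).
Qed.

Lemma dX_le k : `|X (k + 1) - X k| <= A ^+ 2 / N%:R.
Proof.
rewrite dX normrZ ger0_norm ?divr_ge0 ?(ltW T0) // mulrAC ler_wpM2r ?invr_ge0 //.
by rewrite expr2; apply: ler_pM => //; [exact: ltW | exact: ds_TA ds].
Qed.

Lemma momE k w : mom l N x T k w = lB l (x k) (vel N x T k) w.
Proof. by rewrite /mom /vel -[w in RHS]scale1r (lBZ ok) mulr1 mulrAC. Qed.

(** It is 1 if the step from [k] to [k + 1] arrives at the vertex 0, and 0 otherwise; it marks the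
    steps affected by the defect [ep]. *)
Definition wrap (k : int) : R := (((k + 1) %/ N)%Z - (k %/ N)%Z)%:~R.

Lemma wrap_ge0 k : 0 <= wrap k.
Proof. by rewrite /wrap (ixS k).2; case: eqP. Qed.

Lemma EL_step k w :
  `|lB l (X (k + 1)) (W (k + 1)) w - lB l (X k) (W k) w - force l N x T (ix (k + 1)) w|
  <= ep * wrap k * `|w|.
Proof.
rewrite /W /X -!momE /wrap; have [ixe ->] := ixS k.
have -> : mom l N x T (ix k) w = mom l N x T (prv N (ix (k + 1))) w by rewrite prv_ixS.
have ltS := ix_lt (k + 1).
move: ixe ltS; case: eqP => [_ -> _|_ E lt].
  by rewrite mulr1; exact: ds_EL0 ds w.
rewrite (ds_EL ds) ?subrr ?normr0 ?mulr0 ?mul0r // lt andbT.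
by rewrite E.
Qed.

Lemma forceE k w : force l N x T (ix (k + 1)) w =
  T / N%:R * (lB1 l (X (k + 1)) w (W (k + 1)) (W (k + 1)) / 2 - lL1 l (X (k + 1)) w (W (k + 1)))
  + (lL l (X (k + 1)) w - lL l (X k) w).
Proof.
rewrite /force prv_ixS; congr (_ + _).
have dlE : dl x (ix (k + 1)) = (T / N%:R) *: W (k + 1).
  rewrite /W /vel scalerA; have -> : T / N%:R * (N%:R / T) = 1; last by rewrite scale1r.
  by field; rewrite !gt_eqF.
rewrite dlE (lB1Z ok) (lL1Z ok) -/(X (k + 1)).
by field; rewrite !gt_eqF.
Qed.

(** An edge lasts the time [T / N], so the discrete force is [T / N] times the continuous one,
    evaluated at a reference state [y], [v]; [D] measures the distance to that state. *)
Lemma force_elf k w y v D : K y -> `|v| <= A ->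
  `|X k - y| <= D -> `|X (k + 1) - y| <= D -> `|W k - v| <= D -> `|W (k + 1) - v| <= D ->
  `|force l N x T (ix (k + 1)) w - T / N%:R * elf y v w| <= (8 * A ^+ 4 * D / N%:R + A ^+ 5 / N%:R ^+ 2) * `|w|.
Proof.
move=> Ky vA h1 h2 h3 h4; have D0 := le_trans (normr_ge0 _) h1.
rewrite forceE.
have t1 := lL_tay ok w (XK k) (XK (k + 1)).
rewrite dX (lL1Zw ok _ _ _ (lag_sub ok (XK k))) in t1.
have t2 : C * `|(T / N%:R) *: W k| ^+ 2 * `|w| <= A ^+ 5 / N%:R ^+ 2 * `|w|.
  rewrite ler_wpM2r //.
  have -> : A ^+ 5 / N%:R ^+ 2 = A * (A ^+ 2 / N%:R) ^+ 2 by field; rewrite gt_eqF.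
  rewrite -dX; apply: ler_pM; rewrite ?exprn_ge0 // ler_sqr ?nnegrE ?dX_le //.
  by rewrite divr_ge0 ?exprn_ge0.
have wk := WA k; have wk1 := WA (k + 1).
have b1 := lB1_diff w Ky (XK (k + 1)) (WA (k + 1)) vA h2 h4.
have w0 := normr_ge0 w.
have b2 : `|lL1 l (X (k + 1)) w (W (k + 1)) - lL1 l y w v| <= 2 * A ^+ 2 * D * `|w|.
  have -> : lL1 l (X (k + 1)) w (W (k + 1)) - lL1 l y w v =
    (lL1 l (X (k + 1)) w (W (k + 1)) - lL1 l y w (W (k + 1))) + lL1 l y w (W (k + 1) - v).
    have -> : lL1 l y w (W (k + 1) - v) = lL1 l y w (W (k + 1)) - lL1 l y w v.
      by rewrite addrC -scaleN1r (lL1_lin ok) mulN1r addrC.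
    ring.
  apply: le_trans (ler_normD _ _) _.
  have -> : 2 * A ^+ 2 * D * `|w| = A * D * `|w| * A + A * (A * `|w|) * D by ring.
  apply: lerD.
    apply: le_trans (lL1_lip ok _ _ Ky (XK (k + 1))) _.
    by rewrite !ler_pM ?mulr_ge0.
  apply: le_trans (lL1_bd ok _ _ Ky) _.
  by rewrite !ler_pM ?mulr_ge0 // ler_peMl.
have b3 : `|lL1 l (X k) (W k) w - lL1 l y v w| <= 2 * A ^+ 2 * D * `|w|.
  have -> : lL1 l (X k) (W k) w - lL1 l y v w =
    (lL1 l (X k) (W k) w - lL1 l y (W k) w) + lL1 l y (W k - v) w.
    have -> : lL1 l y (W k - v) w = lL1 l y (W k) w - lL1 l y v w.
      by rewrite addrC -scaleN1r (lL1_linw ok) ?mulN1r 1?addrC //; exact: (lag_sub ok).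
    ring.
  apply: le_trans (ler_normD _ _) _.
  have -> : 2 * A ^+ 2 * D * `|w| = A * D * A * `|w| + A * (A * D) * `|w| by ring.
  apply: lerD.
    apply: le_trans (lL1_lip ok _ _ Ky (XK k)) _.
    by rewrite !ler_pM ?mulr_ge0.
  apply: le_trans (lL1_bd ok _ _ Ky) _.
  by rewrite !ler_pM ?mulr_ge0 // (le_trans h3) // ler_peMl.
set t := T / N%:R in t1 *.
have t0 : 0 <= t by rewrite divr_ge0 // ltW.
have tA : t <= A / N%:R by rewrite ler_wpM2r ?invr_ge0 // (ds_TA ds).
rewrite /elf /om.
set a1 := lB1 l (X (k + 1)) _ _ _ in b1 *; set a2 := lL1 l (X (k + 1)) _ _ in b2 *.
set a3 := lL1 l (X k) _ _ in b3 t1; set a4 := lB1 l y _ _ _ in b1 *.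
set a5 := lL1 l y w v in b2 *; set a6 := lL1 l y v w in b3 *.
have -> : t * (a1 / 2 - a2) + (lL l (X (k + 1)) w - lL l (X k) w) - t * (a4 / 2 + (a6 - a5))
  = t * ((a1 - a4) / 2 - (a2 - a5) + (a3 - a6)) + (lL l (X (k + 1)) w - lL l (X k) w - t * a3).
  by ring.
apply: le_trans (ler_normD _ _) _; rewrite [leRHS]mulrDl; apply: lerD; last exact: le_trans t1 t2.
rewrite normrM ger0_norm //.
have -> : 8 * A ^+ 4 * D / N%:R * `|w| = A / N%:R * (8 * A ^+ 3 * D * `|w|) by ring.
apply: ler_pM => //.
have A23 : A ^+ 2 <= A ^+ 3 by apply: ler_weXn2l.
have Dw : 0 <= D * `|w| by rewrite mulr_ge0.
have := ler_wpM2r Dw A23.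
have : 0 <= A ^+ 3 * (D * `|w|) by rewrite mulr_ge0 // exprn_ge0.
move: b1 b2 b3; rewrite !ler_norml.
move=> /andP[? ?] /andP[? ?] /andP[? ?] ? ?; apply/andP; split; lra.
Qed.

Lemma force_bd k w : `|force l N x T (ix (k + 1)) w| <= 3 * A ^+ 4 / N%:R * `|w|.
Proof.
have w0 := normr_ge0 w; have wk1 := WA (k + 1).
rewrite forceE; apply: le_trans (ler_normD _ _) _.
have h1 : `|lL l (X (k + 1)) w - lL l (X k) w| <= A ^+ 3 / N%:R * `|w|.
  apply: le_trans (lL_lip ok _ (XK k) (XK (k + 1))) _.
  rewrite ler_wpM2r // exprS -mulrA; apply: ler_pM => //; exact: dX_le.
have h2 : `|lB1 l (X (k + 1)) w (W (k + 1)) (W (k + 1))| <= A ^+ 3 * `|w|.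
  apply: le_trans (lB1_bd ok _ _ _ (XK (k + 1))) _.
  have -> : A ^+ 3 * `|w| = A * `|w| * A * A by ring.
  by rewrite !ler_pM ?mulr_ge0.
have h3 : `|lL1 l (X (k + 1)) w (W (k + 1))| <= A ^+ 2 * `|w|.
  apply: le_trans (lL1_bd ok _ _ (XK (k + 1))) _.
  have -> : A ^+ 2 * `|w| = A * `|w| * A by ring.
  by rewrite !ler_pM ?mulr_ge0.
have A23 : A ^+ 2 <= A ^+ 3 by apply: ler_weXn2l.
have A34 : A ^+ 3 <= A ^+ 4 by apply: ler_weXn2l.
set t := T / N%:R.
have t0 : 0 <= t by rewrite divr_ge0 // ltW.
have tA : t <= A / N%:R by rewrite ler_wpM2r ?invr_ge0 // (ds_TA ds).
rewrite normrM (ger0_norm t0).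
have -> : 3 * A ^+ 4 / N%:R * `|w| = A / N%:R * (2 * A ^+ 3 * `|w|) + A ^+ 4 / N%:R * `|w| by ring.
apply: lerD; last by apply: le_trans h1 _; rewrite ler_wpM2r // ler_wpM2r ?invr_ge0.
apply: ler_pM => //.
have := ler_wpM2r w0 A23; have : 0 <= A ^+ 3 * `|w| by rewrite mulr_ge0 // exprn_ge0.
move: h2 h3; rewrite !ler_norml => /andP[? ?] /andP[? ?] ? ?; apply/andP; split; lra.
Qed.

(** Ellipticity at the new vertex turns the increment of the momentum into an increment of the
    velocity; changing the point at which the metric is taken costs [O(1/N)]. *)
Lemma dW_le k : `|W (k + 1) - W k| <= 4 * A ^+ 5 / N%:R + A * ep * wrap k.
Proof.
set d := W (k + 1) - W k.
have [->|d0] := eqVneq d 0.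
  rewrite normr0 addr_ge0 ?mulr_ge0 ?invr_ge0 ?exprn_ge0 ?wrap_ge0 //; exact: ds_ep ds.
have dp : 0 < `|d| by rewrite normr_gt0.
rewrite -(ler_pM2r dp) -expr2.
have lBl y p q z : lB l y (p - q) z = lB l y p z - lB l y q z.
  by rewrite addrC -scaleN1r (lB_lin ok) mulN1r addrC.
have el := lB_ell ok d (XK (k + 1)).
have E : lB l (X (k + 1)) d d = (lB l (X (k + 1)) (W (k + 1)) d - lB l (X k) (W k) d)
    - (lB l (X (k + 1)) (W k) d - lB l (X k) (W k) d).
  by rewrite {1}/d lBl; ring.
have h1 := EL_step k d; have h2 := force_bd k d.
have h3 : `|lB l (X (k + 1)) (W k) d - lB l (X k) (W k) d| <= A ^+ 4 / N%:R * `|d|.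
  apply: le_trans (lB_lip ok _ _ (XK k) (XK (k + 1))) _.
  have -> : A ^+ 4 / N%:R * `|d| = A * (A ^+ 2 / N%:R) * A * `|d| by ring.
  by have wk := WA k; have dk := dX_le k; rewrite !ler_pM ?mulr_ge0.
have h4 : lB l (X (k + 1)) d d <= (4 * A ^+ 4 / N%:R + ep * wrap k) * `|d|.
  by move: h1 h2 h3; rewrite E !ler_norml => /andP[? ?] /andP[? ?] /andP[? ?]; lra.
apply: le_trans el _; apply: le_trans (ler_wpM2l C0 h4) _.
have -> : (4 * A ^+ 5 / N%:R + A * ep * wrap k) * `|d| = A * ((4 * A ^+ 4 / N%:R + ep * wrap k) * `|d|) by ring.
rewrite ler_wpM2r // mulr_ge0 // addr_ge0 ?mulr_ge0 ?invr_ge0 ?exprn_ge0 ?wrap_ge0 //.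
exact: ds_ep ds.
Qed.

(** A window of at most [N] steps meets the vertex 0 a bounded number of times, so the defect
    contributes [O(ep)] to it, whatever its length. *)
Lemma wrap_sum (k : int) (m : nat) : (m <= N)%N -> \sum_(j < m) wrap (k + j%:Z) <= 2.
Proof.
move=> mN; have -> : \sum_(j < m) wrap (k + j%:Z) = (((k + m%:Z) %/ N)%Z - (k %/ N)%Z)%:~R.
  elim: m {mN} => [|m IH]; first by rewrite big_ord0 addr0 subrr.
  rewrite big_ord_recr /= IH /wrap -intrD; congr (_%:~R).
  have -> : k + m.+1%:Z = k + m%:Z + 1 by rewrite -addn1 PoszD addrA.
  by ring.
rewrite (_ : 2 = (2 : int)%:~R) // ler_int.
have h : ((k + m%:Z) %/ N)%Z <= ((k + N%:Z) %/ N)%Z.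
  by apply: lez_pdiv2r => //; rewrite lerD2l lez_nat.
have NN : ((k + N%:Z) %/ N)%Z = (k %/ N)%Z + 1 by rewrite addrC -{1}[N%:Z]mul1r divzMDl // addrC.
rewrite NN in h.
by rewrite lerBlDl (le_trans h) // lerD2l.
Qed.

Lemma chain_le (W' : normedModType R) (f : int -> W') (a b : R) (k : int) (m : nat) :
  0 <= a -> 0 <= b -> (m <= N)%N ->
  (forall j, (j < m)%N -> `|f (k + j%:Z + 1) - f (k + j%:Z)| <= a + b * wrap (k + j%:Z)) ->
  `|f (k + m%:Z) - f k| <= m%:R * a + 2 * b.
Proof.
move=> a0 b0 mN H.
have : `|f (k + m%:Z) - f k| <= \sum_(j < m) (a + b * wrap (k + j%:Z)).
  elim: m {mN} H => [|m IH] H; first by rewrite big_ord0 addr0 subrr normr0.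
  have -> : f (k + m.+1%:Z) - f k = (f (k + m%:Z) - f k) + (f (k + m%:Z + 1) - f (k + m%:Z)).
    have -> : k + m.+1%:Z = k + m%:Z + 1 by rewrite -addn1 PoszD addrA.
    by rewrite [RHS]addrC addrA subrK.
  rewrite big_ord_recr /=; apply: le_trans (ler_normD _ _) _; apply: lerD; last exact: H.
  by apply: IH => j jm; apply: H; exact: leqW.
move=> /le_trans; apply; rewrite big_split /= sumr_const card_ord -[a *+ m]mulr_natl lerD2l.
by rewrite -mulr_sumr mulrC ler_wpM2r // wrap_sum.
Qed.

Let h k := lB l (X k) (W k) (W k).

(* The energy is conserved up to second order: its increment is
   [(P' - P)(W + W') - (B' - B)(W, W')], and both terms equal
   [T / N * lB1 (X; W, W, W)] to first order. *)
Lemma energy_step k : (ix k).+1 != N -> `|h (k + 1) - h k| <= 100 * A ^+ 10 / N%:R ^+ 2.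
Proof.
move=> ne; have wr : wrap k = 0 by rewrite /wrap (ixS k).2 (negbTE ne).
have dW := dW_le k; rewrite wr mulr0 addr0 in dW.
have EL w : lB l (X (k + 1)) (W (k + 1)) w - lB l (X k) (W k) w = force l N x T (ix (k + 1)) w.
  have := EL_step k w; rewrite wr mulr0 mul0r normr_le0 subr_eq0 => /eqP; exact.
have wk := WA k; have wk1 := WA (k + 1).
set D := 4 * A ^+ 5 / N%:R in dW.
have D0 : 0 <= D by rewrite divr_ge0 ?mulr_ge0 ?exprn_ge0.
have dXD : `|X (k + 1) - X k| <= D.
  apply: le_trans (dX_le k) _; rewrite ler_wpM2r ?invr_ge0 //.
  have : A ^+ 2 <= A ^+ 5 by apply: ler_weXn2l.
  have : 0 <= A ^+ 5 by rewrite exprn_ge0.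
  lra.
have dW' := dW; set w := W (k + 1) - W k in dW'; set t := T / N%:R.
have t0 : 0 <= t by rewrite divr_ge0 // ltW.
have tA : t <= A / N%:R by rewrite ler_wpM2r ?invr_ge0 // (ds_TA ds).
have lBDr y u p q : lB l y u (p + q) = lB l y u p + lB l y u q.
  by rewrite (lB_sym ok) -[p]scale1r (lB_lin ok) mul1r scale1r (lB_sym ok) [lB l y q u](lB_sym ok).
have W1 : W (k + 1) = W k + w by rewrite /w [RHS]addrC subrK.
clearbody w.
have fo : `|force l N x T (ix (k + 1)) (W k + W (k + 1)) - t * elf (X k) (W k) (W k + W (k + 1))|
   <= 66 * A ^+ 10 / N%:R ^+ 2.
  have := force_elf (W k + W (k + 1)) (XK k) wk _ dXD _ dW.
  rewrite !subrr !normr0 => /(_ D0 D0) /le_trans; apply.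
  have -> : 66 * A ^+ 10 / N%:R ^+ 2 = (33 * A ^+ 9 / N%:R ^+ 2) * (2 * A) by ring.
  apply: ler_pM => //.
  - by rewrite addr_ge0 ?divr_ge0 ?mulr_ge0 ?exprn_ge0.
  - have -> : 33 * A ^+ 9 / N%:R ^+ 2 = 8 * A ^+ 4 * D / N%:R + A ^+ 9 / N%:R ^+ 2.
      by rewrite /D; field; rewrite gt_eqF.
    rewrite lerD2l ler_wpM2r ?invr_ge0 ?exprn_ge0 //; exact: ler_weXn2l.
  - by apply: le_trans (ler_normD _ _) _; lra.
have el : `|t * elf (X k) (W k) (W k + W (k + 1)) - t * lB1 l (X k) (W k) (W k) (W k)| <= 12 * A ^+ 10 / N%:R ^+ 2.
  have Uk := lag_sub ok (XK k).
  have -> : W k + W (k + 1) = 2 *: W k + w.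
    by rewrite W1 (_ : 2 = 1 + 1 :> R) // scalerDl scale1r addrA.
  have -> : t * elf (X k) (W k) (2 *: W k + w) - t * lB1 l (X k) (W k) (W k) (W k)
     = t * (lB1 l (X k) w (W k) (W k) / 2 + om l (X k) (W k) w).
    rewrite /elf /om (lB1_linw ok) // (lL1_lin ok) (lL1_linw ok) //; by field.
  have b1 : `|lB1 l (X k) w (W k) (W k)| <= A ^+ 3 * D.
    apply: le_trans (lB1_bd ok _ _ _ (XK k)) _.
    have -> : A ^+ 3 * D = A * D * A * A by ring.
    by rewrite !ler_pM ?mulr_ge0.
  have b2 : `|lL1 l (X k) (W k) w| <= A ^+ 2 * D.
    apply: le_trans (lL1_bd ok _ _ (XK k)) _.
    have -> : A ^+ 2 * D = A * A * D by ring.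
    by rewrite !ler_pM ?mulr_ge0.
  have b3 : `|lL1 l (X k) w (W k)| <= A ^+ 2 * D.
    apply: le_trans (lL1_bd ok _ _ (XK k)) _.
    have -> : A ^+ 2 * D = A * D * A by ring.
    by rewrite !ler_pM ?mulr_ge0.
  have -> : 12 * A ^+ 10 / N%:R ^+ 2 = A / N%:R * (3 * A ^+ 4 * D).
    by rewrite /D; field; rewrite gt_eqF.
  rewrite normrM ger0_norm //; apply: ler_pM => //.
  have m1 : A ^+ 3 * D <= A ^+ 4 * D by rewrite ler_wpM2r //; exact: ler_weXn2l.
  have m2 : A ^+ 2 * D <= A ^+ 4 * D by rewrite ler_wpM2r //; exact: ler_weXn2l.
  rewrite /om; move: b1 b2 b3; rewrite !ler_norml => /andP[? ?] /andP[? ?] /andP[? ?].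
  by apply/andP; split; lra.
have q1 : `|lB l (X (k + 1)) (W k) w - lB l (X k) (W k) w| <= 4 * A ^+ 10 / N%:R ^+ 2.
  apply: le_trans (lB_lip ok _ _ (XK k) (XK (k + 1))) _.
  have dXk := dX_le k.
  apply: (@le_trans _ _ (A * (A ^+ 2 / N%:R) * A * D)); first by rewrite !ler_pM ?mulr_ge0.
  have -> : A * (A ^+ 2 / N%:R) * A * D = 4 * A ^+ 9 / N%:R ^+ 2.
    by rewrite /D; field; rewrite gt_eqF.
  rewrite ler_wpM2r ?invr_ge0 ?exprn_ge0 // ler_wpM2l //; exact: ler_weXn2l.
have q2 : `|lB l (X (k + 1)) (W k) (W k) - lB l (X k) (W k) (W k) - t * lB1 l (X k) (W k) (W k) (W k)|
   <= A ^+ 10 / N%:R ^+ 2.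
  have := lB_tay ok (W k) (W k) (XK k) (XK (k + 1)).
  rewrite dX (lB1Zw ok _ _ _ _ (lag_sub ok (XK k))) => /le_trans; apply.
  rewrite -dX; have dXk := dX_le k.
  have dX2 : `|X (k + 1) - X k| ^+ 2 <= (A ^+ 2 / N%:R) ^+ 2.
    by rewrite ler_sqr ?nnegrE // divr_ge0 ?exprn_ge0.
  apply: (@le_trans _ _ (A * (A ^+ 2 / N%:R) ^+ 2 * A * A)).
    by rewrite !ler_pM ?mulr_ge0 ?exprn_ge0.
  have -> : A * (A ^+ 2 / N%:R) ^+ 2 * A * A = A ^+ 7 / N%:R ^+ 2 by field; rewrite gt_eqF.
  rewrite ler_wpM2r ?invr_ge0 ?exprn_ge0 //; exact: ler_weXn2l.
have E : h (k + 1) - h k = force l N x T (ix (k + 1)) (W k + W (k + 1))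
   - (lB l (X (k + 1)) (W k) (W k) - lB l (X k) (W k) (W k))
   - (lB l (X (k + 1)) (W k) w - lB l (X k) (W k) w).
  by rewrite -EL /h !W1 !lBDr [lB _ _ (W k + w) (W k)](lB_sym ok) !lBDr; ring.
rewrite E; move: fo el q1 q2; rewrite !ler_norml.
move=> /andP[? ?] /andP[? ?] /andP[? ?] /andP[? ?]; apply/andP; split; lra.
Qed.

(** [energy_step] covers every step but the one into the vertex 0. Two indices below [N] are joined
    without it, by at most [N] steps of size [O(1/N^2)], and the mean of the energies is [2 e] by
    the equation for the period. *)
Lemma energy_le k : `|h k - 2 * e| <= 200 * A ^+ 10 / N%:R.
Proof.
have E10 : 0 <= A ^+ 10 by rewrite exprn_ge0.
pose c := 100 * A ^+ 10 / N%:R ^+ 2.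
have c0 : 0 <= c by rewrite divr_ge0 ?mulr_ge0 ?exprn_ge0.
have ixN (j : nat) : (j < N)%N -> ix j%:Z = j.
  by move=> jN; rewrite /ix modz_nat absz_nat modn_small.
have hE i : h i = h (ix i)%:Z by rewrite /h /X /W ixN ?ix_lt.
have st j : (0 < j < N)%N -> `|h j%:Z - h j.-1%:Z| <= c.
  case: j => // j /= jN; have := @energy_step j%:Z.
  rewrite (ixN j (ltnW jN)) => /(_ _).
  by rewrite -PoszD addn1; apply; rewrite neq_ltn jN.
have pw i j : (i < N)%N -> (j < N)%N -> `|h j%:Z - h i%:Z| <= 100 * A ^+ 10 / N%:R.
  move=> iN jN.
  have := chain_bound (f := fun j => h j%:Z) (c := fun=> c) st (fun=> c0) iN jN.
  rewrite sumr_const card_ord -mulr_natl => /le_trans; apply.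
  by rewrite le_eqVlt; apply/orP; left; apply/eqP; rewrite /c; field; rewrite gt_eqF.
have mean : 2 * e = (\sum_(j < N) h j%:Z) / N%:R.
  have := ds_en ds; rewrite /En.
  have -> : \sum_(k < N) lB l (x k) (dl x k) (dl x k) = (T / N%:R) ^+ 2 * \sum_(j < N) h j%:Z.
    rewrite mulr_sumr; apply: eq_bigr => j _; rewrite /h /X /W ixN // /vel (lBZ ok).
    by field; rewrite !gt_eqF.
  have T2 : T ^+ 2 != 0 by rewrite expf_neq0 // gt_eqF.
  move=> en; apply: (mulIf T2); rewrite -en; field; by rewrite gt_eqF.
have h0 : `|h 0 - 2 * e| <= 100 * A ^+ 10 / N%:R.
  have -> : h 0 - 2 * e = (\sum_(j < N) (h 0 - h j%:Z)) / N%:R.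
    by rewrite mean sumrB sumr_const card_ord -[h 0 *+ N]mulr_natl; field; rewrite gt_eqF.
  rewrite normrM [`|N%:R^-1|]ger0_norm ?invr_ge0 // ler_pdivrMr // mulrC.
  by apply: (sum_const_le (f := fun j => h 0 - h j%:Z)) => j jN; rewrite (pw j 0%N).
rewrite hE; have := pw _ _ N0 (ix_lt k) => hk.
have -> : h (ix k)%:Z - 2 * e = (h (ix k)%:Z - h 0) + (h 0 - 2 * e) by ring.
apply: le_trans (ler_normD _ _) _; apply: le_trans (lerD hk h0) _.
by rewrite le_eqVlt; apply/orP; left; apply/eqP; ring.
Qed.

Variables (k : int) (m : nat).
Hypothesis mN : (m <= N)%N.

Let D := 4 * A ^+ 5 * (m%:R / N%:R) + 2 * A * ep.

Let ep0 : 0 <= ep := ds_ep ds.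

Lemma X_chain j : (j <= m)%N -> `|X (k + j%:Z) - X k| <= D.
Proof.
move=> jm.
have := @chain_le _ X (A ^+ 2 / N%:R) 0 k j _ (lexx 0) (leq_trans jm mN) (fun i _ => _).
rewrite divr_ge0 ?exprn_ge0 // => /(_ isT) H.
apply: le_trans (H _) _; first by move=> i; rewrite mul0r addr0; exact: dX_le.
rewrite mulr0 addr0; apply: (@le_trans _ _ (m%:R * (A ^+ 2 / N%:R))).
  by rewrite ler_wpM2r ?divr_ge0 ?exprn_ge0 // ler_nat.
rewrite /D ler_wpDr ?mulr_ge0 //.
have -> : m%:R * (A ^+ 2 / N%:R) = A ^+ 2 * (m%:R / N%:R) by ring.
rewrite ler_wpM2r ?divr_ge0 //.
have : A ^+ 2 <= A ^+ 5 by apply: ler_weXn2l.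
have : 0 <= A ^+ 5 by rewrite exprn_ge0.
lra.
Qed.

Lemma W_chain j : (j <= m)%N -> `|W (k + j%:Z) - W k| <= D.
Proof.
move=> jm.
have a0 : 0 <= 4 * A ^+ 5 / N%:R by rewrite !mulr_ge0 ?invr_ge0 ?exprn_ge0.
have b0 : 0 <= A * ep by rewrite mulr_ge0.
have := chain_le (f := W) (k := k) a0 b0 (leq_trans jm mN) (fun i _ => dW_le (k + i%:Z)).
move=> /le_trans; apply; rewrite /D -[2 * A * ep]mulrA lerD2r.
have -> : 4 * A ^+ 5 * (m%:R / N%:R) = m%:R * (4 * A ^+ 5 / N%:R) by ring.
by rewrite ler_wpM2r // ler_nat.
Qed.

(** Within the window the velocity stays within [D] of its initial value, and [D] is of the order of
    [m / N] up to a multiple of [ep]; when [ep] tends to 0 the remainder becomes quadratic in the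
    length of the window. *)
Lemma X_window : `|X (k + m%:Z) - X k - (m%:R / N%:R * T) *: W k| <= A * D * (m%:R / N%:R).
Proof.
pose f (i : int) : V := X i - ((i - k)%:~R * (T / N%:R)) *: W k.
have fk : f k = X k by rewrite /f subrr mul0r scale0r subr0.
have a0 : 0 <= A * D / N%:R.
  by rewrite divr_ge0 ?mulr_ge0 ?addr_ge0 ?mulr_ge0 ?exprn_ge0 ?divr_ge0.
have := chain_le (f := f) (k := k) a0 (lexx 0) mN.
have -> : f (k + m%:Z) - f k = X (k + m%:Z) - X k - (m%:R / N%:R * T) *: W k.
  rewrite fk /f (_ : k + m%:Z - k = m%:Z); last by ring.
  by rewrite -pmulrn addrAC; congr (_ - _ *: _); ring.
have -> : m%:R * (A * D / N%:R) + 2 * 0 = A * D * (m%:R / N%:R) by ring.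
apply=> j jm; rewrite mul0r addr0 /f.
have -> : X (k + j%:Z + 1) - ((k + j%:Z + 1 - k)%:~R * (T / N%:R)) *: W k
   - (X (k + j%:Z) - ((k + j%:Z - k)%:~R * (T / N%:R)) *: W k)
   = (T / N%:R) *: (W (k + j%:Z) - W k).
  rewrite scalerBr -dX (_ : k + j%:Z + 1 - k = (k + j%:Z - k) + 1); last by ring.
  by rewrite intrD mulrDl mul1r scalerDl; apply/rowP => i; rewrite !mxE; ring.
rewrite normrZ ger0_norm ?divr_ge0 ?(ltW T0) //.
have -> : A * D / N%:R = A / N%:R * D by ring.
apply: ler_pM; rewrite ?divr_ge0 ?(ltW T0) //; last exact: W_chain (ltnW jm).
by rewrite ler_wpM2r ?invr_ge0 // (ds_TA ds).
Qed.

Lemma P_window w : `|lB l (X (k + m%:Z)) (W (k + m%:Z)) w - lB l (X k) (W k) w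
    - m%:R / N%:R * T * elf (X k) (W k) w|
  <= ((8 * A ^+ 4 * D + A ^+ 5 / N%:R) * (m%:R / N%:R) + 2 * ep) * `|w|.
Proof.
pose f (i : int) : R^o := lB l (X i) (W i) w - ((i - k)%:~R * (T / N%:R)) * elf (X k) (W k) w.
have D0 : 0 <= D by rewrite addr_ge0 ?mulr_ge0 ?exprn_ge0 ?divr_ge0.
have a0 : 0 <= (8 * A ^+ 4 * D / N%:R + A ^+ 5 / N%:R ^+ 2) * `|w|.
  by rewrite mulr_ge0 // addr_ge0 ?divr_ge0 ?mulr_ge0 ?exprn_ge0.
have b0 : 0 <= ep * `|w| by rewrite mulr_ge0.
have := chain_le (f := f) (k := k) a0 b0 mN.
have -> : f k = lB l (X k) (W k) w by rewrite /f subrr mul0r mul0r subr0.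
have -> : f (k + m%:Z) - lB l (X k) (W k) w = lB l (X (k + m%:Z)) (W (k + m%:Z)) w - lB l (X k) (W k) w
    - m%:R / N%:R * T * elf (X k) (W k) w.
  by rewrite /f (addrC k) addrK -pmulrn; ring.
have -> : m%:R * ((8 * A ^+ 4 * D / N%:R + A ^+ 5 / N%:R ^+ 2) * `|w|) + 2 * (ep * `|w|)
  = ((8 * A ^+ 4 * D + A ^+ 5 / N%:R) * (m%:R / N%:R) + 2 * ep) * `|w|.
  by field; rewrite gt_eqF.
apply=> j jm.
have -> : f (k + j%:Z + 1) - f (k + j%:Z) =
   (lB l (X (k + j%:Z + 1)) (W (k + j%:Z + 1)) w - lB l (X (k + j%:Z)) (W (k + j%:Z)) w
     - force l N x T (ix (k + j%:Z + 1)) w)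
   + (force l N x T (ix (k + j%:Z + 1)) w - T / N%:R * elf (X k) (W k) w).
  rewrite /f (_ : k + j%:Z + 1 - k = (k + j%:Z - k) + 1); last by ring.
  by rewrite intrD; ring.
apply: le_trans (ler_normD _ _) _; rewrite addrC; apply: lerD.
  have SE : k + j%:Z + 1 = k + j.+1%:Z by rewrite -addn1 PoszD addrA.
  apply: force_elf => //.
  - exact: X_chain (ltnW jm).
  - by rewrite SE; exact: X_chain.
  - exact: W_chain (ltnW jm).
  - by rewrite SE; exact: W_chain.
have := EL_step (k + j%:Z) w; rewrite mulrAC; exact.
Qed.

End One.
End DiscreteSolution.

(** * Passage to the limit along an ultrafilter *)

Section OneSided.
Variable R : realType.

(** The windows only give forward estimates, but uniformly in the starting point: a quotient with
    negative increment is a forward quotient from the earlier time, where [g] is close to [g t] by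
    continuity. *)
Lemma is_derive_right_quadratic (V : normedModType R) (f g : R -> V) (c r t : R) : 0 < r ->
  (forall s h, 0 <= h -> h <= r -> `|f (s + h) - f s - h *: g s| <= c * h ^+ 2) ->
  {for t, continuous g} -> is_derive t 1 f (g t).
Proof.
move=> r0 H cg.
have c0 : 0 <= c.
  have := le_trans (normr_ge0 _) (H t r (ltW r0) (lexx r)).
  by rewrite pmulr_lge0 // exprn_gt0.
suff C : (fun h : R => h^-1 *: (f (h *: 1 + t) - f t)) @ (0 : R)^' --> g t.
  split; first by apply/cvg_ex; exists (g t).
  exact: (cvg_lim _ C).
apply/cvgrPdist_le => ep ep0.
have [d d0 dP] : exists2 d : R, 0 < d & c * d <= ep / 2.
  exists (ep / (2 * (c + 1))); first by rewrite divr_gt0 // mulr_gt0 // ltr_wpDl.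
  have cp : 0 < c + 1 by rewrite ltr_wpDl.
  have -> : ep / (2 * (c + 1)) = (ep / 2) / (c + 1) by field; rewrite gt_eqF.
  rewrite mulrA ler_pdivrMr // mulrC ler_wpM2l ?divr_ge0 ?(ltW ep0) // lerDl //.
have e20 : 0 < ep / 2 by rewrite divr_gt0.
have cg' : \forall s \near t, `|g t - g s| <= ep / 2 by move/cvgrPdist_le : cg => /(_ _ e20).
have cg0 : \forall h \near (0 : R)^', `|g t - g (h + t)| <= ep / 2.
  have ct : (fun h : R => h + t) @ (0 : R)^' --> t.
    rewrite -[X in _ --> X]add0r; apply: cvgD; last exact: cvg_cst.
    exact: nbhs_dnbhs.
  exact: (ct _ cg').
near=> h.
have h0 : h != 0 by near: h; exact: nbhs_dnbhs_neq.
have hd : `|h| <= d.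
  near: h; apply: nbhs_dnbhs; apply/nbhs_ballP; exists d => //= z.
  by rewrite -ball_normE /= sub0r normrN => /ltW.
have hr : `|h| <= r.
  near: h; apply: nbhs_dnbhs; apply/nbhs_ballP; exists r => //= z.
  by rewrite -ball_normE /= sub0r normrN => /ltW.
have hg : `|g t - g (h + t)| <= ep / 2 by near: h.
have ch : c * `|h| <= ep / 2 by apply: le_trans dP; rewrite ler_wpM2l.
have hn : 0 < `|h| by rewrite normr_gt0.
rewrite -[h *: 1]/(h * 1) mulr1.
rewrite -(ler_pM2l hn) -normrZ scalerBr scalerA divff // scale1r.
case: (ltrgtP h 0) h0 => // hs _.
  have := H (h + t) (- h); rewrite oppr_ge0 (ltW hs) => /(_ isT).
  rewrite -{1}(ltr0_norm hs) => /(_ hr).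
  rewrite (_ : h + t - h = t); last by ring.
  move=> h1.
  have -> : h *: g t - (f (h + t) - f t) = h *: (g t - g (h + t)) + (f t - f (h + t) - (- h) *: g (h + t)).
    by rewrite scalerBr scaleNr opprK addrCA subrK opprB addrC.
  apply: le_trans (ler_normD _ _) _; rewrite normrZ.
  have -> : `|h| * ep = `|h| * (ep / 2) + `|h| * (ep / 2) by field.
  apply: lerD; first by rewrite ler_wpM2l.
  apply: le_trans h1 _; rewrite sqrrN.
  have -> : c * h ^+ 2 = `|h| * (c * `|h|) by rewrite (ltr0_norm hs); ring.
  by rewrite ler_wpM2l.
have := H t h (ltW hs); rewrite -{1}(gtr0_norm hs) => /(_ hr) h1.
rewrite distrC (addrC h); apply: le_trans h1 _.
have -> : c * h ^+ 2 = `|h| * (c * `|h|) by rewrite (gtr0_norm hs); ring.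
rewrite ler_wpM2l // (le_trans ch) // ler_pdivrMr //; lra.
Unshelve. all: by end_near.
Qed.

End OneSided.

(** The equation is stated for the momentum tested against constant vectors, which is what the limit
    of the discrete equations yields; no derivative of the velocity appears. *)
Record ode (R : realType) (n : nat) (K : set 'rV[R]_n) (l : lag R n) (e T : R)
    (x v : R -> 'rV[R]_n) : Prop := Ode {
  ode_perx : forall t, x (t + T) = x t;
  ode_perv : forall t, v (t + T) = v t;
  ode_K : forall t, K (x t);
  ode_vel : forall t : R, is_derive t 1 x (v t);
  ode_EL : forall (t : R) w, is_derive t 1 (fun s => lB l (x s) (v s) w) (elf l (x t) (v t) w);
  ode_en : forall t, lB l (x t) (v t) (v t) = 2 * e }.

Section Limit.
Variables (R : realType) (n : nat).
Local Notation V := 'rV[R]_n.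
Variables (U K : set V) (C : R) (l : lag R n).
Hypothesis ok : lag_ok U K C l.
Variables (A T1 e : R).
Hypothesis CA : C <= A.
Hypothesis T10 : 0 < T1.
Hypothesis cK : compact K.
Variables (F : set_system nat) (UF : UltraFilter F).
Variables (Nm : nat -> nat) (x : nat -> nat -> V) (T ep : nat -> R).
Hypothesis Fds : \forall m \near F, dsol K l A e (Nm m) (x m) (T m) (ep m).
Hypothesis FT : \forall m \near F, T1 <= T m.
Hypothesis FN : forall k, \forall m \near F, (k <= Nm m)%N.
Hypothesis Fep : ep m @[m --> F] --> (0 : R).

Lemma elf_cvg (S : Type) (G : set_system S) (FG : Filter G) (y v w : S -> V) y0 v0 w0 : U y0 ->
  y m @[m --> G] --> y0 -> v m @[m --> G] --> v0 ->
  w m @[m --> G] --> w0 -> elf l (y m) (v m) (w m) @[m --> G] --> elf l y0 v0 w0.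
Proof.
move=> Uy cy cv cw; apply: cvgD; first by apply: cvgM; [exact: (lB1_cvg ok) | exact: cvg_cst].
by apply: cvgB; exact: (lL1_cvg ok).
Qed.

Let C1 : 1 <= C := lag_C1 ok.
Let A1 : 1 <= A. Proof. exact: le_trans C1 CA. Qed.
Let A0 : 0 <= A. Proof. exact: le_trans ler01 A1. Qed.

(** One ultrafilter makes the samples at all times converge at once, which replaces the extraction
    of subsequences. *)
Lemma ultra_cvg (S : topologicalType) (D : set S) (f : nat -> S) : compact D ->
  (\forall m \near F, D (f m)) -> exists2 p, D p & f m @[m --> F] --> p.
Proof.
rewrite compact_ultra => cD FD.
have := cD (f @ F) _ FD.
case=> [|p [Dp fp]]; last by exists p.
split; first exact: fmap_proper_filter.
move=> G PG FG; apply/seteqP; split=> // B GB.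
have [//|FB] := in_ultra_setVsetC (f @^-1` B) UF.
have GB' : G (~` B) by exact: FG.
by have := filter_not_empty G; case; rewrite -(setICr B); exact: filterI.
Qed.

(** The polygon is sampled at the vertex of index [floor (s N)], without interpolation; the
    parameter [s] ranges over the whole line, with period 1. *)
Let fl (s : R) m : int := Num.floor (s * (Nm m)%:R).
Let Xm s m : V := x m (ix (Nm m) (fl s m)).
Let Wm s m : V := vel (Nm m) (x m) (T m) (ix (Nm m) (fl s m)).

Let cX s : {p | K p /\ Xm s m @[m --> F] --> p}.
Proof.
apply: cid; have [|p Kp fp] := @ultra_cvg _ K (Xm s) cK; last by exists p.
apply: filterS Fds => m ds; exact: (ds_K ds (ix_lt ds _)).
Qed.

Let cW s : {p | `|p| <= A /\ Wm s m @[m --> F] --> p}.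
Proof.
apply: cid; have [||p Kp fp] := @ultra_cvg _ [set v : V | `|v| <= A] (Wm s); last by exists p.
  apply: bounded_closed_compact.
    by exists A; split; [exact: num_real | move=> B AB v /= /le_trans -> //; exact: ltW].
  by apply: (@preimage_closed _ _ (fun v : V => `|v|) [set t : R | t <= A]);
    [move=> v _; exact: norm_continuous | exact: closed_le].
apply: filterS Fds => m ds; exact: (ds_vel ds (ix_lt ds _)).
Qed.

Let cT : {t | (T1 <= t <= A) /\ T m @[m --> F] --> t}.
Proof.
apply: cid; have [||p Kp fp] := @ultra_cvg _ `[T1, A]%classic T; last by exists p.
  exact: segment_compact.
by near=> m; rewrite /= in_itv /=; apply/andP; split; [near: m | apply: (@ds_TA _ _ K l A e (Nm m) (x m) (T m) (ep m)); near: m].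
Unshelve. all: by end_near.
Qed.

Let X s := sval (cX s).
Let W s := sval (cW s).
Let T0 := sval cT.

Let XK s : K (X s). Proof. exact: (svalP (cX s)).1. Qed.
Let Xc s : Xm s m @[m --> F] --> X s. Proof. exact: (svalP (cX s)).2. Qed.
Let WA s : `|W s| <= A. Proof. exact: (svalP (cW s)).1. Qed.
Let Wc s : Wm s m @[m --> F] --> W s. Proof. exact: (svalP (cW s)).2. Qed.
Let Tc : T m @[m --> F] --> T0. Proof. exact: (svalP cT).2. Qed.
Let T0T : T1 <= T0 <= A. Proof. exact: (svalP cT).1. Qed.

Let XU s : U (X s). Proof. exact: (lag_sub ok). Qed.

Let Nc : (Nm m)%:R^-1 @[m --> F] --> (0 : R).
Proof.
apply/cvgrPdist_le => d d0.
near=> m.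
rewrite sub0r normrN ger0_norm ?invr_ge0 //.
have : ((Num.truncn d^-1).+1 <= Nm m)%N by near: m; exact: FN.
rewrite -(ler_nat R) => h.
have h2 : d^-1 < (Nm m)%:R by apply: lt_le_trans h; exact: truncnS_gt.
have N0 : 0 < (Nm m)%:R :> R by apply: lt_trans h2; rewrite invr_gt0.
by rewrite -[d]invrK lef_pV2 ?posrE ?invr_gt0 // ltW.
Unshelve. all: by end_near.
Qed.

Let N_gt0 : \forall m \near F, 0 < (Nm m)%:R :> R.
Proof. by near=> m; rewrite ltr0n; near: m; exact: (FN 1). Unshelve. all: by end_near. Qed.

Lemma floor_div s : (fl s m)%:~R / (Nm m)%:R @[m --> F] --> s.
Proof.
apply/cvgrPdist_le => d d0.
have Nd : \forall m \near F, `|0 - (Nm m)%:R^-1| <= d by move/cvgrPdist_le : Nc; exact.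
near=> m.
have N0 : 0 < (Nm m)%:R :> R by near: m.
have : `|0 - (Nm m)%:R^-1| <= d by near: m.
rewrite sub0r normrN ger0_norm ?invr_ge0 // => /(le_trans _); apply.
have -> : s - (fl s m)%:~R / (Nm m)%:R = (s * (Nm m)%:R - (fl s m)%:~R) / (Nm m)%:R.
  by field; rewrite gt_eqF.
rewrite normrM (ger0_norm (x := (Nm m)%:R^-1)) ?invr_ge0 // ler_piMl ?invr_ge0 //.
have /andP[h1 h2] := floor_itv (s * (Nm m)%:R).
rewrite intrD in h2; rewrite /fl ger0_norm ?subr_ge0 //; lra.
Unshelve. all: by end_near.
Qed.

Section Window.
Variables (s h : R).
Hypothesis h0 : 0 <= h.
Hypothesis h1 : h <= 1 / 2.

Let mm m : nat := `|fl (s + h) m - fl s m|%N.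

Let flE m : fl (s + h) m = fl s m + (mm m)%:Z.
Proof.
rewrite /mm gez0_abs; first by rewrite [RHS]addrC subrK.
by rewrite subr_ge0 le_floor // ler_wpM2r // lerDl.
Qed.

Let mc : (mm m)%:R / (Nm m)%:R @[m --> F] --> h.
Proof.
have -> : (fun m => (mm m)%:R / (Nm m)%:R : R) = (fun m => (fl (s + h) m)%:~R / (Nm m)%:R - (fl s m)%:~R / (Nm m)%:R).
  by apply/funext => m; rewrite flE intrD -pmulrn; ring.
rewrite -[h in X in _ --> X](addrK s) (addrC h).
by apply: cvgB; exact: floor_div.
Qed.

Let mN : \forall m \near F, (mm m <= Nm m)%N.
Proof.
(* The window contains about [h N] vertices; the strict inequality leaves room for rounding, so that
   it eventually has at most [N]. *)
have h2 : h < 1 by apply: le_lt_trans h1 _; rewrite ltr_pdivrMr // mul1r ltr1n.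
have H : \forall m \near F, `|h - (mm m)%:R / (Nm m)%:R| <= 1 - h.
  by move/cvgrPdist_le : mc; apply; rewrite subr_gt0.
near=> m.
have N0 : 0 < (Nm m)%:R :> R by near: m.
rewrite -(ler_nat R) -[leRHS]mul1r -ler_pdivrMr //.
have : `|h - (mm m)%:R / (Nm m)%:R| <= 1 - h by near: m.
by rewrite ler_norml => /andP[? _]; lra.
Unshelve. all: by end_near.
Qed.

Let Dm m : R := 4 * A ^+ 5 * ((mm m)%:R / (Nm m)%:R) + 2 * A * ep m.

Let Dc : Dm m @[m --> F] --> 4 * A ^+ 5 * h.
Proof.
rewrite -[X in _ --> X]addr0 -[X in _ --> _ + X](mulr0 (2 * A)).
by apply: cvgD; apply: cvgM => //; exact: cvg_cst.
Qed.

(** The jump of the velocity at the vertex 0 is [O(ep)] and disappears in the limit, so the limit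
    curve has no corner at its base point. *)
Lemma W_lip : `|W (s + h) - W s| <= 4 * A ^+ 5 * h.
Proof.
apply: (ler_cvg_to (a := F) (f := fun m => `|Wm (s + h) m - Wm s m|) (g := Dm)) => //.
  by apply: cvg_norm; apply: cvgB.
near=> m; rewrite /Wm flE.
have ds : dsol K l A e (Nm m) (x m) (T m) (ep m) by near: m.
have mNm : (mm m <= Nm m)%N by near: m.
exact: (W_chain ok CA ds (fl s m) mNm (leqnn _)).
Unshelve. all: by end_near.
Qed.

Lemma X_quad : `|X (s + h) - X s - (h * T0) *: W s| <= 4 * A ^+ 6 * h ^+ 2.
Proof.
have -> : 4 * A ^+ 6 * h ^+ 2 = A * (4 * A ^+ 5 * h) * h by ring.
apply: (ler_cvg_to (a := F) (f := fun m => `|Xm (s + h) m - Xm s m - ((mm m)%:R / (Nm m)%:R * T m) *: Wm s m|)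
   (g := fun m => A * Dm m * ((mm m)%:R / (Nm m)%:R))).
- apply: cvg_norm; apply: cvgB; first exact: cvgB.
  by apply: cvgZ => //; exact: cvgM.
- by apply: cvgM => //; apply: cvgM => //; exact: cvg_cst.
near=> m; rewrite /Xm /Wm flE.
have ds : dsol K l A e (Nm m) (x m) (T m) (ep m) by near: m.
have mNm : (mm m <= Nm m)%N by near: m.
exact: (X_window ok CA ds (fl s m) mNm).
Unshelve. all: by end_near.
Qed.

Lemma P_quad w : `|lB l (X (s + h)) (W (s + h)) w - lB l (X s) (W s) w - h * T0 * elf l (X s) (W s) w|
  <= 32 * A ^+ 9 * `|w| * h ^+ 2.
Proof.
have -> : 32 * A ^+ 9 * `|w| * h ^+ 2 = ((8 * A ^+ 4 * (4 * A ^+ 5 * h) + A ^+ 5 * 0) * h + 2 * 0) * `|w| by ring.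
apply: (ler_cvg_to (a := F) (f := fun m => `|lB l (Xm (s + h) m) (Wm (s + h) m) w - lB l (Xm s m) (Wm s m) w
     - (mm m)%:R / (Nm m)%:R * T m * elf l (Xm s m) (Wm s m) w|)
   (g := fun m => ((8 * A ^+ 4 * Dm m + A ^+ 5 * (Nm m)%:R^-1) * ((mm m)%:R / (Nm m)%:R) + 2 * ep m) * `|w|)).
- have cw : (fun=> w) m @[m --> F] --> w by exact: cvg_cst.
  apply: cvg_norm; apply: cvgB; first by apply: cvgB; exact: (lB_cvg ok).
  by apply: cvgM; [exact: cvgM | exact: elf_cvg].
- apply: cvgM; last exact: cvg_cst.
  apply: cvgD; last by apply: cvgM => //; exact: cvg_cst.
  apply: cvgM => //; apply: cvgD; apply: cvgM => //; exact: cvg_cst.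
near=> m; rewrite /Xm /Wm flE.
have ds : dsol K l A e (Nm m) (x m) (T m) (ep m) by near: m.
have mNm : (mm m <= Nm m)%N by near: m.
exact: (P_window ok CA ds (fl s m) mNm w).
Unshelve. all: by end_near.
Qed.

End Window.

Lemma energy_lim s : lB l (X s) (W s) (W s) = 2 * e.
Proof.
apply/eqP; rewrite -subr_eq0 -normr_le0 -(mulr0 (200 * A ^+ 10)).
apply: (ler_cvg_to (a := F) (f := fun m => `|lB l (Xm s m) (Wm s m) (Wm s m) - 2 * e|)
   (g := fun m => 200 * A ^+ 10 * (Nm m)%:R^-1)).
- by apply: cvg_norm; apply: cvgB; [exact: (lB_cvg ok) | exact: cvg_cst].
- by apply: cvgM => //; exact: cvg_cst.
near=> m.
have ds : dsol K l A e (Nm m) (x m) (T m) (ep m) by near: m.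
exact: (energy_le ok CA ds (fl s m)).
Unshelve. all: by end_near.
Qed.

Let ixP s m : ix (Nm m) (fl (s + 1) m) = ix (Nm m) (fl s m).
Proof.
rewrite /ix /fl mulrDl mul1r floorDrz ?rpred_nat // -[(Nm m)%:R]/((Nm m)%:Z%:~R) intrKfloor.
by rewrite modzDr.
Qed.

Let XP s : X (s + 1) = X s.
Proof.
apply/eqP; rewrite -subr_eq0 -normr_le0.
apply: (ler_cvg_to (a := F) (f := fun m => `|Xm (s + 1) m - Xm s m|) (g := fun=> 0)).
- by apply: cvg_norm; apply: cvgB.
- exact: cvg_cst.
by near=> m; rewrite /Xm ixP subrr normr0.
Unshelve. all: by end_near.
Qed.

Let WP s : W (s + 1) = W s.
Proof.
apply/eqP; rewrite -subr_eq0 -normr_le0.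
apply: (ler_cvg_to (a := F) (f := fun m => `|Wm (s + 1) m - Wm s m|) (g := fun=> 0)).
- by apply: cvg_norm; apply: cvgB.
- exact: cvg_cst.
by near=> m; rewrite /Wm ixP subrr normr0.
Unshelve. all: by end_near.
Qed.

Lemma limit_ode : exists (T' : R) (x' v' : R -> V), T1 <= T' /\ ode K l e T' x' v'.
Proof.
have /andP[T0l T0A] := T0T; have Tp : 0 < T0 := lt_le_trans T10 T0l.
have Tn : T0 != 0 by rewrite gt_eqF.
exists T0, (fun t => X (t / T0)), (fun t => W (t / T0)); split=> //.
have half (h : R) : 0 <= h -> h <= T0 / 2 -> 0 <= h / T0 /\ h / T0 <= 1 / 2.
  move=> h0 h2; split; first by rewrite divr_ge0 // ltW.
  by rewrite ler_pdivrMr // mul1r mulrC.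
have r0 : 0 < T0 / 2 by rewrite divr_gt0.
have Wlip (s h : R) : 0 <= h -> h <= T0 / 2 -> `|W ((s + h) / T0) - W (s / T0)| <= 4 * A ^+ 5 / T0 * h.
  move=> h0 h2; have [a b] := half _ h0 h2.
  have := W_lip (s / T0) a b; rewrite -mulrDl; congr (_ <= _); ring.
have Xquad (s h : R) : 0 <= h -> h <= T0 / 2 -> `|X ((s + h) / T0) - X (s / T0) - h *: W (s / T0)| <= 4 * A ^+ 6 / T0 ^+ 2 * h ^+ 2.
  move=> h0 h2; have [a b] := half _ h0 h2.
  have := X_quad (s / T0) a b; rewrite -mulrDl divfK //; congr (_ <= _); field; exact: Tn.
have Pquad w (s h : R) : 0 <= h -> h <= T0 / 2 ->
   `|lB l (X ((s + h) / T0)) (W ((s + h) / T0)) w - lB l (X (s / T0)) (W (s / T0)) w - h *: (elf l (X (s / T0)) (W (s / T0)) w : R^o)|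
    <= 32 * A ^+ 9 * `|w| / T0 ^+ 2 * h ^+ 2.
  move=> h0 h2; have [a b] := half _ h0 h2.
  have := P_quad (s / T0) a b w; rewrite -mulrDl divfK //; congr (_ <= _); field; exact: Tn.
have cont (f : R -> V) (c t : R) : (forall s h : R, 0 <= h -> h <= T0 / 2 -> `|f (s + h) - f s| <= c * h) ->
    {for t, continuous f}.
  move=> H; apply/cvgrPdist_le => d d0.
  have c0 : 0 <= c.
    have := le_trans (normr_ge0 _) (H t _ (ltW r0) (lexx _)).
    by rewrite pmulr_lge0.
  have cp : 0 < c + 1 by rewrite ltr_wpDl.
  have [d1 d10 dP] : exists2 d1 : R, 0 < d1 & c * d1 <= d.
    exists (d / (c + 1)); first by rewrite divr_gt0.
    by rewrite mulrA ler_pdivrMr // mulrC ler_wpM2l ?(ltW d0) // lerDl.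
  have nb d' : 0 < d' -> \forall s \near t, `|t - s| <= d'.
    by move=> d0'; move/cvgrPdist_le : (@cvg_id _ (nbhs t)); apply.
  near=> s.
  have h1 : `|t - s| <= d1.
    by near: s; exact: nb.
  have h2 : `|t - s| <= T0 / 2.
    by near: s; exact: nb.
  apply: le_trans dP; apply: (@le_trans _ _ (c * `|t - s|)); last by rewrite ler_wpM2l.
  case: (leP s t) => st.
    have := H s (t - s); rewrite subr_ge0 => /(_ st); rewrite (addrC s) subrK.
    by rewrite ger0_norm ?subr_ge0 // in h2 *; apply.
  have := H t (s - t); rewrite subr_ge0 => /(_ (ltW st)); rewrite (addrC t) subrK.
  rewrite -normrN opprB in h2; rewrite -normrN opprB -[`|t - s|]normrN opprB.
  by rewrite gtr0_norm ?subr_gt0 // in h2 *; apply.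
have Wcont (t : R) : {for t, continuous (fun t : R => W (t / T0))} by exact: (cont (fun t => W (t / T0)) _ _ Wlip).
have Xcont (t : R) : {for t, continuous (fun t : R => X (t / T0))}.
  apply: (cont (fun t => X (t / T0)) (4 * A ^+ 6 / T0 ^+ 2 * (T0 / 2) + A)) => s h h0 h2.
  have -> : X ((s + h) / T0) - X (s / T0) = (X ((s + h) / T0) - X (s / T0) - h *: W (s / T0)) + h *: W (s / T0).
    by rewrite subrK.
  apply: le_trans (ler_normD _ _) _; rewrite [leRHS]mulrDl; apply: lerD.
    apply: le_trans (Xquad s h h0 h2) _.
    rewrite expr2 mulrA ler_wpM2r // ler_wpM2l // divr_ge0 ?mulr_ge0 ?exprn_ge0 // ltW //.
  by rewrite normrZ ger0_norm // mulrC ler_wpM2r.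
split=> [t|t|t|t|t w|t].
- by rewrite mulrDl divff // XP.
- by rewrite mulrDl divff // WP.
- exact: XK.
- exact: (is_derive_right_quadratic r0 Xquad (Wcont t)).
- apply: (@is_derive_right_quadratic R R^o (fun t => lB l (X (t / T0)) (W (t / T0)) w)
    (fun t => elf l (X (t / T0)) (W (t / T0)) w) _ _ t r0 (Pquad w)).
  have cw : (fun=> w) u @[u --> t] --> w by exact: cvg_cst.
  exact: (elf_cvg (nbhs_filter t) (XU (t / T0)) (Xcont t) (Wcont t) cw).
- exact: energy_lim.
Unshelve. all: by end_near.
Qed.

End Limit.

(** * Penalised minimisers *)

Section Penalty.
Variables (R : realType) (n : nat).
Local Notation V := 'rV[R]_n.

(** The norm of row vectors is the maximum norm, which is not differentiable; the sum of squares is,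
    and it dominates the square of the norm. *)
Definition pen (o z : V) : R := \sum_i (z 0 i - o 0 i) ^+ 2.
Definition dpen (o z w : V) : R := \sum_i 2 * (z 0 i - o 0 i) * w 0 i.

Lemma pen_der (o z w : V) (t : R) :
  is_derive t 1 (fun s : R => pen o (z + s *: w)) (dpen o (z + t *: w) w).
Proof.
rewrite /pen /dpen.
have -> : (fun s => \sum_i ((z + s *: w) 0 i - o 0 i) ^+ 2) =
   \sum_i (fun s => ((z 0 i - o 0 i) + s * w 0 i) ^+ 2).
  apply/funext => s; rewrite fct_sumE; apply: eq_bigr => i _.
  by rewrite !mxE addrAC.
apply: is_derive_sum => i; apply: is_derive_eq.
by rewrite !mxE /GRing.scale /=; ring.
Qed.

Lemma dpen_cvg o (I : Type) (F : set_system I) (FF : Filter F) (z : I -> V) (z0 w : V) :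
  z @ F --> z0 -> dpen o (z t) w @[t --> F] --> dpen o z0 w.
Proof.
move=> cz; rewrite /dpen.
apply: cvg_sumr => i.
apply: cvgM; last exact: cvg_cst.
apply: cvgM; first exact: cvg_cst.
apply: cvgB; last exact: cvg_cst.
exact: (cvg_comp z (fun v : V => v 0 i) cz (@entry_continuous R 1 n 0 i z0)).
Qed.

Lemma pen_continuous o : continuous (pen o).
Proof.
move=> z; rewrite /pen; apply: (cvg_sumr (F := nbhs z)) => i.
by apply: cvgM; apply: cvgB; (try exact: cvg_cst); exact: entry_continuous.
Qed.

Lemma pen_ge o z : `|z - o| ^+ 2 <= pen o z.
Proof.
have p0 : 0 <= pen o z by apply: sumr_ge0 => i _; exact: sqr_ge0.
rewrite -[leRHS]sqr_sqrtr // ler_sqr ?nnegrE ?sqrtr_ge0 //.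
apply: mx_norm_le; first exact: sqrtr_ge0.
move=> i j; rewrite ord1 -ler_sqr ?nnegrE ?sqrtr_ge0 // sqr_sqrtr // !mxE.
rewrite real_normK ?num_real // /pen (bigD1 j) //= lerDl.
by apply: sumr_ge0 => k _; exact: sqr_ge0.
Qed.

Lemma pen_ge0 o z : 0 <= pen o z.
Proof. exact: le_trans (sqr_ge0 _) (pen_ge o z). Qed.

Lemma penxx o : pen o o = 0.
Proof. by rewrite /pen big1 // => i _; rewrite subrr expr0n. Qed.

Lemma dpen_le o z w : `|dpen o z w| <= 2 * n%:R * `|z - o| * `|w|.
Proof.
have -> : 2 * n%:R * `|z - o| * `|w| = \sum_(i < n) (2 * `|z - o| * `|w|).
  by rewrite sumr_const card_ord -mulr_natl; ring.
apply: le_trans (ler_norm_sum _ _ _) _; apply: ler_sum => i _.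
rewrite !normrM (ger0_norm (x := 2)) // -!mulrA ler_wpM2l //.
apply: ler_pM => //; last exact: entry_norm.
by have := entry_norm (z - o) 0 i; rewrite !mxE.
Qed.

End Penalty.

Section Monotone.
Variables (R : realType) (n : nat).
Local Notation V := 'rV[R]_n.

Lemma transition_mono (W K2 K2' : set V) (A A' : R) (l1 l2 : lag R n) phi dphi :
  transition W K2 A l1 l2 phi dphi -> A <= A' -> K2 `<=` K2' -> transition W K2' A' l1 l2 phi dphi.
Proof.
move=> tr AA KK; split; first exact: le_trans (tr_A1 tr) AA.
- by move=> y /(tr_K tr)/KK.
- exact: (tr_lin tr).
- by move=> y v Wy; apply: le_trans (tr_bd tr _ Wy) _; rewrite ler_wpM2r.
- by move=> y y' Wy Wy'; apply: le_trans (tr_lip tr Wy Wy') _; rewrite ler_wpM2r.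
- move=> y y' v Wy Wy'; apply: le_trans (tr_dlip tr _ Wy Wy') _.
  by rewrite -!mulrA ler_wpM2r // mulr_ge0.
- by move=> y y' Wy Wy'; apply: le_trans (tr_tay tr Wy Wy') _; rewrite ler_wpM2r ?exprn_ge0.
- exact: (tr_B tr).
- exact: (tr_om tr).
Qed.

Lemma cball_trans (y o z : V) (a b c : R) : cball y a o -> cball o b z -> a + b <= c -> cball y c z.
Proof.
rewrite /cball /= => h1 h2; apply: le_trans.
have -> : z - y = (o - y) + (z - o) by rewrite [RHS]addrC addrA subrK.
by apply: le_trans (ler_normD _ _) _; apply: lerD.
Qed.

End Monotone.

Section ChartMinimizer.
Variables (R : realType) (n : nat).
Local Notation V := 'rV[R]_n.
Variables (U K : set V) (C : R) (l : lag R n).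
Hypothesis ok : lag_ok U K C l.
Variables (N : nat) (e : R).
Hypothesis N0 : (0 < N)%N.
Hypothesis e0 : 0 < e.
Variables (y0 : V) (r rho T1 T2 M : R).
Hypothesis KE : K = cball y0 (3 * r).
Hypothesis rho0 : 0 < rho.
Hypothesis rho_r : 2 * rho <= r.
Hypothesis rho1 : rho <= 1.
Hypothesis rhoC : C ^+ 2 * rho * (1 + T2) <= 1 / 100.
Hypothesis rhoM : 2 * C * T2 * M <= rho ^+ 2.
Hypothesis T1E : T1 = 1 / (20 * C ^+ 2).
Variables (o : V) (d : R).
Hypothesis OK : cball o d `<=` cball y0 (2 * r).
Variables (x : nat -> V) (T : R).
Hypothesis ax : adm K l N e T1 T2 M (cball o d) x T.
Hypothesis mx : forall x' T', adm K l N e T1 T2 M (cball o d) x' T' ->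
  act l N e x T + pen o (x 0%N) <= act l N e x' T' + pen o (x' 0%N).
Hypothesis kM : kin l N e x T <= M / 2.
Hypothesis TT2 : T <= T2 / 2.

Let C0 : 0 < C. Proof. exact: lt_le_trans ltr01 (lag_C1 ok). Qed.
Let T10 : 0 < T1. Proof. by rewrite T1E divr_gt0 // mulr_gt0 // exprn_gt0. Qed.
Let T0 : 0 < T. Proof. exact: lt_le_trans T10 (adm_T1 ax). Qed.
Let rx : rayhyp K C l N e x T := adm_ray ok e0 KE rho0 rho_r rho1 rhoC rhoM T10 OK ax.
Let kp : 0 < kin l N e x T := kin_gt0 ok (adm_K ax) T0 e0.

Let crit_eq (eta : nat -> V) th : eta N = eta 0%N ->
  (\forall t \near (0 : R), cball o d (x 0%N + t *: eta 0%N)) ->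
  dact l N e x T eta th + dpen o (x 0%N) (eta 0%N) = 0.
Proof.
move=> etaN nO; apply: (@crit _ _ U K C l ok N e T1 T2 M T10 (cball o d) (pen o) (dpen o) (@pen_der _ _ o) (@dpen_cvg _ _ o) x T eta th e0 rx _ _ _ _ etaN nO mx).
- move=> k kN; exact: (adm_interior ok e0 KE rho0 rho_r rhoM T10 OK ax kN).
(* [T1] is a quarter of the lower bound for the period, which makes this constraint strict. *)
- apply: lt_le_trans (ray_T1 ok e0 rx); rewrite T1E ltr_pM2l // ltf_pV2 ?posrE ?mulr_gt0 ?exprn_gt0 //.
  by rewrite ltr_pM2r ?exprn_gt0 // ltr_nat.
- by apply: le_lt_trans TT2 _; have : 0 < T2 by [exact: lt_le_trans T0 (adm_T2 ax)]; lra.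
- apply: le_lt_trans kM _; have : 0 < M / 2 by [exact: lt_le_trans kp kM]; lra.
Qed.

Let xU k : (k < N)%N -> U (x k).
Proof. by move=> kN; apply: (lag_sub ok); exact: (adm_K ax kN). Qed.

Let bas0 k (w : V) : (0 < k)%N -> bas N k w 0%N = 0.
Proof. by rewrite /bas mod0n; case: k. Qed.

(** Varying a vertex other than the base leaves [x 0] in place: the equation holds even if the base
    vertex lies on the boundary of its ball, and the penalty does not enter. *)
Lemma min_EL k w : (0 < k < N)%N -> mom l N x T k w - mom l N x T (prv N k) w = force l N x T k w.
Proof.
move=> /andP[k0 kN].
have basN : bas N k w N = bas N k w 0%N by rewrite /bas modnn mod0n.
have := crit_eq 0 basN; rewrite bas0 //.
have -> : dpen o (x 0%N) 0 = 0 by rewrite /dpen big1 // => i _; rewrite mxE mulr0.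
rewrite addr0 (dact_basis ok e N0 w) ?gt_eqF //.
move=> H; apply/eqP; rewrite eq_sym -subr_eq0; apply/eqP; apply: H.
by near=> t; rewrite scaler0 addr0; exact: adm_O ax.
Unshelve. all: by end_near.
Qed.

Lemma min_energy : En l N x = 2 * e * T ^+ 2.
Proof.
have := @crit_eq (fun=> 0) 1 erefl.
have -> : dpen o (x 0%N) 0 = 0 by rewrite /dpen big1 // => i _; rewrite mxE mulr0.
rewrite addr0 (dact_time ok) ?gt_eqF // => H.
have : e - En l N x / (2 * T ^+ 2) = 0.
  by apply: H; near=> t; rewrite scaler0 addr0; exact: adm_O ax.
move=> /eqP; rewrite subr_eq0 => /eqP {1}->; field; by rewrite gt_eqF.
Unshelve. all: by end_near.
Qed.

(** Available before the base vertex is known to be interior; the comparison of charts, which proves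
    interiority, relies on it. *)
Lemma min_vel k : (k < N)%N -> N%:R * `|dl x k| <= velB C T1 T2.
Proof.
have [sq pe] := adm_per ok e0 rho0 rhoM T10 ax.
apply: (velocity_bound ok T10 N0 (adm_K ax) (adm_T1 ax) (adm_T2 ax) _ _ min_EL).
  by apply: le_trans sq _; rewrite exprn_ile1 // ltW.
exact: le_trans rho1.
Qed.

(** From the interior of the ball the base vertex can move freely, and the equation holds up to the
    gradient of the penalty, which is linear in the distance to [o]. *)
Lemma min_EL0 w : `|x 0%N - o| < d ->
  `|mom l N x T 0 w - mom l N x T (prv N 0) w - force l N x T 0 w| <= 2 * n%:R * `|x 0%N - o| * `|w|.
Proof.
move=> xo.
have basN : bas N 0 w N = bas N 0 w 0%N by rewrite /bas modnn mod0n.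
have b0 : bas N 0 w 0%N = w by rewrite /bas mod0n eqxx.
have H : dact l N e x T (bas N 0 w) 0 + dpen o (x 0%N) w = 0.
  rewrite -{2}b0; apply: crit_eq basN _; rewrite b0.
  have c : x 0%N + t *: w @[t --> (0 : R)] --> x 0%N.
    rewrite -[X in _ --> X]addr0 -(scale0r w).
    by apply: cvgD; [exact: cvg_cst | exact: cvgZr_tmp].
  have dx : 0 < d - `|x 0%N - o| by rewrite subr_gt0.
  move/cvgrPdist_le : c => /(_ _ dx); apply: filterS => t h; rewrite /cball /=.
  have -> : x 0%N + t *: w - o = (x 0%N - o) - (x 0%N - (x 0%N + t *: w)).
    by apply/rowP => i; rewrite !mxE; ring.
  by apply: le_trans (ler_normB _ _) _; lra.
move: H; rewrite (dact_basis ok e N0 w) ?gt_eqF // => H.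
have -> : mom l N x T 0 w - mom l N x T (prv N 0) w - force l N x T 0 w = dpen o (x 0%N) w by lra.
exact: dpen_le.
Qed.

Lemma min_dsol A : T2 <= A -> velB C T1 T2 / T1 <= A -> `|x 0%N - o| < d ->
  dsol K l A e N x T (2 * n%:R * `|x 0%N - o|).
Proof.
move=> T2A vA xo; split=> //.
- exact: adm_loop ax.
- exact: adm_K ax.
- exact: le_trans (adm_T2 ax) T2A.
- move=> k kN; apply: le_trans vA; rewrite /vel normrZ ger0_norm ?divr_ge0 ?(ltW T0) //.
  rewrite mulrAC; apply: ler_pM; rewrite ?mulr_ge0 ?invr_ge0 ?(ltW T0) ?min_vel //.
  by rewrite lef_pV2 ?posrE // (adm_T1 ax).
- exact: min_EL.
- by move=> w; exact: min_EL0.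
- exact: min_energy.
Qed.

End ChartMinimizer.

Lemma ultra_fin (I : finType) (F : set_system nat) (UF : UltraFilter F) (f : nat -> I) :
  exists i, \forall m \near F, f m = i.
Proof.
apply: contrapT => H.
have H' i : \forall m \near F, f m <> i.
  have [h|//] := in_ultra_setVsetC [set m | f m = i] UF.
  by exfalso; apply: H; exists i.
have : \forall m \near F, forall i, f m <> i by exact: (filter_forall _ H').
by move=> /(@filter_ex _ F)[m] /(_ (f m)).
Qed.

(** * Minimisation over finitely many charts *)

Section Assembly.
Variables (R : realType) (n : nat) (I : finType).
Local Notation V := 'rV[R]_n.
Variables (U : I -> set V) (y : I -> V) (r : I -> R) (l : I -> lag R n) (C : R).
Hypothesis ok : forall i, lag_ok (U i) (cball (y i) (3 * r i)) C (l i).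
Variables (eta rho T1 T2 Ct M e : R).
Hypothesis e0 : 0 < e.
Hypothesis eta_r : forall i, eta <= r i.
Hypothesis trans : forall i o, cball (y i) (r i) o -> exists j phi dphi A,
  transition (cball o eta) (cball (y j) (r j)) A (l i) (l j) phi dphi.
Hypothesis rho0 : 0 < rho.
Hypothesis rho_r : 4 * rho <= eta.
Hypothesis rho1 : rho <= 1.
Hypothesis rhoC : C ^+ 2 * rho * (1 + T2) <= 1 / 100.
Hypothesis rhoM : 2 * C * T2 * M <= rho ^+ 2.
Hypothesis T1E : T1 = 1 / (20 * C ^+ 2).
Hypothesis T2E : T2 = 20 * Ct.
Hypothesis ME : M = 20 * Ct * e.
Hypothesis Ct0 : 0 < Ct.
Hypothesis test : \forall m \near \oo, exists i x T,
  adm (cball (y i) (3 * r i)) (l i) (4 * m) e T1 T2 M (cball (y i) (r i)) x T /\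
  act (l i) (4 * m) e x T <= Ct * e.

Let K i := cball (y i) (3 * r i).

Let eta0 : 0 < eta. Proof. by apply: lt_le_trans rho_r; rewrite mulr_gt0. Qed.
Let r0 i : 0 < r i. Proof. exact: lt_le_trans eta0 (eta_r i). Qed.

(** A chart, a polygon and a period whose action is within [1/(m+1)] of the infimum over all charts.
    There are [4 m] edges because the test loops are parallelograms with [m] edges per side. *)
Let near_min (m : nat) (p : I * (nat -> V) * R) :=
  [/\ adm (K p.1.1) (l p.1.1) (4 * m) e T1 T2 M (cball (y p.1.1) (r p.1.1)) p.1.2 p.2,
   act (l p.1.1) (4 * m) e p.1.2 p.2 <= Ct * e + m.+1%:R^-1 &
   forall i x T, adm (K i) (l i) (4 * m) e T1 T2 M (cball (y i) (r i)) x T ->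
     act (l p.1.1) (4 * m) e p.1.2 p.2 <= act (l i) (4 * m) e x T + m.+1%:R^-1].

Let i1 : exists i : I, True.
Proof.
by have [m [i _]] := @filter_ex _ \oo _ _ test; exists i.
Qed.

Let C1 : 1 <= C. Proof. by have [i _] := i1; exact: lag_C1 (ok i). Qed.
Let C0 : 0 < C. Proof. exact: lt_le_trans ltr01 C1. Qed.
Let T10 : 0 < T1. Proof. by rewrite T1E divr_gt0 // mulr_gt0 // exprn_gt0. Qed.

Let rr i : 2 * rho <= r i.
Proof. by apply: le_trans (eta_r i); apply: le_trans rho_r; rewrite ler_pM2r // ler_nat. Qed.

Let rOK i : cball (y i) (r i) `<=` cball (y i) (2 * r i).
Proof.
by move=> z; rewrite /cball /= => /le_trans; apply; rewrite ler_peMl ?(ltW (r0 i)) // ler1n.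
Qed.

Lemma near_min_exists : \forall m \near \oo, exists p, near_min m p.
Proof.
apply: filterS test => m [i0 [x0 [T0 [a0 ac0]]]].
pose S : set R := [set a | exists i x T,
  adm (K i) (l i) (4 * m) e T1 T2 M (cball (y i) (r i)) x T /\ a = act (l i) (4 * m) e x T].
have hS : has_inf S.
  split; first by exists (act (l i0) (4 * m) e x0 T0), i0, x0, T0.
  exists 0 => _ [i [x [T [a ->]]]].
  have rx := adm_ray (ok i) e0 erefl rho0 (rr i) rho1 rhoC rhoM T10 (@rOK i) a.
  apply: le_trans (ray_act (ok i) e0 rx); rewrite mulr_ge0 // ltW //.
  exact: (kin_gt0 (ok i) (ray_K1 rx) (ray_T rx) e0).
have m0 : 0 < m.+1%:R^-1 :> R by rewrite invr_gt0.
have [_ [i [x [T [a ->]]]] lt] := inf_adherent m0 hS.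
exists (i, x, T); split=> //=; first last.
  move=> i' x' T' a'; apply: le_trans (ltW lt) _; rewrite lerD2r.
  by apply: ge_inf; [exact: hS.2 | exists i', x', T'].
apply: le_trans (ltW lt) _; rewrite lerD2r; apply: le_trans ac0.
by apply: ge_inf; [exact: hS.2 | exists i0, x0, T0].
Qed.

(** Let [o] be the limit of base vertices of near-minimisers in a chart [i]; in this chart the
    action plus [pen o] is minimised with base vertex near [o]. The minimiser, moved to a chart [j]
    whose central ball contains the image of its base vertex, competes there with the
    near-minimisers, so its action cannot lie below theirs by more than a vanishing amount. Its
    penalty therefore vanishes in the limit: the base vertex tends to [o], becomes interior, and the
    defect there tends to 0. *)
Lemma exists_ode : exists i T x v, 0 < T /\ ode (cball (y i) (3 * r i)) (l i) e T x v.
Proof.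
have [F [UF oF]] := @ultraFilterLemma nat \oo _.
have PF : ProperFilter F := ultra_proper.
have [i0 _] := i1.
have /choice[p pP] : forall m, exists q, (exists q, near_min m q) -> near_min m q.
  move=> m; have [[q Hq]|no] := pselect (exists q, near_min m q); first by exists q.
  by exists (i0, fun=> 0, 0).
have Fp : \forall m \near F, near_min m (p m).
  by apply: oF; apply: filterS near_min_exists => m; exact: pP.
have [i Fi] := ultra_fin UF (fun m => (p m).1.1).
have Fp1 : \forall m \near F, near_min m (i, (p m).1.2, (p m).2).
  by apply: filterS2 Fp Fi => m; case: (p m) => [[j x] T] /= + ji; rewrite ji.
pose x1 m := (p m).1.2; pose t1 m := (p m).2.
have Fx1 : \forall m \near F, cball (y i) (r i) (x1 m 0%N).
  by apply: filterS Fp1 => m [a _ _]; exact: adm_O a.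
case: (ultra_cvg UF (f := fun m => x1 m 0%N) (@cball_compact _ _ (y i) _ (ltW (r0 i))) Fx1) => o oi oc.
have [j [phi [dphi [A0 tr0]]]] := trans oi.
pose A := Num.max (Num.max A0 C) (Num.max (velB C T1 T2) (Num.max T2 (velB C T1 T2 / T1))).
have AA0 : A0 <= A by rewrite !le_max lexx.
have CA : C <= A by rewrite !le_max lexx !orbT.
have vA : velB C T1 T2 <= A by rewrite !le_max lexx !orbT.
have TA : T2 <= A by rewrite !le_max lexx !orbT.
have vTA : velB C T1 T2 / T1 <= A by rewrite !le_max lexx !orbT.
have tr : transition (cball o eta) (cball (y j) (3 * r j)) A (l i) (l j) phi dphi.
  apply: transition_mono tr0 AA0 _ => z; rewrite /cball /= => /le_trans; apply.
  by rewrite ler_peMl ?(ltW (r0 j)) // ler1n.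
(* One half of [eta] is for the base vertex, the other for the loop, whose dilations extend by at
   most [2 rho <= eta / 2]; together they stay in the domain of the transition. *)
pose d := eta / 2.
have d0 : 0 < d by rewrite divr_gt0.
have OK : cball o d `<=` cball (y i) (2 * r i).
  by move=> z zo; apply: (cball_trans oi zo); have := eta_r i; rewrite /d; have := eta0; lra.
have WK : cball o eta `<=` K i.
  by move=> z zo; apply: (cball_trans oi zo); have := eta_r i; have := r0 i; lra.
pose mini m (q : (nat -> V) * R) := adm (K i) (l i) (4 * m) e T1 T2 M (cball o d) q.1 q.2 /\
  forall x' T', adm (K i) (l i) (4 * m) e T1 T2 M (cball o d) x' T' ->
    act (l i) (4 * m) e q.1 q.2 + pen o (q.1 0%N) <= act (l i) (4 * m) e x' T' + pen o (x' 0%N).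
have Fo : \forall m \near F, `|o - x1 m 0%N| <= d by move/cvgrPdist_le : oc; exact.
have Fadm : \forall m \near F, adm (K i) (l i) (4 * m) e T1 T2 M (cball o d) (x1 m) (t1 m).
  apply: filterS2 Fp1 Fo => m [a _ _] xo.
  by case: a => /= a1 a2 _ a3 a4 a5 a6; split=> //; rewrite /cball /= distrC.
have FN k : \forall m \near F, (k <= 4 * m)%N.
  by apply: oF; exists k => // m /= km; apply: leq_trans km _; rewrite leq_pmull.
have /choice[q qP] : forall m, exists q, (exists q, mini m q) -> mini m q.
  move=> m; have [[q Hq]|no] := pselect (exists q, mini m q); first by exists q.
  by exists (fun=> 0, 0).
have Fq : \forall m \near F, mini m (q m).
  apply: filterS2 Fadm (FN 1%N) => m a N0; apply: qP.
  have cK : compact (K i) by apply: cball_compact; rewrite mulr_ge0 // ltW.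
  have cO : closed (cball o d).
    by apply: compact_closed; [exact: norm_hausdorff | apply: cball_compact; exact: ltW].
  have [x [T [ax mx]]] := adm_min (ok i) T10 N0 cK cO (@pen_continuous R n o) (ex_intro _ _ (ex_intro _ _ a)).
  by exists (x, T).
pose x m := (q m).1; pose T m := (q m).2.
pose w m : R := pen o (x1 m 0%N) + m.+1%:R^-1.
have cm : m.+1%:R^-1 @[m --> F] --> (0 : R).
  by apply: cvg_trans (cvg_harmonic (R := R)); apply: cvg_app; exact: oF.
have cw : w m @[m --> F] --> 0.
  rewrite -[X in _ --> X]addr0; apply: cvgD => //; rewrite -(penxx o).
  exact: (cvg_comp _ (pen o) oc (@pen_continuous R n o o)).
have Cte : 0 < Ct * e by rewrite mulr_gt0.
have Fw : \forall m \near F, w m <= Ct * e / 10.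
  have c10 : 0 < Ct * e / 10 by rewrite divr_gt0.
  have : \forall m \near F, `|0 - w m| <= Ct * e / 10 by move/cvgrPdist_le : cw; exact.
  by apply: filterS => m; rewrite sub0r normrN; apply: le_trans; exact: ler_norm.
have Fact : \forall m \near F, act (l i) (4 * m) e (x m) (T m) + pen o (x m 0%N) <=
     act (l i) (4 * m) e (x1 m) (t1 m) + pen o (x1 m 0%N).
  by apply: filterS2 Fq Fadm => m [_ mq] a; exact: mq.
have Frx : \forall m \near F, rayhyp (K i) C (l i) (4 * m) e (x m) (T m).
  by apply: filterS Fq => m [a _]; exact: (adm_ray (ok i) e0 erefl rho0 (rr i) rho1 rhoC rhoM T10 OK a).
have Fkin : \forall m \near F, kin (l i) (4 * m) e (x m) (T m) <= M / 2 /\ T m <= T2 / 2.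
  near=> m.
  have rx : rayhyp (K i) C (l i) (4 * m) e (x m) (T m) by near: m.
  have h1 := ray_act (ok i) e0 rx; have h2 := ray_eT (ok i) rx.
  have h3 : act (l i) (4 * m) e (x m) (T m) + pen o (x m 0%N) <=
     act (l i) (4 * m) e (x1 m) (t1 m) + pen o (x1 m 0%N) by near: m.
  have h4 : w m <= Ct * e / 10 by near: m.
  have [_ h5 _] : near_min m (i, x1 m, t1 m) by near: m.
  have h6 := pen_ge0 o (x m 0%N).
  rewrite /= in h5; rewrite /w in h4.
  (* [46/100 kin] is at most the action, hence at most [11/10 Ct e]; the factor 5 is generous. It
     suffices for [kin <= M / 2 = 10 Ct e] and, as [e T <= kin], for [T <= T2 / 2 = 10 Ct]. *)
  have kb : kin (l i) (4 * m) e (x m) (T m) <= 5 * (Ct * e).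
    have ar (k a a1 a2 p0 p1 c : R) : 46 / 100 * k <= a -> a + p0 <= a1 + p1 -> a1 <= c + a2 ->
      p1 + a2 <= c / 10 -> 0 <= p0 -> 0 < c -> k <= 5 * c by lra.
    exact: (ar _ _ _ _ _ _ _ h1 h3 h5 h4 h6 Cte).
  split; first by rewrite ME; lra.
  rewrite -(ler_pM2l e0) T2E; lra.
have Fdata : \forall m \near F, (0 < 4 * m)%N /\ mini m (q m) by apply: filterS2 (FN 1%N) Fq.
have FE : \forall m \near F, 160 * A ^+ 8 / (4 * m)%:R <= e / (500 * C ^+ 2).
  have B0 : 0 <= 160 * A ^+ 8.
    by apply: mulr_ge0; [rewrite ler0n | apply: exprn_ge0; exact: le_trans (ltW C0) CA].
  have E0 : 0 < e / (500 * C ^+ 2).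
    by apply: (divr_gt0 e0); apply: mulr_gt0; [rewrite ltr0n | exact: exprn_gt0].
  have := FN (Num.truncn (160 * A ^+ 8 / (e / (500 * C ^+ 2)))).+1.
  apply: filterS => m hm.
  have h : 160 * A ^+ 8 / (e / (500 * C ^+ 2)) < (4 * m)%:R.
    by apply: lt_le_trans (truncnS_gt _) _; rewrite ler_nat.
  have N0 : 0 < (4 * m)%:R :> R by apply: le_lt_trans h; exact: divr_ge0 B0 (ltW E0).
  by rewrite ler_pdivrMr // [leRHS]mulrC -(ler_pdivrMr _ _ E0) ltW.
have Fpen : \forall m \near F, pen o (x m 0%N) <= w m + 320 * A ^+ 8 / (4 * m)%:R.
  near=> m.
  have [N0 [ax mx]] : (0 < 4 * m)%N /\ mini m (q m) by near: m.
  have [kM TT2] : kin (l i) (4 * m) e (x m) (T m) <= M / 2 /\ T m <= T2 / 2 by near: m.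
  have rx : rayhyp (K i) C (l i) (4 * m) e (x m) (T m) by near: m.
  have NE : 160 * A ^+ 8 / (4 * m)%:R <= e / (500 * C ^+ 2) by near: m.
  have h3 : act (l i) (4 * m) e (x m) (T m) + pen o (x m 0%N) <=
     act (l i) (4 * m) e (x1 m) (t1 m) + pen o (x1 m 0%N) by near: m.
  have [_ _ h5] : near_min m (i, x1 m, t1 m) by near: m.
  have [sq pe] := adm_per (ok i) e0 rho0 rhoM T10 ax.
  have xW s k : s \in `[(0 : R), 2] -> (k <= 4 * m)%N -> cball o eta (scal s (x m) k).
    rewrite in_itv /= => /andP[s0 s2] kN; rewrite /cball /=.
    have -> : scal s (x m) k - o = (x m 0%N - o) + s *: vv (x m) k by rewrite /scal addrAC.
    apply: le_trans (ler_normD _ _) _; rewrite normrZ ger0_norm //.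
    have -> : eta = d + d by rewrite /d; field.
    apply: lerD; first exact: (adm_O ax).
    apply: (@le_trans _ _ (2 * rho)); last by have := rho_r; rewrite /d; lra.
    by apply: ler_pM => //; exact: le_trans (vv_per _ kN) pe.
  have xv k : (k < 4 * m)%N -> (4 * m)%:R * `|dl (x m) k| <= A.
    move=> kN; apply: le_trans vA.
    exact: (min_vel (ok i) N0 e0 erefl rho0 (rr i) rho1 rhoC rhoM T1E OK ax mx kM TT2 kN).
  have phiO : cball (y j) (r j) (phi (x m 0%N)).
    apply: (tr_K tr0); have := adm_O ax; rewrite /cball /= => /le_trans; apply.
    by rewrite /d; have := eta0; lra.
  have T1C : T1 <= 1 / (20 * C ^+ 2) by rewrite T1E.
  have [s [as' cs]] := compare (ok i) (ok j) tr CA WK N0 e0 rx xW xv rho0 rhoC rhoM T1C TT2 kM phiO NE.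
  have ar (a a1 aj p0 p1 a2 E : R) : a + p0 <= a1 + p1 -> a1 <= aj + a2 -> aj <= a + E ->
    p0 <= p1 + a2 + E by lra.
  exact: (ar _ _ _ _ _ _ _ h3 (h5 _ _ _ as') cs).
have cA : 320 * A ^+ 8 / (4 * m)%:R @[m --> F] --> 0.
  rewrite -[X in _ --> X](mulr0 (320 * A ^+ 8)); apply: cvgM; first exact: cvg_cst.
  apply/cvgrPdist_le => ep ep0.
  have : \forall m \near F, (4 * m)%:R^-1 <= m.+1%:R^-1 :> R.
    apply: filterS (FN 4) => m; rewrite -{1}(muln1 4) leq_mul2l /= => m1.
    by rewrite lef_pV2 ?posrE ?ltr0n ?muln_gt0 // ler_nat;
      apply: (@leq_trans (2 * m)); rewrite ?leq_mul2r ?orbT // mul2n -addnn -addn1 leq_add2l.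
  have : \forall m \near F, `|0 - m.+1%:R^-1| <= ep by move/cvgrPdist_le : cm; exact.
  apply: filterS2 => m; rewrite !sub0r !normrN !ger0_norm ?invr_ge0 // => h1 h2.
  exact: le_trans h2 h1.
have cpen : pen o (x m 0%N) @[m --> F] --> 0.
  apply: (@squeeze_cvgr _ _ _ _ (fun=> 0) (fun m => w m + 320 * A ^+ 8 / (4 * m)%:R)).
  - by apply: filterS Fpen => m ->; rewrite pen_ge0.
  - exact: cvg_cst.
  - by rewrite -[X in _ --> X]addr0; exact: cvgD.
pose ep m : R := 2 * n%:R * `|x m 0%N - o|.
have cx : `|x m 0%N - o| @[m --> F] --> 0.
  apply/cvgrPdist_le => ee ee0.
  have e2 : 0 < ee ^+ 2 by rewrite exprn_gt0.
  have : \forall m \near F, `|0 - pen o (x m 0%N)| <= ee ^+ 2 by move/cvgrPdist_le : cpen; exact.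
  apply: filterS => m; rewrite !sub0r !normrN ger0_norm ?pen_ge0 // normr_id => h.
  by rewrite -ler_sqr ?nnegrE ?(ltW ee0) // (le_trans (pen_ge _ _) h).
have cep : ep m @[m --> F] --> 0.
  by rewrite -[X in _ --> X](mulr0 (2 * n%:R)); apply: cvgM => //; exact: cvg_cst.
have Fxd : \forall m \near F, `|x m 0%N - o| < d by exact: (cvgr_lt _ cx).
have Fds : \forall m \near F, dsol (K i) (l i) A e (4 * m) (x m) (T m) (ep m).
  near=> m.
  have [N0 [ax mx]] : (0 < 4 * m)%N /\ mini m (q m) by near: m.
  have [kM TT2] : kin (l i) (4 * m) e (x m) (T m) <= M / 2 /\ T m <= T2 / 2 by near: m.
  have xd : `|x m 0%N - o| < d by near: m.
  exact: (min_dsol (ok i) N0 e0 erefl rho0 (rr i) rho1 rhoC rhoM T1E OK ax mx kM TT2 TA vTA xd).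
have FT1 : \forall m \near F, T1 <= T m by apply: filterS Fq => m [a _]; exact: adm_T1 a.
have cK : compact (K i) by apply: cball_compact; rewrite mulr_ge0 // ltW.
have [T' [x' [v' [T1T' od]]]] := limit_ode (ok i) CA T10 cK UF Fds FT1 FN cep.
by exists i, T', x', v'; split=> //; exact: lt_le_trans T10 T1T'.
Unshelve. all: by end_near.
Qed.

End Assembly.

(** * Lagrangians in a chart *)

Section Bilinear.
Variables (R : realType) (n : nat).
Local Notation V := 'rV[R]_n.

Definition bil (A : 'M[R]_n) (u v : V) : R := (u *m A *m v^T) 0 0.
Definition pair (p v : V) : R := (p *m v^T) 0 0.

Lemma bil_sum A u v : bil A u v = \sum_i \sum_j u 0 i * A i j * v 0 j.
Proof.
rewrite /bil mxE exchange_big /=; apply: eq_bigr => j _.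
by rewrite !mxE mulr_suml.
Qed.

Lemma pair_sum p v : pair p v = \sum_j p 0 j * v 0 j.
Proof. by rewrite /pair mxE; apply: eq_bigr => j _; rewrite mxE. Qed.

Lemma bil_linl A a u u' v : bil A (a *: u + u') v = a * bil A u v + bil A u' v.
Proof. by rewrite /bil !mulmxDl -!scalemxAl !mxE. Qed.

Lemma bilZ A a b v w : bil A (a *: v) (b *: w) = a * b * bil A v w.
Proof. by rewrite /bil linearZ /= -!scalemxAl -scalemxAr scalerA mxE. Qed.

Lemma bil_linA a A A' u v : bil (a *: A + A') u v = a * bil A u v + bil A' u v.
Proof. by rewrite /bil mulmxDr mulmxDl -scalemxAr -scalemxAl !mxE. Qed.

Lemma bilB A A' u v : bil (A - A') u v = bil A u v - bil A' u v.
Proof. by rewrite addrC -scaleN1r bil_linA mulN1r addrC. Qed.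

Lemma bil_tr A u v : bil A^T u v = bil A v u.
Proof.
rewrite !bil_sum exchange_big; apply: eq_bigr => j _; apply: eq_bigr => i _.
by rewrite mxE; ring.
Qed.

Lemma pair_linr p a v v' : pair p (a *: v + v') = a * pair p v + pair p v'.
Proof. by rewrite /pair linearD linearZ /= mulmxDr -scalemxAr !mxE. Qed.

Lemma pair_linl a p p' v : pair (a *: p + p') v = a * pair p v + pair p' v.
Proof. by rewrite /pair mulmxDl -scalemxAl !mxE. Qed.

Lemma pairB p p' v : pair (p - p') v = pair p v - pair p' v.
Proof. by rewrite addrC -scaleN1r pair_linl mulN1r addrC. Qed.

Let sumc (c : R) : \sum_(i < n) c = n%:R * c.
Proof. by rewrite sumr_const card_ord mulr_natl. Qed.

Lemma bil_le A u v : `|bil A u v| <= n%:R ^+ 2 * `|A| * `|u| * `|v|.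
Proof.
have -> : n%:R ^+ 2 * `|A| * `|u| * `|v| = \sum_(i < n) \sum_(j < n) `|u| * `|A| * `|v|.
  by rewrite !sumc; ring.
rewrite bil_sum (le_trans (ler_norm_sum _ _ _)) // ler_sum // => i _.
rewrite (le_trans (ler_norm_sum _ _ _)) // ler_sum // => j _.
by rewrite !normrM !ler_pM ?mulr_ge0 // entry_norm.
Qed.

Lemma pair_le p v : `|pair p v| <= n%:R * `|p| * `|v|.
Proof.
have -> : n%:R * `|p| * `|v| = \sum_(i < n) `|p| * `|v|.
  by rewrite sumc; ring.
rewrite pair_sum (le_trans (ler_norm_sum _ _ _)) // ler_sum // => i _.
by rewrite !normrM ler_pM // entry_norm.
Qed.

Lemma entry_cvg (T : Type) (F : set_system T) (FF : Filter F) p q (A : T -> 'M[R]_(p, q)) (A0 : 'M[R]_(p, q)) i j :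
  A @ F --> A0 -> A t i j @[t --> F] --> A0 i j.
Proof. by move=> cA; exact: (cvg_comp A (fun M : 'M[R]_(p, q) => M i j) cA (@entry_continuous R p q i j A0)). Qed.

Lemma bil_cvg (T : Type) (F : set_system T) (FF : Filter F) (A : T -> 'M[R]_n) (u v : T -> V) (A0 : 'M[R]_n) (u0 v0 : V) :
  (forall i j, A t i j @[t --> F] --> A0 i j) -> u @ F --> u0 -> v @ F --> v0 ->
  bil (A t) (u t) (v t) @[t --> F] --> bil A0 u0 v0.
Proof.
move=> cA cu cv.
have -> : (fun t => bil (A t) (u t) (v t)) = (fun t => \sum_i \sum_j u t 0 i * A t i j * v t 0 j).
  by apply/funext => t; exact: bil_sum.
rewrite bil_sum; apply: cvg_sumr => i; apply: cvg_sumr => j.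
by apply: cvgM; [apply: cvgM => //|]; exact: entry_cvg.
Qed.

Lemma pair_cvg (T : Type) (F : set_system T) (FF : Filter F) (p v : T -> V) (p0 v0 : V) :
  (forall j, p t 0 j @[t --> F] --> p0 0 j) -> v @ F --> v0 ->
  pair (p t) (v t) @[t --> F] --> pair p0 v0.
Proof.
move=> cp cv.
have -> : (fun t => pair (p t) (v t)) = (fun t => \sum_j p t 0 j * v t 0 j).
  by apply/funext => t; exact: pair_sum.
rewrite pair_sum; apply: cvg_sumr => j.
by apply: cvgM => //; exact: entry_cvg.
Qed.

Lemma bil_der (A : R -> 'M[R]_n) (A' : 'M[R]_n) u v (t : R) :
  (forall i j, is_derive t 1 (fun s => A s i j : R) (A' i j)) ->
  is_derive t 1 (fun s => bil (A s) u v) (bil A' u v).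
Proof.
move=> dA; rewrite bil_sum.
have -> : (fun s => bil (A s) u v) = \sum_i \sum_j (fun s => (u 0 i * v 0 j) *: (A s i j : R^o)).
  apply/funext => s; rewrite bil_sum fct_sumE; apply: eq_bigr => i _.
  by rewrite fct_sumE; apply: eq_bigr => j _; rewrite /GRing.scale /=; ring.
apply: is_derive_sum => i; apply: is_derive_sum => j.
have -> : u 0 i * A' i j * v 0 j = (u 0 i * v 0 j) *: (A' i j : R^o) by rewrite /GRing.scale /=; ring.
exact: (@is_deriveZ R R^o R^o (fun s => A s i j) (u 0 i * v 0 j) t 1 (A' i j) (dA i j)).
Qed.

Lemma pair_der (p : R -> V) (p' : V) v (t : R) :
  (forall j, is_derive t 1 (fun s => p s 0 j : R) (p' 0 j)) ->
  is_derive t 1 (fun s => pair (p s) v) (pair p' v).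
Proof.
move=> dp; rewrite pair_sum.
have -> : (fun s => pair (p s) v) = \sum_j (fun s => (v 0 j) *: (p s 0 j : R^o)).
  apply/funext => s; rewrite pair_sum fct_sumE; apply: eq_bigr => j _.
  by rewrite /GRing.scale /=; ring.
apply: is_derive_sum => j.
have -> : p' 0 j * v 0 j = v 0 j *: (p' 0 j : R^o) by rewrite /GRing.scale /=; ring.
exact: (@is_deriveZ R R^o R^o (fun s => p s 0 j) (v 0 j) t 1 (p' 0 j) (dp j)).
Qed.

End Bilinear.

Section ChartLagrangian.
Variables (R : realType) (n : nat).
Local Notation V := 'rV[R]_n.

(** Entrywise, so that the entries are known without a differentiability hypothesis; [dmxE]
    identifies it with the derivative of the matrix-valued map where that exists. *)
Definition dmx p q (f : V -> 'M[R]_(p, q)) (y w : V) : 'M[R]_(p, q) :=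
  \matrix_(i, j) 'D_w (fun z => f z i j : R) y.

Definition mklag (G : V -> 'M[R]_n) (L : V -> V) : lag R n := {|
  lB := fun y => bil (G y);
  lB1 := fun y w => bil (dmx G y w);
  lL := fun y => pair (L y);
  lL1 := fun y w => pair (dmx L y w) |}.

Lemma D_cvg (U : set V) (f : V -> R) (T : Type) (F : set_system T) (FF : Filter F)
    (y w : T -> V) (y0 w0 : V) : open U -> Ck_on 1 U f -> U y0 ->
  y @ F --> y0 -> w @ F --> w0 -> 'D_(w t) f (y t) @[t --> F] --> 'D_w0 f y0.
Proof.
move=> oU [_ df] Uy cy cw.
have d1 v z : U z -> derivable f z v by move=> Uz; have [+ _] := df v; exact.
have d2 v z : U z -> {for z, continuous (fun y => 'D_v f y)} by move=> Uz; have [_ [+ _]] := df v; exact.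
have E z v : U z -> 'D_v f z = \sum_i v 0 i * 'D_(delta_mx 0 i) f z.
  by move=> Uz; exact: (derive_coord_sum oU d1 d2).
have nU : \forall t \near F, U (y t) by apply: cy; exact: open_nbhs_nbhs.
apply: cvg_trans (_ : (fun t => \sum_i w t 0 i * 'D_(delta_mx 0 i) f (y t)) @ F --> _).
  by apply: near_eq_cvg; apply: filterS nU => t Ut; rewrite E.
rewrite E //; apply: cvg_sumr => i; apply: cvgM; first exact: entry_cvg.
exact: (cvg_comp y (fun z => 'D_(delta_mx 0 i) f z) cy (d2 _ _ Uy)).
Qed.

Lemma dmxE p q (f : V -> 'M[R]_(p, q)) y w : derivable f y w -> dmx f y w = 'D_w f y.
Proof. by move=> d; rewrite derive_mx //; apply/matrixP => i j; rewrite !mxE. Qed.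

Lemma dmx_lin p q (U : set V) (f : V -> 'M[R]_(p, q)) y a w w' : open U -> Ck_on 1 U f -> U y ->
  dmx f y (a *: w + w') = a *: dmx f y w + dmx f y w'.
Proof.
move=> oU cf Uy; apply/matrixP => i j; rewrite !mxE.
have [_ df] := Ck_on_entry i j oU cf.
have d1 v z : U z -> derivable (fun z => f z i j : R) z v by move=> Uz; have [+ _] := df v; exact.
have d2 v z : U z -> {for z, continuous (fun y => 'D_v (fun z => f z i j : R) y)}.
  by move=> Uz; have [_ [+ _]] := df v; exact.
by rewrite (deriveDdir oU d1 d2) // (derivableZdir _ (d1 w y Uy)).2.
Qed.

Lemma dmx_line p q (U : set V) (f : V -> 'M[R]_(p, q)) y w (t : R) i j : open U -> Ck_on 1 U f ->
  U (y + t *: w) -> is_derive t 1 (fun s => f (y + s *: w) i j : R) (dmx f (y + t *: w) w i j).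
Proof.
move=> oU cf Uy; rewrite mxE.
have [_ df] := Ck_on_entry i j oU cf.
by apply: (is_derive_line (f := fun z => f z i j : R)); have [+ _] := df w; exact.
Qed.

Lemma dmx_cvg p q (U : set V) (f : V -> 'M[R]_(p, q)) (T : Type) (F : set_system T) (FF : Filter F)
    (y w : T -> V) (y0 w0 : V) i j : open U -> Ck_on 1 U f -> U y0 ->
  y @ F --> y0 -> w @ F --> w0 -> dmx f (y t) (w t) i j @[t --> F] --> dmx f y0 w0 i j.
Proof.
move=> oU cf Uy cy cw; rewrite mxE.
have -> : (fun t => dmx f (y t) (w t) i j) = (fun t => 'D_(w t) (fun z => f z i j : R) (y t)).
  by apply/funext => t; rewrite mxE.
exact: (D_cvg FF oU (Ck_on_entry i j oU cf)).
Qed.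

(** The quadratic form attains a positive minimum on the product of [K] with the unit sphere, and
    homogeneity extends the bound to all vectors. *)
Lemma elliptic (K U : set V) (G : V -> 'M[R]_n) : compact K -> K `<=` U ->
  (forall y, U y -> {for y, continuous G}) ->
  (forall y v, U y -> v != 0 -> 0 < bil (G y) v v) ->
  exists c, forall y v, K y -> `|v| ^+ 2 <= c * bil (G y) v v.
Proof.
move=> cK KU cG pG.
pose S : set V := [set v | `|v| = 1].
have cS : compact S.
  apply: bounded_closed_compact.
    exists 1; split; first exact: num_real.
    by move=> B B1 v; rewrite /S /= => ->; exact: ltW.
  by apply: (@preimage_closed _ _ (fun v : V => `|v|) [set t : R | t = 1]);
    [move=> v _; exact: norm_continuous | exact: closed_eq].
have hom y v : v != 0 -> bil (G y) v v = `|v| ^+ 2 * bil (G y) (`|v|^-1 *: v) (`|v|^-1 *: v).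
  move=> v0; rewrite bilZ mulrA -expr2 -exprMn divff ?expr1n ?mul1r //.
  by rewrite normr_eq0.
have Sv v : v != 0 -> S (`|v|^-1 *: v).
  by move=> v0; rewrite /S /= normrZ ger0_norm ?invr_ge0 // mulVf // normr_eq0.
(* The product is empty when [K] is empty or 0 is the only vector; the constant 0 then works. *)
have [[[y1 v1] [/= K1 S1]]|no] := pselect ((K `*` S) !=set0); last first.
  exists 0 => y v Ky; have [->|v0] := eqVneq v 0; first by rewrite normr0 expr0n mul0r.
  by exfalso; apply: no; exists (y, `|v|^-1 *: v); split=> //; exact: Sv.
pose f (p : V * V) := bil (G p.1) p.2 p.2.
have [|||[y2 v2] [[/= K2 S2] _] Hm] := @compact_min_closed R _ (K `*` S) setT f (compact_setX cK cS).
- by exists (y1, v1).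
- move=> [y v] [/= Ky Sv']; apply: bil_cvg.
  + move=> i j; apply: entry_cvg.
    apply: (cvg_comp (fun p : V * V => p.1) G _ (cG y (KU _ Ky))); exact: cvg_fst.
  + exact: cvg_snd.
  + exact: cvg_snd.
- by [].
have v20 : v2 != 0 by apply/eqP => v0; move: S2; rewrite /S /= v0 normr0 => /esym/eqP; rewrite oner_eq0.
have m0 : 0 < f (y2, v2) by apply: pG => //; exact: KU.
exists (f (y2, v2))^-1 => y v Ky.
have [->|v0] := eqVneq v 0; first by rewrite normr0 expr0n mulr_ge0 ?invr_ge0 ?(ltW m0) // /bil mul0mx mul0mx mxE.
rewrite mulrC ler_pdivlMr // hom // ler_wpM2l ?exprn_ge0 //.
by apply: (Hm (y, `|v|^-1 *: v)); split=> //; split=> //; exact: Sv.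
Qed.

(** Every [C] above a threshold is allowed, so that one constant can serve finitely many charts.
    Passing from norms of matrices, which are largest entries, to the forms costs [n^2] for [lB] and
    [n] for [lL]. *)
Lemma mklag_ok (U : set V) (y0 : V) (r : R) (G : V -> 'M[R]_n) (L : V -> V) :
  open U -> 0 <= r -> cball y0 r `<=` U -> Ck_on 2 U G -> Ck_on 2 U L ->
  (forall y, (G y)^T = G y) -> (forall y v, U y -> v != 0 -> 0 < bil (G y) v v) ->
  exists C0, forall C, C0 <= C -> lag_ok U (cball y0 r) C (mklag G L).
Proof.
move=> oU r0 KU cG cL sG pG.
have [cg cg0 [g1 g2 g3 g4 g5]] := C2_bound r0 oU KU cG.
have [cl cl0 [l1 l2 l3 l4 l5]] := C2_bound r0 oU KU cL.
have [ce ell] := elliptic (@cball_compact _ _ y0 _ r0) KU (fun y Uy => cG.1 y Uy) pG.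
have cG1 := Ck_onW cG; have cL1 := Ck_onW cL.
have dG y w : cball y0 r y -> dmx G y w = 'D_w G y.
  by move=> Ky; apply: dmxE; have [+ _] := cG.2 w; apply; exact: KU.
have dL y w : cball y0 r y -> dmx L y w = 'D_w L y.
  by move=> Ky; apply: dmxE; have [+ _] := cL.2 w; apply; exact: KU.
pose nn : R := n%:R ^+ 2.
have nn0 : 0 <= nn by rewrite exprn_ge0.
exists (1 + nn * cg + n%:R * cl + `|ce|) => C HC.
have h1 : 0 <= nn * cg by rewrite mulr_ge0.
have h2 : 0 <= n%:R * cl by rewrite mulr_ge0.
have h3 := normr_ge0 ce; have h4 := ler_norm ce.
have C1 : 1 <= C by lra.
have C0 : 0 <= C by lra.
have CG : nn * cg <= C by lra.
have CL : n%:R * cl <= C by lra.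
have CE : ce <= C by lra.
have bb (A : 'M[R]_n) (b : R) (u v : V) : `|A| <= cg * b -> 0 <= b -> `|bil A u v| <= C * b * `|u| * `|v|.
  move=> Ab b0; apply: le_trans (bil_le A u v) _.
  rewrite !ler_wpM2r //; apply: (@le_trans _ _ (nn * (cg * b))); first by rewrite ler_wpM2l.
  by rewrite mulrA ler_wpM2r.
have pb (p : V) (b : R) (v : V) : `|p| <= cl * b -> 0 <= b -> `|pair p v| <= C * b * `|v|.
  move=> Ab b0; apply: le_trans (pair_le p v) _.
  rewrite !ler_wpM2r //; apply: (@le_trans _ _ (n%:R * (cl * b))); first by rewrite ler_wpM2l.
  by rewrite mulrA ler_wpM2r.
split=> //=.
- by move=> *; exact: bil_linl.
- by move=> y u v; rewrite -{1}sG bil_tr.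
- by move=> *; exact: bil_linl.
- move=> y w u v; rewrite -bil_tr; congr (bil _ _ _); apply/matrixP => i j; rewrite !mxE.
  by congr ('D_w _ y); apply/funext => z; rewrite -{1}sG mxE.
- by move=> y a w w' u v Uy; rewrite (dmx_lin _ _ _ oU cG1 Uy) bil_linA.
- by move=> *; exact: pair_linr.
- by move=> *; exact: pair_linr.
- by move=> y a w w' u Uy; rewrite (dmx_lin _ _ _ oU cL1 Uy) pair_linl.
- move=> y v Ky; apply: le_trans (ell _ _ Ky) _; rewrite ler_wpM2r //.
  by have [->|v0] := eqVneq v 0; [rewrite /bil !mul0mx mxE | apply: ltW; apply: pG => //; exact: KU].
- by move=> y u v Ky; rewrite -[C]mulr1; apply: bb => //; rewrite mulr1; exact: g1.
- by move=> y y' u v Ky Ky'; rewrite -bilB; apply: bb => //; exact: g3.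
- move=> y y' u v Ky Ky'; rewrite -!bilB dG //; apply: bb; rewrite ?exprn_ge0 //; exact: g5.
- by move=> y w u v Ky; rewrite dG //; apply: bb => //; exact: g2.
- move=> y y' w u v Ky Ky'; rewrite -bilB !dG // -[C * _ * `|w|]mulrA; apply: bb; rewrite ?mulr_ge0 //.
  by rewrite mulrA; exact: g4.
- by move=> y v Ky; rewrite -[C]mulr1; apply: pb => //; rewrite mulr1; exact: l1.
- by move=> y y' v Ky Ky'; rewrite -pairB; apply: pb => //; exact: l3.
- move=> y y' v Ky Ky'; rewrite -!pairB dL //; apply: pb; rewrite ?exprn_ge0 //; exact: l5.
- by move=> y w v Ky; rewrite dL //; apply: pb => //; exact: l2.
- move=> y y' w v Ky Ky'; rewrite -pairB !dL // -[C * _ * `|w|]mulrA; apply: pb; rewrite ?mulr_ge0 //.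
  by rewrite mulrA; exact: l4.
- by move=> y w u v t Uy; apply: bil_der => i j; exact: (dmx_line _ _ oU cG1).
- by move=> y w v t Uy; apply: pair_der => j; exact: (dmx_line _ _ oU cL1).
- move=> T F FF y u v y1 u0 v0 Uy cy cu cv; apply: bil_cvg => // i j.
  by apply: entry_cvg; exact: (cvg_comp y G cy (cG.1 _ Uy)).
- move=> T F FF y w u v y1 w0 u0 v0 Uy cy cw cu cv; apply: bil_cvg => // i j.
  exact: (dmx_cvg FF oU cG1 Uy cy cw).
- move=> T F FF y v y1 v0 Uy cy cv; apply: pair_cvg => // j.
  by apply: entry_cvg; exact: (cvg_comp y L cy (cL.1 _ Uy)).
- move=> T F FF y w v y1 w0 v0 Uy cy cw cv; apply: pair_cvg => // j.
  exact: (dmx_cvg FF oU cL1 Uy cy cw).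
Qed.

End ChartLagrangian.

(** * Sums, products and matrices of functions of class Ck *)

Section CkAlgebra.
Variables (R : realType) (n : nat).
Local Notation V := 'rV[R]_n.
Variable U : set V.
Hypothesis oU : open U.

Lemma Ck_on_cst (W : normedModType R) (a : W) k : Ck_on k U (fun=> a).
Proof.
elim: k a => [|k IH] a; first by split=> // y _; exact: cst_continuous.
split=> [y _|v]; first exact: cst_continuous.
split=> [y _|]; first exact: derivable_cst.
by apply: Ck_on_ext (IH 0) => // y _; rewrite derive_cst.
Qed.

Lemma Ck_on_add k (f g : V -> R) : Ck_on k U f -> Ck_on k U g -> Ck_on k U (fun y => f y + g y).
Proof.
elim: k f g => [|k IH] f g [cf df] [cg dg].
  by split=> // y Uy; apply: continuousD; [exact: cf | exact: cg].
split=> [y Uy|v]; first by apply: continuousD; [exact: cf | exact: cg].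
have [df1 cf1] := df v; have [dg1 cg1] := dg v.
split=> [y Uy|]; first by apply: derivableD; [exact: df1 | exact: dg1].
apply: Ck_on_ext (IH _ _ cf1 cg1) => // y; rewrite inE => Uy.
by rewrite (deriveD (df1 y Uy) (dg1 y Uy)).
Qed.

Lemma Ck_on_mul k (f g : V -> R) : Ck_on k U f -> Ck_on k U g -> Ck_on k U (fun y => f y * g y).
Proof.
elim: k f g => [|k IH] f g cf cg.
  by have [cf' _] := cf; have [cg' _] := cg; split=> // y Uy; apply: continuousM; [exact: cf' | exact: cg'].
have cfW := Ck_onW cf; have cgW := Ck_onW cg.
have [cf' df] := cf; have [cg' dg] := cg.
split=> [y Uy|v]; first by apply: continuousM; [exact: cf' | exact: cg'].
have [df1 cf1] := df v; have [dg1 cg1] := dg v.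
split=> [y Uy|]; first by apply: derivableM; [exact: df1 | exact: dg1].
apply: Ck_on_ext (Ck_on_add (IH _ _ cfW cg1) (IH _ _ cgW cf1)) => // y; rewrite inE => Uy.
by rewrite (deriveM (df1 y Uy) (dg1 y Uy)).
Qed.

Lemma Ck_on_sum (I : Type) (r : seq I) k (f : I -> V -> R) :
  (forall i, Ck_on k U (f i)) -> Ck_on k U (fun y => \sum_(i <- r) f i y).
Proof.
move=> cf; elim: r => [|i r IH].
  by apply: Ck_on_ext (Ck_on_cst (0 : R) k) => // y _; rewrite big_nil.
by apply: Ck_on_ext (Ck_on_add (cf i) IH) => // y _; rewrite big_cons.
Qed.

Lemma entry_derive (i : 'I_n) (c y v : V) : is_derive y v (fun z : V => z 0 i - c 0 i) (v 0 i).
Proof.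
have E : (fun h : R => h^-1 *: (((fun z : V => z 0 i - c 0 i) \o shift y) (h *: v) - (y 0 i - c 0 i))) @ (0 : R)^' --> v 0 i.
  apply: cvg_trans (_ : (fun=> v 0 i) @ (0 : R)^' --> _); last exact: cvg_cst.
  apply: near_eq_cvg; near=> h.
  have h0 : h != 0 by near: h; exact: nbhs_dnbhs_neq.
  rewrite /= !mxE; have -> : h * v 0 i + y 0 i - c 0 i - (y 0 i - c 0 i) = h * v 0 i by ring.
  by rewrite /GRing.scale /= mulKf.
split; first by apply/cvg_ex; exists (v 0 i).
exact: (cvg_lim _ E).
Unshelve. all: by end_near.
Qed.

Lemma Ck_on_coord (i : 'I_n) (c : V) k : Ck_on k U (fun y => y 0 i - c 0 i : R).
Proof.
have cc y : {for y, continuous (fun y : V => y 0 i - c 0 i : R)}.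
  by apply: (cvgB (F := nbhs y)); [exact: entry_continuous | exact: cvg_cst].
case: k => [|k]; first by split=> // y _; exact: cc.
split=> [y _|v]; first exact: cc.
split=> [y _|]; first by case: (entry_derive i c y v).
by apply: Ck_on_ext (Ck_on_cst (v 0 i : R) k) => // y _; have [_ ->] := entry_derive i c y v.
Qed.

Lemma mx_cvg (T : Type) (F : set_system T) (FF : Filter F) p q (f : T -> 'M[R]_(p, q)) (a : 'M[R]_(p, q)) :
  (forall i j, f t i j @[t --> F] --> a i j) -> f @ F --> a.
Proof.
move=> fa; apply/cvgrPdist_le => e e0.
have H : \forall t \near F, forall ij : 'I_p * 'I_q, `|a ij.1 ij.2 - f t ij.1 ij.2| <= e.
  apply: (filter_forall _ _) => -[i j] /=.
  by have /cvgrPdist_le/(_ _ e0) := fa i j.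
apply: filterS H => t H; apply: mx_norm_le; first exact: ltW.
by move=> i j; rewrite !mxE; exact: (H (i, j)).
Qed.

Lemma Ck_on_mx p q k (f : V -> 'M[R]_(p, q)) :
  (forall i j, Ck_on k U (fun y => f y i j : R)) -> Ck_on k U f.
Proof.
elim: k f => [|k IH] f cf.
  by split=> // y Uy; apply: (mx_cvg (F := nbhs y)) => i j; have [+ _] := cf i j; apply.
split=> [y Uy|v]; first by apply: (mx_cvg (F := nbhs y)) => i j; have [+ _] := cf i j; apply.
have dv y : U y -> derivable f y v.
  by move=> Uy; apply/derivable_mxP => i j; have [_ /(_ v)[+ _]] := cf i j; apply.
split=> //; apply: IH => i j; have [_ /(_ v)[_ cij]] := cf i j.
apply: Ck_on_ext cij => // y; rewrite inE => Uy.
by rewrite derive_mx ?mxE //; exact: dv.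
Qed.

End CkAlgebra.

Lemma dmx_entry (R : realType) (n p q : nat) (f : 'rV[R]_n -> 'M[R]_(p, q)) y w i j :
  dmx f y w i j = 'D_w (fun z => f z i j : R) y.
Proof. by rewrite mxE. Qed.

Lemma bil_antisym_sum (R : realType) (n : nat) (A : 'M[R]_n) (D : 'I_n -> 'I_n -> R) (u v : 'rV[R]_n) :
  (forall a b, D a b - D b a = A a b) ->
  \sum_a \sum_b u 0 a * D a b * v 0 b - \sum_a \sum_b v 0 a * D a b * u 0 b = bil A u v.
Proof.
move=> DA; rewrite bil_sum [X in _ - X]exchange_big -sumrB; apply: eq_bigr => a _.
rewrite -sumrB; apply: eq_bigr => b _; rewrite -DA; ring.
Qed.

(** * Integrals over the unit interval and the Poincare lemma *)

Section UnitIntegral.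
Variable R : realType.
Local Notation mu := (@lebesgue_measure R).

Definition cont01 (phi : R -> R) := forall s, s \in `[(0 : R), 1] -> {for s, continuous phi}.
Definition int01 (phi : R -> R) : R := \int[mu]_(s in `[0%R, 1%R]) phi s.

Let mI : measurable (`[0%R, 1%R]%classic : set (measurableTypeR R)).
Proof. exact: measurable_itv. Qed.

Let ci phi : cont01 phi -> mu.-integrable `[0%R, 1%R] (EFin \o phi).
Proof.
move=> c; apply: continuous_compact_integrable; first exact: segment_compact.
by apply/continuous_in_subspaceT => s; rewrite inE /=; exact: c.
Qed.

Lemma cont01Z a phi : cont01 phi -> cont01 (fun s => a * phi s).
Proof. by move=> c s /c cs; apply: (cvgM (F := nbhs s)); [exact: cvg_cst | exact: cs]. Qed.

Lemma cont01D phi psi : cont01 phi -> cont01 psi -> cont01 (fun s => phi s + psi s).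
Proof. by move=> c d s s01; apply: (cvgD (F := nbhs s)); [exact: c | exact: d]. Qed.

Lemma cont01B phi psi : cont01 phi -> cont01 psi -> cont01 (fun s => phi s - psi s).
Proof. by move=> c d s s01; apply: (cvgB (F := nbhs s)); [exact: c | exact: d]. Qed.

Lemma cont01X m phi : cont01 phi -> cont01 (fun s => s ^+ m * phi s).
Proof. by move=> c s /c cs; apply: (cvgM (F := nbhs s)); [exact: exprn_continuous | exact: cs]. Qed.

Lemma int01_ext phi psi : (forall s, s \in `[(0 : R), 1] -> phi s = psi s) -> int01 phi = int01 psi.
Proof. by move=> E; apply: eq_Rintegral => s; rewrite inE /=; exact: E. Qed.

Lemma int01Z a phi : cont01 phi -> int01 (fun s => a * phi s) = a * int01 phi.
Proof. by move=> /ci i; rewrite /int01 (RintegralZl a mI). Qed.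

Lemma int01D phi psi : cont01 phi -> cont01 psi ->
  int01 (fun s => phi s + psi s) = int01 phi + int01 psi.
Proof. by move=> /ci i /ci j; rewrite /int01 (RintegralD mI). Qed.

Lemma int01B phi psi : cont01 phi -> cont01 psi ->
  int01 (fun s => phi s - psi s) = int01 phi - int01 psi.
Proof. by move=> /ci i /ci j; rewrite /int01 (RintegralB mI). Qed.

Lemma int01_0 : int01 (fun=> 0) = 0.
Proof.
have c0 : cont01 (fun=> 0) by move=> s _; exact: cst_continuous.
have := int01Z 0 c0; rewrite (mul0r (int01 _)) => E.
by rewrite -[RHS]E; apply: int01_ext => s _; rewrite mul0r.
Qed.

Lemma int01_sum (J : Type) (r : seq J) (phi : J -> R -> R) : (forall j, cont01 (phi j)) ->
  int01 (fun s => \sum_(j <- r) phi j s) = \sum_(j <- r) int01 (phi j).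
Proof.
move=> c; suff [] : cont01 (fun s => \sum_(j <- r) phi j s) /\
  int01 (fun s => \sum_(j <- r) phi j s) = \sum_(j <- r) int01 (phi j) by [].
elim: r => [|j r [ch IH]].
  have -> : (fun s : R => \sum_(j <- [::]) phi j s) = (fun=> 0) by apply/funext => s; rewrite big_nil.
  by rewrite big_nil int01_0; split=> // s _; exact: cst_continuous.
have -> : (fun s : R => \sum_(j <- j :: r) phi j s) = (fun s => phi j s + \sum_(j <- r) phi j s).
  by apply/funext => s; rewrite big_cons.
by rewrite big_cons int01D // IH; split=> //; exact: cont01D.
Qed.

Lemma int01_ftc F F' : cont01 F' -> (forall s : R, s \in `[(0 : R), 1] -> is_derive s 1 F (F' s)) ->
  int01 F' = F 1 - F 0.
Proof.
move=> c dF.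
have cF s : s \in `[(0 : R), 1] -> {for s, continuous F}.
  by move=> /dF[d _]; apply: differentiable_continuous; exact/derivable1_diffP.
have := @continuous_FTC2 R F' F 0 1 ltr01.
rewrite /int01 /Rintegral => -> //.
- by apply/continuous_in_subspaceT => s; rewrite inE /=; exact: c.
- split.
  + by move=> s s01; have [] := dF s (subset_itv_oo_cc s01).
  + by apply: cvg_at_right_filter; apply: cF; rewrite in_itv /= lexx ler01.
  + by apply: cvg_at_left_filter; apply: cF; rewrite in_itv /= lexx ler01.
- by move=> s s01; rewrite derive1E; have [_ ->] := dF s (subset_itv_oo_cc s01).
Qed.

Lemma int01_le phi C : cont01 phi -> (forall s, s \in `[(0 : R), 1] -> `|phi s| <= C) ->
  `|int01 phi| <= C.
Proof.
move=> c H; have ip := ci c.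
apply: le_trans (le_normr_Rintegral mI ip) _.
have cC : cont01 (fun=> C) by move=> s _; exact: cst_continuous.
have E : C = int01 (fun=> C).
  have dC (s : R) : is_derive s 1 (fun s : R => s * C) C.
    by apply: is_derive_eq; rewrite /GRing.scale /=; ring.
  by rewrite (int01_ftc cC (fun s _ => dC s)) mul1r mul0r subr0.
rewrite [leRHS]E; apply: (le_Rintegral mI) => //.
- exact: (integrable_norm ip).
- exact: ci cC.
Qed.

End UnitIntegral.

Section Segment.
Variables (R : realType) (n : nat).
Local Notation V := 'rV[R]_n.
Variables (c : V) (R0 : R).
Let U : set V := ball c R0.

Definition seg (y : V) (s : R) : V := c + s *: (y - c).
(** Moments of [f] along the segment from [c] to [y]. Differentiating in [y] brings out a factor
    [s], so that derivatives of moments are moments of higher order, and smoothness follows by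
    induction. *)
Definition smom (m : nat) (f : V -> R) (y : V) : R := int01 (fun s => s ^+ m * f (seg y s)).

Let oU : open U. Proof. exact: ball_open. Qed.

Lemma seg_U y s : U y -> s \in `[(0 : R), 1] -> U (seg y s).
Proof.
rewrite /U -ball_normE /= in_itv /= => cy /andP[s0 s1].
have -> : c - seg y s = s *: (c - y) by rewrite /seg opprD addrA subrr sub0r -scalerN opprB.
by rewrite normrZ ger0_norm //; apply: le_lt_trans cy; rewrite ler_piMl.
Qed.

Lemma seg_cont (f : V -> R) y : (forall z, U z -> {for z, continuous f}) -> U y ->
  cont01 (fun s : R => f (seg y s)).
Proof.
move=> cf Uy s s01.
apply: (@continuous_comp _ _ _ (seg y) f); last by apply: cf; exact: seg_U.
by apply: cvgD; [exact: cvg_cst | exact: cvgZr_tmp].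
Qed.

Lemma smom_int m (f : V -> R) y : (forall z, U z -> {for z, continuous f}) -> U y ->
  cont01 (fun s => s ^+ m * f (seg y s)).
Proof. by move=> cf Uy; apply: cont01X; exact: seg_cont. Qed.

Lemma smom_lip m (f : V -> R) (y y' : V) C : (forall z, U z -> {for z, continuous f}) -> U y -> U y' ->
  (forall s, s \in `[(0 : R), 1] -> `|f (seg y' s) - f (seg y s)| <= C) ->
  `|smom m f y' - smom m f y| <= C.
Proof.
move=> cf Uy Uy' H.
have i1 := smom_int (m := m) cf Uy; have i2 := smom_int (m := m) cf Uy'.
rewrite /smom -int01B //; apply: int01_le.
  exact: cont01B.
move=> s s01; rewrite -mulrBr normrM.
have C0 : 0 <= C := le_trans (normr_ge0 _) (H s s01).
rewrite -[C]mul1r; apply: ler_pM => //; last exact: H.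
move: s01; rewrite in_itv /= => /andP[s0 s1].
by rewrite normrX ger0_norm // exprn_ile1.
Qed.

Lemma seg_K r y s : cball c r y -> s \in `[(0 : R), 1] -> cball c r (seg y s).
Proof.
move=> Ky s01; apply: cball_convex => //; apply: cball_center.
exact: le_trans (normr_ge0 _) Ky.
Qed.

Lemma inner_ball y : U y -> exists r, [/\ 0 <= r, cball c r `<=` U & nbhs y (cball c r)].
Proof.
rewrite /U -ball_normE /= => cy.
exists ((`|c - y| + R0) / 2); split.
- rewrite divr_ge0 // addr_ge0 // (le_trans _ (ltW cy)) //.
- move=> z; rewrite /cball /ball_ /= distrC => /le_lt_trans; apply; lra.
- apply/nbhs_ballP; exists ((R0 - `|c - y|) / 2) => /=; first by rewrite divr_gt0 // subr_gt0.
  move=> z; rewrite -ball_normE /cball /= => yz.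
  have -> : z - c = - ((c - y) + (y - z)) by apply/rowP => i; rewrite !mxE; ring.
  rewrite normrN; apply: le_trans (ler_normD _ _) _; lra.
Qed.

Lemma segD y v h s : seg (y + h *: v) s - seg y s = (s * h) *: v.
Proof. by rewrite /seg; apply/rowP => i; rewrite !mxE; ring. Qed.

Lemma smom_cont m (f : V -> R) y : Ck_on 1 U f -> U y -> {for y, continuous (smom m f)}.
Proof.
move=> cf Uy; have [r [r0 KU yK]] := inner_ball Uy.
have [C C0 [_ _ lip]] := C1_bound r0 oU KU cf.
have [cf0 _] := cf.
apply/(cvgrPdist_le (F := nbhs y)) => e e0.
have [d d0 dP] : exists2 d : R, 0 < d & C * d <= e.
  have cp : 0 < C + 1 by rewrite ltr_wpDl.
  exists (e / (C + 1)); first by rewrite divr_gt0.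
  by rewrite mulrA ler_pdivrMr // mulrC ler_wpM2l ?(ltW e0) // lerDl.
have nb : \forall z \near y, `|y - z| <= d by move/cvgrPdist_le : (@cvg_id _ (nbhs y)); apply.
near=> z.
have Kz : cball c r z by near: z.
have Ky : cball c r y := nbhs_singleton yK.
apply: le_trans dP; apply: smom_lip => //; first exact: KU.
move=> s s01; apply: le_trans (lip _ _ (seg_K Kz s01) (seg_K Ky s01)) _.
rewrite ler_wpM2l //.
have -> : seg y s - seg z s = s *: (y - z) by rewrite /seg; apply/rowP => i; rewrite !mxE; ring.
move: s01; rewrite in_itv /= => /andP[s0 s1].
rewrite normrZ ger0_norm //; have : `|y - z| <= d by near: z.
by apply: le_trans; rewrite ler_piMl.
Unshelve. all: by end_near.
Qed.

(** Differentiation under the integral sign: the quadratic Taylor remainder of [f] is uniform on a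
    ball around [c] that contains the segments involved. *)
Lemma smom_der m (f : V -> R) y v : Ck_on 2 U f -> U y ->
  is_derive y v (smom m f) (smom m.+1 (fun z => 'D_v f z) y).
Proof.
move=> cf Uy; have [r [r0 KU yK]] := inner_ball Uy.
have [C C0 [_ _ _ _ tay]] := C2_bound_real r0 oU KU cf.
have [cf0 df] := cf; have [dfv cfv] := df v; have cfv0 := cfv.1.
have Ky : cball c r y := nbhs_singleton yK.
suff E : (fun h : R => h^-1 *: ((smom m f \o shift y) (h *: v) - smom m f y)) @ (0 : R)^'
    --> smom m.+1 (fun z => 'D_v f z) y.
  split; first by apply/cvg_ex; eexists; exact: E.
  exact: (cvg_lim _ E).
apply/cvgrPdist_le => e e0.
pose D := C * `|v| ^+ 2.
have D0 : 0 <= D by rewrite mulr_ge0 ?exprn_ge0.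
have [d d0 dP] : exists2 d : R, 0 < d & D * d <= e.
  have cp : 0 < D + 1 by rewrite ltr_wpDl.
  exists (e / (D + 1)); first by rewrite divr_gt0.
  by rewrite mulrA ler_pdivrMr // mulrC ler_wpM2l ?(ltW e0) // lerDl.
have nb : \forall h \near (0 : R)^', `|0 - h| <= d.
  by apply: nbhs_dnbhs; move/cvgrPdist_le : (@cvg_id _ (nbhs (0 : R))); apply.
have nK : \forall h \near (0 : R)^', cball c r (y + h *: v).
  apply: nbhs_dnbhs.
  have cy : y + h *: v @[h --> (0 : R)] --> y.
    rewrite -[X in _ --> X]addr0 -(scale0r v).
    by apply: cvgD; [exact: cvg_cst | exact: cvgZr_tmp].
  exact: (cy _ yK).
near=> h.
have h0 : h != 0 by near: h; exact: nbhs_dnbhs_neq.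
have hd : `|h| <= d by rewrite -normrN -sub0r; near: h.
have Kh : cball c r (y + h *: v) by near: h.
rewrite /= [h *: v + y]addrC.
have Uh := KU _ Kh.
have i1 := smom_int (m := m) cf0 Uy; have i2 := smom_int (m := m) cf0 Uh.
have i3 := smom_int (m := m.+1) cfv0 Uy.
have hn : 0 < `|h| by rewrite normr_gt0.
rewrite -(ler_pM2l hn) -normrM mulrBr /GRing.scale /= mulVKf //.
rewrite distrC /smom -(int01Z h i3) -(int01B i2 i1) -int01B; first last.
- exact: cont01Z.
- exact: cont01B.
apply: le_trans (_ : D * h ^+ 2 <= _); last first.
  rewrite -[h ^+ 2]real_normK ?num_real // expr2 mulrCA ler_wpM2l //.
  by apply: le_trans dP; rewrite ler_wpM2l.
apply: int01_le.
  by apply: cont01B; [exact: cont01B | exact: cont01Z].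
move=> s s01.
have := tay _ _ (seg_K Ky s01) (seg_K Kh s01).
rewrite segD => T.
have ds : derivable f (seg y s) v by apply: dfv; exact: KU (seg_K Ky s01).
rewrite (derivableZdir (s * h) ds).2 normrZ exprMn in T.
have -> : s ^+ m * f (seg (y + h *: v) s) - s ^+ m * f (seg y s) - h * (s ^+ m.+1 * 'D_v f (seg y s))
   = s ^+ m * (f (seg (y + h *: v) s) - f (seg y s) - (s * h) *: ('D_v f (seg y s) : R^o)).
  by rewrite /GRing.scale /= exprS; ring.
rewrite normrM -[leRHS]mul1r; move: (s01); rewrite in_itv /= => /andP[s0 s1].
apply: ler_pM => //; first by rewrite normrX ger0_norm // exprn_ile1.
apply: le_trans T _; rewrite /D normrM exprMn real_normK ?num_real // [`|h| ^+ 2]real_normK ?num_real //.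
have s2 : s ^+ 2 <= 1 by rewrite exprn_ile1.
have q0 : 0 <= C * `|v| ^+ 2 * h ^+ 2 by rewrite mulr_ge0 // sqr_ge0.
have := ler_wpM2l q0 s2; lra.
Unshelve. all: by end_near.
Qed.

Lemma smom_Ck k m (f : V -> R) : smooth_on U f -> Ck_on k U (smom m f).
Proof.
elim: k m f => [|k IH] m f sf; first by split=> // y Uy; apply: smom_cont => //; exact: sf.
split=> [y Uy|v]; first by apply: smom_cont => //; exact: sf.
have d y : U y -> is_derive y v (smom m f) (smom m.+1 (fun z => 'D_v f z) y).
  by move=> Uy; apply: smom_der => //; exact: sf.
split=> [y /d[]|] //.
apply: Ck_on_ext (IH m.+1 (fun z => 'D_v f z) _) => //.
  by move=> y; rewrite inE => /d[_ ->].
by move=> j; have [_ /(_ v)[]] := sf j.+1.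
Qed.

(** Fundamental theorem of calculus for [s^2 f (c + s (y - c))] on the unit interval. *)
Lemma smom_ftc (f : V -> R) y : smooth_on U f -> U y ->
  2 * smom 1 f y + smom 2 (fun z => 'D_(y - c) f z) y = f y.
Proof.
move=> sf Uy.
have cf : forall z, U z -> {for z, continuous f} by have [] := sf 0%N.
have [_ /(_ (y - c))[df [cdf _]]] := sf 1%N.
have i1 := smom_int (m := 1) cf Uy; have i2 := smom_int (m := 2) cdf Uy.
pose F (s : R) : R := s ^+ 2 * f (seg y s).
pose F' (s : R) : R := 2 * (s ^+ 1 * f (seg y s)) + s ^+ 2 * 'D_(y - c) f (seg y s).
have dF s : s \in `[(0 : R), 1] -> is_derive s 1 F (F' s).
  move=> s01; have d1 : is_derive s 1 (fun s : R => f (seg y s)) ('D_(y - c) f (seg y s)).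
    by apply: is_derive_line; apply: df; exact: seg_U.
  apply: is_derive_eq; rewrite /F' /GRing.scale /=; ring.
rewrite /smom -(int01Z 2 i1) -(int01D (cont01Z i1) i2) (int01_ftc (F := F)) //.
  by rewrite /F expr1n mul1r expr0n mul0r subr0 /seg scale1r addrC subrK.
by apply: cont01D i2; exact: cont01Z.
Qed.

(* The classical homotopy operator of the Poincare lemma. *)
Definition primitive (W : V -> 'M[R]_n) (y : V) : V :=
  \row_j \sum_i (y 0 i - c 0 i) * smom 1 (fun z => W z i j) y.

Lemma primitive_Ck k (W : V -> 'M[R]_n) : smooth_on U W -> Ck_on k U (primitive W).
Proof.
move=> sW; apply: Ck_on_mx => // i j.
apply: Ck_on_ext (Ck_on_sum oU (index_enum 'I_n) (fun i : 'I_n => Ck_on_mul oU (Ck_on_coord oU i c k)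
   (smom_Ck k 1 (fun l => Ck_on_entry i j oU (sW l))))) => // y _.
by rewrite !mxE.
Qed.

Lemma primitive_der (W : V -> 'M[R]_n) y (v : V) j : smooth_on U W -> U y ->
  dmx (primitive W) y v 0 j = \sum_i (v 0 i * smom 1 (fun z => W z i j) y
     + (y 0 i - c 0 i) * smom 2 (fun z => 'D_v (fun z => W z i j) z) y).
Proof.
move=> sW Uy; rewrite mxE.
have -> : (fun z : V => primitive W z 0 j : R) = \sum_(i < n) (fun z : V => (z 0 i - c 0 i) * smom 1 (fun z => W z i j) z).
  by apply/funext => z; rewrite mxE fct_sumE.
have D i : is_derive y v (fun z => (z 0 i - c 0 i) * smom 1 (fun z => W z i j) z)
   (v 0 i * smom 1 (fun z => W z i j) y
     + (y 0 i - c 0 i) * smom 2 (fun z => 'D_v (fun z => W z i j) z) y).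
  have d1 := entry_derive i c y v.
  have d2 := smom_der 1 v (Ck_on_entry i j oU (sW 2%N)) Uy.
  apply: is_derive_eq; rewrite /GRing.scale /=; ring.
by have [_ ->] := @is_derive_sum _ _ _ _ _ y v _ D.
Qed.

(** On basis vectors [a], [b] the left-hand side is twice the first moment of [W a b] plus the sum
    over [i] of [y i - c i] times the second moment of [D_a W i b - D_b W i a]. Closedness and
    antisymmetry turn this difference into [D_i W a b], and [smom_ftc] adds up the two terms. *)
Lemma poincare (W : V -> 'M[R]_n) y (u v : V) : smooth_on U W -> (forall y, (W y)^T = - W y) ->
  (forall y, U y -> forall i j k, partial i (fun z => W z j k : R) y + partial j (fun z => W z k i : R) y
     + partial k (fun z => W z i j : R) y = 0) -> U y ->
  pair (dmx (primitive W) y u) v - pair (dmx (primitive W) y v) u = bil (W y) u v.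
Proof.
move=> sW aW cW Uy.
have oUy := oU.
have P1 : Ck_on 1 U (primitive W) := primitive_Ck 1 sW.
have basis (a b : 'I_n) : dmx (primitive W) y (delta_mx 0 a) 0 b - dmx (primitive W) y (delta_mx 0 b) 0 a = W y a b.
  apply: (eq_trans (congr2 (fun p q => p - q) (@primitive_der W y (delta_mx 0 a) b sW Uy)
    (@primitive_der W y (delta_mx 0 b) a sW Uy))).
  rewrite -sumrB.
  have aWe z i j : W z i j = - W z j i by rewrite -[in LHS](trmxK (W z)) aW !mxE.
  have sab : smooth_on U (fun z => W z a b : R) by move=> l; exact: Ck_on_entry.
  have cab : Ck_on 1 U (fun z => W z a b : R) by exact: sab.
  rewrite -(smom_ftc sab Uy).
  have E2 : smom 2 (fun z => 'D_(y - c) (fun z => W z a b : R) z) y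
     = \sum_i (y 0 i - c 0 i) * smom 2 (fun z => partial i (fun z => W z a b : R) z) y.
    have [_ dab] := cab.
    have d1 w z : U z -> derivable (fun z => W z a b : R) z w by move=> Uz; have [+ _] := dab w; exact.
    have d2 w z : U z -> {for z, continuous (fun y => 'D_w (fun z => W z a b : R) y)}.
      by move=> Uz; have [_ [+ _]] := dab w; exact.
    have ii i : cont01 (fun s => s ^+ 2 * partial i (fun z => W z a b : R) (seg y s)).
      by apply: smom_int => // z Uz; exact: d2.
    rewrite /smom; under [RHS]eq_bigr do rewrite -int01Z //.
    rewrite -int01_sum; last by move=> i; exact: cont01Z.
    apply: int01_ext => s s01.
    rewrite (derive_coord_sum oU d1 d2); last exact: seg_U.
    by rewrite mulr_sumr; apply: eq_bigr => i _; rewrite !mxE /partial; ring.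
  rewrite E2.
  have anti m i j : smom m (fun z => W z i j : R) y = - smom m (fun z => W z j i : R) y.
    rewrite /smom -mulN1r -int01Z; last first.
      exact: (smom_int (f := fun z => W z j i : R) (Ck_on_entry j i oU (sW 0%N)).1 Uy).
    by apply: int01_ext => s _; rewrite (aWe _ i j); ring.
  rewrite (eq_bigr (fun i => ((delta_mx 0 a : V) 0 i * smom 1 (fun z => W z i b : R) y - (delta_mx 0 b : V) 0 i * smom 1 (fun z => W z i a : R) y)
    + (y 0 i - c 0 i) * smom 2 (fun z => partial i (fun z => W z a b : R) z) y)); last first.
    move=> i _.
    have -> : smom 2 (fun z => partial i (fun z => W z a b : R) z) y
     = smom 2 (fun z => 'D_(delta_mx 0 a) (fun z => W z i b : R) z) y - smom 2 (fun z => 'D_(delta_mx 0 b) (fun z => W z i a : R) z) y.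
      rewrite /smom -int01B.
      - apply: int01_ext => s s01; rewrite -mulrBr; congr (_ * _).
        have := cW _ (seg_U Uy s01) i a b.
        have -> : (fun z => W z b i : R) = - (fun z => W z i b : R).
          by apply/funext => z; rewrite fctE /= aWe.
        rewrite /partial deriveN; first by move=> h; apply/eqP; rewrite -subr_eq0; apply/eqP; rewrite -h; ring.
        have [_ /(_ (delta_mx 0 a))[+ _]] := Ck_on_entry i b oU (sW 1%N); apply; exact: seg_U.
      - exact: (smom_int (f := fun z => 'D_(delta_mx 0 a) (fun z => W z i b : R) z) ((Ck_on_entry i b oU (sW 1%N)).2 _).2.1 Uy).
      - exact: (smom_int (f := fun z => 'D_(delta_mx 0 b) (fun z => W z i a : R) z) ((Ck_on_entry i a oU (sW 1%N)).2 _).2.1 Uy).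
    have ar (p q r t p' q' t' : R) : p * q + r * t - (p' * q' + r * t') = p * q - p' * q' + r * (t - t') by ring.
    exact: ar.
  rewrite big_split /= sumrB; congr (_ + _).
  rewrite (bigD1 a) //= big1 ?addr0; last by move=> i ia; rewrite mxE eqxx (negbTE ia) mul0r.
  rewrite (bigD1 b) //= big1 ?addr0; last by move=> i ib; rewrite mxE eqxx (negbTE ib) mul0r.
  by rewrite !mxE !eqxx !mul1r (anti 1%N b a) opprK mulr_natl mulr2n.
have expand (p q : V) : pair (dmx (primitive W) y p) q
    = \sum_a \sum_b p 0 a * dmx (primitive W) y (delta_mx 0 a) 0 b * q 0 b.
  rewrite pair_sum exchange_big /=; apply: eq_bigr => b _; rewrite -mulr_suml; congr (_ * _).
  have [_ dP] := Ck_on_entry 0 b oU P1.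
  have d1 w z : U z -> derivable (fun z => primitive W z 0 b : R) z w by move=> Uz; have [+ _] := dP w; exact.
  have d2 w z : U z -> {for z, continuous (fun y => 'D_w (fun z => primitive W z 0 b : R) y)}.
    by move=> Uz; have [_ [+ _]] := dP w; exact.
  apply: (eq_trans (dmx_entry (primitive W) y p 0 b)).
  apply: (eq_trans (derive_coord_sum oU d1 d2 p Uy)).
  by apply: eq_bigr => a _; congr (_ * _); exact/esym/dmx_entry.
apply: (eq_trans (congr2 (fun p q => p - q) (expand u v) (expand v u))).
exact: (bil_antisym_sum u v basis).
Qed.

End Segment.

(** * Test loops *)

Section Parallelogram.
Variables (R : realType) (n : nat).
Local Notation V := 'rV[R]_n.
Variables (o u w : V) (m : nat).
Hypothesis m0 : (0 < m)%N.

Let mR : 0 < m%:R :> R. Proof. by rewrite ltr0n. Qed.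

(** The corners are 0, [u], [u + w], [w] in this order. The default value 0, taken at index 4, is
    what closes [pgram] at [4 m]. *)
Definition side (s : nat) (t : R) : V :=
  match s with
  | 0 => t *: u
  | 1 => u + t *: w
  | 2 => w + (1 - t) *: u
  | 3 => (1 - t) *: w
  | _ => 0
  end.

Definition edge (s : nat) : V :=
  match s with 0 => u | 1 => w | 2 => - u | _ => - w end.

Definition pgram (a : R) (k : nat) : V := o + a *: side (k %/ m) ((k %% m)%:R / m%:R).

Lemma side_end s : (s < 4)%N -> side s 1 = side s.+1 0.
Proof.
case: s => [|[|[|[|]]]] //= _; rewrite ?scale1r ?scale0r ?addr0 ?subrr ?scale0r ?subr0 ?scale1r ?addr0 //.
by rewrite addrC.
Qed.

Lemma pgramE a s j : (s < 4)%N -> (j <= m)%N -> pgram a (s * m + j) = o + a *: side s (j%:R / m%:R).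
Proof.
move=> s4; rewrite leq_eqVlt => /orP[/eqP ->|jm].
  rewrite /pgram addnC -mulSn mulnK // modnMl mul0r divff ?gt_eqF //.
  by rewrite side_end.
by rewrite /pgram divnMDl // divn_small // addn0 modnMDl modn_small.
Qed.

Lemma side_diff s t h : (s < 4)%N -> side s (t + h) - side s t = h *: edge s.
Proof.
by case: s => [|[|[|[|]]]] //= _; apply/rowP => i; rewrite !mxE; ring.
Qed.

Lemma dl_pgram a s j : (s < 4)%N -> (j < m)%N -> dl (pgram a) (s * m + j) = (a / m%:R) *: edge s.
Proof.
move=> s4 jm; rewrite /dl -addnS pgramE // pgramE ?(ltnW jm) //.
rewrite opprD addrACA subrr add0r -scalerBr -natr1 mulrDl mul1r side_diff //.
by rewrite scalerA.
Qed.

Lemma pgram0 a : pgram a 0 = o.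
Proof. by have := @pgramE a 0 0 isT (leq0n m); rewrite mul0n mul0r /= scale0r scaler0 addr0. Qed.

Lemma pgram_loop a : pgram a (4 * m) = pgram a 0.
Proof. by rewrite pgram0 /pgram mulnK // scaler0 addr0. Qed.

Lemma sum_sides (f : nat -> R) :
  \sum_(k < 4 * m) f k = \sum_(j < m) \sum_(s < 4) f (s * m + j)%N.
Proof.
rewrite exchange_big /= -!(big_mkord xpredT) /=.
have split4 N : \sum_(0 <= k < N * m) f k = \sum_(0 <= s < N) \sum_(j < m) f (s * m + j)%N.
  elim: N => [|N IH]; first by rewrite mul0n !big_geq.
  rewrite big_nat_recr //= -IH mulSn (@big_cat_nat _ _ _ (N * m)) ?leq_addl //=; congr (_ + _).
  rewrite -{1}[(N * m)%N]add0n big_addn addnK big_mkord.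
  by apply: eq_bigr => j _; rewrite addnC.
by rewrite split4 big_mkord.
Qed.

Variable B : R.
Hypothesis uB : `|u| <= B.
Hypothesis wB : `|w| <= B.

Lemma edge_le s : `|edge s| <= B.
Proof. by case: s => [|[|[|]]] *; rewrite /= ?normrN. Qed.

Lemma side_le s (t : R) : 0 <= t <= 1 -> `|side s t| <= 2 * B.
Proof.
move=> /andP[t0 t1]; have B0 : 0 <= B := le_trans (normr_ge0 _) uB.
have sc (c : R) (v : V) : 0 <= c -> c <= 1 -> `|v| <= B -> `|c *: v| <= B.
  by move=> c0 c1 vB; rewrite normrZ ger0_norm // -[B]mul1r ler_pM.
have h1 : 0 <= 1 - t by rewrite subr_ge0.
have h2 : 1 - t <= 1 by rewrite lerBlDr lerDl.
case: s => [|[|[|[|s]]]] /=.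
- by apply: le_trans (sc t u t0 t1 uB) _; rewrite ler_peMl // ler1n.
- by apply: le_trans (ler_normD _ _) _; rewrite mulr_natl mulr2n lerD // sc.
- by apply: le_trans (ler_normD _ _) _; rewrite mulr_natl mulr2n lerD // sc.
- by apply: le_trans (sc (1 - t) w h1 h2 wB) _; rewrite ler_peMl // ler1n.
- by rewrite normr0 mulr_ge0.
Qed.

Lemma pgram_le a k : 0 <= a -> `|pgram a k - o| <= 2 * a * B.
Proof.
move=> a0; rewrite /pgram addrC addKr normrZ ger0_norm // (_ : 2 * a * B = a * (2 * B)); last by ring.
rewrite ler_wpM2l //; apply: side_le; rewrite divr_ge0 //= ler_pdivrMr // mul1r ler_nat.
exact: ltnW (ltn_pmod _ m0).
Qed.

Lemma sqn_pgram a : sqn (4 * m) (pgram a) <= 16 * a ^+ 2 * B ^+ 2.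
Proof.
rewrite /sqn (sum_sides (fun k => `|dl (pgram a) k| ^+ 2)).
apply: (@le_trans _ _ ((4 * m)%:R * \sum_(j < m) \sum_(s < 4) (a / m%:R) ^+ 2 * B ^+ 2)).
  rewrite ler_wpM2l //; apply: ler_sum => j _; apply: ler_sum => s _.
  rewrite dl_pgram // normrZ exprMn real_normK ?num_real // ler_wpM2l ?sqr_ge0 //.
  by rewrite ler_sqr ?nnegrE ?edge_le // (le_trans (normr_ge0 _) uB).
rewrite !sumr_const !card_ord -mulrnA -[X in _ * X]mulr_natl !natrM.
by rewrite le_eqVlt; apply/orP; left; apply/eqP; field; rewrite gt_eqF.
Qed.

Variables (U K : set V) (C : R) (l : lag R n).
Hypothesis ok : lag_ok U K C l.
Hypothesis Ko : K o.

(** A left-endpoint Riemann sum of a bilinear form around the parallelogram. In the integral the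
    symmetric part cancels and [om] remains; the endpoint rule adds an error proportional to
    [1 / m]. *)
Lemma flux_pgram a : flux l (4 * m) (pgram a) =
  a ^+ 2 * (om l o u w - (lL1 l o u u + lL1 l o w w) / m%:R).
Proof.
have Uo := lag_sub ok Ko.
have bD p q v : lL1 l o (p + q) v = lL1 l o p v + lL1 l o q v.
  by rewrite -[p]scale1r (lL1_linw ok) // mul1r scale1r.
have bN p v : lL1 l o p (- v) = - lL1 l o p v by rewrite -scaleN1r (lL1Z ok) mulN1r.
have bZ c p v : lL1 l o (c *: p) v = c * lL1 l o p v by exact: (lL1Zw ok).
rewrite /flux (sum_sides (fun k => lL1 l (pgram a 0) (vv (pgram a) k) (dl (pgram a) k))).
pose c := lL1 l o u u + lL1 l o w w.
rewrite (eq_bigr (fun j : 'I_m => a ^+ 2 / m%:R * (om l o u w - c + 2 * c / m%:R * j%:R))); last first.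
  move=> j _; have jm := ltn_ord j.
  rewrite !big_ord_recr big_ord0 /= add0r !dl_pgram // pgram0.
  rewrite /vv pgram0 !pgramE ?(ltnW jm) //.
  have oC (v : V) : o + v - o = v by rewrite addrC addKr.
  rewrite !oC !(lL1Z ok) !bZ /=.
  rewrite !bN !bD !bZ /c /om.
  by field; rewrite gt_eqF.
rewrite -mulr_sumr big_split /= -mulr_sumr sumr_const card_ord -mulr_natl.
have -> : \sum_(j < m) j%:R = m%:R * (m%:R - 1) / 2 :> R.
  elim: (m) => [|p IH]; first by rewrite big_ord0 mul0r mul0r.
  by rewrite big_ord_recr /= IH -natr1; field.
by rewrite -/c; field; rewrite gt_eqF.
Qed.

End Parallelogram.

Section TestLoop.
Variables (R : realType) (n : nat).
Local Notation V := 'rV[R]_n.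
Variables (U K : set V) (C : R) (l : lag R n).
Hypothesis ok : lag_ok U K C l.
Variables (o u w : V) (B r : R).
Hypothesis Ko : K o.
Hypothesis r0 : 0 < r.
Hypothesis KE : cball o r `<=` K.
Hypothesis uB : `|u| <= B.
Hypothesis wB : `|w| <= B.
Hypothesis B0 : 0 < B.
Variable beta : R.
Hypothesis betaE : om l o u w = beta.
Hypothesis beta0 : 0 < beta.

Variable T : R.
Hypothesis TE : T = 16 * C * B ^+ 2 / beta.

Let C1 : 1 <= C := lag_C1 ok.
Let C0 : 0 < C. Proof. exact: lt_le_trans ltr01 C1. Qed.
Let B2 : 0 < B ^+ 2. Proof. exact: exprn_gt0. Qed.

(** As a value of [om] on vectors of norm at most [B], [beta] is at most [2 C B^2]. *)
Lemma test_period_ge : 8 <= T.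
Proof.
rewrite TE ler_pdivlMr //.
have h1 := lL1_bd ok u w Ko; have h2 := lL1_bd ok w u Ko.
have h3 : C * `|u| * `|w| <= C * B * B by rewrite !ler_pM ?mulr_ge0 // ltW.
have h4 : C * `|w| * `|u| <= C * B * B by rewrite !ler_pM ?mulr_ge0 // ltW.
have h5 : beta <= `|lL1 l o u w| + `|lL1 l o w u|.
  by rewrite -betaE /om; apply: le_trans (ler_norm _) (ler_normB _ _).
rewrite expr2; lra.
Qed.

Let T0 : 0 < T. Proof. by apply: lt_le_trans test_period_ge. Qed.

Variables (e rho T2 M : R).
Hypothesis e0 : 0 < e.
Hypothesis rho0 : 0 < rho.
Hypothesis T2E : T2 = 80 * T.
Hypothesis ME : M = 80 * T * e.
Hypothesis rhoC : C ^+ 2 * rho * (1 + T2) <= 1 / 100.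
Hypothesis rhoM : 2 * C * T2 * M <= rho ^+ 2.
Hypothesis er : 16 * e * T * B ^+ 2 <= beta * r ^+ 2.
Variable m : nat.
Hypothesis m0 : (0 < m)%N.
Hypothesis mC : 100 * `|lL1 l o u u + lL1 l o w w| <= beta * m%:R.

Let mR : 0 < m%:R :> R. Proof. by rewrite ltr0n. Qed.
(** [T] makes [En / (2 T)] at most half of [beta a^2], which is about the flux. At [a1] the flux is
    about [4 e T] and [kin] at most [3 e T]; at [a1 / 10] the flux is about [4/100 e T] and [kin] at
    least [e T]. The Nehari function changes sign in between. *)
Let a1 := Num.sqrt (4 * e * T / beta).
Let a1E : a1 ^+ 2 = 4 * e * T / beta.
Proof. by rewrite sqr_sqrtr // divr_ge0 ?mulr_ge0 ?(ltW T0) ?(ltW e0) ?(ltW beta0). Qed.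
Let a10 : 0 < a1.
Proof. by rewrite sqrtr_gt0 divr_gt0 // !mulr_gt0. Qed.

Let x a := pgram o u w m a.
Let N := (4 * m)%N.

Let xK a : 0 <= a -> a <= a1 -> forall k, (k < N)%N -> K (x a k).
Proof.
move=> a0 aa k kN; apply: KE; rewrite /cball /=.
apply: le_trans (pgram_le o m0 uB wB k a0) _.
rewrite -ler_sqr ?nnegrE ?mulr_ge0 ?(ltW r0) ?(ltW B0) // !exprMn.
have h : a ^+ 2 <= a1 ^+ 2 by rewrite ler_sqr ?nnegrE // ltW.
rewrite a1E in h; rewrite -(ler_pM2l beta0); apply: le_trans er.
have := ler_wpM2r (ltW B2) h; rewrite -(ler_pM2l beta0).
have -> : beta * (4 * e * T / beta * B ^+ 2) = 4 * e * T * B ^+ 2 by field; rewrite gt_eqF.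
lra.
Qed.

Let kin_le a : 0 <= a -> a <= a1 -> kin l N e (x a) T <= beta * a ^+ 2 / 2 + e * T.
Proof.
move=> a0 aa; rewrite /kin lerD2r ler_pdivrMr ?mulr_gt0 //.
have En_le : En l N (x a) <= C * sqn N (x a).
  rewrite /sqn /En mulrCA ler_wpM2l // mulr_sumr ler_sum // => k _.
  have := lB_bd ok (dl (x a) k) (dl (x a) k) (xK a0 aa (ltn_ord k)).
  by rewrite -mulrA -expr2; apply: le_trans; exact: ler_norm.
apply: le_trans En_le _; have := sqn_pgram o m0 uB wB a => h.
apply: le_trans (ler_wpM2l (ltW C0) h) _.
have -> : beta * a ^+ 2 / 2 * (2 * T) = 16 * C * B ^+ 2 * a ^+ 2.
  by rewrite TE; field; rewrite gt_eqF.
by rewrite le_eqVlt; apply/orP; left; apply/eqP; ring.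
Qed.

Let kin_ge a : 0 <= a -> a <= a1 -> e * T <= kin l N e (x a) T.
Proof.
move=> a0 aa; rewrite lerDr; apply: divr_ge0; first exact: (En_ge0 ok (xK a0 aa)).
by rewrite mulr_ge0 // ltW.
Qed.

Let kin3 a : 0 <= a -> a <= a1 -> kin l N e (x a) T <= 3 * (e * T).
Proof.
move=> a0 aa; apply: le_trans (kin_le a0 aa) _.
have h : a ^+ 2 <= a1 ^+ 2 by rewrite ler_sqr ?nnegrE // ltW.
rewrite a1E -(ler_pM2l beta0) in h.
have E : beta * (4 * e * T / beta) = 4 * (e * T) by field; rewrite gt_eqF.
rewrite E in h; lra.
Qed.

Let eT : 0 < e * T. Proof. exact: mulr_gt0. Qed.

Let kinM a : 0 <= a -> a <= a1 -> kin l N e (x a) T <= M.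
Proof. by move=> a0 aa; apply: le_trans (kin3 a0 aa) _; rewrite ME; have := eT; lra. Qed.

Let TT2 : T <= T2.
Proof. by rewrite T2E; have := T0; lra. Qed.

Let sm a : 0 <= a -> a <= a1 -> small C N (x a) T <= 1 / 100.
Proof.
move=> a0 aa.
have M0 : 0 <= M by rewrite ME mulr_ge0 ?mulr_ge0 ?(ltW T0) ?(ltW e0).
have [_ pe] := K_per ok e0 rho0 rhoM (xK a0 aa) T0 TT2 (kinM a0 aa) M0.
apply: le_trans rhoC; apply: ler_pM.
- by rewrite mulr_ge0 ?exprn_ge0 ?per_ge0 ?(ltW C0).
- by rewrite addr_ge0 // ltW.
- by rewrite ler_wpM2l // exprn_ge0 ?(ltW C0).
- by rewrite lerD2l.
Qed.

Let flux_bd a : 99 / 100 * (beta * a ^+ 2) <= flux l N (x a) <= 101 / 100 * (beta * a ^+ 2).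
Proof.
rewrite (@flux_pgram R n o u w m m0 U K C l ok Ko a) betaE.
have mC' := mC; set c := (lL1 l o u u + lL1 l o w w) in mC' *.
have h : `|c / m%:R| <= beta / 100.
  rewrite normrM (ger0_norm (x := m%:R^-1)) ?invr_ge0 // ler_pdivrMr //.
  by have := mC'; lra.
rewrite ler_norml in h; have /andP[h1 h2] := h.
rewrite [beta * a ^+ 2]mulrC !(mulrCA _ (a ^+ 2)).
by apply/andP; split; rewrite ler_wpM2l ?sqr_ge0 //; lra.
Qed.

Let neh_cont : {within `[a1 / 10, a1], continuous (fun a => neh l N e (x a) T)}.
Proof.
apply/subspace_continuousP => a /=; rewrite in_itv /= => /andP[aa0 aa1].
have a0 : 0 <= a by apply: le_trans aa0; rewrite divr_ge0 // ltW.
apply: (neh_cvg ok (F := within `[a1 / 10, a1]%classic (nbhs a)) _ (y := x) (T := fun=> T)).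
- move=> k kN; apply: cvgD; first exact: cvg_cst.
  by apply: cvgZr_tmp; exact: (@cvg_within _ (nbhs a)).
- exact: cvg_cst.
- by move=> k kN; apply: (lag_sub ok); exact: xK.
- by rewrite gt_eqF.
Qed.

Lemma test_loop T1 : T1 <= 8 -> exists x, adm K l N e T1 T2 M (cball o r) x T /\
  act l N e x T <= 4 * T * e.
Proof.
move=> T18.
have a10' : 0 <= a1 / 10 by rewrite divr_ge0 // ltW.
have a1le : a1 / 10 <= a1 by have := a10; lra.
have est a (a0 : 0 <= a) (aa : a <= a1) := neh_kin ok (xK a0 aa) (pgram_loop o u w m0 a) T0 e0.
have G1 : 0 <= neh l N e (x (a1 / 10)) T.
  have := est _ a10' a1le; have := sm a10' a1le; have := kin_ge a10' a1le.
  have /andP[_ f2] := flux_bd (a1 / 10).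
  have E : beta * (a1 / 10) ^+ 2 = 4 / 100 * (e * T).
    by rewrite exprMn a1E; field; rewrite gt_eqF.
  rewrite E in f2.
  move=> k1 s1; rewrite ler_norml => /andP[n1 _].
  have kk : 4 * small C N (x (a1 / 10)) T * kin l N e (x (a1 / 10)) T <= 4 / 100 * kin l N e (x (a1 / 10)) T.
    by rewrite ler_wpM2r //; [exact: le_trans (ltW eT) k1 | lra].
  move: k1 n1 f2 kk eT; move: (neh _ _ _ _ _) (kin _ _ _ _ _) (flux _ _ _) (e * T) (_ * small _ _ _ _ * _).
  move=> a b c d f *; lra.
have G2 : neh l N e (x a1) T <= 0.
  have := est _ (ltW a10) (lexx a1); have := sm (ltW a10) (lexx a1).
  have := kin_ge (ltW a10) (lexx a1); have := kin3 (ltW a10) (lexx a1).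
  have /andP[f1 _] := flux_bd a1.
  have E : beta * a1 ^+ 2 = 4 * (e * T) by rewrite a1E; field; rewrite gt_eqF.
  rewrite E in f1.
  move=> k3 k1 s1; rewrite ler_norml => /andP[_ n1].
  have kk : 4 * small C N (x a1) T * kin l N e (x a1) T <= 4 / 100 * kin l N e (x a1) T.
    by rewrite ler_wpM2r //; [exact: le_trans (ltW eT) k1 | lra].
  move: k3 k1 n1 f1 kk eT; move: (neh _ _ _ _ _) (kin _ _ _ _ _) (flux _ _ _) (e * T) (_ * small _ _ _ _ * _).
  move=> a b c d f *; lra.
have [|a] := IVT a1le neh_cont (v := 0).
  by apply/andP; split; rewrite ?ge_min ?le_max; apply/orP; [right|left].
rewrite in_itv /= => /andP[aa0 aa1] Ga; have a0 := le_trans a10' aa0.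
exists (x a); split.
  split.
  - exact: pgram_loop.
  - exact: xK.
  - by rewrite /x pgram0 // /cball /= subrr normr0 ltW.
  - exact: le_trans T18 test_period_ge.
  - exact: TT2.
  - exact: kinM.
  - exact: Ga.
have := act_kin ok (xK a0 aa1) (pgram_loop o u w m0 a) T0 e0.
have := sm a0 aa1; have := kin_ge a0 aa1; have := kin3 a0 aa1.
have /andP[f1 _] := flux_bd a.
have f0 : 0 <= 99 / 100 * (beta * a ^+ 2) by rewrite !mulr_ge0 ?sqr_ge0 // ltW.
move=> k3 k1 s1; rewrite ler_norml => /andP[_ n1].
have kk : 2 * small C N (x a) T * kin l N e (x a) T <= 2 / 100 * kin l N e (x a) T.
  by rewrite ler_wpM2r //; [exact: le_trans (ltW eT) k1 | lra].
have -> : 4 * T * e = 4 * (e * T) by ring.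
move: k3 k1 n1 f1 kk eT f0; move: (act _ _ _ _ _) (kin _ _ _ _ _) (flux _ _ _) (e * T) (_ * small _ _ _ _ * _) (_ * (beta * _)).
move=> p b c d f g *; lra.
Qed.

End TestLoop.

(** * Charts of a manifold *)

Section Jacobian.
Variables (R : realType) (n : nat).
Local Notation V := 'rV[R]_n.

Lemma mul_jacobian p q (f : 'rV[R]_p -> 'rV[R]_q) y v :
  differentiable f y -> v *m 'J f y = 'D_v f y.
Proof. by move=> df; rewrite deriveEjacobian. Qed.

Lemma eq_mulmx_row p q (A B : 'M[R]_(p, q)) : (forall v : 'rV[R]_p, v *m A = v *m B) -> A = B.
Proof. by move=> AB; apply/row_matrixP => i; rewrite !rowE. Qed.

Lemma near_eq_jacobian p q (f g : 'rV[R]_p -> 'rV[R]_q) y :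
  (\near y, f y = g y) -> differentiable f y -> differentiable g y -> 'J f y = 'J g y.
Proof.
move=> fg df dg; apply: eq_mulmx_row => v.
apply: eq_trans (mul_jacobian v df) _; apply: eq_trans (esym (mul_jacobian v dg)).
exact: (@near_eq_derive R 'rV[R]_p 'rV[R]_q f g y v fg).
Qed.

Lemma jacobian_comp p q s (f : 'rV[R]_p -> 'rV[R]_q) (h : 'rV[R]_q -> 'rV[R]_s) y :
  differentiable f y -> differentiable h (f y) -> 'J (h \o f) y = 'J f y *m 'J h (f y).
Proof.
move=> df dh; apply: eq_mulmx_row => v.
have dc : differentiable (h \o f) y by exact: differentiable_comp.
rewrite (mul_jacobian v dc) mulmxA (mul_jacobian v df) (mul_jacobian _ dh).
by rewrite (deriveE _ dc) (deriveE _ df) (deriveE _ dh) (diff_comp df dh).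
Qed.

Lemma jacobian_id p (y : 'rV[R]_p) : 'J id y = 1%:M.
Proof.
apply: eq_mulmx_row => v.
have di : differentiable (@id 'rV[R]_p) y by [].
by rewrite (mul_jacobian v di) mulmx1 derive_id.
Qed.

End Jacobian.

Section Charts.
Variables (R : realType) (n : nat) (M : topologicalType) (A : atlas R M n).
Hypothesis sm : smooth_manifold A.
Local Notation V := 'rV[R]_n.
Implicit Types (c d e : chart A) (y v : V).

Definition cimg c : set V := coord A c @` dom A c.
Definition ovl c d : set V := coord A c @` (dom A c `&` dom A d).
Definition tra c d : V -> V := coord A d \o param A c.

Lemma cimg_param c y : cimg c y -> dom A c (param A c y).
Proof. by case=> x cx <-; rewrite (coordK sm). Qed.

Lemma paramK c y : cimg c y -> coord A c (param A c y) = y.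
Proof. by case=> x cx <-; rewrite (coordK sm). Qed.

Lemma coord_cimg c x : dom A c x -> cimg c (coord A c x).
Proof. by move=> cx; exists x. Qed.

Lemma ovlP c d y : ovl c d y <-> cimg c y /\ dom A d (param A c y).
Proof.
split=> [[x [cx dx] <-]|[cy dy]]; first by rewrite (coordK sm) //; split=> //; exact: coord_cimg.
by exists (param A c y); [split=> //; exact: cimg_param | exact: paramK].
Qed.

Lemma ovl_coord c d x : dom A c x -> dom A d x -> ovl c d (coord A c x).
Proof. by move=> cx dx; exists x. Qed.

Lemma cimg_open c : open (cimg c). Proof. exact: coord_open sm c. Qed.

Lemma ovl_open c d : open (ovl c d).
Proof.
rewrite openE => y /ovlP[cy dy].
have h1 := open_nbhs_nbhs (conj (@cimg_open c) cy).
have h2 := param_continuous sm cy (open_nbhs_nbhs (conj (dom_open sm d) dy)).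
by apply: filterS2 h1 h2 => z cz dz; apply/ovlP.
Qed.

Lemma ovl_nbhs c d y : ovl c d y -> \forall z \near y, ovl c d z.
Proof. by move=> cdy; apply: open_nbhs_nbhs; split=> //; exact: ovl_open. Qed.

Lemma tra_ovl c d y : ovl c d y -> ovl d c (tra c d y).
Proof.
move=> /ovlP[cy dy]; apply/ovlP; split; first exact: coord_cimg.
by rewrite /tra /= (coordK sm) //; exact: cimg_param.
Qed.

Lemma tra_param c d y : ovl c d y -> param A d (tra c d y) = param A c y.
Proof. by move=> /ovlP[cy dy]; rewrite /tra /= (coordK sm). Qed.

Lemma tra_coord c d x : dom A c x -> tra c d (coord A c x) = coord A d x.
Proof. by move=> cx; rewrite /tra /= (coordK sm). Qed.

Lemma tra_Ck c d k : Ck_on k (ovl c d) (tra c d).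
Proof. exact: (transition_smooth sm c d k). Qed.

Lemma tra_diff c d y : ovl c d y -> differentiable (tra c d) y.
Proof. by move=> cdy; exact: (C1_differentiable_mx (@ovl_open c d) (@tra_Ck c d 1) cdy). Qed.

Lemma chart_changeE c d y : ovl c d y -> chart_change c d (param A c y) = 'J (tra c d) y.
Proof. by move=> /ovlP[cy _]; rewrite /chart_change paramK. Qed.

Lemma chart_change_cocycle c d e x : dom A c x -> dom A d x -> dom A e x ->
  chart_change c d x *m chart_change d e x = chart_change c e x.
Proof.
move=> cx dx ex; rewrite /chart_change -/(tra c d) -/(tra d e) -/(tra c e).
have cd := ovl_coord cx dx; have ce := ovl_coord cx ex.
have de := ovl_coord dx ex.
have E : tra c d (coord A c x) = coord A d x by exact: tra_coord.
rewrite -{1}E -jacobian_comp ?E; [|exact: tra_diff|exact: tra_diff].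
apply: near_eq_jacobian; [|by apply: differentiable_comp; rewrite ?E; exact: tra_diff|exact: tra_diff].
apply: filterS (ovl_nbhs cd) => z cz.
by rewrite /= [tra d e _]/(coord A e (param A d _)) tra_param.
Qed.

Lemma chart_change_id c x : dom A c x -> chart_change c c x = 1%:M.
Proof.
move=> cx; rewrite /chart_change -/(tra c c) -(jacobian_id (coord A c x)).
have cc := ovl_coord cx cx.
apply: near_eq_jacobian; [|exact: tra_diff|by []].
by apply: filterS (ovl_nbhs cc) => z /ovlP[cz _]; rewrite /tra /= paramK.
Qed.

Lemma chart_changeK c d x : dom A c x -> dom A d x ->
  chart_change c d x *m chart_change d c x = 1%:M.
Proof. by move=> cx dx; rewrite chart_change_cocycle // chart_change_id. Qed.

(** The field is given in the preferred chart at each point, which may jump from point to point; the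
    cocycle rule eliminates this chart. *)
Lemma components2_change (B : M -> 'M[R]_n) c d y : ovl c d y ->
  components2 B c y = 'J (tra c d) y *m components2 B d (tra c d y) *m ('J (tra c d) y)^T.
Proof.
move=> cdy; have [cy dy] := (ovlP c d y).1 cdy.
have cx := cimg_param cy.
have px := dom_chart_at sm (param A c y).
rewrite /components2 (tra_param cdy) -(chart_changeE cdy).
by rewrite -(chart_change_cocycle cx dy px) trmx_mul !mulmxA.
Qed.

Lemma components2_at (B : M -> 'M[R]_n) x : components2 B (chart_at A x) (coord A (chart_at A x) x) = B x.
Proof.
have px := dom_chart_at sm x.
by rewrite /components2 (coordK sm) // chart_change_id // trmx1 mulmx1 mul1mx.
Qed.

Lemma components2_trmx (B : M -> 'M[R]_n) c y (a : R) :
  (forall x, (B x)^T = a *: B x) -> (components2 B c y)^T = a *: components2 B c y.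
Proof.
move=> Bt; rewrite /components2 !trmx_mul trmxK Bt -scalemxAl -scalemxAr.
by rewrite mulmxA.
Qed.

Lemma bil_conj (J G : 'M[R]_n) u v : bil (J *m G *m J^T) u v = bil G (u *m J) (v *m J).
Proof. by rewrite /bil trmx_mul !mulmxA. Qed.

Lemma components2_bil (B : M -> 'M[R]_n) c d y u v : ovl c d y ->
  bil (components2 B c y) u v = bil (components2 B d (tra c d y)) ('D_u (tra c d) y) ('D_v (tra c d) y).
Proof.
move=> cdy; have df := tra_diff cdy.
have E := components2_change B cdy.
apply: eq_trans (congr1 (fun G => bil G u v) E) _; apply: eq_trans (bil_conj _ _ u v) _.
exact: (congr2 (bil _) (mul_jacobian u df) (mul_jacobian v df)).
Qed.

Lemma components2_pos (g : M -> 'M[R]_n) c y v : (forall x v, v != 0 -> 0 < (v *m g x *m v^T) 0 0) ->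
  cimg c y -> v != 0 -> 0 < bil (components2 g c y) v v.
Proof.
move=> gp cy v0; have cx := cimg_param cy.
rewrite /components2 bil_conj; apply: gp; apply: contra_neq v0 => vJ.
rewrite -[v]mulmx1 -(chart_changeK cx (dom_chart_at sm (param A c y))).
by rewrite mulmxA vJ mul0mx.
Qed.

Section Transition.
Variables (g Omega : M -> 'M[R]_n) (c d : chart A) (U1 U2 : set V) (L1 L2 : V -> V).
Hypothesis om1 : forall y u v, U1 y ->
  om (mklag (components2 g c) L1) y u v = bil (components2 Omega c y) u v.
Hypothesis om2 : forall y u v, U2 y ->
  om (mklag (components2 g d) L2) y u v = bil (components2 Omega d y) u v.

Lemma tra_transition (z : V) (s : R) (K2 : set V) : 0 <= s ->
  cball z s `<=` ovl c d -> cball z s `<=` U1 -> K2 `<=` U2 ->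
  (forall y, cball z s y -> K2 (tra c d y)) ->
  exists A, transition (cball z s) K2 A (mklag (components2 g c) L1)
    (mklag (components2 g d) L2) (tra c d) (fun y v => 'D_v (tra c d) y).
Proof.
move=> s0 so sU KU tK.
have [C C0 [b1 b2 b3 b4 b5]] := C2_bound s0 (@ovl_open c d) so (@tra_Ck c d 2).
exists (Num.max 1 C).
have CA : C <= Num.max 1 C by rewrite le_max lexx orbT.
have W (a b : R) : a <= C * b -> 0 <= b -> a <= Num.max 1 C * b.
  by move=> h b0; apply: le_trans h _; apply: ler_wpM2r.
split.
- by rewrite le_max lexx.
- exact: tK.
- move=> y a u v /so cy; have df := tra_diff cy.
  by rewrite -!(mul_jacobian _ df) mulmxDl scalemxAl.
- by move=> y v cy; apply: W => //; exact: b2.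
- by move=> y y' cy cy'; apply: W => //; exact: b3.
- by move=> y y' v cy cy'; rewrite -mulrA; apply: W; rewrite ?mulr_ge0 // mulrA; exact: b4.
- by move=> y y' cy cy'; apply: W; rewrite ?sqr_ge0 //; exact: b5.
- by move=> y u v cy; exact: esym (components2_bil g u v (so _ cy)).
- move=> y u v cy; have cU := sU _ cy; have tU := KU _ (tK _ cy).
  apply: eq_trans (om2 _ _ tU) _; apply: eq_trans (esym (om1 u v cU)).
  exact: esym (components2_bil Omega u v (so _ cy)).
Qed.

End Transition.

End Charts.

(** The near-covering form of compactness is applied to the filter on finite sequences in which a
    property holds eventually if it holds for all sequences containing a given one. *)
Lemma compact_finite_cover (X : topologicalType) (V : X -> set X) : compact [set: X] ->
  (forall x, nbhs x (V x)) -> exists D : seq X, forall x, exists2 p, p \in D & V p x.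
Proof.
move=> /compact_near_coveringP cX nV.
pose F : set_system (seq X) := [set P : set (seq X) | exists D0 : seq X, forall D : seq X, {subset D0 <= D} -> P D].
have FF : Filter F.
  split; first by exists [::].
  - move=> P Q [D0 h0] [D1 h1]; exists (D0 ++ D1) => D sD; split.
    + by apply: h0 => z zD; apply: sD; rewrite mem_cat zD.
    + by apply: h1 => z zD; apply: sD; rewrite mem_cat zD orbT.
  - by move=> P Q PQ [D0 h0]; exists D0 => D sD; apply: PQ; exact: h0.
have [|D0 h] := cX _ F (fun D x => exists2 p, p \in D & V p x) FF.
  move=> x _; exists (V x, [set D : seq X | x \in D]); first split=> //=.
    by exists [:: x] => D sD /=; apply: sD; rewrite mem_head.
  by case=> y D /= [Vy xD]; exists x.
by exists D0 => x; apply: h => // z.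
Qed.

(** * Uniform constants for a finite cover by chart balls *)

Section Cover.
Variables (R : realType) (n : nat) (M : topologicalType) (A : atlas R M n).
Variables (Omega g : M -> 'M[R]_n).
Hypothesis n0 : (0 < n)%N.
Hypothesis M0 : [set: M] !=set0.
Hypothesis cM : closed_manifold A.
Hypothesis sO : symplectic_form A Omega.
Hypothesis rg : riemannian_metric A g.
Local Notation V := 'rV[R]_n.
Let sm : smooth_manifold A := cM.1.

Definition chart_center (p : M) : V := coord A (chart_at A p) p.

(** The one-form is a primitive of the symplectic form only on a ball around the center contained in
    the image of the chart; each chart is therefore cut down to such a ball, of radius [R0]. *)
Definition chart_lag (p : M) : lag R n :=
  mklag (components2 g (chart_at A p))
        (primitive (chart_center p) (components2 Omega (chart_at A p))).

Lemma center_dom p : dom A (chart_at A p) p. Proof. exact: dom_chart_at sm p. Qed.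

Section OneChart.
Variables (p : M) (R0 : R).
Hypothesis R00 : 0 < R0.
Hypothesis sR : ball (chart_center p) R0 `<=` cimg (chart_at A p).
Let c := chart_at A p.
Let U : set V := ball (chart_center p) R0.

Lemma chart_g_Ck k : Ck_on k U (components2 g c).
Proof. exact: Ck_on_open_subset sR (metric_smooth rg c k). Qed.

Lemma chart_Omega_smooth : smooth_on U (components2 Omega c).
Proof. by move=> k; exact: Ck_on_open_subset sR (symplectic_smooth sO c k). Qed.

Lemma chart_om y u v : U y -> om (chart_lag p) y u v = bil (components2 Omega c y) u v.
Proof.
move=> Uy; apply: (@poincare R n (chart_center p) R0) => //.
- exact: chart_Omega_smooth.
- move=> z; rewrite -scaleN1r; apply: components2_trmx => x.
  by rewrite scaleN1r; exact: symplectic_antisym sO x.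
- by move=> z Uz i j k; exact: (symplectic_closed sO (sR Uz)).
Qed.

Lemma chart_lag_ok : exists C0, forall C, C0 <= C ->
  lag_ok U (cball (chart_center p) (3 * (R0 / 4))) C (chart_lag p).
Proof.
apply: mklag_ok.
- exact: ball_open.
- have ar (a : R) : 0 < a -> 0 <= 3 * (a / 4) by lra.
  exact: ar.
- have ar (a b : R) : 0 < a -> b <= 3 * (a / 4) -> b < a by lra.
  by move=> y; rewrite /cball /U -ball_normE /= distrC; exact: ar.
- exact: chart_g_Ck.
- exact: primitive_Ck chart_Omega_smooth.
- move=> z; rewrite -[RHS]scale1r; apply: components2_trmx => x.
  by rewrite scale1r; exact: metric_sym rg x.
- by move=> y v /sR cy v0; exact: (components2_pos sm (metric_pos rg) cy v0).
Qed.

End OneChart.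

Lemma chart_radius p : exists R0 : R, 0 < R0 /\ ball (chart_center p) R0 `<=` cimg (chart_at A p).
Proof.
have h := open_nbhs_nbhs (conj (@cimg_open _ _ _ _ sm (chart_at A p)) (coord_cimg (center_dom p))).
by have /nbhs_ballP[e e0 H] := h; exists e.
Qed.

Section Radii.
Variable R0 : M -> R.
Hypothesis R0P : forall p, 0 < R0 p /\ ball (chart_center p) (R0 p) `<=` cimg (chart_at A p).
Let r p := R0 p / 4.
Let r0 p : 0 < r p. Proof. by have [h _] := R0P p; rewrite /r; lra. Qed.

Lemma radius_cover : exists D : seq M, forall x, exists2 p, p \in D &
  dom A (chart_at A p) x /\ ball (chart_center p) (r p) (coord A (chart_at A p) x).
Proof.
apply: compact_finite_cover cM.2 _ => p.
apply: filterI; first exact: open_nbhs_nbhs (conj (dom_open sm _) (center_dom p)).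
apply: (Defs.coord_continuous sm (center_dom p)); exact: nbhsx_ballx.
Qed.

Lemma cball_ball (y z : V) (a b : R) : a < b -> cball y a z -> ball y b z.
Proof. by move=> ab; rewrite /cball -ball_normE /= distrC => h; exact: le_lt_trans ab. Qed.

Lemma ball_cball (y z : V) (a : R) : ball y a z -> cball y a z.
Proof. by rewrite /cball -ball_normE /= distrC => /ltW. Qed.

(** The target ball has radius [r q], a third of the radius of the ball that carries the estimates:
    the image of a base vertex near [o] is then an admissible base vertex in chart [q]. *)
Definition good_transition (p q : M) (o : V) (s : R) : Prop := exists A',
  transition (cball o s) (cball (chart_center q) (r q)) A' (chart_lag p) (chart_lag q)
    (tra (chart_at A p) (chart_at A q)) (fun y v => 'D_v (tra (chart_at A p) (chart_at A q)) y).

Lemma near_good_transition p q (o : V) :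
  ball (chart_center p) (R0 p) o -> dom A (chart_at A q) (param A (chart_at A p) o) ->
  ball (chart_center q) (r q) (tra (chart_at A p) (chart_at A q) o) ->
  \forall o' \near o & s \near (0 : R)^'+, good_transition p q o' s.
Proof.
set c := chart_at A p; set d := chart_at A q => bo dq bq.
have [_ sp] := R0P p; have [_ sq] := R0P q.
have oo : ovl c d o by apply/ovlP => //; split=> //; exact: sp.
have df := tra_diff sm oo.
have n1 := ovl_nbhs sm oo.
have n2 : nbhs o (ball (chart_center p) (R0 p)) by apply: open_nbhs_nbhs; split=> //; exact: ball_open.
have n3 : nbhs o [set z | ball (chart_center q) (r q) (tra c d z)].
  by apply: (differentiable_continuous df); apply: open_nbhs_nbhs; split=> //; exact: ball_open.
have [a /= a0 ha] := (@nbhs_ballP R V _ _).1 (filterI n1 (filterI n2 n3)).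
exists (ball o (a / 2), [set s | 0 < s /\ s < a / 2]).
  split; first by apply: nbhsx_ballx; lra.
  by apply: filterI; [exact: nbhs_right_gt | apply: nbhs_right_lt; lra].
case=> o' s /= [bo' [s0 sa]].
have sub z : cball o' s z -> ball o a z.
  move=> /(cball_ball sa) h; have -> : a = a / 2 + a / 2 by lra.
  exact: ball_triangle bo' h.
apply: (@tra_transition _ _ _ _ sm g Omega c d (ball (chart_center p) (R0 p))
   (ball (chart_center q) (R0 q))).
- by move=> y u v; exact: (chart_om sp).
- by move=> y u v; exact: (chart_om sq).
- exact: ltW.
- by move=> z /sub /ha[].
- by move=> z /sub /ha[_ []].
- by move=> z; apply: cball_ball; have := r0 q; rewrite /r; lra.
- by move=> z /sub /ha[_ [_ /ball_cball]].
Qed.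

(** A Lebesgue number argument: near each point of the compact balls, all small radii work for some
    target chart, and compactness makes the radius uniform. *)
Lemma uniform_transition (N : nat) (P : 'I_N -> M) :
  (forall x, exists i, dom A (chart_at A (P i)) x /\
     ball (chart_center (P i)) (r (P i)) (coord A (chart_at A (P i)) x)) ->
  exists eta : R, [/\ 0 < eta, forall i, eta <= r (P i) & forall i o, cball (chart_center (P i)) (r (P i)) o ->
    exists j, good_transition (P i) (P j) o eta].
Proof.
move=> cov.
have K i : \forall s \near (0 : R)^'+, cball (chart_center (P i)) (r (P i)) `<=`
    [set z | exists j, good_transition (P i) (P j) z s].
  have /compact_near_coveringP ck := @cball_compact _ _ (chart_center (P i)) _ (ltW (r0 (P i))).
  apply: (ck _ _ (fun s z => exists j, good_transition (P i) (P j) z s)) => z kz.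
  have bz : ball (chart_center (P i)) (R0 (P i)) z.
    by apply: cball_ball kz; have := r0 (P i); rewrite /r; lra.
  have [j [dj bj]] := cov (param A (chart_at A (P i)) z).
  have := near_good_transition bz dj bj.
  by apply: filterS => -[z' s] /= h; exists j.
have L : \forall s \near (0 : R)^'+, forall i : 'I_N, s <= r (P i).
  by apply: (@filter_forall R _ (fun i s => s <= r (P i))) => i; exact: nbhs_right_le.
have K' := @filter_forall R _ (fun (i : 'I_N) (s : R) => cball (chart_center (P i)) (r (P i)) `<=`
    [set z | exists j, good_transition (P i) (P j) z s]) _ (@at_right_proper_filter R 0) K.
have [s [s0 [h1 h2]]] := filter_ex (filterI (nbhs_right_gt (0 : R)) (filterI L K')).
by exists s; split=> // i o; exact: h2.
Qed.

Lemma uniform_lag_ok (N : nat) (P : 'I_N -> M) : exists C, forall i,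
  lag_ok (ball (chart_center (P i)) (R0 (P i))) (cball (chart_center (P i)) (3 * r (P i))) C (chart_lag (P i)).
Proof.
have /choice[C0 h] i := chart_lag_ok (R0P (P i)).1 (R0P (P i)).2.
exists (\sum_i `|C0 i|) => i; apply: h.
rewrite (bigD1 i) //= (le_trans (ler_norm _)) // lerDl.
by apply: sumr_ge0 => j _; exact: normr_ge0.
Qed.

End Radii.

(** With [w = u Omega] the form takes as value the Euclidean square of [w], which is positive by
    nondegeneracy because [u] is not 0 in positive dimension. *)
Lemma om_center p : exists u w, 0 < om (chart_lag p) (chart_center p) u w.
Proof.
have [R0 [R00 sR]] := chart_radius p.
pose u : V := const_mx 1; exists u, (u *m Omega p).
have E := chart_om sR u (u *m Omega p) (ballxx _ R00).
rewrite E /chart_center components2_at // -/(chart_center p).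
have w0 : u *m Omega p != 0.
  apply/eqP => /(symplectic_nondegenerate sO) /rowP /(_ (Ordinal n0)).
  by rewrite !mxE => /eqP; rewrite oner_eq0.
set w := u *m Omega p in w0 *; rewrite /bil -/w mxE.
rewrite lt_neqAle; apply/andP; split; last first.
  by apply: sumr_ge0 => i _; rewrite [w^T _ _]mxE -expr2 sqr_ge0.
apply: contra_neq w0 => /esym h; apply/rowP => i; rewrite [RHS]mxE.
have := psumr_eq0P _ h.
move=> /(_ _ i isT); rewrite [w^T _ _]mxE => hh; apply/eqP; rewrite -sqrf_eq0 expr2; apply/eqP; apply: hh.
by move=> j _; rewrite [w^T _ _]mxE -expr2 sqr_ge0.
Qed.

Lemma exists_chart_ode : exists2 e0 : R, 0 < e0 & forall e, 0 < e -> e < e0 ->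
  exists p (R0 T : R) x v, [/\ 0 < R0, ball (chart_center p) R0 `<=` cimg (chart_at A p), 0 < T &
    ode (cball (chart_center p) (3 * (R0 / 4))) (chart_lag p) e T x v].
Proof.
have /choice[R0 R0P] := chart_radius.
have [D cov] := radius_cover R0P.
pose P (i : 'I_(size D)) := tnth (in_tuple D) i.
have covP x : exists i, dom A (chart_at A (P i)) x /\
    ball (chart_center (P i)) (R0 (P i) / 4) (coord A (chart_at A (P i)) x).
  have [p pD h] := cov x; have /tnthP[i pE] : p \in in_tuple D by [].
  by exists i; rewrite /P -pE.
have [eta [eta0 etar trans]] := uniform_transition R0P covP.
have [C okC] := uniform_lag_ok R0P P.
have [x0 _] := M0; have [i0 _] := covP x0.
have r0 : 0 < R0 (P i0) / 4 by have [h _] := R0P (P i0); lra.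
set r := R0 (P i0) / 4 in r0.
have ok := okC i0; have C1 := lag_C1 ok.
have C0 : 0 < C := lt_le_trans ltr01 C1.
have [u [w]] := om_center (P i0); set o := chart_center (P i0); set l := chart_lag (P i0).
move eb : (om l o u w) => beta beta0.
pose B := Num.max 1 (Num.max `|u| `|w|).
have uB : `|u| <= B by rewrite !le_max lexx !orbT.
have wB : `|w| <= B by rewrite !le_max lexx !orbT.
have B0 : 0 < B by rewrite lt_max ltr01.
move eT : (16 * C * B ^+ 2 / beta) => T.
have T0 : 0 < T by rewrite -eT divr_gt0 // mulr_gt0 ?exprn_gt0 // mulr_gt0.
move eK : (C ^+ 2 * (1 + 80 * T)) => k.
have k0 : 0 < k.
  by rewrite -eK mulr_gt0 ?exprn_gt0 // ltr_wpDr // mulr_ge0 // ltW.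
(* The three bounds yield [rho <= 1], [4 rho <= eta] and [C^2 rho (1 + T2) <= 1/100] with
   [T2 = 80 T]. *)
pose rho := Num.min 1 (Num.min (eta / 4) (1 / (100 * k))).
have rho0 : 0 < rho by rewrite !lt_min ltr01 !divr_gt0 // mulr_gt0.
have rho1 : rho <= 1 by rewrite ge_min lexx.
have rhoe : 4 * rho <= eta.
  have : rho <= eta / 4 by rewrite !ge_min lexx !orbT.
  lra.
have rhok : C ^+ 2 * rho * (1 + 80 * T) <= 1 / 100.
  have h : rho <= 1 / (100 * k) by rewrite !ge_min lexx !orbT.
  rewrite -mulrA (mulrC rho) mulrA eK.
  have := ler_wpM2l (ltW k0) h.
  suff -> : k * (1 / (100 * k)) = 1 / 100 by [].
  by field; rewrite gt_eqF.
have p1 : (0 : R) < 12800 by lra.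
have d1 : 0 < 12800 * C * T ^+ 2 := mulr_gt0 (mulr_gt0 p1 C0) (exprn_gt0 2 T0).
have d2 : 0 < 16 * T * B ^+ 2 by rewrite mulr_gt0 ?exprn_gt0 // mulr_gt0.
(* With [T2 = 80 T] and [M = 80 T e], the first bound amounts to [2 C T2 M <= rho^2]; the second
   makes the test parallelogram fit into the ball of radius [r]. *)
exists (Num.min (rho ^+ 2 / (12800 * C * T ^+ 2)) (beta * r ^+ 2 / (16 * T * B ^+ 2))).
  rewrite lt_min (divr_gt0 _ d1) ?exprn_gt0 //=.
  by apply: divr_gt0 d2; rewrite mulr_gt0 ?exprn_gt0.
move=> e e0; rewrite lt_min (ltr_pdivlMr _ _ d1) (ltr_pdivlMr _ _ d2) => /andP[e1 e2].
(* The test loop has action at most [4 T e]: [Ct] is [4 T], and [T2 = 20 Ct]. *)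
have Ct0 : 0 < 4 * T by rewrite mulr_gt0.
have E2 : 80 * T = 20 * (4 * T) by ring.
have E3 : 80 * T * e = 20 * (4 * T) * e by rewrite E2.
have rhoM : 2 * C * (80 * T) * (80 * T * e) <= rho ^+ 2.
  by apply: le_trans (ltW e1); rewrite le_eqVlt; apply/orP; left; apply/eqP; ring.
have er : 16 * e * T * B ^+ 2 <= beta * r ^+ 2.
  by apply: le_trans (ltW e2); rewrite le_eqVlt; apply/orP; left; apply/eqP; ring.
have T18 : 1 / (20 * C ^+ 2) <= 8.
  have c2 : 1 <= C ^+ 2 by rewrite -(expr1n R 2) ler_pXn2r // nnegrE ?ler01 // ltW.
  have h20 : 1 <= 20 * C ^+ 2 by apply: mulr_ege1 => //; rewrite ler1n.
  apply: (@le_trans _ _ 1); last by rewrite ler1n.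
  by rewrite (ler_pdivrMr _ _ (lt_le_trans ltr01 h20)) mul1r.
have trans' i z : cball (chart_center (P i)) (R0 (P i) / 4) z -> exists j phi dphi A',
    transition (cball z eta) (cball (chart_center (P j)) (R0 (P j) / 4)) A'
      (chart_lag (P i)) (chart_lag (P j)) phi dphi.
  move=> /trans[j [A' h]]; exists j.
  by exists (tra (chart_at A (P i)) (chart_at A (P j))), (fun y v => 'D_v (tra (chart_at A (P i)) (chart_at A (P j))) y), A'.
have sub : cball o r `<=` cball o (3 * r).
  move=> z h; apply: (le_trans h); apply: ler_peMl (ltW r0) _; by rewrite ler1n.
have test : \forall m \near \oo, exists i x t,
    adm (cball (chart_center (P i)) (3 * (R0 (P i) / 4))) (chart_lag (P i)) (4 * m) e
      (1 / (20 * C ^+ 2)) (80 * T) (80 * T * e) (cball (chart_center (P i)) (R0 (P i) / 4)) x t /\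
    act (chart_lag (P i)) (4 * m) e x t <= 4 * T * e.
  have m1 : \forall m \near \oo, (0 < m)%N by exists 1%N.
  have m2 := nbhs_infty_ger (100 * `|lL1 l o u u + lL1 l o w w| / beta).
  apply: filterS2 m1 m2 => m m0; rewrite ler_pdivrMr // (mulrC m%:R) => mC.
  have [x h] := test_loop ok (sub _ (@cball_center _ _ o _ (ltW r0))) r0 sub uB wB B0 eb beta0
    (esym eT) e0 rho0 (erefl _) (erefl _) rhok rhoM er m0 mC T18.
  by exists i0, x, T.
have [i [T' [x [v [T'0 h]]]]] := exists_ode okC e0 etar trans' rho0 rhoe rho1 rhok rhoM (erefl _)
  E2 E3 Ct0 test.
have [h1 h2] := R0P (P i).
by exists (P i), (R0 (P i)), T', x, v; split.
Qed.

End Cover.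

(** * The kinetic energy and the twisted form *)

Section InverseMetric.
Variables (R : realType) (n : nat).
Local Notation V := 'rV[R]_n.

Lemma pair_sym (p v : V) : pair p v = pair v p.
Proof. by rewrite !pair_sum; apply: eq_bigr => j _; rewrite mulrC. Qed.

Lemma pair_mulmx (G : 'M[R]_n) (u v : V) : pair (u *m G) v = bil G u v. Proof. by []. Qed.

Lemma bil_linr (A : 'M[R]_n) a (u v v' : V) : bil A u (a *: v + v') = a * bil A u v + bil A u v'.
Proof. by rewrite -!(bil_tr A) bil_linl. Qed.

Lemma cauchy_schwarz (G : 'M[R]_n) (u v : V) : (forall v, v != 0 -> 0 < bil G v v) -> G^T = G ->
  bil G u v ^+ 2 <= bil G u u * bil G v v.
Proof.
move=> Gp Gt; have [->|v0] := eqVneq v 0.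
  have E w : bil G w 0 = 0 by rewrite /bil trmx0 mulmx0 mxE.
  by rewrite !E expr0n mulr0.
have vp := Gp _ v0.
pose a := bil G u v / bil G v v.
have S : bil G v u = bil G u v by rewrite -bil_tr Gt.
have q : 0 <= bil G (- a *: v + u) (- a *: v + u).
  have [->|h] := eqVneq (- a *: v + u) 0; first by rewrite /bil !mul0mx mxE.
  exact: ltW (Gp _ h).
rewrite bil_linl !bil_linr S in q.
have E : a * bil G v v = bil G u v by rewrite /a divfK // gt_eqF.
have ar (b x y z : R) : b * z = x -> 0 < z -> 0 <= - b * (- b * z + x) + (- b * x + y) -> x ^+ 2 <= y * z.
  move=> bz z0 h; have : 0 <= (- b * (- b * z + x) + (- b * x + y)) * z by rewrite mulr_ge0 // ltW.
  suff -> : (- b * (- b * z + x) + (- b * x + y)) * z = y * z - x ^+ 2 by rewrite subr_ge0.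
  by rewrite -bz; ring.
exact: (ar _ _ _ _ E vp q).
Qed.

(** Cauchy-Schwarz for [g x] bounds the set by the length of [w], and the normalised [w] attains
    this bound; for [w = 0] the same witness works because the inverse of 0 is 0. *)
Lemma dual_norm_flat (T : Type) (g : T -> 'M[R]_n) (x : T) (w : V) :
  (forall v, v != 0 -> 0 < bil (g x) v v) -> (g x)^T = g x ->
  dual_norm g (Covector x (w *m g x)) ^+ 2 = bil (g x) w w.
Proof.
move=> gp gt; rewrite /dual_norm /=.
have b0 v : 0 <= bil (g x) v v.
  have [->|h] := eqVneq v 0; first by rewrite /bil !mul0mx mxE.
  exact: ltW (gp _ h).
set S := [set _ | _ in _]; pose s := Num.sqrt (bil (g x) w w).
have s2 : s ^+ 2 = bil (g x) w w by rewrite sqr_sqrtr.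
have s0 : 0 <= s by exact: sqrtr_ge0.
suff -> : sup S = s by [].
have ubS : ubound S s.
  move=> _ [v /= bv <-]; rewrite -[_ 0 0]/(bil (g x) w v) -(ger0_norm s0) -ler_sqr ?nnegrE //.
  rewrite !real_normK ?num_real // s2.
  apply: le_trans (cauchy_schwarz w v gp gt) _.
  by rewrite -[leRHS]mulr1; apply: ler_wpM2l; [exact: b0 | exact: bv].
have sS : S s.
  exists (s^-1 *: w) => /=.
    rewrite -[_ 0 0]/(bil (g x) (s^-1 *: w) (s^-1 *: w)) bilZ -s2 -expr2 -exprMn.
    by have [->|h] := eqVneq s 0; rewrite ?mulr0 ?expr0n ?ler01 // mulVf // expr1n.
  rewrite -[_ 0 0]/(bil (g x) w (s^-1 *: w)).
  have -> : bil (g x) w (s^-1 *: w) = s.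
    rewrite -{1}[w]scale1r bilZ mul1r -s2.
    by have [->|h] := eqVneq s 0; rewrite ?expr0n ?mulr0 // expr2 mulrA mulVf // mul1r.
  by rewrite ger0_norm.
apply/eqP; rewrite eq_le; apply/andP; split.
  by apply: ge_sup; [exists s | exact: ubS].
by apply: ub_le_sup; [exists s | exact: sS].
Qed.

Lemma prod_cvg (T I : Type) (F : set_system T) (FF : Filter F) (r : seq I) (f : I -> T -> R) (a : I -> R) :
  (forall i, f i x @[x --> F] --> a i) ->
  \prod_(i <- r) f i x @[x --> F] --> \prod_(i <- r) a i.
Proof.
move=> fa; elim: r => [|i r IH].
  rewrite big_nil; under eq_fun do rewrite big_nil; exact: cvg_cst.
rewrite big_cons; under eq_fun do rewrite big_cons; exact: cvgM.
Qed.

Lemma det_cvg (m : nat) (T : Type) (F : set_system T) (FF : Filter F) (A : T -> 'M[R]_m) (A0 : 'M[R]_m) :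
  (forall i j, A t i j @[t --> F] --> A0 i j) -> \det (A t) @[t --> F] --> \det A0.
Proof.
move=> cA; rewrite /determinant; apply: cvg_sumr => s.
by apply: cvgM; [exact: cvg_cst | exact: prod_cvg].
Qed.

Lemma unitmx_pos (G : 'M[R]_n) : (forall v, v != 0 -> 0 < bil G v v) -> G \in unitmx.
Proof.
move=> Gp; rewrite -row_free_unit -kermx_eq0; apply/eqP/row_matrixP => i; rewrite row0.
have kG : row i (kermx G) *m G = 0.
  by apply/sub_kermxP; exact: row_sub.
apply/eqP/negP => /negP /Gp; rewrite /bil kG mul0mx mxE ltxx //.
Qed.

(** The cofactor formula gives each entry of the inverse as a quotient of polynomials in the
    entries; it holds where the matrix is invertible, hence the condition along the filter. *)
Lemma invmx_cvg (T : Type) (F : set_system T) (FF : Filter F) (A : T -> 'M[R]_n) (A0 : 'M[R]_n) :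
  (forall i j, A t i j @[t --> F] --> A0 i j) -> A0 \in unitmx -> (\forall t \near F, A t \in unitmx) ->
  forall i j, invmx (A t) i j @[t --> F] --> invmx A0 i j.
Proof.
move=> cA u0 uA i j.
have E (B : 'M[R]_n) : B \in unitmx -> invmx B i j = (\det B)^-1 * \adj B i j.
  by move=> uB; rewrite /invmx uB mxE.
rewrite (E _ u0).
apply: (@cvg_trans _ ((fun t => (\det (A t))^-1 * \adj (A t) i j) @ F)).
  by apply: near_eq_cvg; apply: filterS uA => t ut; rewrite E.
apply: cvgM.
  by apply: cvgV; [rewrite -unitfE -unitmxE | exact: det_cvg].
rewrite mxE /cofactor; apply: (@cvg_trans _ ((fun t => (-1) ^+ (j + i) * \det (row' j (col' i (A t)))) @ F)).
  by apply: near_eq_cvg; apply: filterE => t; rewrite mxE.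
apply: cvgM; first exact: cvg_cst.
by apply: det_cvg => k l; rewrite !mxE; under eq_fun do rewrite !mxE; exact: cA.
Qed.

(* Derivative of the dual quadratic form without differentiating the inverse
   matrix: with [w_s G_s = p_s],
   [w_s p_s - w_0 p_0 = (w_s + w_0) (p_s - p_0) - w_s (G_s - G_0) w_0]. *)
Lemma dual_quadratic_der (G : R -> 'M[R]_n) (G' : 'M[R]_n) (p q w : V) :
  (forall i j, is_derive (0 : R) 1 (fun s => G s i j : R) (G' i j)) ->
  (\forall s \near (0 : R), G s \in unitmx /\ (G s)^T = G s) -> w *m G 0 = p ->
  is_derive (0 : R) 1 (fun s => 2^-1 * pair ((p + s *: q) *m invmx (G s)) (p + s *: q))
    (pair q w - 2^-1 * bil G' w w).
Proof.
move=> dG Gs wG.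
have [u0 t0] := nbhs_singleton Gs.
pose P s := p + s *: q; pose W s := P s *m invmx (G s).
have W0 : W 0 = w by rewrite /W /P scale0r addr0 -wG mulmxK.
have idE (s : R) : G s \in unitmx -> (G s)^T = G s ->
    pair (W s) (P s) - pair (W 0) (P 0) = s * (pair (W s) q + pair w q) - bil (G s - G 0) (W s) w.
  move=> us ts.
  have WG : W s *m G s = P s by rewrite /W mulmxKV.
  have e1 : bil (G s) (W s) w = pair w (P s) by rewrite -pair_mulmx WG pair_sym.
  have e2 : bil (G 0) (W s) w = pair (W s) p.
    by rewrite -bil_tr t0 -pair_mulmx wG pair_sym.
  rewrite W0 bilB e1 e2 /P scale0r addr0.
  have L a : pair a (p + s *: q) = s * pair a q + pair a p by rewrite addrC pair_linr.
  by rewrite !L; ring.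
have cG i j : G s i j @[s --> (0 : R)^'] --> G 0 i j.
  apply: cvg_within_filter; have [/derivable1_diffP /differentiable_continuous h _] := dG i j.
  exact: h.
have nG : \forall s \near (0 : R)^', G s \in unitmx /\ (G s)^T = G s by exact: cvg_within Gs.
have cW : W s @[s --> (0 : R)^'] --> w.
  rewrite -W0; apply: mx_cvg => i j; rewrite [W 0 i j]mxE.
  apply: (@cvg_trans _ ((fun s => \sum_k P s i k * invmx (G s) k j) @ (0 : R)^')).
    by apply: near_eq_cvg; apply: filterE => s; rewrite mxE.
  apply: cvg_sumr => k; apply: cvgM.
    have PE s : P s i k = p i k + s * q i k by rewrite !mxE.
    rewrite PE; apply: (@cvg_trans _ ((fun s : R => p i k + s * q i k) @ (0 : R)^')).
      by apply: near_eq_cvg; apply: filterE => s; rewrite PE.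
    apply: cvgD; first exact: cvg_cst.
    by apply: cvgM; [apply: cvg_within_filter; exact: cvg_id | exact: cvg_cst].
  apply: (@invmx_cvg _ _ _ _ _ cG u0).
  by apply: filterS nG => s [].
have cvq : (fun s : R => s^-1 *: (2^-1 * pair (W s) (P s) - 2^-1 * pair (W 0) (P 0))) @ (0 : R)^'
    --> pair q w - 2^-1 * bil G' w w.
  apply: (@cvg_trans _ ((fun s : R => 2^-1 * (pair (W s) q + pair w q) - 2^-1 * bil (s^-1 *: (G s - G 0)) (W s) w) @ (0 : R)^')).
    apply: near_eq_cvg; apply: filterS2 nG (nbhs_dnbhs_neq (0 : R)) => s [us ts] s0.
    have B : bil (s^-1 *: (G s - G 0)) (W s) w = s^-1 * bil (G s - G 0) (W s) w.
      by rewrite /bil -scalemxAr -scalemxAl mxE.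
    have ar (x y a b c : R) : c != 0 -> x - y = c * a - b ->
        2^-1 * a - 2^-1 * (c^-1 * b) = c^-1 * (2^-1 * x - 2^-1 * y).
      by move=> c0 h; rewrite -[in RHS]mulrBr h; field.
    by rewrite B; exact: (ar _ _ _ _ _ s0 (idE s us ts)).
  have -> : pair q w - 2^-1 * bil G' w w = 2^-1 * (pair w q + pair w q) - 2^-1 * bil G' w w.
    rewrite (pair_sym q) ; by field.
  apply: cvgB.
    apply: cvgM; first exact: cvg_cst.
    apply: cvgD; last exact: cvg_cst.
    apply: pair_cvg; last exact: cvg_cst.
    by move=> j; apply: entry_cvg; exact: cW.
  apply: cvgM; first exact: cvg_cst.
  apply: bil_cvg; [|exact: cW|exact: cvg_cst].
  move=> i j; have [ex ev] := dG i j.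
  have := ex; rewrite /derivable => /cvg_ex[a ca].
  have : 'D_1 (fun s => G s i j : R) 0 = a.
    by rewrite /derive; apply/cvg_lim.
  rewrite ev => ->.
  apply: cvg_trans ca; apply: near_eq_cvg; apply: filterE => s.
  by rewrite /= !mxE [s *: 1]mulr1 addr0.
have E0 (s : R) : s^-1 *: (2^-1 * pair (W (s *: 1 + 0)) (P (s *: 1 + 0)) - 2^-1 * pair (W 0) (P 0)) =
  s^-1 *: (2^-1 * pair (W s) (P s) - 2^-1 * pair (W 0) (P 0)) by rewrite [s *: 1]mulr1 addr0.
have cvq' : (fun s : R => s^-1 *: (2^-1 * pair (W (s *: 1 + 0)) (P (s *: 1 + 0)) - 2^-1 * pair (W 0) (P 0))) @ (0 : R)^'
    --> pair q w - 2^-1 * bil G' w w.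
  by apply: cvg_trans cvq; apply: near_eq_cvg; apply: filterE => s; rewrite E0.
split.
  by apply/cvg_ex; exists (pair q w - 2^-1 * bil G' w w); exact: cvq'.
by rewrite /derive; apply/cvg_lim; [|exact: cvq'].
Qed.

End InverseMetric.

Section LineDerivative.
Variables (R : realType) (n : nat).

Lemma near_eq_differentiable p q (f h : 'rV[R]_p -> 'rV[R]_q) y :
  (\near y, f y = h y) -> differentiable f y -> differentiable h y.
Proof.
move=> fh df.
have cf := diff_continuous df.
have E : h \o shift y = cst (h y) + 'd f y +o_ 0 id.
  have /eqaddoP D := diff_locally df.
  apply/eqaddoP => e e0; have De := D e e0.
  have S : \forall z \near (0 : 'rV[R]_p), f (z + y) = h (z + y).
    have [a a0 ha] := (@nbhs_ballP R _ _ _).1 fh; apply/nbhs_ballP; exists a => //= z.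
    rewrite -ball_normE /= sub0r normrN => za; apply: ha; rewrite -ball_normE /=.
    by rewrite opprD addrCA subrr addr0 normrN.
  apply: filterS2 S De => z zE; rewrite !fctE /= -zE -(nbhs_singleton fh); exact.
by apply/diff_locallyP; rewrite (diff_unique cf E).
Qed.

Lemma is_derive_of_line (W : normedModType R) (f : 'rV[R]_n -> W) (y v : 'rV[R]_n) df :
  is_derive (0 : R) 1 (fun s : R => f (y + s *: v)) df -> is_derive y v f df.
Proof.
move=> [ex ev].
have E : (fun h : R => h^-1 *: (f (h *: v + y) - f y)) =
  (fun h : R => h^-1 *: (f (y + (h *: 1 + 0) *: v) - f (y + (0 : R) *: v))).
  by apply/funext => h; rewrite scale0r !addr0 [h *: 1]mulr1 (addrC y).
by split; [rewrite /derivable E | rewrite -ev /derive E].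
Qed.

End LineDerivative.

(** * Canonical coordinates of the cotangent bundle *)

Section Cotangent.
Variables (R : realType) (n : nat) (M : topologicalType) (A : atlas R M n).
Hypothesis sm : smooth_manifold A.
Local Notation V := 'rV[R]_n.
Local Notation CA := (cotangent_atlas A).
Implicit Types (c d a : chart A).

(** The differential of the projection in adapted coordinates, as a matrix acting on rows from the
    right. *)
Definition Pi : 'M[R]_(n + n, n) := col_mx 1%:M 0.

Lemma mulmx_Pi (v : 'rV[R]_(n + n)) : v *m Pi = lsubmx v.
Proof. by rewrite -{1}[v]hsubmxK mul_row_col mulmx1 mulmx0 addr0. Qed.

Lemma mulmx_PiT (v : V) : v *m Pi^T = row_mx v 0.
Proof. by rewrite /Pi tr_col_mx mul_mx_row trmx1 trmx0 mulmx1 mulmx0. Qed.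

Lemma jacobian_lsubmx (Y : 'rV[R]_(n + n)) : 'J (@lsubmx R 1 n n) Y = Pi.
Proof.
apply: eq_mulmx_row => v; rewrite mulmx_Pi.
have df : differentiable (@lsubmx R 1 n n) Y by exact: differentiable_lsubmx.
rewrite (mul_jacobian v df) (deriveE _ df).
have E : 'd (@lsubmx R 1 n n) Y = @lsubmx R 1 n n :> (_ -> _).
  by apply: (@diff_lin _ _ _ _ Y); exact: continuous_lsubmx.
by rewrite E.
Qed.

Lemma tra_lsubmx_jacobian c d (Y : 'rV[R]_(n + n)) : ovl c d (lsubmx Y) ->
  differentiable (tra c d \o @lsubmx R 1 n n) Y /\
  'J (tra c d \o @lsubmx R 1 n n) Y = Pi *m 'J (tra c d) (lsubmx Y).
Proof.
move=> o; have df : differentiable (@lsubmx R 1 n n) Y by exact: differentiable_lsubmx.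
have dt := tra_diff sm o.
split; first exact: differentiable_comp.
by rewrite (jacobian_comp df dt) jacobian_lsubmx.
Qed.

(** The preferred chart at a covector is the one at its base point, so in coordinates the projection
    is [lsubmx] followed by the change from a chart to itself. *)
Lemma tangent_map_base (X : cotangent R M n) : tangent_map CA A (@base R M n) X = Pi.
Proof.
set q := base X; set a := chart_at A q.
have aq : dom A a q := dom_chart_at sm q.
pose Y := coord CA a X.
have lY : lsubmx Y = coord A a q by rewrite /Y /= row_mxKl.
have o : ovl a a (lsubmx Y) by rewrite lY; exact: ovl_coord.
have [_ h] := tra_lsubmx_jacobian o.
apply: eq_trans h _.
have -> : 'J (tra a a) (lsubmx Y) = 1%:M by rewrite lY; exact: chart_change_id.
by rewrite mulmx1.
Qed.

Section OneChart.
Variables (d : chart A) (Y : 'rV[R]_(n + n)).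
Hypothesis dY : cimg d (lsubmx Y).
Let q := param A d (lsubmx Y).
Let a := chart_at A q.
Let dq : dom A d q := cimg_param sm dY.
Let aq : dom A a q := dom_chart_at sm q.

Lemma cotangent_paramK : coord CA d (param CA d Y) = Y.
Proof.
rewrite /= -/q -/a (paramK sm dY) -mulmxA -trmx_mul.
by rewrite (chart_changeK sm dq aq) trmx1 mulmx1 hsubmxK.
Qed.

Let Psi := coord CA a \o param CA d.

Let D k l (y : V) : R := 'D_(delta_mx 0 k) (tra a d) y 0 l.

(** [Psi] is the change from the chart [d] of the cotangent bundle to the preferred one at
    [param CA d Y]. Written this way, its fibre part is linear in the fibre with coefficients
    [D k l] of class C1, which gives differentiability. *)
Let Psi_near : \forall Z \near Y, Psi Z = row_mx (tra d a (lsubmx Z))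
  (\row_k \sum_l Z 0 (rshift n l) * D k l (tra d a (lsubmx Z))).
Proof.
have oY : ovl d a (lsubmx Y) by apply/ovlP.
have : \forall Z \near Y, ovl d a (lsubmx Z).
  exact: (@continuous_lsubmx R 1 n n Y _ (ovl_nbhs sm oY)).
apply: filterS => Z oZ; have [dZ aZ] := (ovlP sm d a _).1 oZ.
rewrite /Psi /=; congr row_mx.
have zq := dom_chart_at sm (param A d (lsubmx Z)).
rewrite -mulmxA -trmx_mul (chart_change_cocycle sm aZ zq (cimg_param sm dZ)).
have o' := tra_ovl sm oZ.
rewrite -{1}(tra_param sm oZ) (chart_changeE sm o').
apply/rowP => k; rewrite !mxE; apply: eq_bigr => l _; rewrite !mxE; congr (_ * _).
by rewrite /D (deriveE _ (tra_diff sm o')).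
Qed.

Let Psi_diff : differentiable Psi Y.
Proof.
have oY : ovl d a (lsubmx Y) by apply/ovlP.
have o' := tra_ovl sm oY.
pose F (Z : 'rV[R]_(n + n)) := row_mx (tra d a (lsubmx Z))
  (\row_k \sum_l Z 0 (rshift n l) * D k l (tra d a (lsubmx Z))).
have nF : \forall Z \near Y, F Z = Psi Z by apply: filterS Psi_near => Z ->.
apply: (@near_eq_differentiable R (n + n) (n + n) F Psi Y nF).
have dl : differentiable (@lsubmx R 1 n n) Y by exact: differentiable_lsubmx.
have dt := differentiable_comp dl (tra_diff sm oY).
apply: differentiable_mx => i j; rewrite ord1.
case: (split_ordP j) => k ->.
  have -> : (fun Z : 'rV[R]_(n + n) => row_mx (tra d a (lsubmx Z))
     (\row_k \sum_l Z 0 (rshift n l) * D k l (tra d a (lsubmx Z))) 0 (lshift n k) : R) =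
     (fun N : V => N 0 k : R) \o (tra d a \o @lsubmx R 1 n n).
    by apply/funext => Z; rewrite row_mxEl.
  by apply: differentiable_comp dt _; exact: differentiable_coord.
have dD l : differentiable (D k l) (tra d a (lsubmx Y)).
  have [_ h] := tra_Ck sm a d 2.
  have dd := C1_differentiable_mx (@ovl_open _ _ _ _ sm a d) (h (delta_mx 0 k)).2 o'.
  apply: (@differentiable_comp _ _ _ _ _ (fun N : V => N 0 l : R)) dd _.
  exact: differentiable_coord.
have -> : (fun Z : 'rV[R]_(n + n) => row_mx (tra d a (lsubmx Z))
     (\row_k \sum_l Z 0 (rshift n l) * D k l (tra d a (lsubmx Z))) 0 (rshift n k) : R) =
     (fun Z => \sum_l Z 0 (rshift n l) * (D k l \o (tra d a \o @lsubmx R 1 n n)) Z).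
  by apply/funext => Z; rewrite row_mxEr mxE.
elim: (index_enum _) => [|l r IH].
  by under eq_fun do rewrite big_nil; exact: differentiable_cst.
under eq_fun do rewrite big_cons.
apply: differentiableD IH; apply: differentiableM; first exact: differentiable_coord.
exact: differentiable_comp dt (dD l).
Qed.

(** This is the formula [p dq], established throughout the chart and not only at a point read in its
    preferred chart, because the exterior derivative compares points with different preferred
    charts. The Jacobian of [Psi] commutes with the projections, and the two chart changes on the
    fibre cancel. *)
Lemma components1_liouville : components1 (A := CA) (liouville_form A) d Y = row_mx (rsubmx Y) 0.
Proof.
pose X := param CA d Y.
have E : components1 (A := CA) (liouville_form A) d Y =
    fiber X *m (tangent_map CA A (@base R M n) X)^T *m ('J Psi (coord CA d X))^T by [].
rewrite E tangent_map_base cotangent_paramK.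
have oY : ovl d a (lsubmx Y) by apply/ovlP.
have J1 : 'J Psi Y *m Pi = Pi *m 'J (tra d a) (lsubmx Y).
  rewrite -(tra_lsubmx_jacobian oY).2 -(jacobian_lsubmx (Psi Y)).
  have dl : differentiable (@lsubmx R 1 n n) (Psi Y) by exact: differentiable_lsubmx.
  rewrite -(jacobian_comp Psi_diff dl); congr ('J _ Y).
  by apply/funext => Z; rewrite /= row_mxKl.
rewrite -mulmxA -trmx_mul J1 trmx_mul mulmxA.
rewrite -(chart_changeE sm oY) /X /= -[chart_at A _]/a -/q -(mulmxA (rsubmx Y)) -trmx_mul.
by rewrite (chart_changeK sm dq aq) trmx1 mulmx1 mulmx_PiT.
Qed.

End OneChart.

Lemma canonical_form_matrix (X : cotangent R M n) :
  canonical_form A X = block_mx 0 1%:M (- 1%:M) 0.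
Proof.
set d := chart_at A (base X); pose Y := coord CA d X.
have dq : dom A d (base X) := dom_chart_at sm (base X).
have dY : cimg d (lsubmx Y) by rewrite /Y /= row_mxKl; exact: coord_cimg.
have nd : nbhs (lsubmx Y) (cimg d) by apply: open_nbhs_nbhs; split=> //; exact: cimg_open.
have nY : \forall Z \near Y, cimg d (lsubmx Z) by exact: (@continuous_lsubmx R 1 n n Y _ nd).
have nE j : \forall Z \near Y, row_mx (rsubmx Z) 0 0 j = components1 (A := CA) (liouville_form A) d Z 0 j :> R.
  by apply: filterS nY => Z dZ; rewrite components1_liouville.
pose m (i j : 'I_(n + n)) : R := 'D_(delta_mx 0 i) (fun Z : 'rV[R]_(n + n) => row_mx (rsubmx Z) (0 : V) 0 j : R) Y.
have E : canonical_form A X = \matrix_(i, j) (m j i - m i j).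
  apply/matrixP => i j; rewrite /canonical_form /d1 !mxE opprB; congr (_ - _); apply/esym; rewrite /m /partial.
    exact: near_eq_derive (nE i).
  exact: near_eq_derive (nE j).
have ml i k : m i (lshift n k) = (i == rshift n k)%:R.
  rewrite /m; have -> : (fun Z : 'rV[R]_(n + n) => row_mx (rsubmx Z) (0 : V) 0 (lshift n k) : R) =
    (fun Z => Z 0 (rshift n k) - (0 : 'rV[R]_(n + n)) 0 (rshift n k)).
    by apply/funext => Z; rewrite row_mxEl !mxE subr0.
  by have [_ ->] := entry_derive (rshift n k) 0 Y (delta_mx 0 i); rewrite mxE eqxx eq_sym.
have mr i k : m i (rshift n k) = 0.
  rewrite /m; have -> : (fun Z : 'rV[R]_(n + n) => row_mx (rsubmx Z) (0 : V) 0 (rshift n k) : R) = (fun=> 0).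
    by apply/funext => Z; rewrite row_mxEr mxE.
  by rewrite derive_cst.
rewrite E; apply/matrixP => i j; rewrite mxE.
case: (split_ordP i) => k ->; case: (split_ordP j) => l ->; rewrite !(ml, mr).
- by rewrite block_mxEul mxE !eq_lrshift subr0.
- by rewrite block_mxEur mxE subr0 eq_rshift eq_sym.
- by rewrite block_mxEdl !mxE sub0r eq_rshift eq_sym.
- by rewrite block_mxEdr mxE subr0.
Qed.

Lemma twisted_form_matrix (Omega : M -> 'M[R]_n) (X : cotangent R M n) :
  twisted_form A Omega X = block_mx (Omega (base X)) 1%:M (- 1%:M) 0.
Proof.
rewrite /twisted_form canonical_form_matrix /pullback2 tangent_map_base.
rewrite /Pi mul_col_mx mul1mx mul0mx tr_col_mx trmx1 trmx0 mul_col_row.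
by rewrite mulmx1 mulmx0 mul0mx mul0mx add_block_mx !add0r !addr0.
Qed.

End Cotangent.

Section ProductRules.
Variables (R : realType) (n : nat).
Local Notation V := 'rV[R]_n.

Lemma is_derive_near (f h : R -> R) (t df : R) :
  (\near t, f t = h t) -> is_derive t 1 f df -> is_derive t 1 h df.
Proof. by move=> fh df'; apply: near_eq_is_derive df'. Qed.

Lemma is_derive_mul (f h : R -> R) (t df dh : R) :
  is_derive t 1 f df -> is_derive t 1 h dh -> is_derive t 1 (fun s => f s * h s) (df * h t + f t * dh).
Proof.
move=> d1 d2; have h1 := @is_deriveM R R^o f h t 1 df dh d1 d2.
by apply: (is_derive_eq h1); apply: eq_trans (addrC _ _) _; congr (_ + _); exact: mulrC.
Qed.

Lemma is_derive_sumr (I : Type) (r : seq I) (f : I -> R -> R) (t : R) (df : I -> R) :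
  (forall i, is_derive t 1 (f i) (df i)) ->
  is_derive t 1 (fun s => \sum_(i <- r) f i s) (\sum_(i <- r) df i).
Proof.
move=> d; elim: r => [|i r IH].
  rewrite big_nil; under eq_fun do rewrite big_nil; exact: is_derive_cst.
rewrite big_cons; under eq_fun do rewrite big_cons.
exact: (@is_deriveD R R^o R^o (f i) (fun s => \sum_(j <- r) f j s) t 1 _ _ (d i) IH).
Qed.

Lemma pair_der2 (p v : R -> V) (p' v' : V) (t : R) :
  is_derive t 1 p p' -> is_derive t 1 v v' ->
  is_derive t 1 (fun s => pair (p s) (v s)) (pair p' (v t) + pair (p t) v').
Proof.
move=> dp dv; rewrite !pair_sum -big_split /=.
under eq_fun do rewrite pair_sum.
apply: is_derive_sumr => j; apply: is_derive_mul; exact: is_derive_entry.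
Qed.

Lemma bil_der3 (A : R -> 'M[R]_n) (A' : 'M[R]_n) (u v : R -> V) (u' v' : V) (t : R) :
  (forall i j, is_derive t 1 (fun s => A s i j : R) (A' i j)) ->
  is_derive t 1 u u' -> is_derive t 1 v v' ->
  is_derive t 1 (fun s => bil (A s) (u s) (v s)) (bil A' (u t) (v t) + bil (A t) u' (v t) + bil (A t) (u t) v').
Proof.
move=> dA du dv; rewrite !bil_sum -!big_split /=.
under eq_fun do rewrite bil_sum.
apply: is_derive_sumr => i; rewrite -!big_split /=; apply: is_derive_sumr => j.
have hu := is_derive_entry 0 i du; have hv := is_derive_entry 0 j dv.
apply: (is_derive_eq (is_derive_mul (is_derive_mul hu (dA i j)) hv)).
by ring.
Qed.

Lemma is_derive_affine (y v : V) (t : R) : is_derive t 1 (fun s : R => y + s *: v) v.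
Proof.
have := is_derive_line (@derivable_id _ _ (y + t *: v) v).
by rewrite derive_id.
Qed.

Lemma pair_delta (p : V) j : pair p (delta_mx 0 j) = p 0 j.
Proof. by rewrite /pair trmx_delta -colE mxE. Qed.

Lemma schwarz_mx (U : set V) (f : V -> V) (u v y : V) : open U -> Ck_on 2 U f -> U y ->
  'D_u (fun z => 'D_v f z) y = 'D_v (fun z => 'D_u f z) y.
Proof.
move=> oU cf Uy.
have E (a b : V) j : 'D_a (fun z => 'D_b f z) y 0 j = 'D_a (fun z => 'D_b (fun x => f x 0 j : R) z) y.
  have [_ h] := cf; have [h1 h2] := h b; have [_ h3] := h2; have d2 := (h3 a).1 y Uy.
  rewrite -(dmxE d2) dmx_entry; apply: near_eq_derive.
  have nU : \forall z \near y, U z by exact: open_nbhs_nbhs.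
  by apply: filterS nU => z Uz; rewrite -(dmxE (h1 z Uz)) dmx_entry.
apply/rowP => j; apply: eq_trans (E u v j) (eq_trans _ (esym (E v u j))).
exact: (schwarz _ _ oU (Ck_on_entry 0 j oU cf) Uy).
Qed.

End ProductRules.

(** * The kinetic energy in coordinates *)

Section Kinetic.
Variables (R : realType) (n : nat) (M : topologicalType) (A : atlas R M n).
Variables (g : M -> 'M[R]_n).
Hypothesis sm : smooth_manifold A.
Hypothesis rg : riemannian_metric A g.
Local Notation V := 'rV[R]_n.
Local Notation CA := (cotangent_atlas A).

Let gsym (d : chart A) y : (components2 g d y)^T = components2 g d y.
Proof.
rewrite -[RHS]scale1r; apply: components2_trmx => x.
by rewrite scale1r; exact: metric_sym rg x.
Qed.

Let gunit (d : chart A) y : cimg d y -> components2 g d y \in unitmx.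
Proof. by move=> dy; apply: unitmx_pos => v v0; exact: (components2_pos sm (metric_pos rg) dy v0). Qed.

Lemma coord_cotangent_at (X : cotangent R M n) : let d := chart_at A (base X) in
  coord CA d X = row_mx (coord A d (base X)) (fiber X).
Proof.
have dq := dom_chart_at sm (base X).
by rewrite /= chart_change_id // trmx1 mulmx1.
Qed.

Lemma kinetic_flat (d : chart A) y (w : V) : cimg d y ->
  kinetic_energy g (param CA d (row_mx y (w *m components2 g d y))) = 2^-1 * bil (components2 g d y) w w.
Proof.
move=> dy; rewrite /kinetic_energy /=; congr (_ * _); rewrite row_mxKl row_mxKr.
set q := param A d y; set a := chart_at A q.
have dq : dom A d q := cimg_param sm dy.
have aq : dom A a q := dom_chart_at sm q.
have KK : chart_change a d q *m chart_change d a q = 1%:M by exact: chart_changeK.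
move: KK; set K := chart_change d a q; set K' := chart_change a d q => KK.
have GE : components2 g d y = K *m g q *m K^T by [].
have fE : w *m components2 g d y *m K'^T = (w *m K) *m g q.
  by rewrite GE !mulmxA -(mulmxA _ K^T) -trmx_mul KK trmx1 mulmx1.
rewrite fE dual_norm_flat; first by rewrite GE bil_conj.
- exact: (metric_pos rg).
- exact: metric_sym rg q.
Qed.

Lemma kinetic_param (d : chart A) y (p : V) : cimg d y ->
  kinetic_energy g (param CA d (row_mx y p)) = 2^-1 * pair (p *m invmx (components2 g d y)) p.
Proof.
move=> dy; have ug := gunit dy.
rewrite -{1}[p](mulmxKV ug) (kinetic_flat _ dy) -pair_mulmx (mulmxKV ug).
by rewrite pair_sym.
Qed.

(** In a chart the energy is half of the inverse metric applied to the momentum. At the momentum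
    [w G] its derivative in the direction [(eta, q)] is [q] paired with [w], minus half the
    derivative of [G] along [eta] evaluated on [w]. *)
Lemma differential_kinetic (X : cotangent R M n) (w : V) : fiber X = w *m g (base X) ->
  let d := chart_at A (base X) in
  differential CA (kinetic_energy g) X =
  row_mx (\row_j (- (2^-1 * bil (dmx (components2 g d) (coord A d (base X)) (delta_mx 0 j)) w w))) w.
Proof.
move=> fX; set d := chart_at A (base X) => /=; set y := coord A d (base X).
have dq : dom A d (base X) := dom_chart_at sm (base X).
have dy : cimg d y by exact: coord_cimg.
have XE : coord CA d X = row_mx y (fiber X) := coord_cotangent_at X.
have Gy : components2 g d y = g (base X) by exact: components2_at.
have L (eta q : V) : is_derive (row_mx y (fiber X)) (row_mx eta q) (kinetic_energy g \o param CA d)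
    (pair q w - 2^-1 * bil (dmx (components2 g d) y eta) w w).
  apply: is_derive_of_line.
  have nI : \forall s \near (0 : R), cimg d (y + s *: eta).
    have h0 : nbhs (y + (0 : R) *: eta) (cimg d).
      by rewrite scale0r addr0; apply: open_nbhs_nbhs; split=> //; exact: cimg_open.
    have dl : is_derive (0 : R) 1 (fun s : R => y + s *: eta) eta.
      exact: is_derive_affine.
    have [/derivable1_diffP /differentiable_continuous h _] := dl.
    exact: h _ h0.
  apply: (@is_derive_near R (fun s => 2^-1 * pair ((fiber X + s *: q) *m invmx (components2 g d (y + s *: eta))) (fiber X + s *: q))).
    apply: filterS nI => s ds.
    have E : row_mx y (fiber X) + s *: row_mx eta q = row_mx (y + s *: eta) (fiber X + s *: q).
      by rewrite scale_row_mx add_row_mx.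
    rewrite E [RHS]/comp; exact: esym (kinetic_param (fiber X + s *: q) ds).
  apply: dual_quadratic_der.
  - move=> i j; have Ck : Ck_on 1 (cimg d) (components2 g d) := metric_smooth rg d 1.
    have := @dmx_line _ _ _ _ (cimg d) (components2 g d) y eta 0 i j (@cimg_open _ _ _ _ sm d) Ck.
    by rewrite scale0r addr0; apply.
  - by apply: filterS nI => s ds; split; [exact: gunit | exact: gsym].
  - by rewrite scale0r addr0 Gy fX.
apply/rowP => i; rewrite mxE /partial XE.
case: (split_ordP i) => j ->.
  have [_ E] := L (delta_mx 0 j) 0; rewrite row_mxEl mxE.
  have -> : delta_mx 0 (lshift n j) = row_mx (delta_mx 0 j) 0 :> 'rV[R]_(n + n).
    apply/rowP => k; case: (split_ordP k) => l ->.
      by rewrite row_mxEl !mxE eq_lshift.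
    by rewrite row_mxEr !mxE eq_rlshift andbF.
  by rewrite [LHS]E /pair mul0mx mxE sub0r.
have [_ E] := L 0 (delta_mx 0 j); rewrite row_mxEr.
have -> : delta_mx 0 (rshift n j) = row_mx 0 (delta_mx 0 j) :> 'rV[R]_(n + n).
  apply/rowP => k; case: (split_ordP k) => l ->.
    by rewrite row_mxEl !mxE eq_lrshift andbF.
  by rewrite row_mxEr !mxE eq_rshift.
rewrite [LHS]E pair_sym pair_delta.
have -> : dmx (components2 g d) y 0 = 0.
  by apply/matrixP => k l; rewrite dmx_entry derive0 mxE.
by rewrite /bil mulmx0 mul0mx mxE mulr0 subr0.
Qed.

End Kinetic.

(** * Lift to the cotangent bundle *)

Lemma half_cancel (R : realType) (p q r s : R) : p + q = (r + 2 * q) / 2 + s -> p = r / 2 + s.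
Proof. lra. Qed.

Section ChartInvariance.
Variables (R : realType) (n : nat) (M : topologicalType) (A : atlas R M n).
Variables (g Omega : M -> 'M[R]_n).
Hypothesis sm : smooth_manifold A.
Hypothesis rg : riemannian_metric A g.
Local Notation V := 'rV[R]_n.
Variables (c d : chart A) (x v : R -> V) (t0 : R).
Hypothesis vel : forall t : R, is_derive t 1 x (v t).
Hypothesis xt0 : ovl c d (x t0).
Let Gc := components2 g c.
Let Gd := components2 g d.
Let Oc := components2 Omega c.
Let Od := components2 Omega d.
Let phi := tra c d.
Let psi := tra d c.
Let z t := phi (x t).
Let z' t := 'D_(v t) phi (x t).
Let Pc t := v t *m Gc (x t).
Let Pd t := z' t *m Gd (z t).
Hypothesis EL : forall w, is_derive t0 1 (fun s => bil (Gc (x s)) (v s) w)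
  (bil (dmx Gc (x t0) w) (v t0) (v t0) / 2 + bil (Oc (x t0)) (v t0) w).

Let near_ovl : \forall s \near t0, ovl c d (x s).
Proof.
have [/derivable1_diffP /differentiable_continuous h _] := vel t0.
by apply: h; exact: ovl_nbhs.
Qed.

Lemma lift_vel : is_derive t0 1 z (z' t0).
Proof. exact: (is_derive_curve (tra_diff sm xt0) (vel t0)). Qed.

Lemma momentum_change s : ovl c d (x s) -> Pd s = Pc s *m ('J psi (z s))^T.
Proof.
move=> o; have [cx dx] := (ovlP sm c d _).1 o; have qx := cimg_param sm cx.
pose J := 'J phi (x s).
have JJ : 'J psi (z s) *m J = 1%:M.
  rewrite /J -(chart_changeE sm o) -(chart_changeE sm (tra_ovl sm o)) (tra_param sm o).
  exact: chart_changeK.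
have GE : Gc (x s) = J *m Gd (z s) *m J^T := components2_change sm g o.
have zE : z' s = v s *m J := esym (mul_jacobian (v s) (tra_diff sm o)).
have alg (u : V) (K G B : 'M[R]_n) : B *m K = 1%:M -> u *m K *m G = u *m (K *m G *m K^T) *m B^T.
  by move=> BK; rewrite -!mulmxA -trmx_mul BK trmx1 mulmx1 !mulmxA.
apply: eq_trans (congr1 (mulmx^~ (Gd (z s))) zE) _; apply: eq_trans (alg _ _ _ _ JJ) _.
exact: (congr1 (fun G : 'M[R]_n => v s *m G *m ('J psi (z s))^T) (esym GE)).
Qed.

Let EL' : V := \row_j (bil (dmx Gc (x t0) (delta_mx 0 j)) (v t0) (v t0) / 2 + bil (Oc (x t0)) (v t0) (delta_mx 0 j)).

Let Pc_der : is_derive t0 1 Pc EL'.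
Proof.
apply: is_derive_mx => i j; rewrite ord1 mxE.
apply: is_derive_near (EL (delta_mx 0 j)).
by apply: filterE => s; rewrite -pair_mulmx pair_delta.
Qed.

(** The new velocity [z'] involves [v], whose differentiability is not known. The new momentum is
    therefore written as the old one, differentiable by [EL], times a Jacobian evaluated along the
    curve. *)
Let Pd_derivable : exists Pd', is_derive t0 1 Pd Pd'.
Proof.
have o' := tra_ovl sm xt0.
pose D k l (y : V) : R := 'D_(delta_mx 0 k) psi y 0 l.
have dD k l : exists D', is_derive t0 1 (fun s => D k l (z s)) D'.
  have [_ h] := tra_Ck sm d c 2.
  have dd := C1_differentiable_mx (@ovl_open _ _ _ _ sm d c) (h (delta_mx 0 k)).2 o'.
  have h1 := is_derive_curve dd lift_vel.
  by exists ('D_(z' t0) (fun y => 'D_(delta_mx 0 k) psi y) (z t0) 0 l); exact: (is_derive_entry 0 l h1).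
have /choice[D' hD'] : forall k, exists D' : 'I_n -> R, forall l, is_derive t0 1 (fun s => D k l (z s)) (D' l).
  by move=> k; have /choice[f hf] := dD k; exists f.
exists (\row_k \sum_l (EL' 0 l * D k l (z t0) + Pc t0 0 l * D' k l)).
apply: is_derive_mx => i k; rewrite ord1 [X in is_derive _ _ _ X]mxE.
apply: (@is_derive_near R (fun s => \sum_l Pc s 0 l * D k l (z s))).
  apply: filterS near_ovl => s os; rewrite (momentum_change os) mxE.
  apply: eq_bigr => l _; congr (_ * _).
  have alg (J : 'M[R]_n) : ((delta_mx 0 k : V) *m J) 0 l = J^T l k by rewrite -rowE !mxE.
  have E := mul_jacobian (delta_mx 0 k) (tra_diff sm (tra_ovl sm os)).
  exact: esym (eq_trans (esym (alg _)) (congr1 (fun u : V => u 0 l) E)).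
apply: is_derive_sumr => l; exact: (is_derive_mul (is_derive_entry 0 l Pc_der) (hD' k l)).
Qed.

Let gsym : (Gd (z t0))^T = Gd (z t0).
Proof.
rewrite -[RHS]scale1r; apply: components2_trmx => q.
by rewrite scale1r; exact: metric_sym rg q.
Qed.

(* The kinetic form is transported by the chart change:
   [D_w Gc (v, v) = (D_{dphi w} Gd) (z', z') + 2 Gd (z', D_w D_v phi)]. *)
Let metric_der w : bil (dmx Gc (x t0) w) (v t0) (v t0) =
  bil (dmx Gd (z t0) ('D_w phi (x t0))) (z' t0) (z' t0) +
  2 * pair (Pd t0) ('D_w (fun y => 'D_(v t0) phi y) (x t0)).
Proof.
have oO := @ovl_open _ _ _ _ sm c d; have o' := tra_ovl sm xt0.
have cx : cimg c (x t0) by have [] := (ovlP sm c d _).1 xt0.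
have dz : cimg d (z t0) by have [] := (ovlP sm d c _).1 o'.
have Gc1 : Ck_on 1 (cimg c) Gc := metric_smooth rg c 1.
have Gd1 : Ck_on 1 (cimg d) Gd := metric_smooth rg d 1.
have a0 : x t0 + (0 : R) *: w = x t0 by rewrite scale0r addr0.
have d1 : is_derive (0 : R) 1 (fun s : R => bil (Gc (x t0 + s *: w)) (v t0) (v t0))
    (bil (dmx Gc (x t0) w) (v t0) (v t0)).
  apply: bil_der => i j.
  have := @dmx_line _ _ _ _ (cimg c) Gc (x t0) w 0 i j (@cimg_open _ _ _ _ sm c) Gc1.
  by rewrite a0; apply.
have af := is_derive_affine (x t0) w 0.
have dphi : is_derive (0 : R) 1 (fun s : R => phi (x t0 + s *: w)) ('D_w phi (x t0)).
  have dt : differentiable phi (x t0 + (0 : R) *: w) by rewrite a0; exact: tra_diff.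
  by have := is_derive_curve dt af; rewrite a0.
have dG i j : is_derive (0 : R) 1 (fun s : R => Gd (phi (x t0 + s *: w)) i j : R) (dmx Gd (z t0) ('D_w phi (x t0)) i j).
  have dg : differentiable (fun y => Gd y i j : R) (phi (x t0 + (0 : R) *: w)).
    rewrite a0; have [_ h] := Ck_on_entry i j (@cimg_open _ _ _ _ sm d) Gd1.
    apply: (@C1_differentiable _ _ (cimg d) _ (@cimg_open _ _ _ _ sm d)) => //.
      by move=> u y Uy; exact: (h u).1.
    by move=> u y Uy; exact: (h u).2.1.
  by have := is_derive_curve dg dphi; rewrite a0 dmx_entry.
have dv : is_derive (0 : R) 1 (fun s : R => 'D_(v t0) phi (x t0 + s *: w)) ('D_w (fun y => 'D_(v t0) phi y) (x t0)).
  have [_ h] := tra_Ck sm c d 2; have [_ h1] := (h (v t0)).2.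
  have hd : derivable (fun y => 'D_(v t0) phi y) (x t0 + (0 : R) *: w) w by rewrite a0; exact: (h1 w).1.
  by have := is_derive_line hd; rewrite a0.
have d2 := bil_der3 dG dv dv.
have nI : \forall s \near (0 : R), ovl c d (x t0 + s *: w).
  have [/derivable1_diffP /differentiable_continuous h _] := af.
  by apply: h; rewrite a0; exact: ovl_nbhs.
have d3 : is_derive (0 : R) 1 (fun s : R => bil (Gc (x t0 + s *: w)) (v t0) (v t0)) _ := is_derive_near _ d2.
have {}d3 := d3 (filterS (fun s os => esym (components2_bil sm g (v t0) (v t0) os)) nI).
have [_ e1] := d1; have [_ e3] := d3.
apply: eq_trans (esym e1) _; apply: eq_trans e3 _; rewrite a0.
rewrite -addrA; congr (_ + _).
have S (a b : V) : bil (Gd (z t0)) a b = bil (Gd (z t0)) b a by rewrite -bil_tr gsym.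
apply: eq_trans (congr1 (+%R^~ _) (S _ _)) _; exact: esym (mulr_natl _ 2).
Qed.

(** The derivative of the new momentum is identified by pairing with ['D_w phi (x s)]: this pairing
    is the old momentum paired with [w], whose derivative is known. The second derivatives of [phi]
    from the product rule and from [metric_der] cancel by symmetry, and the vectors ['D_w phi]
    exhaust the space as the Jacobian is invertible. *)
Lemma lift_EL : is_derive t0 1 Pd
  (\row_j (bil (dmx Gd (z t0) (delta_mx 0 j)) (z' t0) (z' t0) / 2 + bil (Od (z t0)) (z' t0) (delta_mx 0 j))).
Proof.
have [Pd' dPd] := Pd_derivable.
have o' := tra_ovl sm xt0.
have H w : pair Pd' ('D_w phi (x t0)) =
    bil (dmx Gd (z t0) ('D_w phi (x t0))) (z' t0) (z' t0) / 2 + bil (Od (z t0)) (z' t0) ('D_w phi (x t0)).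
  have [_ h] := tra_Ck sm c d 2.
  have dw : is_derive t0 1 (fun s => 'D_w phi (x s)) ('D_(v t0) (fun y => 'D_w phi y) (x t0)).
    have dd := C1_differentiable_mx (@ovl_open _ _ _ _ sm c d) (h w).2 xt0.
    exact: is_derive_curve dd (vel t0).
  have d1 := pair_der2 dPd dw.
  have d2 : is_derive t0 1 (fun s => bil (Gc (x s)) (v s) w) _ := is_derive_near _ d1.
  have {}d2 := d2 (filterS (fun s os => esym (components2_bil sm g (v s) w os)) near_ovl).
  have [_ e1] := EL w; have [_ e2] := d2.
  have E := eq_trans (esym e2) e1.
  rewrite metric_der (components2_bil sm Omega (v t0) w xt0) in E.
  rewrite (schwarz_mx w (v t0) (@ovl_open _ _ _ _ sm c d) (tra_Ck sm c d 2) xt0) in E.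
  exact: half_cancel E.
suff -> : (\row_j (bil (dmx Gd (z t0) (delta_mx 0 j)) (z' t0) (z' t0) / 2 +
    bil (Od (z t0)) (z' t0) (delta_mx 0 j))) = Pd' by [].
apply/rowP => j; rewrite mxE -pair_delta.
pose w : V := delta_mx 0 j *m 'J psi (z t0).
suff wE : 'D_w phi (x t0) = delta_mx 0 j by rewrite -wE H.
rewrite -(mul_jacobian w (tra_diff sm xt0)) /w -mulmxA.
have [cx dx] := (ovlP sm c d _).1 xt0; have qx := cimg_param sm cx.
rewrite -(chart_changeE sm xt0) -(chart_changeE sm o') (tra_param sm xt0).
by rewrite (chart_changeK sm dx qx) mulmx1.
Qed.

End ChartInvariance.

Lemma is_derive_row_mx (R : realType) (p q : nat) (f : R -> 'rV[R]_p) (h : R -> 'rV[R]_q) (t : R) f' h' :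
  is_derive t 1 f f' -> is_derive t 1 h h' ->
  is_derive t 1 (fun s => row_mx (f s) (h s)) (row_mx f' h').
Proof.
move=> df dh; apply: is_derive_mx => i j; rewrite ord1.
case: (split_ordP j) => k ->.
  rewrite row_mxEl; have -> : (fun s => row_mx (f s) (h s) 0 (lshift q k) : R) = (fun s => f s 0 k).
    by apply/funext => s; rewrite row_mxEl.
  exact: (is_derive_entry 0 k df).
rewrite row_mxEr; have -> : (fun s => row_mx (f s) (h s) 0 (rshift p k) : R) = (fun s => h s 0 k).
  by apply/funext => s; rewrite row_mxEr.
exact: (is_derive_entry 0 k dh).
Qed.

Lemma three_quarters_lt (R : realType) (a : R) : 0 < a -> 3 * (a / 4) < a.
Proof. lra. Qed.

(** * The periodic orbit over the limit curve *)

Section Orbit.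
Variables (R : realType) (n : nat) (M : topologicalType) (A : atlas R M n).
Variables (Omega g : M -> 'M[R]_n).
Hypothesis sm : smooth_manifold A.
Hypothesis sO : symplectic_form A Omega.
Hypothesis rg : riemannian_metric A g.
Local Notation V := 'rV[R]_n.
Local Notation CA := (cotangent_atlas A).
Variables (p : M) (R0 e T : R) (x v : R -> V).
Hypothesis R00 : 0 < R0.
Let c := chart_at A p.
Let y0 := chart_center A p.
Hypothesis sR : ball y0 R0 `<=` cimg c.
Hypothesis xv : ode (cball y0 (3 * (R0 / 4))) (chart_lag A Omega g p) e T x v.
Let Gc := components2 g c.

Definition flow_lift (t : R) : cotangent R M n := param CA c (row_mx (x t) (v t *m Gc (x t))).

Let xU t : ball y0 R0 (x t).
Proof. by apply: cball_ball (ode_K xv t); exact: three_quarters_lt. Qed.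

Let xc t : cimg c (x t). Proof. exact: sR. Qed.

Let cotangent_param (d : chart A) (y w : V) : param CA d (row_mx y w) =
  Covector (param A d y) (w *m (chart_change (chart_at A (param A d y)) d (param A d y))^T).
Proof. by rewrite /= row_mxKl row_mxKr. Qed.

Lemma base_lift t : base (flow_lift t) = param A c (x t).
Proof. by rewrite /flow_lift cotangent_param. Qed.

Lemma lift_energy t : kinetic_energy g (flow_lift t) = e.
Proof.
rewrite /flow_lift kinetic_flat // -[bil _ _ _]/(lB (chart_lag A Omega g p) (x t) (v t) (v t)).
by rewrite (ode_en xv) mulrA mulVf ?mul1r.
Qed.

Lemma coord_lift (d : chart A) s : ovl c d (x s) ->
  coord CA d (flow_lift s) = row_mx (tra c d (x s)) ('D_(v s) (tra c d) (x s) *m components2 g d (tra c d (x s))).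
Proof.
move=> o; have [cx dx] := (ovlP sm c d _).1 o; have qx := cimg_param sm cx.
have aq := dom_chart_at sm (param A c (x s)).
have P := momentum_change g sm (fun s => v s) o.
have alg (w : V) (K K' L : 'M[R]_n) : K' *m K = L -> w *m K^T *m K'^T = w *m L^T.
  by move=> <-; rewrite -mulmxA -trmx_mul.
have E := chart_changeE sm (tra_ovl sm o); rewrite (tra_param sm o) in E.
have C := eq_trans (chart_change_cocycle sm dx aq qx) E.
rewrite /flow_lift cotangent_param.
exact: (congr1 (row_mx (tra c d (x s))) (eq_trans (alg _ _ _ _ C) (esym P))).
Qed.

(** The equation is required in the preferred chart at each point of the orbit, whereas the solution
    lives in the chart [c]; [lift_vel] and [lift_EL] carry it over. There [(z', P')] times the
    twisted form is [(z' Omega - P', z')]; the magnetic term in [P'] cancels, and the differential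
    of the energy remains. *)
Lemma lift_orbit : hamiltonian_orbit CA (twisted_form A Omega) (kinetic_energy g) flow_lift.
Proof.
move=> t; set d := chart_at A (base (flow_lift t)).
have dq : dom A d (base (flow_lift t)) := dom_chart_at sm _.
have ot : ovl c d (x t) by apply/ovlP => //; split=> //; rewrite -base_lift.
have EL w : is_derive t 1 (fun s => bil (Gc (x s)) (v s) w)
    (bil (dmx Gc (x t) w) (v t) (v t) / 2 + bil (components2 Omega c (x t)) (v t) w).
  have E := chart_om g sO sR (v t) w (xU t).
  exact: (is_derive_eq (ode_EL xv t w) (congr1 (+%R (bil (dmx Gc (x t) w) (v t) (v t) / 2)) E)).
have dz := lift_vel sm (ode_vel xv) ot.
have dP := lift_EL sm rg (ode_vel xv) ot EL.
set z' := 'D_(v t) (tra c d) (x t) in dz dP.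
set P' := \row_j _ in dP.
have zt : tra c d (x t) = coord A d (base (flow_lift t)) by rewrite base_lift.
have nO : \forall s \near t, ovl c d (x s).
  have [/derivable1_diffP /differentiable_continuous h _] := ode_vel xv t.
  by apply: h; exact: ovl_nbhs.
exists (row_mx z' P').
  split.
    by apply: filterS nO => s /ovlP-/(_ sm)[_ ds]; rewrite /= -/d row_mxKl.
  apply: near_eq_is_derive (is_derive_row_mx dz dP).
  by apply: filterS nO => s os; rewrite coord_lift.
have Gq : components2 g d (tra c d (x t)) = g (base (flow_lift t)) by rewrite zt components2_at.
have fE : fiber (flow_lift t) = z' *m g (base (flow_lift t)).
  have := eq_trans (esym (coord_cotangent_at sm (flow_lift t))) (coord_lift ot).
  by move=> /eq_row_mx[_ ->]; rewrite Gq.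
rewrite (differential_kinetic sm rg fE) (twisted_form_matrix sm) mul_row_block.
rewrite !mulmx1 !mulmx0 addr0 mulmxN mulmx1; congr row_mx.
apply/rowP => j; rewrite !mxE -zt.
have -> : \sum_k z' 0 k * Omega (base (flow_lift t)) k j = bil (components2 Omega d (tra c d (x t))) z' (delta_mx 0 j).
  by rewrite -pair_mulmx pair_delta mxE zt components2_at.
by rewrite opprD addrCA subrr addr0 mulrC.
Qed.

(** The base curve stays in the image of one chart ball, where it shrinks linearly to the center. *)
Lemma lift_contractible : contractible_loop T (fun t => base (flow_lift t)).
Proof.
pose h (s : R * R) : V := y0 + (1 - s.1) *: (x s.2 - y0).
have hU s : s.1 \in `[(0 : R), 1] -> ball y0 R0 (h s).
  rewrite in_itv /= => /andP[s0 s1].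
  have := xU s.2; rewrite -ball_normE /= /h opprD addNKr normrN normrZ distrC => xs.
  apply: le_lt_trans xs; rewrite -[leRHS]mul1r; apply: ler_wpM2r => //.
  by rewrite ger0_norm ?subr_ge0 // gerBl.
exists (param A c y0), (param A c \o h); split.
- apply: continuous_in_subspaceT => s; rewrite inE => -[/= s1 _].
  apply: continuous_comp; last by apply: (param_continuous sm); exact: sR (hU _ s1).
  have cx : {for s.2, continuous x}.
    by have [/derivable1_diffP /differentiable_continuous hx _] := ode_vel xv s.2.
  apply: cvgD; first exact: cvg_cst.
  apply: cvgZ.
    by apply: cvgB; [exact: cvg_cst | exact: cvg_fst].
  apply: cvgB; last exact: cvg_cst.
  apply: (@continuous_comp _ _ _ (@snd R R) x s); [exact: cvg_snd | exact: cx].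
- by move=> t _; rewrite base_lift /h /= subr0 scale1r addrCA subrr addr0.
- by move=> t _; rewrite /h /= subrr scale0r addr0.
- by move=> s _; rewrite /h /= -(ode_perx xv 0) add0r.
Qed.

Lemma lift_periodic t : flow_lift (t + T) = flow_lift t.
Proof.
exact: (congr2 (fun a b : V => param CA c (row_mx a (b *m Gc a))) (ode_perx xv t) (ode_perv xv t)).
Qed.

End Orbit.

Theorem corollary1p4 (R : realType) (n : nat) (M : topologicalType)
    (A : atlas R M n) (Omega g : M -> 'M[R]_n)
    (n_gt0 : (0 < n)%N) (M_nonempty : [set: M] !=set0)
    (M_closed : closed_manifold A)
    (Omega_symplectic : symplectic_form A Omega)
    (g_metric : riemannian_metric A g) :
  exists2 e0 : R, 0 < e0 &
    {ae lebesgue_measure, forall e : R, 0 < e < e0 ->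
      contractible_periodic_orbit_on_level A (twisted_form A Omega)
        (kinetic_energy g) e}.
Proof.
have sm := M_closed.1.
have [e0 e00 H] := exists_chart_ode n_gt0 M_nonempty M_closed Omega_symplectic g_metric.
exists e0 => //; apply: aeW => e /andP[e1 e2].
have [p [R0 [T [x [v [R00 sR T0 xv]]]]]] := H e e1 e2.
exists (flow_lift A g p x v), T; split; first exact: T0.
- exact: (lift_orbit sm Omega_symplectic g_metric R00 sR xv).
- exact: (lift_periodic xv).
- exact: (lift_energy sm g_metric R00 sR xv).
- exact: (lift_contractible sm R00 sR xv).
Qed.
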